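(* Let $p$ be a prime, $K$ a finite extension of $\mathbb{Q}_p$, $d$ an odd prime with $p\equiv 1 \bmod d$, and $a\in\mathbb{Z}$ with $1<a<d$. Let $X$ be the smooth projective model over $K$ of the affine curve $y^d=x^a(x-1)^{d+1-a}$, let $\zeta_d\in K^*$ be a primitive $d$-th root of unity, and let $\delta$ be the automorphism $(x,y)\mapsto(x,\zeta_d y)$ of $X$. Let $\mathcal{L}\in\mathrm{Jac}(X)$ be such that $\delta^*(\mathcal{L})=\mathcal{L}$. Then for every integer $n>0$, $$\mathrm{Jac}(X)[p^n]_1\cap(\Theta-\mathcal{L})\subset\{0\}.$$
   Context: The genus of $X$ is $g=(d-1)/2$. Let $\infty$ be the unique point of $X$ not lying above the affine curve. $\mathrm{Jac}(X)$ denotes the group of isomorphism classes of invertible sheaves of degree $0$ on $X$ (written additively), and $$\Theta:=\{\mathcal{P}\in\mathrm{Jac}(X) : H^0(X,\mathcal{P}((g-1)\infty))\neq 0\},\qquad \Theta-\mathcal{L}:=\{\mathcal{P}\in\mathrm{Jac}(X) : \mathcal{P}\otimes\mathcal{L}\in\Theta\}.$$ For $n>0$, $\mathrm{Jac}(X)[p^n]$ is the subgroup of elements killed by $p^n$; it is a $\mathbb{Z}_p$-module. Since $p\equiv1\bmod d$, $\zeta_d$ lies in $\mathbb{Z}_p\subset K$, and $$\mathrm{Jac}(X)[p^n]_1:=\{\mathcal{P}\in\mathrm{Jac}(X)[p^n] : \delta^*(\mathcal{P})=\zeta_d\mathcal{P}\}.$$ *)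

(* Defs.v *)
From HB Require Import structures.
From mathcomp Require Import all_boot all_order all_algebra all_field.
From mathcomp Require Import boolp classical_sets functions cardinality fsbigop.

Set Implicit Arguments.
Unset Strict Implicit.
Unset Printing Implicit Defensive.

Import Order.TTheory GRing.Theory Num.Theory.

(* Z_p is the inverse limit of the rings Z/p^n; a class modulo p^n is
   represented by its residue in {0, ..., p^n - 1}, so that z n below is the
   image of z in Z/p^n.  Taking m = n in the axiom gives z n < p^n. *)
Record padic_int (p : nat) (p_pr : prime p) := PadicInt {
  pres :> nat -> nat;
  presP : forall m n, m <= n -> pres n %% p ^ m = pres m }.

Section PadicInt.
Variables (p : nat) (p_pr : prime p).
Local Notation Zp := (padic_int p_pr).
Implicit Types u v w : Zp.

HB.instance Definition _ := gen_eqMixin Zp.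
HB.instance Definition _ := gen_choiceMixin Zp.

Lemma padic_eqP u v : u =1 v -> u = v.
Proof.
case: u => u hu; case: v => v hv /= /funext e; subst v.
by congr PadicInt; apply: Prop_irrelevance.
Qed.

Lemma pres_mod u n : u n %% p ^ n = u n.
Proof. exact: presP. Qed.

Lemma modn_pexp k m n : m <= n -> k %% p ^ n %% p ^ m = k %% p ^ m.
Proof. by move=> le_mn; rewrite modn_dvdm // dvdn_exp2l. Qed.

Definition padic_nat k : Zp := @PadicInt p p_pr (fun n => k %% p ^ n) (@modn_pexp k).

Fact padic_add_subproof u v m n : m <= n ->
  (u n + v n) %% p ^ n %% p ^ m = (u m + v m) %% p ^ m.
Proof. by move=> le_mn; rewrite modn_pexp // -modnDm !presP. Qed.
Definition padic_add u v : Zp :=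
  @PadicInt p p_pr (fun n => (u n + v n) %% p ^ n) (padic_add_subproof u v).

Fact padic_mul_subproof u v m n : m <= n ->
  (u n * v n) %% p ^ n %% p ^ m = (u m * v m) %% p ^ m.
Proof. by move=> le_mn; rewrite modn_pexp // -modnMm !presP. Qed.
Definition padic_mul u v : Zp :=
  @PadicInt p p_pr (fun n => (u n * v n) %% p ^ n) (padic_mul_subproof u v).

Fact padic_opp_subproof u m n : m <= n ->
  ((p ^ n).-1 * u n) %% p ^ n %% p ^ m = ((p ^ m).-1 * u m) %% p ^ m.
Proof.
move=> le_mn; rewrite modn_pexp //; apply/eqP.
have pos k : 0 < p ^ k by rewrite expn_gt0 prime_gt0.
rewrite -(eqn_modDl (u n)) -mulSn prednK // -[X in _ == X]modnDml presP //.
rewrite -mulSn prednK // modnMr -(subnK le_mn) expnD -mulnA mulnCA.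
by rewrite modnMr.
Qed.
Definition padic_opp u : Zp :=
  @PadicInt p p_pr (fun n => ((p ^ n).-1 * u n) %% p ^ n) (padic_opp_subproof u).

Fact padic_addA : associative padic_add.
Proof. by move=> u v w; apply: padic_eqP => n /=; rewrite modnDmr modnDml addnA. Qed.
Fact padic_addC : commutative padic_add.
Proof. by move=> u v; apply: padic_eqP => n /=; rewrite addnC. Qed.
Fact padic_add0 : left_id (padic_nat 0) padic_add.
Proof. by move=> u; apply: padic_eqP => n /=; rewrite mod0n add0n pres_mod. Qed.
Fact padic_addN : left_inverse (padic_nat 0) padic_opp padic_add.
Proof.
move=> u; apply: padic_eqP => n /=; rewrite mod0n modnDml addnC -mulSn prednK.
  by rewrite modnMr.
by rewrite expn_gt0 prime_gt0.
Qed.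

HB.instance Definition _ :=
  GRing.isZmodule.Build Zp padic_addA padic_addC padic_add0 padic_addN.

Fact padic_mulA : associative padic_mul.
Proof. by move=> u v w; apply: padic_eqP => n /=; rewrite modnMmr modnMml mulnA. Qed.
Fact padic_mulC : commutative padic_mul.
Proof. by move=> u v; apply: padic_eqP => n /=; rewrite mulnC. Qed.
Fact padic_mul1 : left_id (padic_nat 1) padic_mul.
Proof. by move=> u; apply: padic_eqP => n /=; rewrite modnMml mul1n pres_mod. Qed.
Fact padic_mulD : left_distributive padic_mul padic_add.
Proof. by move=> u v w; apply: padic_eqP => n /=; rewrite modnMml modnDm mulnDl. Qed.
Fact padic_1neq0 : padic_nat 1 != padic_nat 0.
Proof.
apply/eqP => /(congr1 (fun u : Zp => u 1)) /=.
by rewrite expn1 mod0n modn_small ?prime_gt1.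
Qed.

HB.instance Definition _ := GRing.Zmodule_isComNzRing.Build Zp
  padic_mulA padic_mulC padic_mul1 padic_mulD padic_1neq0.

Definition padic_unit : {pred Zp} := fun u => `[< exists v, (v * u = 1)%R >].
Definition padic_inv u : Zp :=
  if pselect (exists v, (v * u = 1)%R) is left uP then projT1 (cid uP) else u.

Fact padic_mulV : {in padic_unit, left_inverse 1%R padic_inv *%R}.
Proof.
move=> u /asboolP uP; rewrite /padic_inv; case: pselect => // {}uP.
by case: (cid uP).
Qed.
Fact padic_unitP u v : (v * u = 1)%R -> padic_unit u.
Proof. by move=> vu; apply/asboolP; exists v. Qed.
Fact padic_inv_out : {in [predC padic_unit], padic_inv =1 id}.
Proof.
move=> u /asboolP uP; rewrite /padic_inv; by case: pselect.
Qed.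

HB.instance Definition _ := GRing.ComNzRing_hasMulInverse.Build Zp
  padic_mulV padic_unitP padic_inv_out.

Lemma padic_neq0 u : u != 0%R -> exists k, forall n, k <= n -> ~~ (p ^ k %| u n).
Proof.
move=> /eqP u0; have [k uk] : exists k, u k <> 0.
  apply: contrapT => /forallNP hu; apply: u0; apply: padic_eqP => n /=.
  by rewrite mod0n; apply: contrapT; apply: hu.
by exists k => n kn; rewrite /dvdn presP //; apply/eqP.
Qed.

Fact padic_idomain u v : (u * v = 0 -> (u == 0) || (v == 0))%R.
Proof.
move=> uv; case: (boolP (u == 0)%R) => //= /padic_neq0[k hk].
apply: contraT => /padic_neq0[l hl].
have {hk} := hk _ (leq_addr l k); have {hl} := hl _ (leq_addl k l).
have /= := congr1 (fun w : Zp => w (k + l)) uv.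
rewrite mod0n => /eqP; rewrite -/(dvdn _ _); move: (u _) (v _) => b c bc.
have [->|b0] := posnP b; first by rewrite dvdn0.
have [->|c0] := posnP c; first by rewrite dvdn0.
move: bc; rewrite !pfactor_dvdn ?muln_gt0 ?b0 // lognM // -!ltnNge => le_kl lt_l lt_k.
by have := leq_ltn_trans le_kl (leq_add lt_k (ltnW lt_l)); rewrite ltnn.
Qed.

HB.instance Definition _ := GRing.ComUnitRing_isIntegral.Build Zp padic_idomain.

End PadicInt.

Notation padic p_pr := {fraction (padic_int p_pr)}.

Section PadicExtension.
Local Open Scope ring_scope.
Variables (p : nat) (p_pr : prime p) (K : fieldExtType (padic p_pr)).

Definition of_padic_int (z : padic_int p_pr) : K := (FracField.tofrac z)%:A.

End PadicExtension.

Local Open Scope classical_set_scope.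
Local Open Scope ring_scope.

Notation ratfun K := {fraction {poly K}}.

Section Curve.
Variables (K : fieldType) (F : fieldExtType (ratfun K)).

Definition constF (c : K) : F := (FracField.tofrac c%:P)%:A.
Definition coord_x : F := (FracField.tofrac 'X)%:A.

(* The smooth projective curve X with function field F is the abstract
   nonsingular curve of F/K: its closed points are the discrete valuation
   rings of F over K, given here by their normalized valuations, with the
   cofinite topology, and a function is regular on U when it has nonnegative
   valuation at every point of U.  The convention ordp P 0 = 0 makes 0 regular
   everywhere. *)
Record closed_point := Point {
  ordp :> F -> int;
  ordp0 : ordp 0 = 0;
  ordpM : forall f g, f != 0 -> g != 0 -> ordp (f * g) = ordp f + ordp g;
  ordpD : forall f g, f != 0 -> g != 0 -> f + g != 0 ->
    Num.min (ordp f) (ordp g) <= ordp (f + g);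
  ordp_const : forall c, ordp (constF c) = 0;
  ordp_surj : exists2 t, t != 0 & ordp t = 1 }.

HB.instance Definition _ := gen_eqMixin closed_point.
HB.instance Definition _ := gen_choiceMixin closed_point.

Lemma point_eqP (P Q : closed_point) : ordp P =1 ordp Q -> P = Q.
Proof.
case: P => P P0 PM PD PC PS; case: Q => Q Q0 QM QD QC QS /= /funext e; subst Q.
by congr Point; apply: Prop_irrelevance.
Qed.

(* Only nonempty open sets are considered: X is infinite, hence irreducible,
   and a sheaf of modules has no nonzero section on the empty set. *)
Definition zopen (U : set closed_point) := finite_set (~` U).

Definition regular_on (U : set closed_point) (f : F) := forall P, U P -> 0 <= ordp P f.

Definition vanishes_at (P : closed_point) (f : F) := f = 0 \/ 0 < ordp P f.

(* The classes of the b i form a K-basis of the residue field of P. *)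
Definition residue_basis (P : closed_point) n (b : 'I_n -> F) :=
  (forall i, 0 <= ordp P (b i)) /\
  forall f, 0 <= ordp P f ->
    exists! c : {ffun 'I_n -> K}, vanishes_at P (f - \sum_i constF (c i) * b i).

Definition point_degree (P : closed_point) : nat :=
  xget 0%N [set n | exists b : 'I_n -> F, residue_basis P b].

(* res U V is meaningful when V is contained in U, and sact U f when f is
   regular on U. *)
Record sheaf := Sheaf {
  sec :> set closed_point -> zmodType;
  res : forall U V, sec U -> sec V;
  sact : forall U, F -> sec U -> sec U;
  resD : forall U V, zopen U -> zopen V -> V `<=` U ->
    {morph @res U V : s t / s + t};
  res_id : forall U, zopen U -> @res U U =1 id;
  res_comp : forall U V W, zopen U -> zopen V -> zopen W ->
    V `<=` U -> W `<=` V -> @res V W \o @res U V =1 @res U W;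
  sactDr : forall U f, zopen U -> regular_on U f -> {morph @sact U f : s t / s + t};
  sactDl : forall U f g s, zopen U -> regular_on U f -> regular_on U g ->
    @sact U (f + g) s = @sact U f s + @sact U g s;
  sactM : forall U f g s, zopen U -> regular_on U f -> regular_on U g ->
    @sact U (f * g) s = @sact U f (@sact U g s);
  sact1 : forall U, zopen U -> @sact U 1 =1 id;
  res_sact : forall U V f s, zopen U -> zopen V -> V `<=` U -> regular_on U f ->
    @res U V (@sact U f s) = @sact V f (@res U V s);
  sheaf_local : forall (I : Type) U (V : I -> set closed_point) (s t : sec U),
    zopen U -> inhabited I -> (forall i, zopen (V i)) ->
    \bigcup_i V i = U -> (forall i, @res U (V i) s = @res U (V i) t) -> s = t;
  sheaf_glue : forall (I : Type) U (V : I -> set closed_point) (s : forall i, sec (V i)),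
    zopen U -> inhabited I -> (forall i, zopen (V i)) -> \bigcup_i V i = U ->
    (forall i j, @res (V i) (V i `&` V j) (s i) = @res (V j) (V i `&` V j) (s j)) ->
    exists t : sec U, forall i, @res U (V i) t = s i }.

Arguments res : clear implicits.
Arguments sact : clear implicits.

Definition is_hom (M N : sheaf) (phi : forall U, M U -> N U) :=
  [/\ forall U, zopen U -> {morph phi U : s t / s + t},
      forall U f s, zopen U -> regular_on U f ->
        phi U (sact M U f s) = sact N U f (phi U s)
    & forall U V s, zopen U -> zopen V -> V `<=` U ->
        phi V (res M U V s) = res N U V (phi U s)].

Definition sheaf_iso (M N : sheaf) :=
  exists2 phi : forall U, M U -> N U, is_hom phi &
    forall U, zopen U -> bijective (phi U).

Definition is_bilinear (L M N : sheaf) (beta : forall U, L U -> M U -> N U) :=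
  [/\ forall U s, zopen U -> {morph beta U s : t t' / t + t'},
      forall U t, zopen U -> {morph (beta U)^~ t : s s' / s + s'},
      forall U f s t, zopen U -> regular_on U f ->
        beta U (sact L U f s) t = sact N U f (beta U s t) /\
        beta U s (sact M U f t) = sact N U f (beta U s t)
    & forall U V s t, zopen U -> zopen V -> V `<=` U ->
        beta V (res L U V s) (res M U V t) = res N U V (beta U s t)].

(* The universal property among sheaves of O_X-modules, so that no
   sheafification has to be carried out. *)
Definition is_tensor (L M N : sheaf) :=
  exists2 beta : forall U, L U -> M U -> N U, is_bilinear beta &
    forall (T : sheaf) (gamma : forall U, L U -> M U -> T U),
      is_bilinear gamma ->
      (exists2 phi : forall U, N U -> T U, is_hom phi &
         forall U s t, zopen U -> phi U (beta U s t) = gamma U s t) /\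
      (forall phi psi : forall U, N U -> T U, is_hom phi -> is_hom psi ->
         (forall U s t, zopen U -> phi U (beta U s t) = psi U (beta U s t)) ->
         forall U, zopen U -> phi U =1 psi U).

(* The map f |-> f e is an isomorphism from O_U to the
   restriction of M to U. *)
Definition is_generator (M : sheaf) U (e : M U) :=
  forall V (s : M V), zopen V -> V `<=` U ->
    exists! f, regular_on V f /\ s = sact M V f (res M U V e).

Definition invertible (M : sheaf) :=
  forall P, exists U, [/\ zopen U, U P & exists e : M U, is_generator e].

(* The order at P of the rational section s, defined on U, of M. *)
Definition has_ord (M : sheaf) U (s : M U) (P : closed_point) (k : int) :=
  exists V, [/\ zopen V, V P & exists e : M V, is_generator e /\
    exists f, [/\ regular_on (U `&` V) f, f != 0,
      res M U (U `&` V) s = sact M (U `&` V) f (res M V (U `&` V) e)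
      & ordp P f = k]].

(* The degree of M is the degree of the divisor of a nonzero rational
   section. *)
Definition has_degree (M : sheaf) (n : int) :=
  exists U, zopen U /\ exists s : M U, s != 0 /\ exists D : closed_point -> int,
    [/\ forall P, has_ord s P (D P), finite_set [set P | D P != 0]
      & n = \sum_(P \in [set: closed_point]) D P * (point_degree P)%:Z].

(* O_X(D): its sections on U are the rational functions f with
   div f + D >= 0 on U. *)
Section DivisorSheaf.
Variable D : closed_point -> int.

Definition div_pred (U : set closed_point) : {pred F} :=
  fun f => `[< f = 0 \/ forall P, U P -> - D P <= ordp P f >].

Lemma div_predP U f :
  reflect (f = 0 \/ forall P, U P -> - D P <= ordp P f) (f \in div_pred U).
Proof. exact: asboolP. Qed.

Lemma ordp1 (P : closed_point) : ordp P 1 = 0.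
Proof. by have := ordp_const P 1; rewrite /constF polyC1 rmorph1 scale1r. Qed.

Lemma ordpN (P : closed_point) f : ordp P (- f) = ordp P f.
Proof.
have [->|f0] := eqVneq f 0; first by rewrite oppr0.
have n1 : (-1 : F) != 0 by rewrite oppr_eq0 oner_neq0.
have e1 : ordp P (-1) = 0.
  by have := ordp_const P (-1); rewrite /constF polyCN polyC1 rmorphN rmorph1 scaleN1r.
by rewrite -mulN1r ordpM // e1 add0r.
Qed.

Fact div_pred_closed U : zmod_closed (div_pred U).
Proof.
split=> [|f g /div_predP hf /div_predP hg]; first by apply/div_predP; left.
apply/div_predP; have [->|f0] := eqVneq f 0.
  rewrite sub0r; case: hg => [->|hg]; first by rewrite oppr0; left.
  by right=> P UP; rewrite ordpN hg.
have [->|g0] := eqVneq g 0.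
  by rewrite subr0; case: hf => [/eqP|hf]; [rewrite (negPf f0)|right].
have [->|fg0] := eqVneq (f - g) 0; [by left|right=> P UP].
case: hf hg => [/eqP|hf]; [by rewrite (negPf f0)|].
case=> [/eqP|hg]; [by rewrite (negPf g0)|].
apply: le_trans (ordpD P f0 _ fg0); last by rewrite oppr_eq0.
by rewrite le_min ordpN hf ?hg.
Qed.

HB.instance Definition _ U :=
  GRing.isZmodClosed.Build F (div_pred U) (div_pred_closed U).

Record div_sec (U : set closed_point) := DivSec { div_val : F; _ : div_val \in div_pred U }.

HB.instance Definition _ U := [isSub for @div_val U].
HB.instance Definition _ U := [Choice of div_sec U by <:].
HB.instance Definition _ U := [SubChoice_isSubZmodule of div_sec U by <:].

Definition div_res U V (s : div_sec U) : div_sec V := insubd 0 (val s).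
Definition div_act U (f : F) (s : div_sec U) : div_sec U := insubd 0 (f * val s).

Lemma div_resE U V (s : div_sec U) : V `<=` U -> val (div_res V s) = val s.
Proof.
move=> VU; rewrite insubdK //; apply/div_predP.
by have /div_predP[] := valP s; [left|right=> P /VU; auto].
Qed.

Lemma div_actE U f (s : div_sec U) : regular_on U f -> val (div_act f s) = f * val s.
Proof.
move=> rf; rewrite insubdK //; apply/div_predP.
have [->|f0] := eqVneq f 0; first by rewrite mul0r; left.
have [->|s0] := eqVneq (val s) 0; first by rewrite mulr0; left.
have /div_predP[/eqP|hs] := valP s; first by rewrite (negPf s0).
by right=> P UP; rewrite ordpM // -[- D P]add0r lerD ?rf ?hs.
Qed.

Lemma regularD U f g : regular_on U f -> regular_on U g -> regular_on U (f + g).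
Proof.
move=> rf rg P UP; have [->|f0] := eqVneq f 0; first by rewrite add0r rg.
have [->|g0] := eqVneq g 0; first by rewrite addr0 rf.
have [->|fg0] := eqVneq (f + g) 0; first by rewrite ordp0.
by apply: le_trans (ordpD P f0 g0 fg0); rewrite le_min rf ?rg.
Qed.

Lemma regularM U f g : regular_on U f -> regular_on U g -> regular_on U (f * g).
Proof.
move=> rf rg P UP; have [->|f0] := eqVneq f 0; first by rewrite mul0r ordp0.
have [->|g0] := eqVneq g 0; first by rewrite mulr0 ordp0.
by rewrite ordpM // addr_ge0 ?rf ?rg.
Qed.

Lemma regular1 U : regular_on U 1.
Proof. by move=> P _; rewrite ordp1. Qed.

Lemma regularS U V f : V `<=` U -> regular_on U f -> regular_on V f.
Proof. by move=> VU rf P /VU; apply: rf. Qed.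

Definition div_sheaf : sheaf.
Proof.
refine (@Sheaf div_sec div_res div_act _ _ _ _ _ _ _ _ _ _).
- by move=> U V _ _ VU s t; apply: val_inj; rewrite raddfD /= !div_resE.
- by move=> U _ s; apply: val_inj; rewrite div_resE.
- move=> U V W _ _ _ VU WV s; apply: val_inj; rewrite /= !div_resE //.
  exact: subset_trans VU.
- by move=> U f _ rf s t; apply: val_inj; rewrite raddfD /= !div_actE // mulrDr.
- move=> U f g s _ rf rg; apply: val_inj.
  by rewrite raddfD /= !div_actE ?mulrDl //; apply: regularD.
- move=> U f g s _ rf rg; apply: val_inj.
  by rewrite !div_actE ?mulrA //; apply: regularM.
- by move=> U _ s; apply: val_inj; rewrite div_actE ?mul1r //; apply: regular1.
- move=> U V f s _ _ VU rf; apply: val_inj.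
  by rewrite !(div_resE, div_actE) //; apply: regularS rf.
- move=> I U V s t _ [i] _ UV st; apply: val_inj.
  have VU : V i `<=` U by rewrite -UV; apply: bigcup_sup.
  by rewrite -(div_resE s VU) st div_resE.
- move=> I U V s _ [i] _ UV st.
  have sE j : val (s j) = val (s i).
    by have /(congr1 val) := st j i; rewrite !div_resE.
  have hs : val (s i) \in div_pred U.
    apply/div_predP; have [->|s0] := eqVneq (val (s i)) 0; [by left|right=> P].
    rewrite -UV => -[j _ VP]; have /div_predP[|] := valP (s j).
      by rewrite sE => /eqP; rewrite (negPf s0).
    by rewrite sE; apply.
  exists (DivSec hs) => j; apply: val_inj; rewrite div_resE /= ?sE //.
  by rewrite -UV; apply: bigcup_sup.
Defined.

End DivisorSheaf.

Definition OX : sheaf := div_sheaf (fun=> 0).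

Section DirectImage.

(* sigma is the comorphism f |-> f \o tau of an automorphism tau of X over
   the x-line. *)
Variable sigma : 'AEnd(F).

Fact aut_neq0 f : f != 0 -> sigma f != 0.
Proof. by rewrite fmorph_eq0. Qed.

Fact aut_const c : sigma (constF c) = constF c.
Proof. by rewrite linearZ rmorph1. Qed.

Lemma aut_invK : cancel (sigma^-1)%VF sigma.
Proof. exact/lker0_lfunVK/AEnd_lker0. Qed.

(* The point tau(P), characterized by f(tau(P)) = (f \o tau)(P). *)
Definition aut_point (P : closed_point) : closed_point.
Proof.
refine (@Point (fun f => ordp P (sigma f)) _ _ _ _ _).
- by rewrite linear0 ordp0.
- by move=> f g f0 g0; rewrite rmorphM ordpM ?aut_neq0.
- by move=> f g f0 g0 fg0; rewrite rmorphD ordpD -?rmorphD ?aut_neq0.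
- by move=> c; rewrite aut_const ordp_const.
- have [t t0 Pt] := ordp_surj P; exists ((sigma^-1)%VF t).
    by apply: contra_neq t0 => t0; rewrite -[t]aut_invK t0 linear0.
  by rewrite aut_invK.
Defined.

Lemma aut_point_inj : injective aut_point.
Proof.
move=> P Q PQ; apply: point_eqP => f.
by have := congr1 (fun R : closed_point => ordp R ((sigma^-1)%VF f)) PQ; rewrite /= aut_invK.
Qed.

Lemma aut_open U : zopen U -> zopen (aut_point @^-1` U).
Proof.
rewrite /zopen preimage_setC => Uo; apply: finite_preimage => //.
by move=> P Q _ _; apply: aut_point_inj.
Qed.

Lemma aut_regular U f : regular_on U f -> regular_on (aut_point @^-1` U) (sigma f).
Proof. by move=> rf P /rf. Qed.

Variable M : sheaf.

Definition direct_image : sheaf.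
Proof.
refine (@Sheaf (fun U => M (aut_point @^-1` U)) (fun U V => res M _ _)
  (fun U f => sact M _ (sigma f)) _ _ _ _ _ _ _ _ _ _).
- by move=> U V Uo Vo VU; apply: resD; [exact: aut_open..|exact: preimage_subset].
- by move=> U Uo; apply: res_id; apply: aut_open.
- by move=> U V W Uo Vo Wo VU WV; apply: res_comp;
    [exact: aut_open..|exact: preimage_subset|exact: preimage_subset].
- by move=> U f Uo rf; apply: sactDr; [exact: aut_open|exact: aut_regular].
- by move=> U f g s Uo rf rg; rewrite rmorphD;
    apply: sactDl; [exact: aut_open|exact: aut_regular..].
- by move=> U f g s Uo rf rg; rewrite rmorphM;
    apply: sactM; [exact: aut_open|exact: aut_regular..].
- by move=> U Uo s; rewrite rmorph1 sact1 //; apply: aut_open.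
- by move=> U V f s Uo Vo VU rf; apply: res_sact;
    [exact: aut_open..|exact: preimage_subset|exact: aut_regular].
- move=> I U V s t Uo i Vo UV; apply: sheaf_local; [exact: aut_open|exact: i| |].
    by move=> j; apply: aut_open (Vo j).
  by rewrite -preimage_bigcup UV.
- move=> I U V s Uo i Vo UV; apply: sheaf_glue; [exact: aut_open|exact: i| |].
    by move=> j; apply: aut_open (Vo j).
  by rewrite -preimage_bigcup UV.
Defined.

End DirectImage.

(* The sections of delta^* M on U are those of M on delta(U): pulling back
   along an automorphism is pushing forward along its inverse. *)
Definition pullback (delta : 'AEnd(F)) (M : sheaf) : sheaf :=
  direct_image (inv_ahom delta) M.

(* Elements of Jac(X) are represented by invertible sheaves of degree 0;
   equality in Jac(X) is sheaf_iso, addition is is_tensor, and 0 is OX. *)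
Definition in_Jac (M : sheaf) := invertible M /\ has_degree M 0.

(* In additive notation, the class of N is m times the class of M; that is, N
   is the m-th tensor power of M. *)
Fixpoint is_multiple (M : sheaf) (m : nat) (N : sheaf) : Prop :=
  if m is m'.+1 then exists2 N', is_multiple M m' N' & is_tensor M N' N
  else sheaf_iso N OX.

Definition in_Jac_tors (m : nat) (M : sheaf) := in_Jac M /\ is_multiple M m OX.

Definition in_Theta (g : nat) (infty : closed_point) (M : sheaf) :=
  in_Jac M /\
  exists2 N, is_tensor M (div_sheaf (fun P => (g%:Z - 1) *+ (P == infty))) N &
    exists s : N setT, s != 0.

Definition in_Theta_sub g infty (L M : sheaf) :=
  in_Jac M /\ exists2 N, is_tensor M L N & in_Theta g infty N.

End Curve.

Arguments res {K F} M U V s : rename.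
Arguments sact {K F} M U f s : rename.

(* On a class killed by p^n, a p-adic integer z acts as the natural number
   z n, which is congruent to z modulo p^n. *)
Definition in_Jac_eigen (p : nat) (p_pr : prime p) (K : fieldExtType (padic p_pr))
    (F : fieldExtType (ratfun K)) (delta : 'AEnd(F)) (zeta : K) (n : nat)
    (M : sheaf F) :=
  in_Jac_tors (p ^ n) M /\
  exists2 z : padic_int p_pr, of_padic_int K z = zeta &
    is_multiple M (z n) (pullback delta M).

(* Main.v *)
From HB Require Import structures.
Require Import Defs.
From mathcomp Require Import all_boot all_order all_algebra all_field.
From mathcomp Require Import boolp classical_sets functions cardinality fsbigop.
From mathcomp Require Import zify ring.

Set Implicit Arguments.
Unset Strict Implicit.
Unset Printing Implicit Defensive.

Import Order.TTheory GRing.Theory Num.Theory.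
Local Open Scope ring_scope.

(* Let q = p^n and let D be a divisor in the class of P, with div f = q D.  A
   class fixed by delta is that of -e P0 + e oo, where P0 is the branch point
   over x = 0, so the theta condition lets D be chosen with D >= e P0 off oo and
   pole order at most g - 1 + e at oo.  Extend the valuation of K to F by the
   Gauss norm of the affine ring A; its residue field is the function field of
   the reduced curve.  The logarithmic derivative of the reduction of f is an
   eigenfunction, regular off oo and of pole order at most d, hence zero: the
   reduction of f is a q-th power.  Lifting the root gives s in A and m' such
   that, for z congruent to zeta, delta (s T^m') is its z-th power up to units
   regular off oo or at oo.  Since H^1(O) has the basis T^-j, j a gap, on which
   only j = 1 has eigenvalue zeta, s T^m' is, up to such units, the inverse of a
   Kummer product G(t / T) with prod_i (1 - zeta^i X)^(z_i) = G(X).  If t is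
   small, a function with divisor D exists.  If t is large, the vanishing of the
   coefficients of a section of O(D) at the gaps gives, over the residue field,
   a polynomial with more roots than its degree. *)

(** Divisors on C and on its reduction B are never matched point by point. With div f = q D off
    infinity, the condition that g vanish along D is written as regularity of g^q / f off infinity,
    and in this form it passes through the Gauss norm. Dimensions are read off as sets of pole
    orders at infinity, where the residue field is K. No completion is formed: units off infinity
    are elements of A with nonzero constant reduction, units at infinity are quotients of functions
    whose pole order survives reduction, and identities hold modulo pi^M. The bound separating small
    from large t depends on the model of f alone, so M, and then z with z^d = 1 modulo p^M, is
    chosen after it. For large t the numbers fit exactly: functions vanishing to order e at P0 have
    g + e gaps, and a pole of order at most g - 1 + e has at most g + e coefficients. Modulo pi the
    coefficients of G up to degree d are 1 / m!, which turns the system into values of one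
    polynomial at distinct residues modulo p; there is room for them because p = 1 modulo d with d
    odd gives 2 d < p. *)

Ltac clia := clear; lia.
Ltac cnia := clear; nia.

Ltac nz := lazymatch goal with |- is_true (negb (eq_op ?e _)) => first [assumption |
 lazymatch e with
 | GRing.mul _ _ => apply: mulf_neq0; nz
 | GRing.exp _ _ => apply: expf_neq0; nz
 | exprz _ _ => apply: expfz_neq0; nz
 | GRing.inv _ => rewrite invr_eq0; nz
 | GRing.opp _ => rewrite oppr_eq0; nz
 | GRing.one => exact: oner_neq0
 | GRing.RMorphism.sort _ _ => rewrite fmorph_eq0; nz
 | _ => solve [trivial with nz nocore]
 end] end.
Create HintDb nz.
#[export] Hint Extern 0 (is_true (negb (eq_op _ _))) => solve [nz] : core.

(** * Normalized discrete valuations of a field *)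

Section Valuations.
Variable F: fieldType.

(** One type serves for the valuation of K, its Gauss extension to F and the points of the curve;
    hence constants are not mentioned here. *)
Record dval := Dval {
 dv :> F -> int;
 dv0 : dv 0 = 0;
 dvM : forall f g, f != 0 -> g != 0 -> dv (f * g) = dv f + dv g;
 dvD : forall f g, f != 0 -> g != 0 -> f + g != 0 ->
 Num.min (dv f) (dv g) <= dv (f + g);
 dv_surj : exists2 t, t != 0 & dv t = 1 }.

HB.instance Definition _ := gen_eqMixin dval.
HB.instance Definition _ := gen_choiceMixin dval.

Lemma dval_eqP (v w: dval) : v =1 w -> v = w.
 case: v => v ? ? ? ?; case: w => w ? ? ? ? /= /funext e; subst w. by congr Dval; apply: Prop_irrelevance.
Qed.

(* [vge v n f] is [n <= v f] with the convention that 0 has infinite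
   valuation. *)
Definition vge (v: dval) (n: int) (f: F) := (f == 0) || (n <= v f).

Variable v: dval.
Implicit Types (f g: F) (n m: int).

Lemma dv1: v 1 = 0.
 apply/eqP; have /eqP := dvM v (oner_neq0 F) (oner_neq0 F).
by rewrite mulr1 -subr_eq0 opprD addrA subrr sub0r oppr_eq0.
Qed.
Lemma dvX f k: f != 0 -> v (f ^+ k) = k%:Z * v f.
 move=> f0; elim: k => [|k IH]; first by rewrite dv1 mul0r. by rewrite exprS dvM // IH; lia.
Qed.
Lemma dvN f: v (- f) = v f.
 have [->|f0] := eqVneq f 0; first by rewrite oppr0. have n1: (-1 : F) != 0 by rewrite oppr_eq0 oner_neq0.
have := dvM v n1 n1; rewrite mulN1r opprK dv1 => e. by rewrite -mulN1r dvM //; lia.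
Qed.
Lemma dvV f: v f^-1 = - v f.
 have [->|f0] := eqVneq f 0; first by rewrite invr0 dv0. have f1: f^-1 != 0 by [].
by have := dvM v f0 f1; rewrite divff // dv1; lia.
Qed.
Lemma dv_div f g: f != 0 -> g != 0 -> v (f / g) = v f - v g.
 by move=> f0 g0; rewrite dvM // dvV. Qed.
Lemma dvXz f (k: int) : f != 0 -> v (f ^ k) = k * v f.
 move=> f0; case: k => k; first by rewrite dvX. by rewrite NegzE -exprz_inv dvX // dvV; lia.
Qed.
Lemma dv_prod (I: Type) (r: seq I) (P: pred I) (E: I -> F) :
 (forall i, P i -> E i != 0) ->
 v (\prod_(i <- r | P i) E i) = \sum_(i <- r | P i) v (E i).
 move=> E0; elim: r => [|i r IH]; first by rewrite !big_nil dv1.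
rewrite !big_cons; case: ifP => // Pi; rewrite dvM ?IH ?E0 //. by elim/big_ind: _ => //; exact: oner_neq0.
Qed.
Lemma vge0 n: vge v n 0.
 by rewrite /vge eqxx. Qed.
Lemma vgeE n f: f != 0 -> vge v n f = (n <= v f).
 by rewrite /vge => /negPf->. Qed.
Lemma vgeW n m f: m <= n -> vge v n f -> vge v m f.
 by rewrite /vge => mn /orP[->//|h]; rewrite (le_trans mn h) orbT. Qed.
Lemma vge1: vge v 0 1.
 by rewrite /vge dv1 orbT. Qed.
Lemma vgeN n f: vge v n (- f) = vge v n f.
 by rewrite /vge oppr_eq0 dvN. Qed.
Lemma vgeD n f g: vge v n f -> vge v n g -> vge v n (f + g).
 have [->|f0] := eqVneq f 0; first by rewrite add0r. have [->|g0] := eqVneq g 0; first by rewrite addr0.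
have [->|fg0] := eqVneq (f + g) 0; first by rewrite vge0.
by rewrite !vgeE // => hf hg; apply: le_trans (dvD v f0 g0 fg0); rewrite le_min hf.
Qed.
Lemma vgeB n f g: vge v n f -> vge v n g -> vge v n (f - g).
 by move=> hf hg; rewrite vgeD ?vgeN. Qed.
Lemma vge_subC n f g: vge v n (f - g) = vge v n (g - f).
 by rewrite -vgeN opprB. Qed.
Lemma vge_trans n f g h: vge v n (f - g) -> vge v n (g - h) -> vge v n (f - h).
 by move=> h1 h2; rewrite -(subrKA g) vgeD. Qed.
Lemma vgeM n m f g: vge v n f -> vge v m g -> vge v (n + m) (f * g).
 have [->|f0] := eqVneq f 0; first by rewrite mul0r !vge0. have [->|g0] := eqVneq g 0; first by rewrite mulr0 !vge0.
by rewrite !vgeE // dvM //; lia.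
Qed.
Lemma vge0M n f g: vge v n f -> vge v 0 g -> vge v n (f * g).
 by move=> hf hg; rewrite -[n]addr0 vgeM. Qed.
Lemma vgeM0 n f g: vge v 0 f -> vge v n g -> vge v n (f * g).
 by move=> hf hg; rewrite -[n]add0r vgeM. Qed.
Lemma vgeX n k f: vge v n f -> vge v (n *+ k) (f ^+ k).
 move=> h; elim: k => [|k IH]; first by rewrite vge1. by rewrite exprS mulrS vgeM.
Qed.
Lemma vge0X k f: vge v 0 f -> vge v 0 (f ^+ k).
 by move=> /(vgeX k); rewrite mul0rn. Qed.
Lemma vgeXr n k f: vge v n f = vge v (n *+ k.+1) (f ^+ k.+1).
 have [->|f0] := eqVneq f 0; first by rewrite expr0n /= !vge0.
by rewrite !vgeE // dvX // -mulr_natl; apply/idP/idP; nia.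
Qed.
Lemma vge_sum n (I: Type) (r: seq I) (P: pred I) (E: I -> F) :
 (forall i, P i -> vge v n (E i)) -> vge v n (\sum_(i <- r | P i) E i).
 by move=> h; elim/big_ind: _ => //; [exact: vge0|exact: vgeD]. Qed.
Lemma vge0_prod (I: Type) (r: seq I) (P: pred I) (E: I -> F) :
 (forall i, P i -> vge v 0 (E i)) -> vge v 0 (\prod_(i <- r | P i) E i).
 by move=> h; elim/big_ind: _ => //; [exact: vge1|move=> f g; exact: vgeM0]. Qed.
Lemma vge_div n f g: g != 0 -> vge v n (f / g) = vge v (n + v g) f.
 move=> g0; have [->|f0] := eqVneq f 0; first by rewrite mul0r !vge0. by rewrite !vgeE // dv_div //; lia.
Qed.
Lemma dvD_lt f g: f != 0 -> vge v (v f + 1) g -> f + g != 0 /\ v (f + g) = v f.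
 move=> f0 hg; have n0: f + g != 0. apply: contraTneq hg => /eqP; rewrite addrC addr_eq0 => /eqP->.
by rewrite vgeN vgeE // -ltNge ltrDl. split=> //; apply/eqP; rewrite eq_le; apply/andP; split.
rewrite leNgt; apply/negP => h; have : vge v (v f + 1) (f + g - g). by apply: vgeB => //; rewrite vgeE // lezD1.
by rewrite addrK vgeE // leNgt ltrDl. by rewrite -vgeE //; apply: vgeD; [rewrite vgeE|apply: vgeW hg; rewrite lerDl].
Qed.
Lemma vgeM_unit n u f: u != 0 -> v u = 0 -> vge v n (u * f) = vge v n f.
 move=> u0 vu; have [->|f0] := eqVneq f 0; first by rewrite mulr0. by rewrite !vgeE // dvM // vu add0r.
Qed.
Lemma sub1_unit n f: 0 < n -> vge v n (f - 1) -> f != 0 /\ v f = 0.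
 move=> n0 h; have := @dvD_lt 1 (f - 1) (oner_neq0 _); rewrite dv1 subrKC; apply. by apply: vgeW h; lia.
Qed.
Lemma vgeX_sub n f g k: vge v 0 f -> vge v 0 g -> vge v n (f - g) ->
 vge v n (f ^+ k - g ^+ k).
 move=> hf hg h; rewrite subrXX; apply: vge0M => //. by apply: vge_sum => i _; apply: vgeM0; apply: vge0X.
Qed.
Lemma vgeM_sub n f f' g g': vge v 0 f -> vge v 0 g' ->
 vge v n (f - f') -> vge v n (g - g') -> vge v n (f * g - f' * g').
 move=> hf hg h h'; have ->: f * g - f' * g' = f * (g - g') + (f - f') * g' by ring.
by apply: vgeD; [apply: vgeM0|apply: vge0M].
Qed.

End Valuations.

(** * Extending a discrete valuation to a field of bounded degree *)

Section Extension.
Variables (F: fieldType) (R0 E: set F) (pi: F) (n: nat).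
Hypotheses (R01: R0 1) (R0B: forall f g, R0 f -> R0 g -> R0 (f - g))
 (R0M: forall f g, R0 f -> R0 g -> R0 (f * g)) (R0pi: R0 pi) (pi0: pi != 0)
 (R0V: ~ R0 pi^-1).
Hypothesis E_pi: forall c, E c -> c != 0 ->
 exists k : int, R0 (c * pi ^ (- k)) /\ R0 (c^-1 * pi ^ k).
Hypothesis algF: forall f, exists c : 'I_n.+1 -> F,
 [/\ forall i, E (c i), exists i, c i != 0 & \sum_i c i * f ^+ i = 0].

Let good (R: set F) := [/\ R0 `<=` R, forall f g, R f -> R g -> R (f - g),
 forall f g, R f -> R g -> R (f * g) & ~ R pi^-1]%classic.

Lemma exists_maximal_subring: exists2 R, good R & forall R', good R' -> (R `<=` R')%classic -> R' = R.
 pose P (R: set F) := (R = set0 \/ good R)%classic. have [|R [PR maxR]] := @Zorn_bigcup F P.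
move=> C CP tot; have [[R [CR gR]]|none] := pselect (exists R, C R /\ good R); last first.
left; rewrite -subset0 => f [R CR Rf]; have [R0'|gR] := CP _ CR; first by rewrite R0' in Rf. by case: none; exists R.
have two f g: (\bigcup_(X in C) X)%classic f -> (\bigcup_(X in C) X)%classic g ->
exists X, [/\ C X, good X, X f & X g]. move=> [X CX Xf] [Y CY Yg].
have gX: good X by case: (CP _ CX) => // e; rewrite e in Xf.
have gY: good Y by case: (CP _ CY) => // e; rewrite e in Yg.
by case: (tot _ _ CX CY) => s; [exists Y|exists X]; split=> //; apply: s.
right; split=> [f /(let: And4 s _ _ _ := gR in s) Rf|f g hf hg|f g hf hg|hp].
- by exists R.
- have [X [CX [_ B _ _] Xf Xg]] := two _ _ hf hg. by exists X => //; apply: B.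
- have [X [CX [_ _ M _] Xf Xg]] := two _ _ hf hg. by exists X => //; apply: M.
- by have [X [CX [_ _ _ nX] /nX]] := two _ _ hp hp. have g0: good R0 by split. case: PR => [R_0|gR].
case: (maxR R0); last by right. by rewrite R_0; split=> // /(_ _ R01).
exists R => // R' gR' RR'; apply: contrapT => ne; apply: (maxR R'); last by right.
by split=> // R'R; apply: ne; rewrite eqEsubset.
Qed.

Section Maximal.
Variable R: set F.
Hypotheses (gR: good R) (maxR: forall R', good R' -> (R `<=` R')%classic -> R' = R).

Let RB f g: R f -> R g -> R (f - g). Proof. by case: gR => _ + _ _; apply. Qed.
Let RM f g: R f -> R g -> R (f * g). Proof. by case: gR => _ _ + _; apply. Qed.
Let R1: R 1. Proof. by case: gR => + _ _ _; apply. Qed.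
Let Rpi: R pi. Proof. by case: gR => + _ _ _; apply. Qed.
Let RVpi: ~ R pi^-1. Proof. by case: gR. Qed.
Let Rz: R 0. Proof. by rewrite -(subrr 1); apply: RB. Qed.
Let RN f: R f -> R (- f). Proof. by rewrite -sub0r; apply: RB. Qed.
Let RD f g: R f -> R g -> R (f + g). Proof. by move=> hf hg; rewrite -[g]opprK; apply: RB (RN _). Qed.
Let RX f k: R f -> R (f ^+ k). Proof. by move=> h; elim: k => // k IH; rewrite exprS; apply: RM. Qed.
Let Rsum (I: Type) (r: seq I) (P: pred I) (G: I -> F) :
 (forall i, P i -> R (G i)) -> R (\sum_(i <- r | P i) G i).
 by move=> h; elim/big_ind: _. Qed.

Let adj (x: F) : set F := [set f | exists2 c : {poly F}, forall i, R c`_i & f = c.[x]].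

(** R[x] is strictly larger than R, so by maximality it can only fail the last condition of
    [good]. *)
Lemma adj_inv_pi x: ~ R x -> adj x pi^-1.
 move=> nRx; apply: contrapT => nadj; apply: nRx.
have <-: adj x = R; last by exists 'X; [move=> i; rewrite coefX; case: eqP|rewrite hornerX].
apply: maxR; last by move=> f Rf; exists f%:P; [move=> i; rewrite coefC; case: ifP|rewrite hornerC]. split=> //.
- move=> f /(let: And4 s _ _ _ := gR in s) Rf. by exists f%:P; [move=> i; rewrite coefC; case: ifP|rewrite hornerC].
- move=> _ _ [c hc ->] [c' hc' ->]; exists (c - c'); last by rewrite hornerD hornerN.
by move=> i; rewrite coefB; apply: RB.
- move=> _ _ [c hc ->] [c' hc' ->]; exists (c * c'); last by rewrite hornerM.
by move=> i; rewrite coefM; apply: Rsum => j _; apply: RM.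
Qed.
(** Let u = 1 - pi f and suppose that u^-1 is not in R. Then pi^-1 is a polynomial in u^-1, so u^m /
    pi lies in R for some m. So does (1 - u^m) / pi, because u is 1 modulo pi, and the sum of the
    two is pi^-1. *)
Lemma unit_sub1 f: R f -> R (1 - pi * f)^-1.
 move=> Rf; have R1f: R (1 - pi * f) by apply: RB => //; apply: RM.
apply: contrapT => /adj_inv_pi [c hc]; set u := 1 - pi * f in hc *. have u0: u != 0.
apply: contra_not_neq RVpi => /eqP; rewrite subr_eq0 => /eqP e. by rewrite -[pi^-1]mulr1 e mulKf.
move=> e; have : R (u ^+ size c / pi). rewrite e horner_coef mulr_sumr; apply: Rsum => i _.
rewrite mulrCA exprVn -expfB_cond ?(negPf u0) ?add0n 1?ltnW //. by apply: RM => //; apply: RX.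
have : R (pi^-1 * (1 - u ^+ size c)). rewrite -(expr1n _ (size c)) subrXX mulrA /u opprB subrKC.
by rewrite mulKf //; apply: RM => //; apply: Rsum => i _; apply: RM; apply: RX.
move=> h1 h2; apply: RVpi; have := RD h1 h2; congr (R _). by rewrite mulrBr mulr1 [u ^+ _ / _]mulrC subrK.
Qed.

(* Degree reduction in the valuation ring criterion: 1 = pi c(x) = pi c'(1/x)
   with deg c >= deg c' > 0 allows lowering deg c. *)
Lemma valuation_ring x: R x \/ R x^-1.
 apply: contrapT => /not_orP[n1 n2]. have x0: x != 0 by apply: contra_not_neq n1 => ->.
have key m: forall y, y != 0 -> ~ R y -> ~ R y^-1 ->
forall c c' : {poly F}, (forall i, R c`_i) -> (forall i, R c'`_i) ->
(size c + size c' <= m)%N ->  pi * c.[y] = 1 -> pi * c'.[y^-1] = 1 -> False.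
elim: m => [|m IH] y y0 ny nvy c c' hc hc' sz e e'. have c0: c = 0 by apply/eqP; rewrite -size_poly_eq0; lia.
by move: e; rewrite c0 horner0 mulr0 => /esym/eqP; rewrite oner_eq0.
wlog le : y y0 ny nvy c c' hc hc' sz e e' / (size c' <= size c)%N.
move=> W; have [le|lt] := leqP (size c') (size c); first exact: (W y y0 ny nvy c c').
apply: (W y^-1) e' _ (ltnW lt) => //; rewrite ?invrK //. by rewrite addnC.
have big (b: {poly F}) z : (forall i, R b`_i) -> pi * b.[z] = 1 -> (1 < size b)%N.
move=> hb eb; rewrite ltnNge; apply/negP => /size1_polyC eb0.
apply: RVpi; rewrite -[pi^-1]mulr1 -eb mulKf // eb0 hornerC; exact: hb.
have s' := big _ _ hc' e'; have s1 := big _ _ hc e.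
(* y^-1 version: 1 = sum_{j>=1} pi b_j y^-j with b_j in R *)
pose u := 1 - pi * c'`_0; pose b j := c'`_j / u. have Rb j: R (b j) by apply: RM => //; apply: unit_sub1.
have u0: u != 0. apply: contra_not_neq RVpi => /eqP; rewrite subr_eq0 => /eqP e0. by rewrite -[pi^-1]mulr1 e0 mulKf.
have eb: 1 = pi * \sum_(j < (size c').-1) b j.+1 * y^-1 ^+ j.+1.
have sc: size c' = (size c').-1.+1 by rewrite prednK // ltnW. apply: (mulfI u0); rewrite mulr1 mulrCA mulr_sumr.
transitivity (pi * \sum_(j < (size c').-1) c'`_j.+1 * y^-1 ^+ j.+1); last first.
by congr (_ * _); apply: eq_bigr => j _; rewrite mulrA [u * _]mulrC divfK.
rewrite /u -{1}e' horner_coef sc big_ord_recl expr0 mulr1 mulrDr. by ring. pose k := (size c).-1.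
pose d := \poly_(i < k) (c`_i + pi * c`_k * \sum_(j < (size c').-1 | (j.+1 + i == k)%N) b j.+1). have Rd i: R d`_i.
rewrite coef_poly; case: ifP => // _; apply: RD => //; apply: RM; first exact: RM. by apply: Rsum => j _; apply: Rb.
apply: (IH y y0 ny nvy d c') => //. by have := size_poly k (fun i => c`_i + pi * c`_k *
\sum_(j < (size c').-1 | (j.+1 + i == k)%N) b j.+1); rewrite -/d /k; lia.
rewrite -[RHS]e; congr (_ * _); rewrite /d horner_poly.
rewrite [RHS]horner_coef -[size c]prednK ?(ltnW s1) // -/k [RHS]big_ord_recr /=.
under eq_bigr do rewrite mulrDl; rewrite big_split /=; congr (_ + _).
transitivity (pi * c`_k * \sum_(i < k) \sum_(j < (size c').-1 | (j.+1 + i == k)%N) b j.+1 * y ^+ i).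
by rewrite mulr_sumr; apply: eq_bigr => i _; rewrite -[in RHS]mulr_suml mulrA.
rewrite -[y ^+ k]mul1r [X in _ * (X * _)]eb -!mulrA mulrCA; congr (_ * (_ * _)).
rewrite (exchange_big_dep xpredT) //= mulr_suml; apply: eq_bigr => j _.
have jk': (j < k)%N by apply: leq_trans (ltn_ord j) _; rewrite /k -!subn1 leq_sub2r.
have jk: (k - j.+1 < k)%N by move: jk'; clia. rewrite (big_pred1 (Ordinal jk)) /=.
by rewrite -mulrA; congr (_ * _); rewrite exprVn [in RHS]mulrC -expfB_cond ?(negPf y0) //.
move=> i; apply/eqP/eqP => [ei|-> /=]; last by rewrite subnKC. by apply: val_inj; rewrite /= -[in RHS]ei addnC addnK.
have [c hc e] := adj_inv_pi n1; have [c' hc' e'] := adj_inv_pi n2.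
by apply: (key _ x x0 n1 n2 c c') => //; rewrite -(e, e') divff.
Qed.
Lemma root_closed f m: R (f ^+ m.+1) -> R f.
 move=> h; have [//|h'] := valuation_ring f. have [->//|f0] := eqVneq f 0.
have ->: f = f ^+ m.+1 * f^-1 ^+ m by rewrite exprS exprVn mulfK // expf_neq0. by apply: RM => //; apply: RX.
Qed.

Let U f := [/\ f != 0, R f & R f^-1].
Let M f := R f /\ ~ U f.
Let UM f g: U f -> U g -> U (f * g).
 by move=> [f0 ? ?] [g0 ? ?]; split; rewrite ?invfM //; apply: RM. Qed.
Let UV f: U f -> U f^-1.
 by case=> ? ? ?; split; rewrite ?invrK. Qed.
Let UX f k: U f -> U (f ^+ k).
 by case=> ? ? ?; split; rewrite -?exprVn //; apply: RX. Qed.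

Let MD f g: M f -> M g -> M (f + g).
 have half (a b: F) : R b -> R (a / b) -> U (a + b) -> b != 0 -> U b. move=> Rb h [ab0 h1 h2] b0; split=> //.
have ->: b^-1 = (a / b + 1) / (a + b) by field; rewrite ab0. by apply: RM => //; apply: RD.
move=> [Rf Mf] [Rg Mg]; split; [exact: RD|move=> Ufg].
have [f0|f0] := eqVneq f 0; first by apply: Mg; rewrite f0 add0r in Ufg.
have [g0|g0] := eqVneq g 0; first by apply: Mf; rewrite g0 addr0 in Ufg.
case: (valuation_ring (f / g)) => [h|]; first by apply: Mg; apply: half h Ufg g0.
rewrite invf_div => h; apply: Mf; apply: half h _ f0 => //. by rewrite addrC.
Qed.
(** In the relation sum c_i f^i = 0 the dominant term must have a unit quotient with another term,
    since it could not cancel otherwise. That quotient is a power of f times elements of E, which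
    are powers of pi up to units. *)
Lemma power_unit_pi f: f != 0 ->
 exists2 i, (0 < i <= n)%N & exists k : int, U (f ^+ i * pi ^ k).
 move=> f0; have [c [Ec [i1 ci1] sum0]] := algF f. pose t i := c i * f ^+ i.
have t0 i: (t i == 0) = (c i == 0) by rewrite mulf_eq0 expf_eq0 (negPf f0) andbF orbF.
have [j tj jmax]: exists2 j, t j != 0 & forall i, R (t i / t j).
have main (s: seq 'I_n.+1) : has (fun i => t i != 0) s -> exists2 j, t j != 0 & forall i, i \in s -> R (t i / t j).
elim: s => //= k s IH; have [/IH[j tj hj]|none] := boolP (has (fun i => t i != 0) s).
case: (valuation_ring (t k / t j)) => [h _|h _]. by exists j => // i; rewrite inE => /predU1P[->//|/hj].
rewrite invf_div in h; have [tk|tk] := eqVneq (t k) 0.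
by exists j => // i; rewrite inE => /predU1P[->|/hj//]; rewrite tk mul0r.
exists k => // i; rewrite inE => /predU1P[->|/hj h']; first by rewrite divff. by have := RM h' h; rewrite mulrA divfK.
rewrite orbF => tk; exists k => // i; rewrite inE => /predU1P[->|si]; first by rewrite divff.
by move/hasPn: none => /(_ i si); rewrite negbK => /eqP->; rewrite mul0r. have [|j tj hj] := main (enum 'I_n.+1).
by apply/hasP; exists i1; rewrite ?mem_enum // t0. by exists j => // i; apply: hj; rewrite mem_enum.
have [i ij Uij]: exists2 i, i != j & U (t i / t j). apply: contrapT => none; have : M (\sum_(i | i != j) t i / t j).
elim/big_ind: _ => //; first by split=> // -[]; rewrite eqxx. by move=> i ij; split=> // Ui; apply: none; exists i.
move=> [_]; apply; rewrite -mulr_suml. have ->: \sum_(i | i != j) t i = - t j.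
by apply/eqP; rewrite -addr_eq0 addrC; have := sum0; rewrite (bigD1 j) //= => ->.
by rewrite mulNr divff //; split; rewrite ?oppr_eq0 ?oner_neq0 ?invrN ?invr1 //; apply: RN.
have ti: t i != 0 by case: Uij; rewrite mulf_eq0 negb_or => /andP[].
have Epi k: t k != 0 -> exists l : int, U (c k * pi ^ l). rewrite t0 => ck; have [l [h1 h2]] := E_pi (Ec k) ck.
exists (- l); case: gR => s _ _ _; split; first by rewrite mulf_neq0. exact: s.
by rewrite invfM invr_expz opprK; apply: s.
have cmp (k l: 'I_n.+1) : (l < k)%N -> t k != 0 -> t l != 0 -> U (t k / t l) ->
exists2 i, (0 < i <= n)%N & exists e : int, U (f ^+ i * pi ^ e).
move=> lk tk tl Ukl; have [a Ua] := Epi _ tk; have [b Ub] := Epi _ tl.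
exists (k - l)%N; first by have := ltn_ord k; lia. exists (b - a); have := UM (UM Ukl (UV Ua)) Ub; congr U.
rewrite /t expfzDr // -invr_expz. have ->: f ^+ k = f ^+ (k - l) * f ^+ l by rewrite -exprD subnK // ltnW.
move: tk tl; rewrite !t0; move: (expfz_neq0 a pi0) (expf_neq0 l f0).
move: (pi ^ a) (pi ^ b) (f ^+ l) (f ^+ (k - l)) (c k) (c l) => x1 x2 x3 x4 x5 x6 *. by field; do ?[apply/andP; split].
case: (ltngtP i j) => [lt|lt|/val_inj e]; last by rewrite e eqxx in ij.
by apply: (cmp j i) => //; rewrite -invf_div; apply: UV. exact: (cmp i j).
Qed.
(** One exponent n! for all f: the values normalized at pi have bounded denominators, which is why
    the value group is discrete. *)
Lemma fact_power_unit f: f != 0 -> exists k : int, U (f ^+ n`! * pi ^ k).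
 move=> /power_unit_pi[i i_n [k Uk]].
have [m ->]: exists m, n`! = (i * m)%N by exists (n`! %/ i)%N; rewrite mulnC divnK // dvdn_fact.
exists (k * m); rewrite exprM -exprz_exp -exprMn_comm; last exact: mulrC. exact: UX.
Qed.
Lemma unit_pi_eq0 (k: int) : U (pi ^ k) -> k = 0.
 have neg m: ~ U (pi ^ Negz m). rewrite NegzE -exprz_inv => -[_ h _]; apply: RVpi. exact: root_closed h.
case: k => [[//|k]|k Uk]; last by case: (neg k). by move=> /UV; rewrite invr_expz => /neg.
Qed.
Lemma maximal_dval: exists v : dval F, (forall f, R f -> vge v 0 f) /\ 0 < v pi.
 have N0: (0 < n`!)%N := fact_gt0 n. pose lam f : int := if pselect (exists k: int, U (f ^+ n`! * pi ^ k)) is left e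
then - projT1 (cid e) else 0. have lamP f: f != 0 -> U (f ^+ n`! * pi ^ (- lam f)).
move=> f0; rewrite /lam; case: pselect => [e|/(_ (fact_power_unit f0))//]. by rewrite opprK; case: (cid e).
have lamE f k: f != 0 -> U (f ^+ n`! * pi ^ (- k)) -> lam f = k. move=> f0 Uk; have := UM (UV (lamP f f0)) Uk.
rewrite invfM mulrACA mulVf // mul1r invr_expz opprK -expfzDr //. by move/unit_pi_eq0; lia.
have lamM f g: f != 0 -> g != 0 -> lam (f * g) = lam f + lam g.
move=> f0 g0; apply: lamE; first by rewrite mulf_neq0.
by rewrite opprD expfzDr // exprMn mulrACA; apply: UM; apply: lamP. have lamR f: f != 0 -> R f <-> 0 <= lam f.
move=> f0; have Uf := lamP f f0; have p0 := expfz_neq0 (- lam f) pi0.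
have Npos (k: nat) : R (pi ^ k) by rewrite -exprnP; apply: RX. rewrite -[n`!]prednK // in Uf; split=> h.
rewrite leNgt; apply/negP => neg; have : R (pi^-1); last exact: RVpi.
apply: (@root_closed _ `|lam f|.-1); rewrite prednK; last by lia. case: Uf => _ _ Uf.
have := RM Uf (RX n`!.-1.+1 h); rewrite invfM mulrAC mulVf // mul1r invr_expz opprK.
by congr R; rewrite exprVn exprnN; congr (_ ^ _); lia.
apply: (@root_closed _ n`!.-1); case: Uf => _ + _ => /RM/(_ (Npos `|lam f|%N)).
by rewrite -mulrA -expfzDr // gez0_abs // addNr mulr1. have lampi: lam pi = n`!.
apply: lamE => //; rewrite -exprnN mulfV //. by split; rewrite ?oner_neq0 ?invr1.
(* [lam] is n! times the valuation normalized by pi -> 1. Its values form a subgroup of the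
   integers, and division by the least positive one, e, gives the surjectivity required of a
   [dval]. *)
have [e [e0 [t t0 te] emin]]: exists e : nat, [/\ (0 < e)%N,
exists2 t, t != 0 & lam t = e & forall f, f != 0 -> 0 < lam f -> e%:Z <= lam f].
have ex: exists e, `[< (0 < e)%N /\ exists2 t, t != 0 & lam t = e%:Z >].
by exists n`!; apply/asboolP; split=> //; exists pi.
case: (ex_minnP ex) => e /asboolP[e0 he] emin; exists e; split=> // f f0 lf. suff : (e <= `|lam f|)%N by lia.
by apply: emin; apply/asboolP; split; [|exists f => //]; lia. have lam_dvd f: f != 0 -> (e %| lam f)%Z.
move=> f0; rewrite -[(_ %| _)%Z]negbK; apply/negP => nd. pose g := f * t ^ (- (lam f %/ e)%Z).
have g0: g != 0 by rewrite mulf_neq0. have lamX (k: int) : lam (t ^ k) = k * e.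
apply: lamE; first exact: expfz_neq0. have := lamP t t0; rewrite te => Ut.
have ->: (t ^ k) ^+ n`! * pi ^ (- (k * e)) = (t ^+ n`! * pi ^ (- e%:Z)) ^ k.
rewrite expfzMl exprz_exp !exprnP !exprz_exp; congr (_ * _ ^ _); last by lia. by rewrite mulrC.
by case: k => k; [rewrite -exprnP; apply: UX|rewrite NegzE -exprz_inv -exprnP; apply: UX; apply: UV].
have lg: lam g = (lam f %% e)%Z. by rewrite lamM // lamX mulNr {1}(divz_eq (lam f) e) addrAC subrr add0r.
have e0': e%:Z != 0 by lia. have m0 := modz_ge0 (lam f) e0'; have := ltz_mod (lam f) e0'.
have := emin g g0; rewrite lg; lia. pose o f : int := if f == 0 then 0 else (lam f %/ e)%Z.
have oE f: f != 0 -> o f * e = lam f by move=> f0; rewrite /o (negPf f0) divzK ?lam_dvd.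
have oR f: f != 0 -> R f <-> 0 <= o f. move=> f0; rewrite lamR // -oE //; split; nia.
have o0: o 0 = 0 by rewrite /o eqxx. have oM f g: f != 0 -> g != 0 -> o (f * g) = o f + o g.
move=> f0 g0; have := lamM f g f0 g0; rewrite -!oE //; nia. have oV f: f != 0 -> o f^-1 = - o f.
move=> f0; have := oM f f^-1 f0; rewrite invr_eq0 divff // => /(_ f0). have ->: o 1 = 0; last by lia.
by have := oM 1 1 (oner_neq0 _) (oner_neq0 _); rewrite mulr1; move: (o 1) => z; lia.
have oD f g: f != 0 -> g != 0 -> f + g != 0 -> Num.min (o f) (o g) <= o (f + g).
move=> f0 g0 fg0; wlog le : f g f0 g0 fg0 / o f <= o g.
move=> W; have [le|lt] := leP (o f) (o g); first by have := W f g f0 g0 fg0 le; rewrite min_l.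
rewrite addrC in fg0 *; have := W g f g0 f0 fg0 (ltW lt); rewrite min_l //; exact: ltW.
rewrite min_l //; have n0: (f + g) / f != 0 by rewrite mulf_neq0. have : R ((f + g) / f).
rewrite mulrDl divff //; apply: RD => //. by apply/oR; rewrite ?oM // oV //; lia.
by move/oR => /(_ n0); rewrite oM // oV //; lia. have os: exists2 s, s != 0 & o s = 1.
by exists t => //; have := oE t t0; rewrite te; nia.
exists (@Dval F o o0 oM oD os); split=> [f Rf|/=]; last by have := oE pi pi0; rewrite lampi; nia.
by have [->|f0] := eqVneq f 0; [exact: vge0|rewrite vgeE //; apply/oR].
Qed.

End Maximal.

Lemma dval_extension: exists v : dval F, (forall f, R0 f -> vge v 0 f) /\ 0 < v pi.
 have [R gR maxR] := exists_maximal_subring.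
have [v [vR vpi]] := maximal_dval gR maxR; exists v; split=> // f Rf; apply: vR. by case: gR => + _ _ _; apply.
Qed.

End Extension.

(** * Independence of discrete valuations *)

Section WeakApproximation.
Variable F: fieldType.
Implicit Types v w : dval F.

(** Units for v are units for w, so w is w(t) times v for a uniformizer t of v, and surjectivity of
    w forces w(t) = 1. *)
Lemma dval_maximal v w: (forall f, vge v 0 f -> vge w 0 f) -> v = w.
 move=> vw; have [t t0 vt] := dv_surj v; have [s s0 ws] := dv_surj w. have unit f: f != 0 -> v f = 0 -> w f = 0.
move=> f0 vf; have h1: vge w 0 f by apply: vw; rewrite vgeE // vf.
have h2: vge w 0 f^-1 by apply: vw; rewrite vgeE // dvV vf. by move: h1 h2; rewrite !vgeE // dvV; lia.
have wE f: f != 0 -> w f = v f * w t. move=> f0; have := unit (f * t ^ (- v f)).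
rewrite !dvM ?mulf_neq0 // !dvXz // vt mulr1 subrr.
by move=> /(_ isT erefl); rewrite mulNr => /eqP; rewrite subr_eq0 => /eqP. have wt: w t = 1.
have := wE s s0; have : 0 <= w t by rewrite -vgeE //; apply: vw; rewrite vgeE // vt.
rewrite ws => wt0 e; have : (w t %| 1)%Z by apply/dvdzP; exists (v s). by rewrite dvdz1; move: (w t) wt0 => z; lia.
apply: dval_eqP => f; have [->|f0] := eqVneq f 0; first by rewrite !dv0. by rewrite wE // wt mulr1.
Qed.
Lemma separate_dval v w: v != w -> exists2 f, f != 0 & 0 < v f /\ w f < 0.
 have one v' w': v' != w' -> exists2 f, f != 0 & 0 <= v' f /\ w' f < 0.
move=> vw; apply: contrapT => none; case/eqP: vw; apply: dval_maximal => f.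
have [->|f0] := eqVneq f 0; first by rewrite !vge0.
rewrite !vgeE // leNgt [_ <= w' f]leNgt; apply: contra => h; rewrite ltNge.
by apply/negP => vf; apply: none; exists f. move=> vw; have [f f0 [vf wf]] := one v w vw.
move: (vw); rewrite eq_sym => /one[g g0 [wg vg]]. exists (f / g); first by []. by rewrite !dv_div //; lia.
Qed.
Lemma separate_dvals v (s: seq (dval F)) : v \notin s ->
 exists2 f, f != 0 & 0 < v f /\ forall w, w \in s -> w f < 0.
 elim: s => [_|w s IH]; first by have [t t0 vt] := dv_surj v; exists t; rewrite ?vt.
rewrite inE negb_or => /andP[/separate_dval[g g0 [vg wg]] /IH[f f0 [vf sf]]].
have [wf|wf] := ltP (w f) 0; first by exists f => //; split=> // u; rewrite inE => /predU1P[->|/sf].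
(* r exceeds every |u f|: g^r dominates where g has a pole, and f dominates elsewhere. *)
pose r := (\sum_(u <- s) `|u f|%N).+1. have wh: f + g ^+ r != 0 /\ w (f + g ^+ r) = w (g ^+ r).
rewrite addrC; apply: dvD_lt; rewrite // vgeE // dvX //; nia. have h0 := wh.1. exists (f + g ^+ r) => //; split.
have := dvD v f0 (expf_neq0 r g0) h0; rewrite dvX //. by apply: lt_le_trans; rewrite lt_min vf /=; nia.
move=> u; rewrite inE => /predU1P[->|us]; first by rewrite wh.2 dvX //; nia.
have uf := sf u us; have rf: (`|u f| < r)%N. by rewrite ltnS (big_rem u us) /= leq_addr. have [ug|ug] := leP 0 (u g).
have [_ ->//]: f + g ^+ r != 0 /\ u (f + g ^+ r) = u f. by apply: dvD_lt => //; rewrite vgeE // dvX //; nia.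
rewrite addrC; have [_ ->]: g ^+ r + f != 0 /\ u (g ^+ r + f) = u (g ^+ r).
by apply: dvD_lt; rewrite // vgeE // dvX //; nia. by rewrite dvX //; nia.
Qed.
(** Take e = 1 / (1 + f^(n+1)), where f is positive at v and negative at every w in s. *)
Lemma weak_approximation v (s: seq (dval F)) (n: nat) : v \notin s ->
 exists e, vge v n (e - 1) /\ forall w, w \in s -> vge w n e.
 move=> /separate_dvals[f f0 [vf sf]]. have vf1: 1 + f ^+ n.+1 != 0 /\ v (1 + f ^+ n.+1) = v 1.
by apply: dvD_lt; rewrite ?oner_neq0 // dv1 vgeE // dvX //; nia.
have h0 := vf1.1; exists (1 + f ^+ n.+1)^-1; split=> [|w /sf wf].
have ->: (1 + f ^+ n.+1)^-1 - 1 = - f ^+ n.+1 / (1 + f ^+ n.+1) by field. rewrite vgeE //.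
by rewrite dv_div // vf1.2 dvN dv1 dvX //; nia.
rewrite vgeE // dvV; have [_ ->]: 1 + f ^+ n.+1 != 0 /\ w (1 + f ^+ n.+1) = w (f ^+ n.+1).
by rewrite addrC; apply: dvD_lt; rewrite // vgeE ?oner_neq0 // dv1 dvX //; nia. by rewrite dvX //; nia.
Qed.

End WeakApproximation.

(** * The residue field of a discrete valuation *)

Section ResidueField.
Variables (F: fieldType) (v: dval F).

(** A chosen representative of each residue class; it makes the residue field a subtype of F, with
    the lift [res_val] built in. *)
Definition canon (f: F) : F := choose (fun g => vge v 1 (g - f)) f.

Lemma canonP f: vge v 1 (canon f - f).
 by apply: (@chooseP _ (fun g => vge v 1 (g - f))); rewrite subrr vge0. Qed.
Lemma canon_eq f g: vge v 1 (f - g) -> canon f = canon g.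
 move=> fg; rewrite /canon -(@eq_choose _ (fun h => vge v 1 (h - g))). by apply: choose_id; rewrite ?subrr ?vge0.
by move=> h /=; apply/idP/idP => k; apply: vge_trans k _; rewrite // vge_subC.
Qed.

Record resf := ResF { res_val : F; _ : vge v 0 res_val && (canon res_val == res_val) }.

HB.instance Definition _ := [isSub for res_val].
HB.instance Definition _ := [Choice of resf by <:].

Fact canon_resf f: vge v 0 f -> vge v 0 (canon f) && (canon (canon f) == canon f).
 move=> vf; apply/andP; split; last by apply/eqP/canon_eq/canonP.
by rewrite -[canon f](subrK f) vgeD //; apply: vgeW (canonP f).
Qed.

(** Outside the valuation ring the value is that of 0, so the rules for [rd] carry integrality
    hypotheses. *)
Definition rd (f: F) : resf :=
 if boolP (vge v 0 f) is AltTrue vf then ResF (canon_resf vf) else ResF (canon_resf (vge0 v 0)).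

Lemma rd_val f: vge v 0 f -> val (rd f) = canon f.
 by rewrite /rd; case: {-}_ / boolP => // /negPf->. Qed.
Lemma rd_eqP f g: vge v 0 f -> vge v 0 g -> rd f = rd g <-> vge v 1 (f - g).
 move=> vf vg; split=> [e|/canon_eq e]; last by apply: val_inj; rewrite !rd_val.
have := congr1 val e; rewrite /= !rd_val // => ce. have h1 := canonP f; have h2 := canonP g; rewrite -ce in h2.
by rewrite vge_subC in h1; apply: vge_trans h1 h2.
Qed.
Lemma vge_res u: vge v 0 (res_val u).
 by case: u => f /= /andP[]. Qed.
Lemma rdK u: rd (res_val u) = u.
 by apply: val_inj; rewrite /= rd_val ?vge_res //; case: u => f /= /andP[_ /eqP]. Qed.
Lemma res_valP f: vge v 0 f -> vge v 1 (res_val (rd f) - f).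
 by move=> vf; apply/rd_eqP; rewrite ?vge_res ?rdK. Qed.

Let add u w := rd (res_val u + res_val w).
Let opp u := rd (- res_val u).
Let mul u w := rd (res_val u * res_val w).
Let inv u := if u == rd 0 then u else rd (res_val u)^-1.

Let addE f g: vge v 0 f -> vge v 0 g -> add (rd f) (rd g) = rd (f + g).
 move=> vf vg; apply/(rd_eqP (vgeD (vge_res _) (vge_res _)) (vgeD vf vg)). by rewrite opprD addrACA vgeD ?res_valP.
Qed.
Let mulE f g: vge v 0 f -> vge v 0 g -> mul (rd f) (rd g) = rd (f * g).
 move=> vf vg; apply/(rd_eqP (vgeM0 (vge_res _) (vge_res _)) (vgeM0 vf vg)).
by apply: vgeM_sub; rewrite ?vge_res ?res_valP.
Qed.
Let oppE f: vge v 0 f -> opp (rd f) = rd (- f).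
 by move=> vf; apply/rd_eqP; rewrite ?vgeN ?vge_res // -opprD vgeN res_valP. Qed.
Let ex u: exists2 f, vge v 0 f & u = rd f.
 by exists (res_val u); rewrite ?vge_res ?rdK. Qed.
Fact res_addA: associative add.
 move=> u w t; have [f vf ->] := ex u; have [g vg ->] := ex w; have [h vh ->] := ex t. by rewrite !addE ?vgeD // addrA.
Qed.
Fact res_addC: commutative add.
 by move=> u w; rewrite /add addrC. Qed.
Fact res_add0: left_id (rd 0) add.
 by move=> u; have [f vf ->] := ex u; rewrite addE ?vge0 // add0r. Qed.
Fact res_addN: left_inverse (rd 0) opp add.
 by move=> u; have [f vf ->] := ex u; rewrite oppE // addE ?vgeN // addNr. Qed.

HB.instance Definition _ := GRing.isZmodule.Build resf res_addA res_addC res_add0 res_addN.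

Fact res_mulA: associative mul.
 move=> u w t; have [f vf ->] := ex u; have [g vg ->] := ex w; have [h vh ->] := ex t.
by rewrite !mulE ?vgeM0 // mulrA.
Qed.
Fact res_mulC: commutative mul.
 by move=> u w; rewrite /mul mulrC. Qed.
Fact res_mul1: left_id (rd 1) mul.
 by move=> u; have [f vf ->] := ex u; rewrite mulE ?vge1 // mul1r. Qed.
Fact res_mulD: left_distributive mul +%R.
 move=> u w t; have [f vf ->] := ex u; have [g vg ->] := ex w; have [h vh ->] := ex t.
rewrite [rd f + rd g]addE // !mulE ?vgeD //. by rewrite [rd (f * h) + _]addE ?vgeM0 // mulrDl.
Qed.
Fact res_1neq0: rd 1 != rd 0.
 apply/eqP => /rd_eqP; rewrite vge1 vge0 subr0 => /(_ isT isT). by rewrite vgeE ?oner_neq0 // dv1.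
Qed.

HB.instance Definition _ := GRing.Zmodule_isComNzRing.Build resf
 res_mulA res_mulC res_mul1 res_mulD res_1neq0.

Fact res_mulV (u: resf) : u != 0 -> inv u * u = 1.
 move=> u0; have nv: ~~ vge v 1 (res_val u). apply: contra u0 => h; apply/eqP; rewrite -[LHS]rdK.
by apply/rd_eqP; rewrite ?vge_res ?vge0 // subr0. have r0: res_val u != 0 by apply: contraNneq nv => ->; apply: vge0.
have vr := vge_res u; rewrite /inv ifN // -[X in _ * X]rdK [LHS]mulE ?mulVf //.
by move: nv vr; rewrite !vgeE // dvV; lia.
Qed.
Fact res_inv0: inv 0 = 0.
 by rewrite /inv eqxx. Qed.

HB.instance Definition _ := GRing.ComNzRing_isField.Build resf res_mulV res_inv0.

Lemma rdD f g: vge v 0 f -> vge v 0 g -> rd (f + g) = rd f + rd g.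
 by move=> vf vg; apply/esym/addE. Qed.
Lemma rdM f g: vge v 0 f -> vge v 0 g -> rd (f * g) = rd f * rd g.
 by move=> vf vg; apply/esym/mulE. Qed.
Lemma rdN f: vge v 0 f -> rd (- f) = - rd f.
 by move=> vf; apply/esym/oppE. Qed.
Lemma rdB f g: vge v 0 f -> vge v 0 g -> rd (f - g) = rd f - rd g.
 by move=> vf vg; rewrite rdD ?vgeN // rdN. Qed.
Lemma rd0: rd 0 = 0. Proof. by []. Qed.
Lemma rd1: rd 1 = 1. Proof. by []. Qed.
Lemma rdX f k: vge v 0 f -> rd (f ^+ k) = rd f ^+ k.
 by move=> vf; elim: k => [|k IH]; rewrite // !exprS rdM ?vge0X ?IH. Qed.
Lemma rd_sum (I: Type) (r: seq I) (P: pred I) (E: I -> F) :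
 (forall i, P i -> vge v 0 (E i)) ->
 rd (\sum_(i <- r | P i) E i) = \sum_(i <- r | P i) rd (E i).
 move=> h; elim: r => [|i r IH]; first by rewrite !big_nil.
by rewrite !big_cons; case: ifP => // Pi; rewrite rdD ?IH ?h //; apply: vge_sum.
Qed.
Lemma rd_eq0 f: vge v 0 f -> (rd f == 0) = vge v 1 f.
 move=> vf; apply/eqP/idP; first by move/rd_eqP; rewrite vge0 subr0; apply.
by move=> h; apply/rd_eqP; rewrite ?vge0 ?subr0.
Qed.
Lemma rd_surj u: exists2 f, vge v 0 f & rd f = u.
 by have [f vf ->] := ex u; exists f. Qed.
Lemma rd_neq0 f: vge v 0 f -> rd f != 0 -> f != 0 /\ v f = 0.
 move=> vf; rewrite rd_eq0 //; have [->|f0] := eqVneq f 0; first by rewrite vge0.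
by move: vf; rewrite !vgeE //; split=> //; lia.
Qed.
Lemma rdV f: f != 0 -> v f = 0 -> rd f^-1 = (rd f)^-1.
 move=> f0 vf; have h: vge v 0 f by rewrite vgeE // vf. have h': vge v 0 f^-1 by rewrite vgeE // dvV vf.
have r0: rd f != 0 by rewrite rd_eq0 // vgeE // vf. by apply: (mulfI r0); rewrite -rdM // !divff.
Qed.

End ResidueField.

(** * The superelliptic function field and its affine ring A *)

Module Curve.
Section Evaluation.
Variables (kap F: fieldType) (s: {rmorphism kap -> F}) (x: F).

Definition evx (c: {poly kap}) : F := (map_poly s c).[x].

Lemma evxD: {morph evx: c c' / c + c'}.
 by move=> c c'; rewrite /evx rmorphD hornerD. Qed.
Lemma evxM: {morph evx: c c' / c * c'}.
 by move=> c c'; rewrite /evx rmorphM hornerM. Qed.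
Lemma evxN c: evx (- c) = - evx c.
 by rewrite /evx rmorphN hornerN. Qed.
Lemma evxB: {morph evx: c c' / c - c'}.
 by move=> c c'; rewrite evxD evxN. Qed.
Lemma evx0: evx 0 = 0. Proof. by rewrite /evx rmorph0 horner0. Qed.
Lemma evx1: evx 1 = 1. Proof. by rewrite /evx rmorph1 hornerC. Qed.
Lemma evxC c: evx c%:P = s c. Proof. by rewrite /evx map_polyC hornerC. Qed.
Lemma evxX: evx 'X = x. Proof. by rewrite /evx map_polyX hornerX. Qed.
Lemma evxXn c n: evx (c ^+ n) = evx c ^+ n.
 by elim: n => [|n IH]; rewrite ?evx1 // !exprS evxM IH. Qed.
Lemma evx_sum (I: Type) (r: seq I) (P: pred I) (G: I -> {poly kap}) :
 evx (\sum_(i <- r | P i) G i) = \sum_(i <- r | P i) evx (G i).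
 exact: (big_morph evx evxD evx0). Qed.
Lemma evx_prod (I: Type) (r: seq I) (P: pred I) (G: I -> {poly kap}) :
 evx (\prod_(i <- r | P i) G i) = \prod_(i <- r | P i) evx (G i).
 exact: (big_morph evx evxM evx1). Qed.
Lemma evx_coef c: evx c = \sum_(i < size c) s c`_i * x ^+ i.
 rewrite /evx horner_coef size_map_inj_poly ?rmorph0 //; last exact: fmorph_inj.
by apply: eq_bigr => i _; rewrite coef_map.
Qed.
End Evaluation.

(* The function field of y^d = x^a (x - 1)^(d+1-a), over a field containing
   the d-th roots of unity. *)
Record scurve (d a: nat) (kap F: fieldType) := SCurve {
 cst : {rmorphism kap -> F};
 cx : F;
 cy : F;
 del : {rmorphism F -> F};
 zet : kap;
 sc_prime : prime d;
 sc_odd : odd d;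
 sc_a : (1 < a < d)%N;
 sc_zet : d.-primitive_root zet;
 sc_eq : cy ^+ d = cx ^+ a * (cx - 1) ^+ (d + 1 - a);
 sc_dcst : forall c, del (cst c) = cst c;
 sc_dx : del cx = cx;
 sc_dy : del cy = cst zet * cy;
 sc_trans : forall c, evx cst cx c = 0 -> c = 0;
 sc_gen : forall f, exists s : nat -> {poly kap}, exists2 c, c != 0 &
 f * evx cst cx c = \sum_(i < d) evx cst cx (s i) * cy ^+ i }.

Lemma irreducible_factor (kap: fieldType) (c: {poly kap}) : (1 < size c)%N ->
 exists2 q, irreducible_poly q & q %| c.
 move=> sc; pose P n := `[< exists q : {poly kap}, [/\ (1 < size q)%N, q %| c & size q = n] >].
have ex: exists n, P n by exists (size c); apply/asboolP; exists c.
case: (ex_minnP ex) => n /asboolP[q [sq qc nq]] min; exists q => //; split=> // r sr rq.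
rewrite -dvdp_size_eqp //; have q0: q != 0 by rewrite -size_poly_gt0 ltnW.
have r0: r != 0 by apply: contraTneq rq => ->; rewrite dvd0p.
rewrite eqn_leq dvdp_leq // nq min //; apply/asboolP; exists r; split=> //.
by rewrite ltn_neqAle eq_sym sr size_poly_gt0. exact: dvdp_trans rq qc.
Qed.

Section Curve.
Variables (d a: nat) (kap F: fieldType) (C: scurve d a kap F).
Notation b := (d + 1 - a)%N.
Notation x := (cx C).
Notation y := (cy C).
Notation ev := (evx (cst C) x).
Notation z := (cst C (zet C)).
Implicit Types (f g: F) (c q r: {poly kap}).

Lemma d_gt0: (0 < d)%N. Proof. exact: prime_gt0 (sc_prime C). Qed.
Lemma ad_bounds: [/\ (0 < a)%N, (a < d)%N, (0 < b)%N & (b < d)%N].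
 by have := sc_a C; split; lia. Qed.
Lemma d_unit: (d%:R : F) != 0.
 by rewrite -(rmorph_nat (cst C)) fmorph_eq0; apply: prim_root_natf_neq0 (sc_zet C). Qed.
Lemma z_unit: z != 0.
 rewrite fmorph_eq0; have := prim_expr_order (sc_zet C); apply: contra_eq_neq => ->.
by rewrite expr0n eqn0Ngt d_gt0 eq_sym oner_neq0.
Qed.
Lemma z_expd: z ^+ d = 1.
 by rewrite -rmorphXn (prim_expr_order (sc_zet C)) rmorph1. Qed.
Lemma z_exp_eq1 k: (z ^+ k == 1) = (d %| k)%N.
 by rewrite (prim_order_dvd (sc_zet C)) -rmorphXn fmorph_eq1. Qed.
Lemma sum_z k: \sum_(j < d) (z ^+ k) ^+ j = if (d %| k)%N then d%:R else 0.
 case: ifP => dk; last first. have z1: z ^+ k - 1 != 0 by rewrite subr_eq0 z_exp_eq1 dk.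
apply: (mulfI z1); rewrite mulr0 -subrX1 exprAC z_expd expr1n subrr //.
have /eqP->: z ^+ k == 1 by rewrite z_exp_eq1. by under eq_bigr do rewrite expr1n; rewrite sumr_const card_ord.
Qed.
Lemma ev0 c: (ev c == 0) = (c == 0).
 by apply/eqP/eqP => [/sc_trans//|->]; rewrite evx0. Qed.
Lemma x_unit: x != 0.
 by rewrite -(evxX (cst C) x) ev0 polyX_eq0. Qed.
Lemma x1E: x - 1 = ev ('X - 1).
 by rewrite evxB evxX evx1. Qed.
Lemma x1_unit: x - 1 != 0.
 by rewrite x1E ev0 polyXsubC_eq0. Qed.
Lemma y_unit: y != 0.
 have := sc_eq C; apply: contra_eq_neq => ->; rewrite expr0n eqn0Ngt d_gt0 /=.
by rewrite eq_sym mulf_neq0 // expf_neq0 ?x_unit ?x1_unit.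
Qed.

Fixpoint dj j : {rmorphism F -> F} :=
 if j is j'.+1 then GRing.RMorphism.clone _ _ (del C \o dj j') _
 else GRing.RMorphism.clone _ _ idfun _.

Lemma djS j f: dj j.+1 f = del C (dj j f). Proof. by []. Qed.
Lemma djD i j f: dj (i + j) f = dj i (dj j f).
 by elim: i => //= i ->. Qed.
Lemma dj_del j f: dj j (del C f) = del C (dj j f).
 by elim: j => //= j ->. Qed.
Lemma del_ev c: del C (ev c) = ev c.
 rewrite evx_coef rmorph_sum; apply: eq_bigr => i _. by rewrite rmorphM rmorphXn sc_dcst sc_dx.
Qed.
Lemma dj_fix j f: del C f = f -> dj j f = f.
 by move=> h; elim: j => //= j ->. Qed.
Lemma dj_ev j c: dj j (ev c) = ev c. Proof. exact/dj_fix/del_ev. Qed.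
Lemma dj_cst j u: dj j (cst C u) = cst C u. Proof. exact/dj_fix/sc_dcst. Qed.
Lemma dj_x j: dj j x = x. Proof. exact/dj_fix/sc_dx. Qed.
Lemma dj_y j: dj j y = z ^+ j * y.
 by elim: j => [|j IH]; rewrite ?mul1r // djS IH rmorphM rmorphXn sc_dcst sc_dy exprSr mulrA.
Qed.
Lemma dj_d f: dj d f = f.
 have [s [c c0 e]] := sc_gen C f; have h: ev c != 0 by rewrite ev0.
apply: (mulIf h); rewrite -{1}(dj_ev d c) -rmorphM e rmorph_sum; apply: eq_bigr => i _.
by rewrite rmorphM rmorphXn dj_ev dj_y z_expd mul1r.
Qed.
Lemma shift_sum (V: zmodType) (G: nat -> V) n : G n = G 0%N ->
 \sum_(j < n) G j.+1 = \sum_(j < n) G j.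
 by move=> e; apply: (addrI (G 0%N)); rewrite -(big_ord_recl n (fun j: 'I_n.+1 => G j)) big_ord_recr /= e addrC.
Qed.

Definition nrm f := \prod_(j < d) dj j f.

Lemma del_nrm f: del C (nrm f) = nrm f.
 rewrite rmorph_prod; under eq_bigr => j _ do rewrite -djS. have [->|f0] := eqVneq f 0.
by rewrite /nrm; apply: eq_bigr => j _; rewrite !rmorph0. have h: dj 0 f != 0 by [].
apply: (mulfI h); rewrite -(big_ord_recl d (fun j: 'I_d.+1 => dj j f)). by rewrite big_ord_recr /= dj_d mulrC.
Qed.
Lemma nrm_neq0 f: f != 0 -> nrm f != 0.
 by move=> f0; apply/prodf_neq0 => j _; rewrite fmorph_eq0. Qed.

Definition inKx f := exists r, exists2 c, c != 0 & f = ev r / ev c.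

(** The average over the group generated by delta kills every component but that of y^0, and a fixed
    f is its own average. *)
Lemma inKx_fix f: del C f = f -> inKx f.
 move=> df; have [s [c c0 e]] := sc_gen C f; have h: ev c != 0 by rewrite ev0.
exists (s 0%N), c => //; apply: (mulIf h); rewrite divfK //; apply: (mulfI d_unit).
have ->: d%:R * (f * ev c) = \sum_(j < d) dj j (f * ev c).
by under eq_bigr do rewrite rmorphM dj_ev dj_fix //; rewrite sumr_const card_ord mulr_natl.
under eq_bigr do rewrite e rmorph_sum; rewrite exchange_big /=.
under eq_bigr => i _ do under eq_bigr => j _ do rewrite rmorphM rmorphXn dj_ev dj_y exprMn exprAC mulrCA.
under eq_bigr => i _ do rewrite -mulr_suml sum_z.
rewrite (bigD1 (Ordinal d_gt0)) //= dvdn0 mulr1 big1 ?addr0 // => i i0.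
by rewrite gtnNdvd ?mul0r // lt0n; apply: contra_neq i0 => e0; apply: val_inj.
Qed.

(* The component of f on which the automorphism acts by z^i. *)
Definition pr i f := d%:R^-1 * \sum_(j < d) (z ^+ i) ^- j * dj j f.

Lemma sum_pr f: \sum_(i < d) pr i f = f.
 rewrite -mulr_sumr exchange_big /=; apply: (mulfI d_unit); rewrite mulVKf ?d_unit //.
under eq_bigr => j _ do rewrite -mulr_suml.
have key j: (j < d)%N -> \sum_(i < d) (z ^+ i) ^- j = if j == 0%N then d%:R else 0.
move=> jd; have := sum_z (d - j); have zj: z ^+ (d - j) = z ^- j.
by rewrite -[LHS]mul1r expfB_cond ?(negPf z_unit) ?(ltnW jd) // z_expd mul1r div1r.
rewrite zj => e; transitivity (\sum_(i < d) z ^- j ^+ i). by apply: eq_bigr => i _; rewrite exprVn exprAC.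
rewrite e; case: eqP => [->|j0]; first by rewrite subn0 dvdnn. by rewrite gtnNdvd //; lia.
rewrite (bigD1 (Ordinal d_gt0)) //= key ?d_gt0 //= big1 ?addr0 // => j j0.
by rewrite key // ifN ?mul0r //; apply: contra_neq j0 => e0; apply: val_inj.
Qed.
Lemma del_pr i f: del C (pr i f) = z ^+ i * pr i f.
 have zi: z ^+ i != 0 by rewrite expf_neq0 ?z_unit. rewrite rmorphM fmorphV rmorph_nat mulrCA; congr (_ * _).
rewrite rmorph_sum mulr_sumr -(@shift_sum _ (fun j => z ^+ i * ((z ^+ i) ^- j * dj j f))).
apply: eq_bigr => j _; rewrite rmorphM fmorphV !rmorphXn sc_dcst exprS invfM. by rewrite !mulrA mulfV // mul1r.
by rewrite dj_d exprAC z_expd expr1n.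
Qed.
Lemma inKx_pr i f: inKx (pr i f / y ^+ i).
 apply: inKx_fix; have yi: y ^+ i != 0 by rewrite expf_neq0 ?y_unit.
have zi: z ^+ i != 0 by rewrite expf_neq0 ?z_unit.
by rewrite rmorphM fmorphV rmorphXn sc_dy del_pr exprMn; field; rewrite zi yi.
Qed.
Lemma inKx_ev c: inKx (ev c).
 by exists c, 1; rewrite ?oner_neq0 // evx1 divr1. Qed.
Lemma inKx_div f g: inKx f -> inKx g -> inKx (f / g).
 move=> [r [c c0 ->]] [r' [c' c'0 ->]]; have [->|r'0] := eqVneq r' 0.
by exists 0, 1; rewrite ?oner_neq0 // evx0 mul0r invr0 mulr0 mul0r. exists (r * c'), (c * r'); first by [].
by rewrite !evxM; field; rewrite !ev0 r'0 c0 c'0.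
Qed.
Lemma inKxM f g: inKx f -> inKx g -> inKx (f * g).
 move=> [r [c c0 ->]] [r' [c' c'0 ->]]; exists (r * r'), (c * c'); first by [].
by rewrite !evxM; field; rewrite !ev0 c0 c'0.
Qed.
Lemma inKx_coprime f: inKx f -> exists r, exists c, [/\ c != 0, coprimep r c & f = ev r / ev c].
 move=> [r [c c0 ->]]; exists (r %/ gcdp r c), (c %/ gcdp r c).
have g0: gcdp r c != 0 by rewrite gcdp_eq0 (negPf c0) andbF.
have c'0: c %/ gcdp r c != 0 by rewrite dvdp_div_eq0 ?dvdp_gcdr.
split=> //; first by apply: coprimep_div_gcd; rewrite c0 orbT.
have er: ev r = ev (r %/ gcdp r c) * ev (gcdp r c) by rewrite -evxM divpK ?dvdp_gcdl.
have ec: ev c = ev (c %/ gcdp r c) * ev (gcdp r c) by rewrite -evxM divpK ?dvdp_gcdr.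
by rewrite {1}er {1}ec; field; rewrite !ev0 g0 c'0.
Qed.

(* Normalized monomials: m i is y^i divided by the largest monomial in x and
   x - 1 keeping it regular off infinity. *)
Definition m i := y ^+ i / (x ^+ (a * i %/ d) * (x - 1) ^+ (b * i %/ d)).

Lemma m_unit i: m i != 0.
 by rewrite mulf_neq0 ?invr_eq0 ?mulf_neq0 ?expf_neq0 ?x_unit ?x1_unit ?y_unit. Qed.
Lemma m0: m 0 = 1.
 by rewrite /m !muln0 div0n mulr1 divr1. Qed.
Lemma m1: m 1 = y.
 by have [? ? ? ?] := ad_bounds; rewrite /m !muln1 !divn_small // mulr1 divr1. Qed.
Lemma m_addd i: m (i + d) = m i.
 rewrite /m !mulnDr ![(_ + _ * d)%N]addnC !divnMDl ?d_gt0 // !exprD sc_eq.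
by field; rewrite !expf_neq0 ?x_unit ?x1_unit.
Qed.
Lemma m_mod i: m i = m (i %% d).
 by rewrite {1}(divn_eq i d) addnC; elim: (i %/ d)%N => [|k IH]; rewrite ?addn0 // mulSnr addnA m_addd. Qed.
Lemma mM i j: exists e e', m i * m j = x ^+ e * (x - 1) ^+ e' * m (i + j).
 have dv n: exists e, (n * (i + j) %/ d = e + n * i %/ d + n * j %/ d)%N.
exists (n * (i + j) %/ d - n * i %/ d - n * j %/ d)%N; rewrite -subnDA -addnA subnK //.
by rewrite mulnDr leq_divRL ?d_gt0 // mulnDl leq_add // leq_divM.
have [e ea] := dv a; have [e' eb] := dv b; exists e, e'.
by rewrite /m ea eb !exprD; field; rewrite !expf_neq0 ?x_unit ?x1_unit.
Qed.
Lemma m_expd i: m i ^+ d = x ^+ (a * i %% d) * (x - 1) ^+ (b * i %% d).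
 rewrite /m exprMn exprVn exprMn exprAC sc_eq exprMn -!exprM.
by rewrite {1}(divn_eq (a * i) d) {1}(divn_eq (b * i) d) !exprD; field; rewrite !expf_neq0 ?x_unit ?x1_unit.
Qed.
Lemma del_m i: del C (m i) = z ^+ i * m i.
 by rewrite /m fmorph_div !rmorphM !rmorphXn rmorphB rmorph1 sc_dx sc_dy exprMn mulrA. Qed.
Lemma inKx_pr_m i f: inKx (pr i f / m i).
 have ->: pr i f / m i = pr i f / y ^+ i * (ev 'X ^+ (a * i %/ d) * ev ('X - 1) ^+ (b * i %/ d)).
rewrite /m -x1E evxX; field. by rewrite !expf_neq0 ?x_unit ?x1_unit ?y_unit.
by rewrite -!evxXn -evxM; apply: inKxM (inKx_ev _); apply: inKx_pr.
Qed.

(** A is the ring of functions regular at all finite places, which [inAP] proves; the explicit free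
    basis supplies the coefficients on which the Gauss norm and the coordinates at infinity are
    built. *)
Definition inA f := exists r : nat -> {poly kap}, f = \sum_(i < d) ev (r i) * m i.

Lemma inA0: inA 0.
 by exists (fun=> 0); rewrite big1 // => i _; rewrite evx0 mul0r. Qed.
Lemma inAD f g: inA f -> inA g -> inA (f + g).
 move=> [r ->] [s ->]; exists (fun i => r i + s i). by rewrite -big_split; apply: eq_bigr => i _; rewrite evxD mulrDl.
Qed.
Lemma inA_evM c f: inA f -> inA (ev c * f).
 move=> [r ->]; exists (fun i => c * r i). by rewrite mulr_sumr; apply: eq_bigr => i _; rewrite evxM mulrA.
Qed.
Lemma inA_sum (I: Type) (s: seq I) (P: pred I) (G: I -> F) :
 (forall i, P i -> inA (G i)) -> inA (\sum_(i <- s | P i) G i).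
 by move=> h; elim/big_ind: _ => //; [exact: inA0|exact: inAD]. Qed.
Lemma inA_m i: inA (m i).
 rewrite m_mod; have id_: (i %% d < d)%N by rewrite ltn_mod d_gt0. exists (fun j => if j == (i %% d)%N then 1 else 0).
rewrite (bigD1 (Ordinal id_)) //= eqxx evx1 mul1r big1 ?addr0 // => j /eqP ji.
by rewrite ifN ?evx0 ?mul0r //; apply: contra_not_neq ji => e; apply: val_inj.
Qed.
Lemma inA_ev c: inA (ev c).
 by rewrite -[ev c]mulr1 -m0; apply/inA_evM/inA_m. Qed.
Lemma inA1: inA 1. Proof. by rewrite -(evx1 (cst C) x); apply: inA_ev. Qed.
Lemma inA_cst u: inA (cst C u). Proof. by rewrite -(evxC (cst C) x); apply: inA_ev. Qed.
Lemma inAM f g: inA f -> inA g -> inA (f * g).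
 move=> [r ->] [s ->]; rewrite mulr_suml; apply: inA_sum => i _.
rewrite mulr_sumr; apply: inA_sum => j _; rewrite mulrACA -evxM; apply: inA_evM.
have [e [e' ->]] := mM i j; rewrite x1E -{1}(evxX (cst C) x) -!evxXn -evxM. exact/inA_evM/inA_m.
Qed.
Lemma inAN f: inA f -> inA (- f).
 by rewrite -mulN1r => h; apply: inAM => //; rewrite -(evx1 (cst C) x) -evxN; apply: inA_ev. Qed.
Lemma inAB f g: inA f -> inA g -> inA (f - g).
 by move=> hf hg; apply/inAD/inAN. Qed.
Lemma inAX k f: inA f -> inA (f ^+ k).
 by move=> h; elim: k => [|k IH]; [exact: inA1|rewrite exprS; apply: inAM]. Qed.
Lemma inA_prod (I: Type) (s: seq I) (P: pred I) (G: I -> F) :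
 (forall i, P i -> inA (G i)) -> inA (\prod_(i <- s | P i) G i).
 by move=> h; elim/big_ind: _ => //; [exact: inA1|exact: inAM]. Qed.
Lemma inA_x: inA x. Proof. by rewrite -(evxX (cst C) x); apply: inA_ev. Qed.
Lemma inA_y: inA y. Proof. by rewrite -m1; apply: inA_m. Qed.
Lemma inA_del f: inA f -> inA (del C f).
 move=> [r ->]; rewrite rmorph_sum; apply: inA_sum => i _; rewrite rmorphM del_ev del_m.
apply: inA_evM; rewrite -rmorphXn; apply: inAM; [exact: inA_cst|exact: inA_m].
Qed.
Lemma inA_dj j f: inA f -> inA (dj j f).
 by move=> h; elim: j => // j IH; rewrite djS; apply: inA_del. Qed.
Lemma pr_ev_m r i j: (i < d)%N -> (j < d)%N -> pr i (ev r * m j) = if i == j then ev r * m j else 0.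
 move=> id_ jd; rewrite /pr; have e k: dj k (ev r * m j) = (z ^+ j) ^+ k * (ev r * m j).
elim: k => [|k IH]; first by rewrite mul1r.
by rewrite djS IH rmorphM rmorphXn rmorphXn sc_dcst rmorphM del_ev del_m exprS; ring.
have ->: \sum_(k < d) (z ^+ i) ^- k * dj k (ev r * m j) =
(\sum_(k < d) (z ^+ i) ^- k * (z ^+ j) ^+ k) * (ev r * m j).
by rewrite mulr_suml; apply: eq_bigr => k _; rewrite e [LHS]mulrA.
have ->: \sum_(k < d) (z ^+ i) ^- k * (z ^+ j) ^+ k = \sum_(k < d) (z ^+ (j + (d - i))) ^+ k.
apply: eq_bigr => k _; rewrite -exprVn -exprMn; congr (_ ^+ _).
rewrite exprD expfB_cond ?(negPf z_unit) ?(ltnW id_) // z_expd div1r mulrC //. rewrite sum_z; case: eqP => [->|ne].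
by rewrite subnKC ?(ltnW jd) // dvdnn mulrA mulVf ?d_unit ?mul1r.
rewrite ifF ?mul0r ?mulr0 //; apply/negP => /dvdnP[k e'].
by move: e' ne id_ jd; clear; case: k => [|[|k]]; rewrite ?mulSn; nia.
Qed.
Lemma inA_pr f: inA f -> exists r : nat -> {poly kap}, forall i, (i < d)%N -> pr i f = ev (r i) * m i.
 move=> [r ->]; exists r => i id_. transitivity (\sum_(j < d) pr i (ev (r j) * m j)).
rewrite -mulr_sumr exchange_big /=; congr (_ * _); apply: eq_bigr => j _. by rewrite rmorph_sum mulr_sumr.
rewrite (bigD1 (Ordinal id_)) //= pr_ev_m // eqxx big1 ?addr0 // => j /eqP ji.
by rewrite pr_ev_m // ifN //; apply: contra_not_neq ji => e; apply: val_inj.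
Qed.
Lemma inA_fix f: inA f -> del C f = f -> exists r, f = ev r.
 move=> /inA_pr[r hr] df; exists (r 0%N); rewrite -[RHS]mulr1 -m0 -hr ?d_gt0 //.
rewrite /pr; under eq_bigr do rewrite expr1n invr1 mul1r dj_fix //.
by rewrite sumr_const card_ord -[f *+ d]mulr_natl mulKf ?d_unit.
Qed.
Lemma inA_nrm f: inA f -> exists r, nrm f = ev r.
 by move=> h; apply: inA_fix (del_nrm f); apply: inA_prod => j _; apply: inA_dj. Qed.
Lemma fracA f: exists w, exists2 c, c != 0 & inA w /\ f = w / ev c.
 have [s [c c0 e]] := sc_gen C f; exists (f * ev c), c => //; split; last first. by rewrite mulfK // ev0.
by rewrite e; apply: inA_sum => i _; apply/inA_evM/inAX/inA_y.
Qed.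

End Curve.

#[export] Hint Resolve d_unit z_unit x_unit x1_unit y_unit m_unit : nz.
End Curve.
Export Curve.

(* At a point where the nonzero summands have distinct orders no cancellation
   occurs. *)
Lemma vge_distinct (F: fieldType) (v: dval F) n (I: finType) (f: I -> F) :
 (forall i j, f i != 0 -> f j != 0 -> v (f i) = v (f j) -> i = j) ->
 vge v n (\sum_i f i) -> forall i, vge v n (f i).
 move=> dist h i; apply: contrapT => /negP ni. have fi: f i != 0 by apply: contraNneq ni => ->; apply: vge0.
have [j fj jmin]: exists2 j, f j != 0 & forall k, f k != 0 -> v (f j) <= v (f k).
by have [j fj jmin] := @arg_minP _ _ _ i (fun k => f k != 0) (fun k => v (f k)) fi; exists j.
have : \sum_k f k != 0 /\ v (\sum_k f k) = v (f j).
rewrite (bigD1 j) //=; apply: dvD_lt => //; apply: vge_sum => k kj. have [->|fk] := eqVneq (f k) 0; first exact: vge0.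
rewrite vgeE // lezD1 lt_neqAle jmin // andbT; apply: contra_neq kj => e. exact: dist.
case=> s0 vs; move: h ni; rewrite !vgeE // vs -ltNge => h1 h2. by have := jmin i fi; lia.
Qed.
Lemma size_mul_lt (kap: fieldType) (r q: {poly kap}) :
 r != 0 -> (1 < size q)%N -> (size r < size (r * q)%R)%N.
 move=> r0 s1; have q0: q != 0 by rewrite -size_poly_gt0 ltnW.
rewrite size_mul //; move: s1; case: (size q) => [|[|k]] // _. by rewrite !addnS /= leq_addr.
Qed.

(** * Places over the x-line and regularity *)

Section Places.
Variables (d a: nat) (kap F: fieldType) (C: scurve d a kap F).
Notation b := (d + 1 - a)%N.
Notation x := (cx C).
Notation ev := (evx (cst C) x).
Notation m := (m C).
Notation inA := (inA C).
Notation inKx := (inKx C).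
Notation pr := (pr C).
Implicit Types (f g: F) (c q r: {poly kap}).

Record place := Place { pv :> dval F; pv_cst : forall u, pv (cst C u) = 0 }.

HB.instance Definition _ := gen_eqMixin place.
HB.instance Definition _ := gen_choiceMixin place.

Lemma place_inj: injective pv.
 by case=> v hv [w hw] /= e; subst w; congr Place; apply: Prop_irrelevance. Qed.

Implicit Types Q R : place.

Lemma vge_cst Q u: vge Q 0 (cst C u).
 by rewrite /vge pv_cst orbT. Qed.
Fact pconj_dval Q j: exists v : dval F, forall f, v f = Q (dj C j f).
 have inj f: f != 0 -> dj C j f != 0 by []. have h0: Q (dj C j 0) = 0 by rewrite rmorph0 dv0.
have hM f g: f != 0 -> g != 0 -> Q (dj C j (f * g)) = Q (dj C j f) + Q (dj C j g).
by move=> f0 g0; rewrite rmorphM dvM. have hD f g: f != 0 -> g != 0 -> f + g != 0 ->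
Num.min (Q (dj C j f)) (Q (dj C j g)) <= Q (dj C j (f + g)). by move=> f0 g0 fg0; rewrite rmorphD dvD -?rmorphD.
have hS: exists2 t, t != 0 & Q (dj C j t) = 1. have [t t0 Qt] := dv_surj Q. have e: dj C j (dj C (d * j - j) t) = t.
rewrite -djD subnKC ?leq_pmull ?(d_gt0 C) // mulnC; elim: (j) => [//|k IH]. by rewrite djD dj_d.
by exists (dj C (d * j - j) t); rewrite ?e. by exists (@Dval F (fun f => Q (dj C j f)) h0 hM hD hS).
Qed.

Definition pconj j Q: place :=
 @Place (projT1 (cid (pconj_dval Q j)))
 (fun u => etrans (projT2 (cid (pconj_dval Q j)) (cst C u))
 (etrans (congr1 Q (dj_cst C j u)) (pv_cst Q u))).

Lemma pconjE j Q f: pconj j Q f = Q (dj C j f).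
 exact: (projT2 (cid (pconj_dval Q j)) f). Qed.
Lemma vge_pconj j Q n f: vge (pconj j Q) n f = vge Q n (dj C j f).
 by rewrite /vge pconjE fmorph_eq0. Qed.

Definition fpl Q := 0 <= Q x.

Lemma finite_pconj j Q: fpl (pconj j Q) = fpl Q.
 by rewrite /fpl pconjE dj_x. Qed.
Lemma vge_x1 Q: fpl Q -> vge Q 0 (x - 1).
 by move=> fQ; rewrite vgeB ?vge1 // vgeE. Qed.
Lemma vge_ev Q c: fpl Q -> vge Q 0 (ev c).
 move=> fQ; rewrite evx_coef; apply: vge_sum => i _; apply: vgeM0; first exact: vge_cst. by apply: vge0X; rewrite vgeE.
Qed.
Lemma vge_m Q i: fpl Q -> vge Q 0 (m i).
 move=> fQ; have := vge_ev ('X ^+ (a * i %% d) * ('X - 1) ^+ (b * i %% d)) fQ.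
rewrite evxM !evxXn -x1E evxX -m_expd => h. by rewrite (vgeXr _ _ d.-1) mul0rn prednK ?(d_gt0 C).
Qed.
Lemma vge_inA Q f: inA f -> fpl Q -> vge Q 0 f.
 move=> [r ->] fQ; apply: vge_sum => i _; apply: vgeM0; first exact: vge_ev. exact: vge_m.
Qed.
(** The norm of the numerator of a uniformizer is a polynomial in x that vanishes at Q. *)
Lemma finite_poly Q: fpl Q -> exists2 c, c != 0 & 0 < Q (ev c).
 move=> fQ; have [t t0 Qt] := dv_surj Q; have [w [c c0 [Aw tw]]] := fracA C t. have ec: ev c != 0 by rewrite ev0.
have w0: w != 0 by apply: contraNneq t0 => w0; rewrite tw w0 mul0r.
have Qw: 0 < Q w by move: Qt (vge_ev c fQ); rewrite tw dv_div // vgeE //; lia.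
have [r er] := inA_nrm Aw; have r0: r != 0. by rewrite -(ev0 C) -er nrm_neq0.
exists r => //; suff : vge Q 1 (ev r) by rewrite vgeE ?ev0.
rewrite -er /nrm (bigD1 (Ordinal (d_gt0 C))) //= -[1]addr0; apply: vgeM. by rewrite vgeE.
apply: vge0_prod => j _; apply: vge_inA => //; exact: inA_dj.
Qed.

Definition over Q q := fpl Q /\ 0 < Q (ev q).

Lemma over_cop Q q c: over Q q -> coprimep q c -> c != 0 /\ Q (ev c) = 0.
 move=> [fQ Qq] /Bezout_coprimepP[[u v] /= h]. have q0: ev q != 0 by apply: contraTneq Qq => ->; rewrite dv0.
have [k k0 e]: exists2 k, k != 0 & u * q + v * c = k%:P.
have /eqP s1: size (u * q + v * c) == 1%N by rewrite (eqp_size h) size_poly1.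
have e := size1_polyC (eq_leq s1); exists (u * q + v * c)`_0 => //.
by apply/eqP => e0; move: s1; rewrite e e0 size_poly0. have kk: 1 = ev u * ev q / cst C k + ev v * ev c / cst C k.
by rewrite -mulrDl -!evxM -evxD e evxC divff // fmorph_eq0.
have Vk: vge Q 0 (cst C k)^-1 by rewrite -fmorphV vge_cst. have h1: vge Q 1 (ev u * ev q / cst C k).
apply: vge0M => //; apply: vgeM0; first exact: vge_ev. by rewrite vgeE. have h2: vge Q 1 (ev c) -> False.
move=> Qc; suff : vge Q 1 1 by rewrite vgeE ?oner_neq0 // dv1.
by rewrite kk vgeD //; apply: vge0M => //; apply: vgeM0 => //; apply: vge_ev.
have c0: ev c != 0 by apply/eqP => c0; apply: h2; rewrite c0 vge0. split; first by rewrite -(ev0 C).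
have := vge_ev c fQ; move/negP: h2; rewrite !vgeE //; lia.
Qed.
Lemma over_irreducible Q: fpl Q -> exists2 q, irreducible_poly q & over Q q.
 move=> fQ; have [c c0 Qc] := finite_poly fQ. elim: {c}(size c) {-2}c (leqnn (size c)) c0 Qc => [|n IH] c sc c0 Qc.
by move: sc c0; rewrite leqn0 size_poly_eq0 => ->. have [s1|s1] := leqP (size c) 1.
by move: Qc; rewrite (size1_polyC s1) evxC pv_cst. have [q iq /dvdpP[r e]] := irreducible_factor s1.
have [q0 r0]: q != 0 /\ r != 0 by move: c0; rewrite e mulf_eq0 negb_or => /andP[].
have := Qc; rewrite e evxM dvM ?ev0 // => h. have [Qq|Qq] := ltP 0 (Q (ev q)); first by exists q.
apply: (IH r) => //; last by lia. by rewrite -ltnS (leq_trans _ sc) // e size_mul_lt // iq.1.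
Qed.
Lemma over_dvd Q q c: irreducible_poly q -> over Q q -> c != 0 -> (0 < Q (ev c)) = (q %| c).
 move=> iq hq c0; apply/idP/idP => [h|/dvdpP[r e]].
apply: contraLR h; rewrite -(irreducible_poly_coprime _ iq) => /(over_cop hq)[_ ->]. by [].
move: c0; rewrite e mulf_eq0 negb_or => /andP[r0 q0]; rewrite evxM dvM ?ev0 //.
by have := vge_ev r hq.1; rewrite vgeE ?ev0 //; case: hq => _; lia.
Qed.
Lemma prod_XsubC_shift f :
 \prod_(j < d) ('X - (dj C j.+1 f)%:P) = \prod_(j < d) ('X - (dj C j f)%:P).
 have h: 'X - (dj C 0 f)%:P != 0 by rewrite polyXsubC_eq0. apply: (mulfI h).
rewrite -(big_ord_recl d (fun j: 'I_d.+1 => 'X - (dj C j f)%:P)). by rewrite big_ord_recr /= dj_d mulrC.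
Qed.
(** f is a root of prod_j (X - delta^j f), whose coefficients are fixed by delta. This is the
    bounded degree that [dval_extension] asks for. *)
Lemma algF f: exists c : 'I_d.+1 -> F,
 [/\ forall i, inKx (c i), exists i, c i != 0 & \sum_i c i * f ^+ i = 0].
 pose p := \prod_(j < d) ('X - (dj C j f)%:P). have sp: size p = d.+1.
by rewrite /p size_prod_XsubC /index_enum -enumT size_enum_ord. exists (fun i => p`_i); split.
- move=> i; apply: inKx_fix; rewrite -coef_map /=; congr (_`_i).
have ->: map_poly (del C) p = \prod_(j < d) ('X - (dj C j.+1 f)%:P).
by rewrite rmorph_prod; apply: eq_bigr => j _; rewrite /= map_polyXsubC. by rewrite prod_XsubC_shift.
- exists ord_max => /=; have : lead_coef p != 0 by rewrite lead_coef_eq0 -size_poly_gt0 sp. by rewrite lead_coefE sp.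
- have : p.[f] = 0. by rewrite horner_prod (bigD1 (Ordinal (d_gt0 C))) //= hornerXsubC subrr mul0r.
by rewrite horner_coef sp.
Qed.
(** The extension theorem for the local ring of K[x] at q, with q in the role of pi. *)
Lemma exists_over q: irreducible_poly q -> exists Q, over Q q.
 move=> iq; have q0: q != 0 by rewrite -size_poly_gt0 ltnW // iq.1.
pose R0 (f: F) := exists r, exists2 c, coprimep q c & f = ev r / ev c. have cq c: coprimep q c -> c != 0.
apply: contraTneq => ->; rewrite coprimep0 -size_poly_eq1; apply/eqP. by case: iq; lia.
have R0ev r: R0 (ev r) by exists r, 1; rewrite ?coprimep1 // evx1 divr1.
have [||||||||v [vR vq]] := @dval_extension F R0 inKx (ev q) d.
- by rewrite -(evx1 (cst C) x).
- move=> _ _ [r [c hc ->]] [r' [c' hc' ->]]; exists (r * c' - r' * c), (c * c'). by rewrite coprimepMr hc.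
by rewrite evxB !evxM; field; rewrite !ev0 !cq.
- move=> _ _ [r [c hc ->]] [r' [c' hc' ->]]; exists (r * r'), (c * c'). by rewrite coprimepMr hc.
by rewrite !evxM; field; rewrite !ev0 !cq.
- exact: R0ev.
- by rewrite ev0.
- move=> [r [c hc /eqP]]; rewrite -(inj_eq (can_inj (@invrK _))) invrK invf_div. rewrite eq_sym => /eqP e.
have rn0: ev r != 0 by apply: contra_neq q0 => r0; apply/eqP; rewrite -(ev0 C) -e r0 invr0 mulr0.
have /eqP: ev c = ev (q * r) by rewrite evxM -e divfK. rewrite -subr_eq0 -evxB ev0 subr_eq0 => /eqP ec.
by move: hc; rewrite ec coprimepMr coprimepp; case: iq; case: (size q) => [|[]].
- move=> _ [r [c c0 ->]] n0; have r0: r != 0. by apply: contraNneq n0 => ->; rewrite evx0 mul0r.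
have split_q (e: {poly kap}) : e != 0 -> exists n e', coprimep q e' /\ e = q ^+ n * e'.
elim: {e}(size e) {-2}e (leqnn (size e)) => [|n IH] e se e0. by move: se e0; rewrite leqn0 size_poly_eq0 => ->.
have [nq|/negbNE/dvdpP[e' ee]] := boolP (~~ (q %| e)).
by exists 0%N, e; rewrite irreducible_poly_coprime // expr0 mul1r.
have e'0: e' != 0 by move: e0; rewrite ee mulf_eq0 negb_or => /andP[]. have [||k [e2 [h ee2]]] := IH e' => //.
by rewrite -ltnS (leq_trans _ se) // ee size_mul_lt // iq.1.
by exists k.+1, e2; rewrite ee ee2 exprS; split=> //; ring.
have [i [r' [hr er]]] := split_q _ r0; have [j [c' [hc ec]]] := split_q _ c0. have eq0: ev q != 0 by rewrite ev0.
exists (i%:Z - j%:Z); rewrite opprB !expfzDr // -!exprnN -!exprnP.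
have [q1 q2]: ev r' != 0 /\ ev c' != 0 by rewrite !ev0 !cq. split; [exists r', c' => //|exists c', r' => //];
by rewrite er ec !evxM !evxXn; field; rewrite ?q1 ?q2 ?expf_neq0.
- exact: algF. have vc u: v (cst C u) = 0. have [->|u0] := eqVneq u 0; first by rewrite rmorph0 dv0.
have h w: w != 0 -> 0 <= v (cst C w).
by move=> w0; rewrite -vgeE //; apply: vR; rewrite -(evxC (cst C) x); apply: R0ev.
have h1 := h u u0; have h2: 0 <= - v (cst C u) by rewrite -dvV -fmorphV h // invr_eq0. by move: h1 h2; clia.
exists (Place vc); split=> //; rewrite /fpl /= -vgeE //; apply: vR. by rewrite -(evxX (cst C) x).
Qed.
Lemma over_pconj j Q q: over Q q -> over (pconj j Q) q.
 by move=> [fQ h]; split; rewrite ?finite_pconj // pconjE dj_ev. Qed.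
(** The d-th power of [m i] is x^r (x - 1)^s with r, s < d, and x and x - 1 do not vanish together.
    Hence [m i] never compensates a denominator q, which makes the [m i] an integral basis. *)
Lemma vm_le Q q i: irreducible_poly q -> over Q q -> Q (m i) < Q (ev q).
 move=> iq hq; have [fQ Qq] := hq. have lin c: irreducible_poly c -> Q (ev c) = 0 \/ Q (ev c) = Q (ev q).
move=> ic; have c0: c != 0 by rewrite -size_poly_gt0 ltnW // ic.1.
have := over_dvd iq hq c0; have [qc|_] := boolP (q %| c); last first.
by have := vge_ev c fQ; rewrite vgeE ?ev0 //; left; lia. have /eqpP[[u v] /= /andP[u0 v0] e] : q %= c.
by apply: (ic.2) => //; rewrite neq_ltn iq.1 orbT.
right; have := congr1 (fun e => Q (ev e)) e; rewrite -!mul_polyC !evxM !evxC.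
by rewrite !dvM ?ev0 ?pv_cst ?add0r // -size_poly_gt0 ltnW // iq.1.
have hx: irreducible_poly ('X : {poly kap}) by rewrite -['X]subr0; apply: irredp_XsubC.
have hx1: irreducible_poly ('X - 1 : {poly kap}) by apply: irredp_XsubC.
have := lin _ hx; have := lin _ hx1; rewrite evxX -x1E. have xx1: ~ (0 < Q x /\ 0 < Q (x - 1)).
move=> [h1 h2]; have : vge Q 1 (x - (x - 1)) by rewrite vgeB // vgeE ?x_unit ?x1_unit.
by rewrite subKr vgeE ?oner_neq0 // dv1.
have := congr1 Q (m_expd C i); rewrite dvX ?m_unit // dvM ?expf_neq0 ?x_unit ?x1_unit //.
rewrite !dvX ?x_unit ?x1_unit //. have := ltn_pmod (a * i) (d_gt0 C); have := ltn_pmod (b * i) (d_gt0 C).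
move: (_ %% _)%N (_ %% _)%N (Q (m i)) (Q x) (Q (x - 1)) (Q (ev q)) Qq xx1 (d_gt0 C).
clear; move=> u v M X X1 q Qq xx1 d0 ud vd e [h1|h1] [h2|h2]; subst; nia.
Qed.
Lemma component_pole Q q f i: irreducible_poly q -> over Q q -> inKx f ->
 vge Q 0 (f * m i) -> exists r, exists2 c, coprimep q c & f = ev r / ev c.
 move=> iq hq /inKx_coprime[r [c [c0 rc ->]]].
have [->|r0] := eqVneq r 0; first by move=> _; exists 0, 1; rewrite ?coprimep1 // evx0 !mul0r.
have n0: ev r / ev c != 0 by rewrite mulf_neq0 ?invr_eq0 ?ev0.
rewrite (vgeE _ _ (mulf_neq0 n0 (m_unit C i))) dvM ?m_unit // dv_div ?ev0 // => h; exists r, c => //; rewrite irreducible_poly_coprime //.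
apply/negP => /dvdpP[c' ec]; have qr: coprimep q r.
by rewrite coprimep_sym; apply: coprimep_dvdl rc; rewrite ec dvdp_mulIr.
move: h; have [_ ->] := over_cop hq qr; have := vm_le i iq hq.
move: c0; rewrite ec mulf_eq0 negb_or => /andP[c'0 q0]; rewrite evxM dvM ?ev0 //.
have := vge_ev c' hq.1; rewrite vgeE ?ev0 //; lia.
Qed.
Lemma vge_pr Q n i f: (forall j, vge (pconj j Q) n f) -> vge Q n (pr i f).
 move=> h; rewrite /pr; apply: vgeM0. by rewrite -(rmorph_nat (cst C)) -fmorphV vge_cst.
apply: vge_sum => j _; apply: vgeM0; last by rewrite -vge_pconj. by rewrite -!rmorphXn -fmorphV vge_cst.
Qed.

Lemma inA_local q f: irreducible_poly q -> (forall Q, over Q q -> vge Q 0 f) ->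
 exists2 c, coprimep q c & inA (ev c * f).
 move=> iq hf; have [Q hQ] := exists_over iq.
have hi i: exists rc : {poly kap} * {poly kap}, coprimep q rc.2 /\ pr i f / m i = ev rc.1 / ev rc.2.
have [||r [c h e]] := @component_pole Q q (pr i f / m i) i iq hQ.
- exact: inKx_pr_m.
- by rewrite divfK ?m_unit //; apply: vge_pr => j; apply: hf; apply: over_pconj. by exists (r, c).
pose rc i := projT1 (cid (hi i)); have rcP i := projT2 (cid (hi i)). exists (\prod_(i < d) (rc i).2).
elim/big_ind: _ => [|u v|i _]; [exact: coprimep1| |exact: (rcP i).1]. by rewrite coprimepMr => -> ->.
rewrite -{1}(sum_pr C f) mulr_sumr; apply: inA_sum => i _. rewrite (bigD1 i) //= evxM mulrAC mulrC; apply: inA_evM.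
have := (rcP i).2 => /(canRL (divfK (m_unit C i))) ->; rewrite mulrCA. have c0: ev (rc i).2 != 0.
have [c0 _] := over_cop hQ (rcP i).1; by rewrite ev0. rewrite mulrA divfK //; apply: inA_evM; exact: inA_m.
Qed.
(** The components of a function regular at all finite places are again regular there. If one had a
    denominator, an irreducible factor of it would carry a place where, by [vm_le], that component
    has a pole. *)
Lemma inAP f: inA f <-> forall Q, fpl Q -> vge Q 0 f.
 split=> [h Q|h]; first exact: vge_inA. rewrite -(sum_pr C f); apply: inA_sum => i _.
have [r [c [c0 rc e]]] := inKx_coprime (inKx_pr_m C i f). have [s1|s1] := leqP (size c) 1.
rewrite -[pr i f](divfK (m_unit C i)) e (size1_polyC s1) evxC -fmorphV -(evxC (cst C) x) -evxM. exact/inA_evM/inA_m.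
have [q iq qc] := irreducible_factor s1; have [Q hQ] := exists_over iq.
have [||r' [c' qc' e']] := @component_pole Q q (pr i f / m i) i iq hQ.
- exact: inKx_pr_m.
- rewrite divfK ?m_unit //; apply: vge_pr => j; apply: h. by rewrite finite_pconj; apply: hQ.1.
have [c'0 Qc'] := over_cop hQ qc'. have qr: coprimep q r by rewrite coprimep_sym; apply: coprimep_dvdl rc.
have [r0 Qr] := over_cop hQ qr. have : Q (ev r / ev c) = Q (ev r' / ev c') by rewrite -e e'. have r'0: r' != 0.
apply/eqP => z0; move: e; rewrite e' z0 evx0 mul0r => /esym/eqP.
by rewrite mulf_eq0 invr_eq0 !ev0 (negPf r0) (negPf c0).
rewrite !dv_div ?ev0 // Qr Qc'; have := over_dvd iq hQ c0; rewrite qc.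
have := vge_ev r' hQ.1; rewrite vgeE ?ev0 //; lia.
Qed.
Lemma inA_root f n: inA (f ^+ n.+1) -> inA f.
 by move=> h; apply/inAP => Q fQ; rewrite (vgeXr _ _ n) mul0rn; apply: vge_inA. Qed.

End Places.

(** * Total ramification and the point at infinity *)

Module Inf.
Lemma weak_approximation2 (F: fieldType) (s1 s2: seq (dval F)) (n: nat) :
 (forall v, v \in s1 -> v \notin s2) ->
 exists e, (forall v, v \in s1 -> vge v n (e - 1)) /\ forall w, w \in s2 -> vge w n e.
 elim: s1 s2 => [|v s1 IH] s2 h. by exists 0; split=> // w _; apply: vge0. have [vs|vs] := boolP (v \in s1).
have [|e [h1 h2]] := IH s2; first by move=> u us; apply: h; rewrite inE us orbT.
by exists e; split=> // u; rewrite inE => /predU1P[->|]; apply: h1. have [|e [h1 h2]] := IH (v :: s2).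
move=> u us; rewrite negb_or h ?inE ?us ?orbT // andbT. by apply: contraNneq vs => <-.
have [|e' [h3 h4]] := @weak_approximation F v (s1 ++ s2) n. by rewrite mem_cat negb_or vs h // mem_head.
exists (e + e'); split=> [u|w ws]. rewrite inE => /predU1P[->|us]. by rewrite -addrA vgeD // h2 // mem_head.
by rewrite addrAC vgeD ?h1 // h4 // mem_cat us. by rewrite vgeD ?h2 ?h4 ?inE ?mem_cat ?ws ?orbT.
Qed.
Lemma int_mul_ge2 (k u: int) : 0 < k -> k <> 1 -> 1 <= k * u -> 2 <= k * u.
 move=> k0 k1 h; have u0: 0 < u by nia. nia.
Qed.

Section Infinity.
Variables (d a: nat) (kap F: fieldType) (C: scurve d a kap F).
Notation b := (d + 1 - a)%N.
Notation x := (cx C).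
Notation y := (cy C).
Notation ev := (evx (cst C) x).
Notation m := (m C).
Notation inA := (inA C).
Notation inKx := (inKx C).
Notation pr := (pr C).
Notation over := (@over d a kap F C).
Implicit Types (f g: F) (c q r: {poly kap}) (P Q: place C).

Section TotallyRamified.
Variables (P: place C) (k w: int).
Hypotheses (k0: 0 < k) (PE: forall e, inKx e -> e != 0 -> (d%:Z * k %| P e)%Z)
 (Py: P y = k * w) (cop: coprimez d w).

Lemma tr_pr f i: pr i f != 0 -> exists e, P (pr i f) = d%:Z * k * e + k * (i%:Z * w).
 move=> f0; have yi: y ^+ i != 0 by rewrite expf_neq0 ?y_unit. have e0: pr i f / y ^+ i != 0 by [].
have /dvdzP[e he] := PE (inKx_pr C i f) e0; exists e. have ->: pr i f = pr i f / y ^+ i * y ^+ i by rewrite divfK.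
by rewrite dvM // he dvX // Py; ring.
Qed.
(** The orders of the components are distinct modulo d k, because y has order k w with w prime to d;
    so no cancellation occurs between them. *)
Lemma tr_vge n f: vge P n f -> forall i, (i < d)%N -> vge P n (pr i f).
 rewrite -{1}(sum_pr C f) => h i id_. apply: (@vge_distinct F P n 'I_d (fun i => pr i f) _ h (Ordinal id_)).
move=> j1 j2 /tr_pr[e1 ->] /tr_pr[e2 ->] e; apply/val_inj/eqP => /=. have : (d %| (j1%:Z - j2%:Z))%Z.
rewrite -(Gauss_dvdzl _ cop); apply/dvdzP; exists (e2 - e1). by apply: (mulfI (lt0r_neq0 k0)); move: e; clia.
rewrite eqn_leq => /dvdzP[q]; have := ltn_ord j1; have := ltn_ord j2.
move: (nat_of_ord j1) (nat_of_ord j2); clear; move=> u v vd ud e. have : q = 0 by nia. by lia.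
Qed.
(** All orders at P are multiples of k, and P has a uniformizer. *)
Lemma tr_k: k = 1.
 have [t t0 Pt] := dv_surj P; apply: contrapT => k1. suff : vge P 2 t by rewrite vgeE // Pt.
have h: vge P 1 t by rewrite vgeE ?Pt. rewrite -(sum_pr C t); apply: vge_sum => i _; have := tr_vge h (ltn_ord i).
have [->|f0] := eqVneq (pr i t) 0; first by rewrite !vge0. rewrite !vgeE //; have [e ->] := tr_pr f0.
have ->: d%:Z * k * e + k * (i%:Z * w) = k * (d%:Z * e + i%:Z * w) by ring. exact: int_mul_ge2.
Qed.
End TotallyRamified.

Lemma tr_unique P Q (w: int) : (forall e, inKx e -> e != 0 -> (d%:Z %| P e)%Z) ->
 P y = w -> coprimez d w -> (forall e, inKx e -> P e = Q e) -> Q y = w -> P = Q.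
 move=> PE Py cop PQ Qy; apply/place_inj/dval_maximal => f h. rewrite -(sum_pr C f); apply: vge_sum => i _.
have e1: P y = 1 * w by rewrite mul1r. have := @tr_vge P 1 w isT _ e1 cop 0 f h i (ltn_ord i).
have PE1 e: inKx e -> e != 0 -> (d%:Z * 1 %| P e)%Z by rewrite mulr1; apply: PE. move=> /(_ PE1).
have yi: y ^+ i != 0 by rewrite expf_neq0 ?y_unit. have [->|f0] := eqVneq (pr i f) 0; first by rewrite !vge0.
have ee (R: place C) : R (pr i f) = R (pr i f / y ^+ i) + R (y ^+ i) by rewrite -dvM // divfK.
by rewrite !vgeE // !ee PQ ?dvX // ?Py ?Qy //; exact: inKx_pr.
Qed.
(** The extension theorem for the rational functions of degree at most 0 in x, with 1 / x in the
    role of pi. *)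
Lemma exists_infinity: exists P, P x < 0.
 pose R0 (f: F) := exists r : {poly kap}, exists2 c : {poly kap}, c != 0 & (size r <= size c)%N /\ f = ev r / ev c.
have [||||||||v [vR vx]] := @dval_extension F R0 inKx x^-1 d.
- by exists 1, 1; rewrite ?oner_neq0 // evx1 divr1.
- move=> _ _ [r [c c0 [h ->]]] [r' [c' c'0 [h' ->]]].
exists (r * c' - r' * c), (c * c'); rewrite //; split; last first. by rewrite evxB !evxM; field; rewrite !ev0 c0 c'0.
apply: leq_trans (size_polyD _ _) _; rewrite size_polyN geq_max.
have sm (u u' e: {poly kap}) : e != 0 -> (size u <= size u')%N -> (size (u * e)%R <= size (u' * e)%R)%N.
move=> e0 le; have [->|u0] := eqVneq u 0; first by rewrite mul0r size_poly0.
have u'0: u' != 0 by rewrite -size_poly_gt0 (leq_trans _ le) // size_poly_gt0.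
by rewrite !size_mul // -!subn1 leq_sub2r // leq_add2r. by rewrite sm //= [c * c']mulrC sm.
- move=> _ _ [r [c c0 [h ->]]] [r' [c' c'0 [h' ->]]]. exists (r * r'), (c * c'); rewrite //; split; last first.
by rewrite !evxM; field; rewrite !ev0 c0 c'0. apply: leq_trans (size_polyMleq _ _) _.
by rewrite size_mul // -!subn1 leq_sub2r // leq_add.
- exists 1, 'X; rewrite ?polyX_eq0 // size_poly1 size_polyX; split=> //. by rewrite evx1 evxX div1r.
- by rewrite invr_eq0 x_unit.
- rewrite invrK => -[r [c c0 [h e]]]; have ec: ev c != 0 by rewrite ev0.
have /eqP: ev (c * 'X) = ev r by rewrite evxM evxX -(divfK ec (ev r)) -e mulrC.
rewrite -subr_eq0 -evxB ev0 subr_eq0 => /eqP rE. by move: h; rewrite -rE size_mulX // ltnn.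
- move=> _ [r [c c0 ->]] n0; have r0: r != 0. by apply: contraNneq n0 => ->; rewrite evx0 mul0r.
have s n (u: {poly kap}) : u != 0 -> size (u * 'X^n) = (n + size u)%N by move=> u0; rewrite size_mulXn.
have [r0' c0']: ev r != 0 /\ ev c != 0 by rewrite !ev0. exists ((size c)%:Z - (size r)%:Z); split.
exists (r * 'X^(size c)), (c * 'X^(size r)); rewrite ?mulf_neq0 ?expf_neq0 ?polyX_eq0 //.
rewrite !s // addnC; split=> //. rewrite !evxM !evxXn evxX opprB expfzDr ?invr_eq0 ?x_unit //.
rewrite -!exprnN -!exprnP !exprVn; field. by rewrite !expf_neq0 ?x_unit ?c0' ?oner_neq0.
exists (c * 'X^(size r)), (r * 'X^(size c)); rewrite ?mulf_neq0 ?expf_neq0 ?polyX_eq0 //.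
rewrite !s // addnC; split=> //. rewrite !evxM !evxXn evxX expfzDr ?invr_eq0 ?x_unit //.
rewrite -!exprnN -!exprnP !exprVn; field. by rewrite !expf_neq0 ?x_unit ?c0' ?r0' ?oner_neq0.
- move=> f; exact: algF. have vc u: v (cst C u) = 0. have [->|u0] := eqVneq u 0; first by rewrite rmorph0 dv0.
have h w: w != 0 -> 0 <= v (cst C w).
move=> w0; rewrite -vgeE ?fmorph_eq0 //; apply: vR; exists w%:P, 1; rewrite ?oner_neq0 //.
by rewrite size_polyC w0 size_poly1 evxC evx1 divr1.
have h1 := h u u0; have h2: 0 <= - v (cst C u) by rewrite -dvV -fmorphV h // invr_eq0. by move: h1 h2; clia.
by exists (Place vc); move: vx; rewrite dvV /=; lia.
Qed.

Definition oo: place C := projT1 (cid exists_infinity).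
Let oo_x_lt0: oo x < 0. Proof. exact: projT2 (cid exists_infinity). Qed.
Lemma neg_ev P c: P x < 0 -> c != 0 -> P (ev c) = P x * ((size c).-1)%:Z.
 move=> Px c0; rewrite evx_coef; have := c0; rewrite -size_poly_gt0 => s0.
rewrite -[size c]prednK // big_ord_recr /= addrC.
have l0: cst C (lead_coef c) != 0 by rewrite fmorph_eq0 lead_coef_eq0.
set n := (size c).-1; have lE: c`_n = lead_coef c by [].
have [||_ ->] := @dvD_lt _ P (cst C c`_n * x ^+ n) (\sum_(i < n) cst C c`_i * x ^+ i).
- by rewrite lE mulf_neq0 ?expf_neq0 ?x_unit.
- apply: vge_sum => i _; apply: vgeM0; first exact: vge_cst.
rewrite lE dvM ?expf_neq0 ?x_unit // pv_cst vgeE ?expf_neq0 ?x_unit // !dvX //.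
have hn (j k: nat) (p: int) : p < 0 -> (j < k)%N -> 0 + k%:Z * p + 1 <= j%:Z * p by nia. exact: hn.
by rewrite lE dvM ?expf_neq0 ?x_unit // pv_cst dvX // add0r mulrC.
Qed.
Lemma neg_E P Q e: P x < 0 -> Q x < 0 -> inKx e -> e != 0 -> P e * Q x = Q e * P x.
 move=> Px Qx [r [c c0 ->]] n0; have r0: r != 0. by apply: contraNneq n0 => ->; rewrite evx0 mul0r.
by rewrite !dv_div ?ev0 // !neg_ev //; ring.
Qed.
(** The equation gives d P(y) = (d + 1) P(x). As d and d + 1 are coprime, P is totally ramified over
    the x-line and [tr_k] fixes the scale. *)
Lemma neg_xy P: P x < 0 -> P x = - d%:Z /\ P y = - (d%:Z + 1).
 move=> Px; have x1: P (x - 1) = P x. by rewrite x1E neg_ev ?size_XsubC ?mulr1 // polyXsubC_eq0.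
have e: d%:Z * P y = (d%:Z + 1) * P x.
rewrite -dvX ?y_unit // sc_eq dvM ?expf_neq0 ?x_unit ?x1_unit // !dvX ?x_unit ?x1_unit // x1.
by have := sc_a C; move: (P x); cnia. have d0 := d_gt0 C; pose k := P y - P x; have Pk: P x = - (- d%:Z * k).
by rewrite /k; move: e; clia. have k0: 0 < - k by move: Px d0; rewrite Pk; cnia.
have Pyk: P y = - k * - (d%:Z + 1) by rewrite -[P y](subrK (P x)) -/k Pk; ring.
have := @tr_k P (- k) (- (d%:Z + 1)) k0 _ Pyk. have PE e': inKx e' -> e' != 0 -> (d%:Z * - k %| P e')%Z.
move=> [r [c c0 ->]] n0; have r0: r != 0. by apply: contraNneq n0 => ->; rewrite evx0 mul0r.
rewrite dv_div ?ev0 // !neg_ev //; apply/dvdzP. by exists (- ((size r).-1%:Z - (size c).-1%:Z)); rewrite Pk; ring.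
have cop: coprimez d (- (d%:Z + 1)).
by rewrite coprimezN /coprimez -[d%:Z + 1]/((d + 1)%N%:Z) /gcdz /= addn1 eqz_nat (eqP (coprimenS d)).
by move=> /(_ PE cop) k1; rewrite Pyk Pk k1 -[k]opprK k1; split; ring.
Qed.
Lemma oo_x: oo x = - d%:Z. Proof. exact: (neg_xy oo_x_lt0).1. Qed.
Lemma oo_y: oo y = - (d%:Z + 1). Proof. exact: (neg_xy oo_x_lt0).2. Qed.
Lemma oo_E e: inKx e -> e != 0 -> (d%:Z %| oo e)%Z.
 move=> [r [c c0 ->]] n0; have r0: r != 0. by apply: contraNneq n0 => ->; rewrite evx0 mul0r.
rewrite dv_div ?ev0 // !neg_ev // oo_x; apply/dvdzP. by exists (- ((size r).-1%:Z - (size c).-1%:Z)); ring.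
Qed.
Lemma coprime_oo: coprimez d (- (d%:Z + 1)).
 by rewrite /coprimez -[d%:Z + 1]/((d + 1)%N%:Z) /= addn1 eqz_nat (eqP (coprimenS d)). Qed.
Lemma oo_pr n f: vge oo n f -> forall i, (i < d)%N -> vge oo n (pr i f).
 apply: (@tr_vge oo 1 (- (d%:Z + 1))) => //; last exact: coprime_oo. by move=> e; rewrite mulr1; apply: oo_E.
by rewrite oo_y mul1r.
Qed.
Lemma oo_unique P: P x < 0 -> P = oo.
 move=> Px; have [Px' Py] := neg_xy Px; apply/esym. apply: (tr_unique oo_E oo_y coprime_oo) Py => e Ee.
have [->|e0] := eqVneq e 0; first by rewrite !dv0. have := neg_E oo_x_lt0 Px Ee e0; rewrite Px' oo_x => /mulIf; apply.
by rewrite oppr_eq0 -lt0n (d_gt0 C).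
Qed.
Lemma fplE P: fpl P = (P != oo).
 apply/idP/idP => [h|]; last by apply: contraR; rewrite -ltNge => /oo_unique->.
by apply: contraTneq h => ->; rewrite -ltNge.
Qed.
Lemma oo_ev c: c != 0 -> oo (ev c) = - (d * (size c).-1)%N%:Z.
 by move=> c0; rewrite neg_ev // oo_x; lia. Qed.
Lemma oo_del f: oo (del C f) = oo f.
 have e: pconj 1 oo = oo by apply: oo_unique; rewrite pconjE dj_x. by rewrite -[in RHS]e pconjE.
Qed.
Lemma oo_m i: oo (m i) = (d * (a * i %/ d) + d * (b * i %/ d))%N%:Z - (i * d.+1)%N%:Z.
 rewrite dv_div ?mulf_neq0 ?expf_neq0 ?x_unit ?x1_unit ?y_unit //.
rewrite dvM ?expf_neq0 ?x_unit ?x1_unit // !dvX ?x1_unit //.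
by rewrite x1E oo_ev ?polyXsubC_eq0 // size_XsubC oo_x oo_y; lia.
Qed.
(** Only the component fixed by delta can have order 0 at oo; its residue is a quotient of leading
    coefficients in x. *)
Lemma oo_residue f: vge oo 0 f -> exists u, vge oo 1 (f - cst C u).
 move=> h; have /inKx_coprime[r [c [c0 _ e]]]: inKx (pr 0 f). by have := inKx_pr C 0 f; rewrite divr1.
exists (if size r == size c then lead_coef r / lead_coef c else 0).
rewrite -[f](sum_pr C f) (bigD1 (Ordinal (d_gt0 C))) //= addrAC; apply: vgeD; last first.
apply: vge_sum => i i0; have := oo_pr h (ltn_ord i). have [->|f0] := eqVneq (pr i f) 0; first by rewrite !vge0.
have PE e': inKx e' -> e' != 0 -> (d%:Z * 1 %| oo e')%Z by rewrite mulr1; apply: oo_E.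
have Py: oo y = 1 * - (d%:Z + 1) by rewrite oo_y mul1r. rewrite !vgeE //; have [e' ->] := tr_pr PE Py f0.
have : (0 < i)%N by rewrite lt0n; apply: contra_neq i0 => i0; apply: val_inj.
have := ltn_ord i; move: (nat_of_ord i) => j.
have ->: d%:Z * 1 * e' + 1 * (j%:Z * - (d%:Z + 1)) = d%:Z * (e' - j%:Z) - j%:Z by ring.
move: (e' - _) => w; clear => ? ? h; have w0: 0 < w by nia. nia.
have := oo_pr h (d_gt0 C); rewrite e => hr; have ec: ev c != 0 by rewrite ev0.
have [s_eq|s_ne] := eqVneq (size r) (size c); last first.
rewrite rmorph0 subr0; have [r0|r0] := eqVneq r 0; first by rewrite r0 evx0 mul0r vge0.
move: hr; rewrite !vgeE ?mulf_neq0 ?ev0 // dv_div ?ev0 // !oo_ev //.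
move: s_ne; have := c0; have := r0; rewrite -!size_poly_gt0; have := d_gt0 C. move: (size r) (size c); cnia.
set u := lead_coef r / lead_coef c. have ->: ev r / ev c - cst C u = ev (r - u *: c) / ev c.
by rewrite evxB -mul_polyC evxM evxC mulrBl mulfK.
have [->|n0] := eqVneq (r - u *: c) 0; first by rewrite evx0 mul0r vge0.
rewrite vgeE ?mulf_neq0 ?ev0 // dv_div ?ev0 // !oo_ev //. have lt: (size (r - u *: c)%R < size c)%N.
have u0: u != 0. rewrite mulf_neq0 ?invr_eq0 ?lead_coef_eq0 //. by rewrite -size_poly_gt0 s_eq size_poly_gt0.
have sle: (size (r - u *: c)%R <= size c)%N.
by apply: leq_trans (size_polyD _ _) _; rewrite size_polyN s_eq size_scale // maxnn.
rewrite ltn_neqAle sle andbT; apply: contraNneq n0 => se.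
rewrite -lead_coef_eq0 lead_coefE se coefB coefZ -{1}s_eq -lead_coefE. by rewrite divfK ?subrr // lead_coef_eq0.
move: lt; have := n0; rewrite -size_poly_gt0; have := d_gt0 C. move: (size _) (size c); cnia.
Qed.

(** The uniformizer at oo in which everything is expanded: delta multiplies it by zeta^-1. *)
Definition T := x / y.
Lemma T_unit: T != 0. Proof. by rewrite mulf_neq0 ?invr_eq0 ?x_unit ?y_unit. Qed.
Lemma oo_T: oo T = 1.
 by rewrite dv_div // oo_x oo_y; ring. Qed.
Lemma oo_leading f: f != 0 -> exists2 u, u != 0 & vge oo (oo f + 1) (f - cst C u * T ^ (oo f)).
 move=> f0; have t0: T ^ oo f != 0 by rewrite expfz_neq0 ?T_unit.
have v0: oo (f / T ^ oo f) = 0 by rewrite dv_div // dvXz ?T_unit // oo_T mulr1 subrr.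
have [|u hu] := @oo_residue (f / T ^ oo f); first by rewrite vgeE // v0. exists u.
by apply: contraTneq hu => ->; rewrite rmorph0 subr0 vgeE // v0.
have ->: f - cst C u * T ^ oo f = T ^ oo f * (f / T ^ oo f - cst C u).
by rewrite mulrBr mulrCA mulfV // mulr1 [_ * cst C u]mulrC.
by apply: vgeM => //; rewrite vgeE // dvXz ?T_unit // oo_T mulr1.
Qed.
(** Subtract the residue at oo: a nonzero difference would have a polynomial norm of positive order
    at oo. *)
Lemma inA_const f: inA f -> vge oo 0 f -> exists u, f = cst C u.
 move=> Af h; have [u hu] := oo_residue h; exists u; apply/eqP; rewrite -subr_eq0.
apply: contraTT hu => n0; rewrite vgeE // -ltNge. have Ag: inA (f - cst C u) by apply: inAB => //; apply: inA_cst.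
have [r er] := inA_nrm Ag; have r0: r != 0 by rewrite -(ev0 C) -er nrm_neq0.
have : oo (nrm C (f - cst C u)) = d%:Z * oo (f - cst C u). rewrite dv_prod => [|j _]; last by [].
rewrite (eq_bigr (fun=> oo (f - cst C u))) => [|j _]. by rewrite sumr_const card_ord -mulr_natl natz.
by elim: (nat_of_ord j) => // i IH; rewrite oo_del. rewrite er oo_ev //; have := d_gt0 C; move: (oo _); cnia.
Qed.
Lemma branch_value P c: 0 < P x -> c != 0 -> (P x %| P (ev c))%Z.
 move=> Px c0; have [n [r]] := multiplicity_XsubC c 0; rewrite c0 subr0 /= => nr e.
have hX: over P 'X by split; rewrite ?evxX ?/fpl ?ltW. have cop: coprimep 'X r.
rewrite irreducible_poly_coprime; last by rewrite -['X]subr0; apply: irredp_XsubC. by rewrite -['X]subr0 dvdp_XsubCl.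
have [r0 vr] := over_cop hX cop.
by rewrite e evxM evxXn evxX dvM ?expf_neq0 ?ev0 ?x_unit // vr add0r dvX // dvdz_mull.
Qed.
Lemma branch_E P e: 0 < P x -> inKx e -> e != 0 -> (P x %| P e)%Z.
 move=> Px [r [c c0 ->]] n0; have r0: r != 0. by apply: contraNneq n0 => ->; rewrite evx0 mul0r.
by rewrite dv_div ?ev0 //; apply: rpredB; apply: branch_value.
Qed.
Lemma coprime_a: coprimez d a.
 have [a0 ad _ _] := ad_bounds C.
by rewrite /coprimez /= eqz_nat -/(coprime d a) prime_coprime ?(sc_prime C) // gtnNdvd.
Qed.
Lemma branch_xy P: 0 < P x -> P x = d%:Z /\ P y = a%:Z.
 move=> Px; have fP: fpl P by rewrite /fpl ltW. have x1: P (x - 1) = 0. have h: vge P 1 x by rewrite vgeE.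
have [] := @dvD_lt _ P (-1) x; rewrite ?oppr_eq0 ?oner_neq0 ?dvN ?dv1 //. by rewrite addrC.
have e: d%:Z * P y = a%:Z * P x. rewrite -dvX // sc_eq dvM ?expf_neq0 ?x_unit ?x1_unit // !dvX ?x1_unit // x1.
by rewrite mulr0 addr0. have d0 := d_gt0 C; have a0: (0 < a)%N by have [] := ad_bounds C.
have /dvdzP[k Pk]: (d %| P x)%Z. rewrite -(Gauss_dvdzr _ coprime_a); apply/dvdzP; exists (P y); rewrite -e; ring.
have k0: 0 < k by move: Px d0; rewrite Pk; cnia. have Pyk: P y = k * a.
by apply: (mulfI (_: d%:Z != 0)); [rewrite eqz_nat -lt0n|rewrite e Pk; ring].
have PE e': inKx e' -> e' != 0 -> (d%:Z * k %| P e')%Z. by move=> *; rewrite mulrC -Pk branch_E.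
by have k1 := tr_k k0 PE Pyk coprime_a; rewrite Pk Pyk k1 !mul1r.
Qed.
Lemma branch_unique P Q: 0 < P x -> 0 < Q x -> P = Q.
 move=> Px Qx; have [Px' Py] := branch_xy Px; have [Qx' Qy] := branch_xy Qx.
apply: (tr_unique _ Py coprime_a) Qy => [e Ee e0|e]. by rewrite -Px' branch_E.
have key c: c != 0 -> P (ev c) = Q (ev c).
move=> c0; have [n [r]] := multiplicity_XsubC c 0; rewrite c0 subr0 /= => nr ec. have cop: coprimep 'X r.
rewrite irreducible_poly_coprime; last by rewrite -['X]subr0; apply: irredp_XsubC. by rewrite -['X]subr0 dvdp_XsubCl.
have ov (R: place C) : 0 < R x -> over R 'X by move=> Rx; split; rewrite ?evxX ?/fpl ?ltW.
have [r0 vr] := over_cop (ov _ Px) cop; have [_ vr'] := over_cop (ov _ Qx) cop.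
by rewrite ec evxM evxXn evxX !dvM ?expf_neq0 ?ev0 ?x_unit // vr vr' !dvX // Px' Qx'.
move=> [r [c c0 ->]]; have [->|r0] := eqVneq r 0; first by rewrite evx0 mul0r !dv0. by rewrite !dv_div ?ev0 // !key.
Qed.
Lemma exists_branch: exists P, 0 < P x.
 have [|P [_ h]] := @exists_over _ _ _ _ C 'X; last by exists P; rewrite evxX in h.
by rewrite -['X]subr0; apply: irredp_XsubC.
Qed.
Lemma branch_pr P n f i: 0 < P x -> vge P n f -> (i < d)%N -> vge P n (pr i f).
 move=> Px h id_; have [Px' Py] := branch_xy Px.
apply: (@tr_vge P 1 a) => //; rewrite ?mul1r //; last exact: coprime_a.
by move=> e; rewrite mulr1 -Px'; apply: branch_E.
Qed.

End Infinity.

#[export] Hint Resolve T_unit : nz.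
End Inf.
Export Inf.

(** * Orbits, supports and residue fields of finite places *)

Section Points.
Variables (d a: nat) (kap F: fieldType) (C: scurve d a kap F).
Notation x := (cx C).
Notation ev := (evx (cst C) x).
Notation m := (m C).
Notation inA := (inA C).
Notation inKx := (inKx C).
Notation over := (@over d a kap F C).
Implicit Types (f g: F) (c q r: {poly kap}) (P Q R: place C).

Lemma dj_mod j f: dj C j f = dj C (j %% d) f.
 rewrite {1}(divn_eq j d); elim: (j %/ d)%N => [//|k IH]. by rewrite -addnA djD -djD djD dj_d -IH.
Qed.
Lemma pconj_conj i j P f: pconj i (pconj j P) f = P (dj C (j + i) f).
 by rewrite !pconjE djD. Qed.

Definition orbit P := [seq pconj j P | j <- iota 0 d].

(** Otherwise some e is 1 along the orbit of P and vanishes along that of Q. Its norm lies in K(x),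
    and q would divide the numerator as seen from Q but not as seen from P. *)
Lemma over_orbit q P Q: irreducible_poly q -> over P q -> over Q q -> Q \in orbit P.
 move=> iq hP hQ; apply: contrapT => nQ. have orbN j: pconj j P \in orbit P. have ->: pconj j P = pconj (j %% d) P.
by apply/place_inj/dval_eqP => f; rewrite !pconjE dj_mod. by apply: map_f; rewrite mem_iota add0n ltn_mod (d_gt0 C).
have [|e [h1 h2]] := @weak_approximation2 F (map (@pv _ _ _ _ C) (orbit P)) (map (@pv _ _ _ _ C) (orbit Q)) 1.
move=> v /mapP[_ /mapP[i _ ->] ->]; apply/negP => /mapP[_ /mapP[j jd ->] e].
apply: nQ; have ->: Q = pconj (i + (d - j)) P; last exact: orbN.
apply/place_inj/dval_eqP => f; have := congr1 (fun v: dval F => v (dj C (d - j) f)) e.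
rewrite /= !pconjE -!djD subnKC ?dj_d //. by move: jd; rewrite mem_iota add0n => /andP[_ /ltnW].
have Pe j: dj C j e != 0 /\ P (dj C j e) = 0. have : vge (pconj j P) 1 (e - 1) by apply: h1; apply: map_f.
by move/(sub1_unit ltr01) => [e0]; rewrite pconjE fmorph_eq0. have Ne: inKx (nrm C e) by apply/inKx_fix/del_nrm.
have e0: e != 0 by have [] := Pe 0%N. have n0 := nrm_neq0 C e0. have PN: P (nrm C e) = 0.
rewrite /nrm dv_prod => [|j _]; last by have [] := Pe j. by rewrite big1 // => j _; have [] := Pe j.
have QN: vge Q 1 (nrm C e). rewrite /nrm (bigD1 (Ordinal (d_gt0 C))) //=; apply: vge0M.
rewrite -[e]/(dj C 0 e) -vge_pconj; apply: h2; apply: map_f. by apply: map_f; rewrite mem_iota (d_gt0 C).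
apply: vge0_prod => j _; apply: (@vgeW _ _ 1) => //; rewrite -vge_pconj; apply: h2.
by apply: map_f; apply: map_f; rewrite mem_iota add0n ltn_ord.
move: Ne => /inKx_coprime[r [c [c0 rc e1]]]; rewrite e1 in n0 PN QN.
have r0: r != 0 by apply: contraNneq n0 => ->; rewrite evx0 mul0r.
move: PN QN; rewrite vgeE // !dv_div ?ev0 // => PN QN. have qr: q %| r.
rewrite -(over_dvd iq hQ r0); have := vge_ev c hQ.1; rewrite vgeE ?ev0 //. by move: QN; clia.
have qc: coprimep q c by apply: coprimep_dvdr rc. have [_ Pc] := over_cop hP qc; have := over_dvd iq hP r0.
by rewrite qr -[P (ev r)]subr0 -{2}Pc PN ltxx.
Qed.
Lemma poly_support c: c != 0 -> exists s : seq (place C), forall P,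
 fpl P -> 0 < P (ev c) -> P \in s.
 elim: {c}(size c) {-2}c (leqnn (size c)) => [|n IH] c sc c0. by move: sc c0; rewrite leqn0 size_poly_eq0 => ->.
have [s1|s1] := leqP (size c) 1. by exists [::] => P _; rewrite (size1_polyC s1) evxC pv_cst.
have [q iq /dvdpP[r e]] := irreducible_factor s1.
have [r0 q0]: r != 0 /\ q != 0 by move: c0; rewrite e mulf_eq0 negb_or => /andP[].
have [|s hs] := IH r _ r0; first by rewrite -ltnS (leq_trans _ sc) // e size_mul_lt // iq.1.
have [P hP] := exists_over C iq; exists (s ++ orbit P) => Q fQ. rewrite e evxM dvM ?ev0 // mem_cat => h.
have [Qq|Qq] := ltP 0 (Q (ev q)); first by rewrite (@over_orbit q P Q) ?orbT. by rewrite hs //; move: h Qq; clia.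
Qed.
Lemma support f: f != 0 -> exists s : seq (place C), forall P, fpl P -> P f != 0 -> P \in s.
 move=> f0; have [w [c c0 [Aw e]]] := fracA C f; have ec: ev c != 0 by rewrite ev0.
have w0: w != 0 by apply: contraNneq f0 => w0; rewrite e w0 mul0r.
have [r er] := inA_nrm Aw; have r0: r != 0 by rewrite -(ev0 C) -er nrm_neq0.
have [|s hs] := @poly_support (r * c); first by rewrite mulf_neq0.
exists s => P fP Pf; apply: hs => //; rewrite evxM dvM ?ev0 // -er. have Pc := vge_ev c fP; rewrite vgeE // in Pc.
have h: vge P (P w) (nrm C w). rewrite /nrm (bigD1 (Ordinal (d_gt0 C))) //=; apply: vge0M; first by rewrite vgeE.
by apply: vge0_prod => j _; apply: vge_inA => //; apply: inA_dj.
have Pw := vge_inA Aw fP; move: Pf h Pw; rewrite e dv_div // !vgeE ?nrm_neq0 //. by move: Pc; clia.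
Qed.
Lemma separate_places P Q: fpl P -> fpl Q -> P != Q ->
 exists u, [/\ inA u, u != 0, P u = 0 & vge Q 1 u].
 move=> fP fQ PQ; have [q iq hQ] := over_irreducible fQ. have q0: q != 0 by rewrite -size_poly_gt0 ltnW // iq.1.
have [Pq|Pq] := ltP 0 (P (ev q)); last first. exists (ev q); split; rewrite ?ev0 //; first exact: inA_ev.
by apply/eqP; rewrite eq_le Pq -vgeE ?ev0 ?vge_ev. by rewrite vgeE ?ev0 //; case: hQ. have hP: over P q by [].
have [|e [h1 h2]] := @weak_approximation2 F [:: pv P] (map (@pv _ _ _ _ C) (filter (predC1 P) (orbit P))) 1.
move=> v; rewrite mem_seq1 => /eqP->; apply/negP => /mapP[R].
by rewrite mem_filter => /andP[/= /eqP RP _] /place_inj/esym. have [e0 Pe] := sub1_unit ltr01 (h1 P (mem_head _ _)).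
have reg R: over R q -> R != P -> vge R 1 e. move=> hR RP; apply: h2; apply: map_f; rewrite mem_filter /= RP.
exact: over_orbit iq hP hR. have [|c cop Au] := @inA_local _ _ _ _ C q e iq.
move=> R hR; have [->|RP] := eqVneq R P; first by rewrite vgeE // Pe. exact: vgeW (reg R hR RP).
have [c0 Pc] := over_cop hP cop. exists (ev c * e); split=> //; first by rewrite mulf_neq0 ?ev0.
by rewrite dvM ?ev0 // Pc Pe. by apply: vgeM0; [apply: vge_ev|apply: reg => //; rewrite eq_sym].
Qed.

Lemma clear_poles P f (D: seq (place C)) : fpl P -> exists u,
 [/\ inA u, u != 0, P u = 0 & forall R, fpl R -> R != P -> vge R (count_mem R D)%:Z (u * f)].
 move=> fP; have [->|f0] := eqVneq f 0. exists 1; split; rewrite ?oner_neq0 ?dv1 //; first exact: inA1.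
by move=> R _ _; rewrite mulr0 vge0. have [s hs] := support f0. pose bd R := (`|R f| + count_mem R D)%N.
have main (l: seq (place C)) : exists u, [/\ inA u, u != 0, P u = 0 &
forall R, fpl R -> R != P -> R \in l -> vge R (bd R)%:Z u]. elim: l => [|R l [u [Au u0 Pu hu]]].
by exists 1; split; rewrite ?oner_neq0 ?dv1 //; apply: inA1.
have [/andP[fR RP]|nR] := boolP (fpl R && (R != P)); last first.
exists u; split=> // R' fR' R'P; rewrite in_cons => /predU1P[e|]; last exact: hu. by move: nR; rewrite -e fR' R'P.
have [|w [Aw w0 Pw Rw]] := separate_places fP fR; first by rewrite eq_sym. exists (u * w ^+ bd R); split; rewrite //.
- by apply: inAM => //; apply: inAX.
- by rewrite dvM // dvX // Pu Pw mulr0.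
- move=> R' fR' R'P; rewrite in_cons => /predU1P[->|hR'].
by apply: vgeM0; [apply: vge_inA|have := vgeX (bd R) Rw; rewrite natz].
by apply: vge0M; [apply: hu|apply: vge_inA => //; apply: inAX].
have [u [Au u0 Pu hu]] := main (s ++ D); exists u; split=> // R fR RP. have [Rl|] := boolP (R \in s ++ D).
have := hu R fR RP Rl; rewrite !vgeE // dvM // /bd; clia.
rewrite mem_cat negb_or => /andP[Rs RD]; rewrite (count_memPn RD). have ->: vge R 0%:Z (u * f) = vge R 0 u.
rewrite !vgeE // dvM // [R f](_: _ = 0) ?addr0 //. by apply/eqP; apply: contraNT Rs => /(hs R fR). exact: vge_inA.
Qed.
(** A / qA has dimension d deg q over the constants: take the remainders modulo q of the d
    coefficients. *)
Lemma dependent_mod q n (u: 'I_n -> F) : q != 0 -> (forall i, inA (u i)) ->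
 (d * (size q).-1 < n)%N -> exists c : 'I_n -> kap,
 (exists i, c i != 0) /\ exists2 w, inA w & \sum_i cst C (c i) * u i = ev q * w.
 move=> q0 Au dn; pose D := (size q).-1.
have hr i: exists r : nat -> {poly kap}, u i = \sum_(j < d) ev (r j) * m j by apply: Au.
pose r i := projT1 (cid (hr i)); have rE i: u i = \sum_(j < d) ev (r i j) * m j := projT2 (cid (hr i)).
pose M := \matrix_(i < n) mxvec (\matrix_(j < d, k < D) (r i j %% q)`_k). have : kermx M != 0.
rewrite kermx_eq0; apply/negP => /eqP e. by have := rank_leq_col M; rewrite e leqNgt dn.
move/rowV0Pn => [v /sub_kermxP vM v0]. have [i vi]: exists i, v 0 i != 0.
apply: contrapT => none; case/eqP: v0; apply/rowP => i; rewrite mxE.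
by apply: contrapT => /eqP vi; apply: none; exists i. exists (fun i => v 0 i); split; first by exists i.
have key j: \sum_i v 0 i *: (r i j %% q) = 0 \/ (d <= j)%N. have [dj|jd] := leqP d j; [by right|left].
apply/polyP => k; rewrite coef_sum coef0; have [kD|Dk] := ltnP k D; last first.
rewrite big1 // => i' _; rewrite coefZ nth_default ?mulr0 //.
by apply: leq_trans Dk; rewrite /D -ltnS prednK ?size_poly_gt0 // ltn_modp.
have := congr1 (fun A => vec_mx A (Ordinal jd) (Ordinal kD)) vM.
rewrite mulmx_sum_row linear_sum summxE linear0 [in RHS]mxE; apply: etrans; apply: eq_bigr => i' _.
by rewrite rowK linearZ /= mxvecK !mxE coefZ. exists (\sum_(j < d) ev (\sum_i v 0 i *: (r i j %/ q)) * m j).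
by apply: inA_sum => j _; apply/inA_evM/inA_m. rewrite mulr_sumr; under eq_bigr => i' _ do rewrite rE mulr_sumr.
rewrite exchange_big; apply: eq_bigr => j _ /=. have [e|h] := key j; last by move: (ltn_ord j); rewrite ltnNge h.
transitivity (ev (\sum_i v 0 i *: r i j) * m j). rewrite evx_sum mulr_suml; apply: eq_bigr => i' _.
by rewrite -mul_polyC evxM evxC mulrA. rewrite mulrA -evxM; congr (ev _ * _).
rewrite -[RHS]addr0 -[X in _ + X]e mulr_sumr -big_split; apply: eq_bigr => i' _ /=.
by rewrite -scalerAr -scalerDr; congr (_ *: _); rewrite mulrC -divp_eq.
Qed.
(** A linear relation between powers of u modulo q, divided by its lowest power of u, exhibits the
    inverse: the image of A in the residue field of P is already a field. *)
Lemma inverse_mod P u: fpl P -> inA u -> u != 0 -> P u = 0 ->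
 exists2 w, inA w & vge P 1 (u * w - 1).
 move=> fP Au u0 Pu; have [q iq hq] := over_irreducible fP. have q0: q != 0 by rewrite -size_poly_gt0 ltnW // iq.1.
pose n := (d * (size q).-1).+1. have [||c [[i0 ci0] [w Aw e]]] := @dependent_mod q n (fun i => u ^+ i) q0.
- by move=> i; apply: inAX.
- exact: ltnSn. have [i ci imin] := @arg_minnP _ i0 (fun i => c i != 0) (fun i => nat_of_ord i) ci0.
have h: vge P 1 (ev q * w) by apply: vge0M; [rewrite vgeE ?ev0 //; case: hq|apply: vge_inA].
pose s := \sum_(j < n | j != i) if (i < j)%N then cst C (c j) * u ^+ (j - i).-1 else 0.
have es: ev q * w = u ^+ i * (cst C (c i) + u * s). rewrite -e (bigD1 i) // mulrDr [u ^+ i * _]mulrC; congr (_ + _).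
rewrite mulrA -exprSr mulr_sumr; apply: eq_bigr => j ji. case: ltnP => [ij|ji'].
by rewrite mulrCA -exprD; congr (_ * _ ^+ _); move: ij; clia.
have [->|cj] := eqVneq (c j) 0; first by rewrite rmorph0 mul0r mulr0.
by case/eqP: ji; apply: val_inj; apply/eqP; rewrite eqn_leq ji' imin. have As: inA s.
apply: inA_sum => j _; case: ifP => _; last exact: inA0. by apply: inAM; [exact: inA_cst|exact: inAX].
exists (- cst C (c i)^-1 * s); first by apply: inAM => //; apply/inAN/inA_cst.
have ->: u * (- cst C (c i)^-1 * s) - 1 = - cst C (c i)^-1 * (cst C (c i) + u * s). by rewrite fmorphV; field.
apply: vgeM0; first by rewrite vgeN vge_cst. by move: h; rewrite es vgeM_unit // dvX // Pu mulr0.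
Qed.
Lemma residue_lift P f: fpl P -> vge P 0 f -> exists2 w, inA w & vge P 1 (f - w).
 move=> fP Pf; have [u [Au u0 Pu hu]] := clear_poles f [::] fP. have Auf: inA (u * f).
apply/inAP => R fR; have [->|RP] := eqVneq R P; last exact: hu. by apply: vgeM0 => //; apply: vge_inA.
have [w Aw h] := inverse_mod fP Au u0 Pu; exists (u * f * w); first exact: inAM.
have ->: f - u * f * w = - (f * (u * w - 1)) by ring. by rewrite vgeN; apply: vgeM0.
Qed.

Definition res_basis P n (bs: 'I_n -> F) :=
 (forall i, vge P 0 (bs i)) /\ forall f, vge P 0 f ->
 exists! c : {ffun 'I_n -> kap}, vge P 1 (f - \sum_i cst C (c i) * bs i).

Definition deg P: nat := xget 0%N [set n | exists bs : 'I_n -> F, res_basis P bs]%classic.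

(** A maximal independent family of residues is a basis. Its size is bounded because residues lift
    to A, where [dependent_mod] applies. *)
Lemma deg_basis P: fpl P -> exists bs : 'I_(deg P) -> F, res_basis P bs.
 move=> fP; suff [n [bs hbs]] : exists n, exists bs : 'I_n -> F, res_basis P bs.
exact: (@xgetPex _ 0%N [set n | exists bs : 'I_n -> F, res_basis P bs]%classic (ex_intro _ n (ex_intro _ bs hbs))).
pose indep n (bs: 'I_n -> F) := (forall i, vge P 0 (bs i)) /\
forall c : 'I_n -> kap, vge P 1 (\sum_i cst C (c i) * bs i) -> forall i, c i = 0.
have [q iq hq] := over_irreducible fP. have q0: q != 0 by rewrite -size_poly_gt0 ltnW // iq.1.
have bound n: (exists bs: 'I_n -> F, indep n bs) -> (n <= d * (size q).-1)%N.
move=> [bs [reg ind]]; rewrite leqNgt; apply/negP => lt. pose w i := projT1 (cid2 (residue_lift fP (reg i))).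
have Aw i: inA (w i) by rewrite /w; case: cid2. have wP i: vge P 1 (bs i - w i) by rewrite /w; case: cid2.
have [c [[i ci] [v Av e]]] := dependent_mod q0 Aw lt. case/eqP: ci; apply: (ind (fun i => c i)) => //.
have ->: \sum_j cst C (c j) * bs j = \sum_j cst C (c j) * (bs j - w j) + ev q * v.
by rewrite -e -big_split; apply: eq_bigr => j _ /=; rewrite mulrBr subrK.
apply: vgeD; first by apply: vge_sum => j _; apply: vgeM0; rewrite ?vge_cst.
by apply: vge0M; [rewrite vgeE ?ev0 //; case: hq|apply: vge_inA].
have ex: exists n, `[< exists bs : 'I_n -> F, indep n bs >].
by exists 0%N; apply/asboolP; exists (fun=> 0); split=> [i|c _ [[]]//]; case: i.
have ub n: `[< exists bs : 'I_n -> F, indep n bs >] -> (n <= d * (size q).-1)%N. by move/asboolP/bound.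
case: (ex_maxnP ex ub) => n /asboolP[bs [reg ind]] nmax; exists n, bs; split=> // f Pf.
have [c hc]: exists c : {ffun 'I_n -> kap}, vge P 1 (f - \sum_i cst C (c i) * bs i).
apply: contrapT => none; suff : (n.+1 <= n)%N by rewrite ltnn.
apply: nmax; apply/asboolP; exists (fun i => if unlift ord_max i is Some j then bs j else f).
split=> [i|c]; first by case: unliftP. rewrite big_ord_recr /= unlift_none.
have wl (i: 'I_n) : widen_ord (leqnSn n) i = lift ord_max i. by apply: val_inj; rewrite /= /bump leqNgt ltn_ord.
under eq_bigr => i _ do rewrite wl liftK. have [c0 h|c0 h] := eqVneq (c ord_max) 0.
move: h; rewrite c0 rmorph0 mul0r addr0 => h i. have := ind (fun i => c (lift ord_max i)) h.
by move=> hh; case: (unliftP ord_max i) => [j ->|->].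
exfalso; apply: none; exists [ffun i => - c (lift ord_max i) / c ord_max]. have cc: cst C (c ord_max) != 0 by [].
rewrite -(@vgeM_unit _ P _ (cst C (c ord_max))) ?pv_cst //.
rewrite mulrBr mulr_sumr -sumrN addrC; congr (vge _ _ (_ + _)): h.
apply: eq_bigr => i _; rewrite ffunE rmorphM fmorphV rmorphN; field. exact: cc.
exists c; split=> // c' hc'; apply/ffunP => i; apply/eqP; rewrite -subr_eq0; apply/eqP.
apply: (ind (fun i => c i - c' i)). have ->: \sum_j cst C (c j - c' j) * bs j =
(f - \sum_j cst C (c' j) * bs j) - (f - \sum_j cst C (c j) * bs j).
rewrite opprB addrC addrA subrK -sumrB; apply: eq_bigr => j _. by ring. exact: vgeB.
Qed.

End Points.

(** * Dimensions counted by pole orders; degrees of divisors *)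

Section Counting.
Variables (d a: nat) (kap F: fieldType) (C: scurve d a kap F).
Notation x := (cx C).
Notation y := (cy C).
Notation inA := (inA C).
Notation oo := (oo C).
Notation cst := (cst C).
Implicit Types (f g: F) (c q r: {poly kap}) (P Q R: place C) (V W: F -> Prop).

Definition subsp V := V 0 /\ forall u f g, V f -> V g -> V (f + cst u * g).

Lemma subspZ V u f: subsp V -> V f -> V (cst u * f).
 by move=> [V0 VD] h; rewrite -[cst u * f]add0r; apply: VD. Qed.
Lemma subspD V f g: subsp V -> V f -> V g -> V (f + g).
 by move=> [V0 VD] hf hg; rewrite -[g]mul1r -(rmorph1 cst); apply: VD. Qed.
Lemma subspB V f g: subsp V -> V f -> V g -> V (f - g).
 by move=> [V0 VD] hf hg; rewrite -mulN1r -(rmorph1 cst) -rmorphN; apply: VD. Qed.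
Lemma subsp_sum V (I: Type) (s: seq I) (A: pred I) (G: I -> F) : subsp V ->
 (forall i, A i -> V (G i)) -> V (\sum_(i <- s | A i) G i).
 by move=> sV h; elim/big_ind: _ => //; [exact: sV.1|move=> f g; exact: subspD]. Qed.

Definition pole_of V (j: nat) := exists f, [/\ V f, f != 0 & oo f = - j%:Z].

(** For a subspace V of A this is the dimension of its elements of pole order less than M: the
    residue field at oo is that of constants, so each pole order contributes one dimension. *)
Definition cnt V M: nat := \sum_(j < M) (`[< pole_of V j >] : nat).

Lemma eq_cnt V W M: (forall f, V f <-> W f) -> cnt V M = cnt W M.
 move=> VW; apply: eq_bigr => j _; congr (nat_of_bool _); apply/asboolP/asboolP. by move=> [f [/VW]]; exists f.
by move=> [f [/VW]]; exists f.
Qed.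
Lemma cntS V M: cnt V M.+1 = (cnt V M + `[< pole_of V M >])%N.
 by rewrite /cnt big_ord_recr. Qed.
Lemma leading_sub f g: f != 0 -> g != 0 -> oo f = oo g ->
 exists2 u, u != 0 & vge oo (oo g + 1) (f - cst u * g).
 move=> f0 g0 e; have [u u0 hu] := oo_leading C f0; have [w w0 hw] := oo_leading C g0. exists (u / w); first by [].
rewrite e in hu; have ->: f - cst (u / w) * g = (f - cst u * T C ^ oo g) - cst (u / w) * (g - cst w * T C ^ oo g).
by rewrite rmorphM fmorphV; field. by apply: vgeB => //; apply: vgeM0; rewrite ?vge_cst.
Qed.
Lemma oo_inA_le0 f: inA f -> f != 0 -> oo f <= 0.
 move=> Af f0; rewrite leNgt; apply/negP => h. have [|u e] := inA_const Af _; first by rewrite vgeE // ltW.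
by move: h; rewrite e pv_cst.
Qed.

Section Hyperplane.
Variables (V: F -> Prop) (phi: F -> kap).
Hypotheses (VA: forall f, V f -> inA f) (sV: subsp V).
Hypothesis phiD: forall u f g, V f -> V g -> phi (f + cst u * g) = phi f + u * phi g.
Hypothesis phi0: exists2 f, V f & phi f != 0.
Let H f := V f /\ phi f = 0.

Let V0: V 0. Proof. exact: sV.1. Qed.
Let phi_0: phi 0 = 0.
 by have := phiD 1 V0 V0; rewrite mulr0 addr0 mul1r -{1}[phi 0]addr0 => /addrI/esym. Qed.

(* Passing to a hyperplane removes exactly one pole order: the least order of
   an element outside it. *)
Lemma cnt_hyperplane: exists M0, forall M, (M0 <= M)%N -> cnt V M = (cnt H M).+1.
 have ex: exists n, `[< exists f, [/\ V f, phi f != 0 & oo f = - n%:Z] >].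
have [f Vf pf] := phi0; exists `|oo f|%N; apply/asboolP; exists f; split=> //.
have f0: f != 0 by apply: contra_neq pf => ->. have := oo_inA_le0 (VA Vf) f0; clia.
case: (ex_minnP ex) => n /asboolP[v [Vv pv vn]] nmin. have v0: v != 0 by apply: contra_neq pv => ->.
have small f: V f -> vge oo (1 - n%:Z) f -> phi f = 0. move=> Vf; have [->//|f0] := eqVneq f 0; rewrite vgeE // => h.
apply: contrapT => /eqP pf; have f1 := oo_inA_le0 (VA Vf) f0.
have e: exists g, [/\ V g, phi g != 0 & oo g = - `|oo f|%N%:Z]. by exists f; split=> //; move: f1; clia.
by have := nmin _ (asboolT e); move: h f1; clia. have nH: ~ pole_of H n.
move=> [f [[Vf pf] f0 fn]]; have [|u u0 h] := @leading_sub v f v0 f0; first by rewrite vn fn.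
have := small (v + cst (- u) * f); rewrite phiD // pf mulr0 addr0 => pz. case/eqP: pv; apply: pz; first exact: sV.2.
by rewrite rmorphN mulNr; move: h; rewrite fn addrC. have HV j: j != n -> pole_of V j -> pole_of H j.
move=> jn [f [Vf f0 fj]]; have [pf|pf] := eqVneq (phi f) 0; first by exists f. have nj: (n < j)%N.
rewrite ltn_neqAle eq_sym jn /= leqNgt; apply/negP => lt; case/eqP: pf; apply: small => //.
by rewrite vgeE // fj; move: lt; clia. have [] := @dvD_lt _ oo f (cst (- (phi f / phi v)) * v) f0.
apply: vgeM0; first exact: vge_cst. by rewrite vgeE // fj vn; move: nj; clia.
move=> h0 hj; exists (f + cst (- (phi f / phi v)) * v); split=> //; last by rewrite hj. split; first exact: sV.2.
by rewrite phiD // mulNr divfK ?subrr. have step M: (`[< pole_of V M >] : nat) = (`[< pole_of H M >] + (M == n))%N.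
have [->|Mn] := eqVneq M n; rewrite ?addn0. by rewrite (asboolF nH) asboolT //; exists v.
congr nat_of_bool; apply/asboolP/asboolP; first exact: HV. by move=> [f [[Vf _]]]; exists f.
have main M: cnt V M = (cnt H M + (n < M))%N. elim: M => [|M IH]; first by rewrite /cnt !big_ord0.
rewrite !cntS IH step; move: (cnt H M) (nat_of_bool `[< _ >]); clia. by exists n.+1 => M nM; rewrite main nM addn1.
Qed.
End Hyperplane.

(** Hyperplanes are cut one at a time; the dual family shows that each functional is nonzero on the
    intersection of the previous kernels. *)
Lemma cnt_codim V n (phi: nat -> F -> kap) : (forall f, V f -> inA f) -> subsp V ->
 (forall i u f g, (i < n)%N -> V f -> V g -> phi i (f + cst u * g) = phi i f + u * phi i g) ->
 (forall i, (i < n)%N -> exists v, [/\ V v, phi i v != 0 & forall j, (j < n)%N -> j != i -> phi j v = 0]) ->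
 exists M0, forall M, (M0 <= M)%N ->
 cnt V M = addn (cnt (fun f => V f /\ forall i, (i < n)%N -> phi i f = 0) M) n.
 move=> VA sV; elim: n => [|n IH] lin dual.
by exists 0%N => M _; rewrite addn0; apply: eq_cnt => f; split=> [Vf|[]//]; split. have [i u f g lt|i lt|M1 h1] := IH.
- by apply: lin; apply: ltnW.
- have [v [Vv v0 vj]] := dual i (ltnW lt); exists v; split=> // j jn; apply: vj; exact: ltnW.
set V' := fun f => _ in h1. have sV': subsp V'. have ph0 i: (i < n)%N -> phi i 0 = 0.
move=> lt; have := lin i 1 0 0 (ltnW lt) sV.1 sV.1; rewrite mulr0 addr0 mul1r.
by rewrite -{1}[phi i 0]addr0 => /addrI/esym. split=> [|u f g [Vf ef] [Vg eg]]; first by split; [exact: sV.1|].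
by split=> [|i lt]; [exact: sV.2|rewrite lin ?ef ?eg ?mulr0 ?addr0 // ltnW].
have [|||M2 h2] := @cnt_hyperplane V' (phi n) _ sV'.
- by move=> f [/VA].
- by move=> u f g [Vf _] [Vg _]; apply: lin.
- have [v [Vv v0 vj]] := dual n (ltnSn n); exists v => //; split=> // i lt.
by apply: vj; [exact: ltnW|rewrite ltn_eqF]. exists (maxn M1 M2) => M; rewrite geq_max => /andP[/h1-> /h2->].
rewrite addSnnS; congr (_ + _)%N; apply: eq_cnt => f; split.
move=> [[Vf h] hn]; split=> // i; rewrite ltnS leq_eqVlt => /predU1P[->//|]; exact: h.
by move=> [Vf h]; split; [split=> // i lt; apply/h/ltnW|apply: h].
Qed.

Definition ideal (D: seq (place C)) f :=
 inA f /\ forall P, fpl P -> vge P (count_mem P D)%:Z f.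

Lemma subsp_ideal D: subsp (ideal D).
 split=> [|u f g [Af hf] [Ag hg]]; first by split; [exact: inA0|move=> P _; apply: vge0].
split=> [|P fP]; first by apply: inAD => //; apply: inAM => //; apply: inA_cst.
by apply: vgeD; [exact: hf|apply: vgeM0; [exact: vge_cst|exact: hg]].
Qed.
(** The functionals are the coordinates of f / t^k in a residue basis at P, where k is the
    multiplicity of P in D. *)
Lemma cnt_ideal_cons P D: fpl P -> exists M0, forall M, (M0 <= M)%N ->
 cnt (ideal D) M = (cnt (ideal (P :: D)) M + deg P)%N.
 move=> fP; have [bs [reg bP]] := deg_basis fP; have [t t0 Pt] := dv_surj P.
set n := deg P in bs reg bP *; pose k := count_mem P D. have tk: P (t ^+ k) = k by rewrite dvX // Pt mulr1.
have hc f: exists c : {ffun 'I_n -> kap}, vge P 0 (f / t ^+ k) -> vge P 1 (f / t ^+ k - \sum_i cst (c i) * bs i).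
have [h|nh] := pselect (vge P 0 (f / t ^+ k)); last by exists [ffun=> 0]. by have [c [hc _]] := bP _ h; exists c.
pose co f := projT1 (cid (hc f)). have coP f: vge P k%:Z f -> vge P 1 (f / t ^+ k - \sum_i cst (co f i) * bs i).
by move=> h; apply: (projT2 (cid (hc f))); rewrite vge_div // tk add0r. have coE f (c: 'I_n -> kap) : vge P k%:Z f ->
vge P 1 (f / t ^+ k - \sum_i cst (c i) * bs i) -> forall i, co f i = c i.
move=> h hcc i; have hf: vge P 0 (f / t ^+ k) by rewrite vge_div // tk add0r.
have [c' [_ uniq]] := bP _ hf; have := uniq _ (coP f h).
have /uniq ->: vge P 1 (f / t ^+ k - \sum_i cst ([ffun i => c i] i) * bs i). by under eq_bigr do rewrite ffunE.
by move=> <-; rewrite ffunE. pose phi i f := if insub i is Some i' then co f i' else 0.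
have [||i u f g lt [Af hf] [Ag hg]|i lt|M0 hM] := @cnt_codim (ideal D) n phi.
- by move=> f [].
- exact: subsp_ideal.
- rewrite /phi insubT; apply: (coE _ (fun i => co f i + u * co g i)).
by apply: vgeD; [exact: hf|apply: vgeM0; [exact: vge_cst|exact: hg]].
have := coP _ (hf P fP); have := coP _ (hg P fP) => h1 h2.
have ->: (f + cst u * g) / t ^+ k - \sum_i cst (co f i + u * co g i) * bs i =
(f / t ^+ k - \sum_i cst (co f i) * bs i) + cst u * (g / t ^+ k - \sum_i cst (co g i) * bs i).
rewrite mulrDl mulrBr mulrA addrACA; congr (_ + _).
rewrite -opprD; congr (- _); rewrite mulr_sumr -big_split; apply: eq_bigr => j _ /=. by ring.
by apply: vgeD => //; apply: vgeM0; rewrite ?vge_cst.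
(* Dual functions: [clear_poles] makes b_i t^k global at the price of a factor u, a unit at P, and w
   undoes this factor modulo P. *)
- pose f0 := bs (Ordinal lt) * t ^+ k.
have [u [Au u0 Pu hu]] := clear_poles f0 D fP; have [w Aw uw] := inverse_mod fP Au u0 Pu.
have Pf0: vge P k%:Z f0 by apply: vgeM0 => //; rewrite vgeE // tk. have I v: inA v -> ideal D (v * (u * f0)).
move=> Av; have h R: fpl R -> vge R (count_mem R D)%:Z (u * f0).
move=> fR; have [->|RP] := eqVneq R P; last exact: hu. by apply: vgeM0 => //; apply: vge_inA.
split=> [|R fR]; last by apply: vgeM0; [exact: vge_inA|exact: h].
apply: inAM => //; apply/inAP => R fR; apply: vgeW (h R fR); clia.
have co_w j: co (w * (u * f0)) j = if j == Ordinal lt then 1 else 0.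
apply: (coE _ (fun j => if j == Ordinal lt then 1 else 0)).
by apply: vgeM0; [exact: vge_inA|apply: vgeM0 => //; exact: vge_inA].
rewrite (bigD1 (Ordinal lt)) //= eqxx rmorph1 mul1r big1 ?addr0 => [|j' /negPf->]; last first.
by rewrite rmorph0 mul0r. have ->: w * (u * f0) / t ^+ k - bs (Ordinal lt) = bs (Ordinal lt) * (u * w - 1).
by rewrite /f0; field. exact: vgeM0. exists (w * (u * f0)); split; first exact: I.
by rewrite /phi insubT co_w eqxx oner_neq0. by move=> j jn ji; rewrite /phi insubT co_w ifN.
exists M0 => M /hM ->; congr (_ + _)%N; apply: eq_cnt => f; split; last first.
move=> [Af hf]; split=> [|i lt]; first split=> // R fR. by apply: vgeW (hf R fR); rewrite /=; clia.
rewrite /phi insubT; apply: (coE _ (fun=> 0)). by apply: vgeW (hf P fP); rewrite /= eqxx /k lez_nat leq_addl.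
rewrite big1 ?subr0 => [|j _]; last by rewrite rmorph0 mul0r.
by rewrite vge_div // tk; have := hf P fP; rewrite /= eqxx.
move=> [[Af hf] h]; split=> // R fR; rewrite /=; have [<-|RP] := eqVneq P R; last exact: hf.
have := coP f (hf P fP); rewrite big1 ?subr0; last first.
move=> i _; have := h i (ltn_ord i); rewrite /phi insubT //= => lt e0.
have ->: co f i = 0 by rewrite -e0; congr (co f _); apply: val_inj. by rewrite rmorph0 mul0r.
by rewrite vge_div // tk.
Qed.

Definition degs (D: seq (place C)) : nat := \sum_(P <- D) deg P.

Lemma cnt_ideal D: all (@fpl _ _ _ _ C) D -> exists M0, forall M, (M0 <= M)%N ->
 cnt inA M = (cnt (ideal D) M + degs D)%N.
 elim: D => [_|P D IH /= /andP[fP /IH[M1 h1]]].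
exists 0%N => M _; rewrite /degs big_nil addn0; apply: eq_cnt => f; split=> [Af|[]//].
by split=> // P; apply: vge_inA. have [M2 h2] := cnt_ideal_cons D fP; exists (maxn M1 M2) => M.
by rewrite geq_max => /andP[/h1-> /h2->]; rewrite /degs big_cons addnA.
Qed.
Lemma pole_of_inA: exists M0, forall j, (M0 <= j)%N -> pole_of inA j.
 exists (d * d.+1)%N => j hj; pose i := (j %% d)%N; pose k := ((j - i * d.+1) %/ d)%N.
have d0 := d_gt0 C; have id_: (i < d)%N by rewrite ltn_mod. have jE: j = (i * d.+1 + k * d)%N.
have le: (i * d.+1 <= j)%N by apply: leq_trans hj; rewrite leq_mul2r ltnW. rewrite divnK ?subnKC // -eqn_mod_dvd //.
by rewrite mulnS addnC modnMDl /i modn_mod. exists (y ^+ i * x ^+ k); split.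
- by apply: inAM; apply: inAX; [exact: inA_y|exact: inA_x].
- by rewrite mulf_neq0 ?expf_neq0 ?x_unit ?y_unit.
- rewrite dvM ?expf_neq0 ?x_unit ?y_unit // !dvX ?x_unit ?y_unit // oo_x oo_y. by rewrite [in RHS]jE; clia.
Qed.
Lemma cnt_stable V M0 M: (forall j, (M0 <= j)%N -> pole_of V j) -> (M0 <= M)%N ->
 cnt V M = (cnt V M0 + (M - M0))%N.
 move=> h /subnKC <-; elim: (M - M0)%N => [|k IH]; first by rewrite addn0 subnn addn0.
by rewrite addnS cntS IH -addnA -addnS; congr (_ + _)%N; rewrite asboolT ?addn1 ?addKn //; apply: h; rewrite leq_addr.
Qed.

Definition divisor_of (D: seq (place C)) f := all (@fpl _ _ _ _ C) D /\
 forall P, fpl P -> P f = (count_mem P D)%:Z.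

Lemma exists_divisor f (e: place C -> nat) : f != 0 ->
 (forall P, fpl P -> P f = 0 -> e P = 0%N) ->
 exists2 D : seq (place C), all (@fpl _ _ _ _ C) D &
 forall P, fpl P -> count_mem P D = e P.
 move=> f0 he; have [s hs] := support C f0. exists (flatten [seq nseq (e P) P | P <- undup [seq P <- s | fpl P]]).
apply/allP => P /flattenP[_ /mapP[Q hQ ->]] /nseqP[-> _]. by move: hQ; rewrite mem_undup mem_filter => /andP[].
move=> P fP; have [Ps|Ps] := boolP (P \in undup [seq P <- s | fpl P]); last first. rewrite [e P]he //; last first.
apply: contrapT => /eqP n0; case/negP: Ps. by rewrite mem_undup mem_filter fP hs.
apply/count_memPn; apply: contra Ps => /flattenP[_ /mapP[Q hQ ->]] /nseqP[-> _] //.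
rewrite count_flatten -map_comp; have := undup_uniq [seq P <- s | fpl P].
elim: (undup _) Ps => //= Q l IH; rewrite in_cons => /predU1P[->|Pl] /andP[Ql ul].
rewrite count_nseq /= eqxx mul1n -[RHS]addn0; congr (_ + _)%N.
rewrite sumnE big_map big1_seq // => R /andP[_ Rl] /=; rewrite count_nseq /=.
by case: eqP => // e0; rewrite -e0 Rl in Ql. rewrite IH // count_nseq /=; case: eqP => // e0; by rewrite e0 Pl in Ql.
Qed.
(** Multiplication by f carries A onto the ideal of D and shifts every pole order by -oo f; for
    large M the count in [cnt_ideal] measures exactly this shift. *)
Lemma div_degree f D: inA f -> f != 0 -> divisor_of D f -> (degs D)%:Z = - oo f.
 move=> Af f0 [fD hD]; have [M1 h1] := cnt_ideal fD; have [M2 h2] := pole_of_inA.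
pose l := `|oo f|%N; have lE: oo f = - l%:Z by have := oo_inA_le0 Af f0; rewrite /l; clia.
have sh M: cnt (ideal D) (l + M) = cnt inA M. have I g: ideal D (f * g) <-> inA g. split=> [[Afg h]|Ag].
apply/inAP => P fP; have [->|g0] := eqVneq g 0; first exact: vge0.
have := h P fP; rewrite !vgeE // dvM // hD //; clia.
by split=> [|P fP]; [exact: inAM|apply: vge0M; [rewrite vgeE ?hD|exact: vge_inA]].
rewrite /cnt big_split_ord /= big1 => [|j _]. apply: eq_bigr => j _; congr (nat_of_bool _); apply/asboolP/asboolP.
move=> [g [Ig g0 gj]]; exists (f^-1 * g); rewrite mulf_neq0 //; split=> //. by apply/I; rewrite mulVKf.
by rewrite dvM // dvV gj lE /=; clia.
move=> [g [Ag g0 gj]]; exists (f * g); rewrite mulf_neq0 //; split=> //; first exact/I.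
by rewrite dvM // gj lE /=; clia. apply/eqP; rewrite eqb0; apply/asboolPn => -[g [Ig g0 gj]].
have Afg: inA (f^-1 * g) by apply/I; rewrite mulVKf. have := oo_inA_le0 Afg; rewrite mulf_neq0 // => /(_ isT).
rewrite dvM // dvV gj lE /=; have := ltn_ord j; clia. have := h1 (l + maxn M1 M2)%N; rewrite sh => /(_ _).
rewrite (@cnt_stable inA M2 (l + maxn M1 M2)) ?(@cnt_stable inA M2 (maxn M1 M2)) //.
- have := leq_maxr M1 M2; have := leq_maxl M1 M2; rewrite lE. by move: (maxn _ _) (cnt _ _) (degs D); clia.
- exact: leq_maxr.
- by apply: leq_trans (leq_maxr _ _) _; apply: leq_addl.
Qed.

End Counting.

(** * A basis of A adapted to pole orders at infinity *)

Module Crd.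
Section Coordinates.
Variables (d a: nat) (kap F: fieldType) (C: scurve d a kap F).
Notation b := (d + 1 - a)%N.
Notation x := (cx C).
Notation y := (cy C).
Notation ev := (evx (cst C) x).
Notation m := (m C).
Notation inA := (inA C).
Notation pr := (pr C).
Notation oo := (oo C).
Notation T := (T C).
Implicit Types (f g: F) (c q r: {poly kap}).

Lemma evm_neq0 r i: r != 0 -> ev r * m i != 0.
 by move=> r0; apply: mulf_neq0; rewrite ?ev0 ?m_unit. Qed.

Definition rco f i: {poly kap} :=
 if pselect (exists r, pr i f = ev r * m i) is left e then projT1 (cid e) else 0.

Lemma rcoP f i: inA f -> (i < d)%N -> pr i f = ev (rco f i) * m i.
 move=> /inA_pr[r hr] lt; rewrite /rco; case: pselect => [e|]; first by case: (cid e).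
by case; exists (r i); apply: hr.
Qed.
Lemma rco_sum f: inA f -> f = \sum_(i < d) ev (rco f i) * m i.
 by move=> Af; rewrite -{1}(sum_pr C f); apply: eq_bigr => i _; apply: rcoP. Qed.
Lemma rco_unique (r: nat -> {poly kap}) i : (i < d)%N ->
 rco (\sum_(j < d) ev (r j) * m j) i = r i.
 move=> lt; have Af: inA (\sum_(j < d) ev (r j) * m j) by exists r.
have := rcoP Af lt; have ->: pr i (\sum_(j < d) ev (r j) * m j) = ev (r i) * m i.
transitivity (\sum_(j < d) pr i (ev (r j) * m j)).
rewrite -mulr_sumr exchange_big /=; congr (_ * _); apply: eq_bigr => j _. by rewrite rmorph_sum mulr_sumr.
rewrite (bigD1 (Ordinal lt)) //= pr_ev_m // eqxx big1 ?addr0 // => j /eqP ji.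
by rewrite pr_ev_m // ifN //; apply: contra_not_neq ji => e; apply: val_inj.
move/(mulIf (m_unit C i)) => /eqP; rewrite -subr_eq0 -evxB ev0 subr_eq0. by move/eqP => ->.
Qed.
Lemma rco_lin i u f g: inA f -> inA g -> (i < d)%N ->
 rco (f + cst C u * g) i = rco f i + u *: rco g i.
 move=> /rco_sum ef /rco_sum eg lt.
rewrite {1}ef {1}eg mulr_sumr -big_split -[RHS](@rco_unique (fun i => rco f i + u *: rco g i)) //.
congr (rco _ _); apply: eq_bigr => j _ /=. by rewrite evxD -mul_polyC evxM evxC mulrDl mulrA.
Qed.

(* The pole order at infinity of m i. *)
Definition pm i: nat := (i * d.+1 - (d * (a * i %/ d) + d * (b * i %/ d)))%N.

Lemma pm_le i: (d * (a * i %/ d) + d * (b * i %/ d) <= i * d.+1)%N.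
 have ab: (d.+1 = a + b)%N by have := sc_a C; lia.
have ->: (i * d.+1 = a * i + b * i)%N by rewrite ab mulnDr ![(i * _)%N]mulnC. by rewrite leq_add // mulnC leq_divM.
Qed.
Lemma oo_mE i: oo (m i) = - (pm i)%:Z.
 by rewrite oo_m -subzn ?pm_le // opprB. Qed.
Lemma pm_mod i: (i < d)%N -> (pm i %% d = i)%N.
 move=> lt; rewrite -[RHS](modn_small lt); apply/eqP.
rewrite -(eqn_modDr (d * (a * i %/ d) + d * (b * i %/ d))) subnK ?pm_le //.
by rewrite -mulnDr mulnS [in X in _ == X]addnC ![(d * _)%N]mulnC !modnMDl addnC modnMDl.
Qed.

(** The pole orders in A congruent to i modulo d are those of x^k [m i], namely [pm i] + d k. So
    [wb l] has pole order l when l is not a gap, and [crd l] is the coefficient of [wb l], set to 0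
    at gaps. *)
Definition nongap l := (pm (l %% d) <= l)%N.
Definition wb l := x ^+ ((l - pm (l %% d)) %/ d) * m (l %% d).
Definition crd l f: kap := if nongap l then (rco f (l %% d))`_((l - pm (l %% d)) %/ d) else 0.

Lemma lmod_lt l: (l %% d < d)%N. Proof. by rewrite ltn_mod (d_gt0 C). Qed.
Lemma nongapE i k: (i < d)%N -> let l := (pm i + d * k)%N in
 [/\ nongap l, (l %% d = i)%N & ((l - pm (l %% d)) %/ d = k)%N].
 move=> lt l; have e: (l %% d = i)%N by rewrite /l addnC mulnC modnMDl pm_mod.
by split; rewrite // /nongap e /l ?leq_addr // addKn mulKn ?(d_gt0 C).
Qed.
Lemma nongap_eq l: nongap l -> l = (pm (l %% d) + d * ((l - pm (l %% d)) %/ d))%N.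
 move=> h; rewrite mulnC divnK ?subnKC // -eqn_mod_dvd //. by rewrite pm_mod // lmod_lt.
Qed.
Lemma oo_wb l: nongap l -> oo (wb l) = - l%:Z.
 move=> h; rewrite dvM ?expf_neq0 ?x_unit ?m_unit // dvX // oo_x oo_mE. by rewrite [in RHS](nongap_eq h); lia.
Qed.
Lemma wb_neq0 l: wb l != 0.
 by apply: mulf_neq0; rewrite ?expf_neq0 ?x_unit ?m_unit. Qed.
Lemma inA_wb l: inA (wb l).
 by apply: inAM; [apply: inAX; apply: inA_x|apply: inA_m]. Qed.
Lemma crd_lin l u f g: inA f -> inA g -> crd l (f + cst C u * g) = crd l f + u * crd l g.
 by move=> Af Ag; rewrite /crd; case: ifP; rewrite ?mulr0 ?addr0 // rco_lin ?lmod_lt // coefD coefZ.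
Qed.
Lemma crd0 l: crd l 0 = 0.
 have := crd_lin l 1 (inA0 C) (inA0 C); rewrite mulr0 addr0 mul1r -{1}[crd l 0]addr0. by move/addrI/esym.
Qed.
Lemma crdZ l u f: inA f -> crd l (cst C u * f) = u * crd l f.
 by move=> Af; rewrite -[cst C u * f]add0r crd_lin ?crd0 ?add0r //; apply: inA0. Qed.
Lemma oo_ev_m r i: r != 0 -> oo (ev r * m i) = - (pm i + d * (size r).-1)%N%:Z.
 by move=> r0; rewrite dvM ?ev0 ?m_unit // oo_ev // oo_mE; lia. Qed.
Lemma vge_ooP f n: inA f -> vge oo (- n%:Z) f <-> forall l, (n < l)%N -> crd l f = 0.
 move=> Af; split=> [h l nl|h]. rewrite /crd; case: ifP => // ng; apply: nth_default; rewrite leqNgt; apply/negP => lt.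
have r0: rco f (l %% d) != 0 by rewrite -size_poly_gt0 (leq_ltn_trans _ lt).
have := oo_pr h (lmod_lt l); rewrite rcoP ?lmod_lt // vgeE ?evm_neq0 //.
rewrite oo_ev_m // lerN2 => le; move: nl; rewrite ltnNge; case/negP.
rewrite (nongap_eq ng); apply: leq_trans le; rewrite leq_add2l leq_mul2l.
by move: lt; move: (size _) (_ %/ _)%N; clear => s k; case: s => // s; rewrite ltnS => ->; rewrite orbT.
rewrite (rco_sum Af); apply: vge_sum => i _. have [->|r0] := eqVneq (rco f i) 0; first by rewrite evx0 mul0r vge0.
rewrite vgeE ?evm_neq0 // oo_ev_m // lerN2 lez_nat leqNgt; apply/negP => lt.
have [ng e1 e2] := nongapE (size (rco f i)).-1 (ltn_ord i).
have := h _ lt; rewrite /crd ng e2 e1 => /eqP; rewrite lead_coef_eq0. by rewrite (negPf r0).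
Qed.
Lemma crd_oo f n: inA f -> f != 0 -> oo f = - n%:Z -> crd n f != 0.
 move=> Af f0 e; apply/negP => /eqP c0. have h: vge oo (- n%:Z) f by rewrite vgeE // e. have [n0|n0] := posnP n.
have [u fu]: exists u, f = cst C u by apply: inA_const => //; rewrite n0 in h.
have u0: u != 0 by move: f0; rewrite fu fmorph_eq0. move: c0; rewrite n0 /crd /nongap mod0n /pm mul0n div0n fu.
have ->: cst C u = \sum_(j < d) ev (if j == 0%N :> nat then u%:P else 0) * m j.
rewrite (bigD1 (Ordinal (d_gt0 C))) //= m0 mulr1 evxC big1 ?addr0 // => j j0.
by rewrite ifN ?evx0 ?mul0r //; apply: contra j0 => /eqP e0; apply/eqP/val_inj.
rewrite (@rco_unique (fun j => if j == 0%N then u%:P else 0)) ?(d_gt0 C) //= coefC /= => u1. by rewrite u1 eqxx in u0.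
have : vge oo (- n.-1%:Z) f. apply/vge_ooP => // l; rewrite prednK // leq_eqVlt => /predU1P[<-//|].
exact: (proj1 (vge_ooP n Af) h). by rewrite vgeE // e; lia.
Qed.
Lemma crd_small f: inA f -> (forall l, crd l f = 0) -> f = 0.
 move=> Af h; apply: contrapT => /eqP f0; have h1 := oo_inA_le0 Af f0. have e: oo f = - `|oo f|%N%:Z by lia.
by have := crd_oo Af f0 e; rewrite h eqxx.
Qed.

Let U1 f := vge oo 1 (f - 1).
Let U1M f g: U1 f -> U1 g -> U1 (f * g).
 move=> hf hg; have [f0 vf] := sub1_unit ltr01 hf; have [g0 vg] := sub1_unit ltr01 hg.
have ->: U1 (f * g) = vge oo 1 (f * g - 1 * 1) by rewrite mulr1. by apply: vgeM_sub => //; rewrite ?vge1 // vgeE ?vf.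
Qed.
Let U1V f: U1 f -> U1 f^-1.
 move=> hf; have [f0 vf] := sub1_unit ltr01 hf; rewrite /U1. have ->: f^-1 - 1 = - ((f - 1) / f) by field.
by rewrite vgeN vge_div // vf.
Qed.
Let U1X f n: U1 f -> U1 (f ^+ n).
 by move=> h; elim: n => [|n IH]; rewrite /U1 ?subrr ?vge0 // exprS; apply: U1M. Qed.
(** By the equation x T^d = (x / (x - 1))^(d + 1 - a), and 1 / x vanishes at oo. *)
Lemma leading_monomials: [/\ U1 (x * T ^+ d), U1 ((x - 1) * T ^+ d) & U1 (y * T ^+ d.+1)].
 have h1: U1 ((x - 1) / x). rewrite /U1; have ->: (x - 1) / x - 1 = - x^-1 by field; apply: x_unit.
by rewrite vgeN vgeE ?invr_eq0 ?x_unit // dvV oo_x; have := d_gt0 C; lia. have hx: U1 (x * T ^+ d).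
have ->: x * T ^+ d = ((x - 1) / x)^-1 ^+ b. rewrite expr_div_n sc_eq exprVn expr_div_n mulrA -exprS.
have ->: x ^+ d.+1 = x ^+ a * x ^+ b by rewrite -exprD; congr (_ ^+ _); have := sc_a C; lia. field.
by rewrite !expf_neq0 ?x_unit ?x1_unit. exact/U1X/U1V. split=> //.
have ->: (x - 1) * T ^+ d = (x - 1) / x * (x * T ^+ d) by field; apply: x_unit. exact: U1M.
by have ->: y * T ^+ d.+1 = x * T ^+ d by rewrite exprS mulrA mulrCA mulfV // mulr1.
Qed.
Lemma pm_split i k: (pm i + d * k + d * (a * i %/ d) + d * (b * i %/ d) = d * k + d.+1 * i)%N.
 have := pm_le i; rewrite /pm [(d.+1 * i)%N]mulnC.
by move: (d * (a * i %/ d))%N (d * (b * i %/ d))%N (i * d.+1)%N (d * k)%N; clia.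
Qed.
Lemma wb_T l: nongap l -> vge oo 1 (wb l * T ^+ l - 1).
 move=> ng; have [h1 h2 h3] := leading_monomials; rewrite [X in T ^+ X](nongap_eq ng) /wb.
set i := (l %% d)%N; set k := (_ %/ d)%N; set A := (a * i %/ d)%N; set B := (b * i %/ d)%N.
have e1: m i * (x ^+ A * (x - 1) ^+ B) = y ^+ i. by rewrite divfK // mulf_neq0 ?expf_neq0 ?x_unit ?x1_unit.
set g := (x * T ^+ d) ^+ A * ((x - 1) * T ^+ d) ^+ B. have hg: U1 g by apply: U1M; apply: U1X.
have e: x ^+ k * m i * T ^+ (pm i + d * k) * g = (x * T ^+ d) ^+ k * (y * T ^+ d.+1) ^+ i.
have g1 (t: F) : (x * t ^+ d) ^+ k * (y * t ^+ d.+1) ^+ i = x ^+ k * y ^+ i * t ^+ (d * k + d.+1 * i).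
by rewrite !exprMn -!exprM exprD mulrACA.
have g2 (t u: F) : x ^+ k * u * t ^+ (pm i + d * k) * ((x * t ^+ d) ^+ A * ((x - 1) * t ^+ d) ^+ B) =
x ^+ k * (u * (x ^+ A * (x - 1) ^+ B)) * t ^+ (pm i + d * k + d * A + d * B). rewrite !exprMn -!exprM !exprD.
by clear => *; ring. rewrite g2 e1 g1; congr (_ * _ ^+ _). exact: pm_split. have [g0 _] := sub1_unit ltr01 hg.
have ->: x ^+ k * m i * T ^+ (pm i + d * k) = (x * T ^+ d) ^+ k * (y * T ^+ d.+1) ^+ i * g^-1. by rewrite -e mulfK.
by apply: U1M; [apply: U1M; apply: U1X|apply: U1V].
Qed.

(* The leading coefficient of a function regular off infinity, with respect to
   the uniformizer x/y. *)
Lemma crd_leading f n: inA f -> vge oo (- n%:Z) f -> vge oo 1 (f * T ^+ n - cst C (crd n f)).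
 move=> Af h; have t0 := T_unit C. have [ng|ng] := boolP (nongap n); last first.
have ->: crd n f = 0 by rewrite /crd (negPf ng).
rewrite rmorph0 subr0; have [->|f0] := eqVneq f 0; first by rewrite mul0r vge0. rewrite vgeE // dvM // dvX // oo_T.
have : oo f <> - n%:Z by move=> e; have := crd_oo Af f0 e; rewrite /crd (negPf ng) eqxx.
by move: h; rewrite vgeE //; lia. pose g := f + cst C (- crd n f) * wb n.
have Ag: inA g by apply: inAD => //; apply: inAM; [apply: inA_cst|apply: inA_wb]. have cw: crd n (wb n) = 1.
rewrite /crd ng; have ->: wb n = \sum_(j < d) ev (if j == (n %% d)%N :> nat then 'X^((n - pm (n %% d)) %/ d) else 0) * m j.
rewrite (bigD1 (Ordinal (lmod_lt n))) //= eqxx evxXn evxX big1 ?addr0 // => j j0.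
by rewrite ifN ?evx0 ?mul0r //; apply: contra j0 => /eqP e0; apply/eqP/val_inj.
rewrite (@rco_unique (fun j => if j == (n %% d)%N then 'X^((n - pm (n %% d)) %/ d) else 0)) ?lmod_lt //.
by rewrite eqxx coefXn eqxx. have cg: crd n g = 0. by rewrite crd_lin ?cw ?mulr1 ?subrr //; apply: inA_wb.
have vg: vge oo (- n%:Z) g. by apply: vgeD => //; apply: vgeM0; [apply: vge_cst|rewrite vgeE ?wb_neq0 // oo_wb].
have ->: f * T ^+ n - cst C (crd n f) = g * T ^+ n + cst C (crd n f) * (wb n * T ^+ n - 1).
by rewrite /g rmorphN; ring. apply: vgeD; last by apply: vgeM0; [apply: vge_cst|apply: wb_T].
have [->|g0] := eqVneq g 0; first by rewrite mul0r vge0. rewrite vgeE // dvM // dvX // oo_T.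
have : oo g <> - n%:Z by move=> e; have := crd_oo Ag g0 e; rewrite cg eqxx. by move: vg; rewrite vgeE //; lia.
Qed.
Lemma cst_small u: vge oo 1 (cst C u) -> u = 0.
 by apply: contraTeq => u0; rewrite vgeE // pv_cst.
Qed.
Lemma crd0_cst u: crd 0 (cst C u) = u.
 have c1 := @crd_leading (cst C u) 0 (inA_cst C u) (vge_cst oo u). apply/eqP; rewrite -subr_eq0; apply/eqP/cst_small.
by rewrite rmorphB vge_subC -[X in X - _]mulr1.
Qed.
Lemma crdM f g n k: inA f -> inA g -> vge oo (- n%:Z) f -> vge oo (- k%:Z) g ->
 crd (n + k) (f * g) = crd n f * crd k g.
 move=> Af Ag hf hg; have h1 := crd_leading Af hf; have h2 := crd_leading Ag hg.
have h3: vge oo (- (n + k)%N%:Z) (f * g) by rewrite PoszD opprD; apply: vgeM.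
have := crd_leading (inAM Af Ag) h3; move=> h4. apply/eqP; rewrite -subr_eq0; apply/eqP/cst_small.
rewrite rmorphB rmorphM; rewrite vge_subC; apply: (@vge_trans _ _ _ _ (f * g * T ^+ (n + k))) => //.
rewrite exprD mulrACA vge_subC; apply: vgeM_sub => //; last exact: vge_cst.
have t0 := T_unit C; have ->: 0 = - n%:Z + n%:Z by rewrite addNr.
by apply: vgeM => //; rewrite vgeE // dvX // oo_T; lia.
Qed.

End Coordinates.
End Crd.
Export Crd.

(** * The Gauss norm on A and on F *)

Section Gauss.
Variables (d a: nat) (K F: fieldType) (C: scurve d a K F) (v: dval K).
Notation x := (cx C).
Notation ev := (evx (cst C) x).
Notation m := (m C).
Notation inA := (inA C).
Notation oo := (oo C).
Notation crd := (crd C).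
Notation cst := (cst C).
Implicit Types (f g: F) (c q r: {poly K}) (n k: int).

Definition vp n r := forall i, vge v n r`_i.

Lemma vpD n r c: vp n r -> vp n c -> vp n (r + c).
 by move=> h h' i; rewrite coefD vgeD. Qed.
Lemma vpM n k r c: vp n r -> vp k c -> vp (n + k) (r * c).
 by move=> h h' i; rewrite coefM; apply: vge_sum => j _; apply: vgeM. Qed.
Lemma vp1: vp 0 1. Proof. by move=> i; rewrite coef1; case: eqP; rewrite ?vge1 ?vge0. Qed.
Lemma vpX: vp 0 'X. Proof. by move=> i; rewrite coefX; case: eqP; rewrite ?vge1 ?vge0. Qed.
Lemma vpX1: vp 0 ('X - 1).
 by move=> i; rewrite coefB vgeB //; [apply: vpX|apply: vp1]. Qed.
Lemma vpXn r i: vp 0 r -> vp 0 (r ^+ i).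
 by move=> h; elim: i => [|i IH]; [exact: vp1|rewrite exprS -[0]addr0; apply: vpM]. Qed.
Lemma vp0 n: vp n 0. Proof. by move=> i; rewrite coef0 vge0. Qed.

Definition vA n f := exists2 r : nat -> {poly K}, (forall i, vp n (r i)) &
 f = \sum_(i < d) ev (r i) * m i.

Lemma vA_inA n f: vA n f -> inA f. Proof. by move=> [r _ ->]; exists r. Qed.
Lemma vA0 n: vA n 0.
 by exists (fun=> 0) => [i|]; [exact: vp0|rewrite big1 // => i _; rewrite evx0 mul0r]. Qed.
Lemma vAD n f g: vA n f -> vA n g -> vA n (f + g).
 move=> [r hr ->] [s hs ->]; exists (fun i => r i + s i) => [i|]; first exact: vpD.
by rewrite -big_split; apply: eq_bigr => i _; rewrite evxD mulrDl.
Qed.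
Lemma vA_sum n (I: Type) (s: seq I) (P: pred I) (G: I -> F) :
 (forall i, P i -> vA n (G i)) -> vA n (\sum_(i <- s | P i) G i).
 by move=> h; elim/big_ind: _ => //; [exact: vA0|exact: vAD]. Qed.
Lemma vA_ev n k r f: vp n r -> vA k f -> vA (n + k) (ev r * f).
 move=> hr [s hs ->]; exists (fun i => r * s i) => [i|]; first exact: vpM.
by rewrite mulr_sumr; apply: eq_bigr => i _; rewrite evxM mulrA.
Qed.
Lemma vA_m i: vA 0 (m i).
 rewrite m_mod; exists (fun j => if j == (i %% d)%N then 1 else 0) => [j|]. by case: eqP => _; [exact: vp1|exact: vp0].
rewrite (bigD1 (Ordinal (lmod_lt C i))) //= eqxx evx1 mul1r big1 ?addr0 // => j /eqP ji.
by rewrite ifN ?evx0 ?mul0r //; apply: contra_not_neq ji => e; apply: val_inj.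
Qed.
Lemma vAM n k f g: vA n f -> vA k g -> vA (n + k) (f * g).
 move=> [r hr ->] [s hs ->]; rewrite mulr_suml; apply: vA_sum => i _.
rewrite mulr_sumr; apply: vA_sum => j _; rewrite mulrACA -evxM -[n + k]addr0. apply: vA_ev; first exact: vpM.
have [e [e' ->]] := mM C i j; rewrite x1E -{1}(evxX cst x) -!evxXn -evxM -[0]addr0. apply: vA_ev; last exact: vA_m.
by rewrite -[0]addr0; apply: vpM; apply: vpXn; [exact: vpX|exact: vpX1].
Qed.
Lemma vA1: vA 0 1. Proof. by rewrite -(m0 C); apply: vA_m. Qed.
Lemma vA_cst n u: vge v n u -> vA n (cst u).
 move=> h; rewrite -[cst u]mulr1 -(evxC cst x) -[n]addr0; apply: vA_ev; last exact: vA1.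
by move=> i; rewrite coefC; case: ifP; rewrite ?vge0.
Qed.
Lemma vAB n f g: vA n f -> vA n g -> vA n (f - g).
 move=> hf hg; apply: vAD => //; rewrite -mulN1r -(rmorph1 cst) -rmorphN -[n]add0r.
by apply: vAM => //; apply: vA_cst; rewrite vgeN vge1.
Qed.
Lemma vAW n k f: n <= k -> vA k f -> vA n f.
 by move=> le [r hr ->]; exists r => // i j; apply: vgeW le _; apply: hr. Qed.
Lemma vA_scale n u f: u != 0 -> vA n f -> vA (v u + n) (cst u * f).
 by move=> u0 h; apply: vAM => //; apply: vA_cst; rewrite vgeE. Qed.
Lemma vA_crd n f: vA n f <-> inA f /\ forall l, vge v n (crd l f).
 split=> [[r hr ->]|[Af h]]. split=> [|l]; first by exists r.
by rewrite /Crd.crd; case: ifP => _; rewrite ?vge0 // rco_unique ?(lmod_lt C) //; apply: hr.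
exists (fun i => if (i < d)%N then rco C f i else 0) => [i|]. case: ifP => lt j; last by rewrite coef0 vge0.
have [ng e1 e2] := nongapE C j lt. by have := h (pm d a i + d * j)%N; rewrite /Crd.crd ng e2 e1.
by rewrite {1}(rco_sum Af); apply: eq_bigr => i _; rewrite ltn_ord.
Qed.

Definition prim f := vA 0 f /\ ~ vA 1 f.

Lemma prim_neq0 f: prim f -> f != 0.
 by move=> [_ h]; apply: contra_not_neq h => ->; apply: vA0. Qed.

(* Up to multiples of the uniformizer a primitive function has a leading
   coefficient that is a unit. *)
Lemma prim_leading f: prim f -> exists g (n: nat), [/\ vA 0 g, vA 1 (f - g), vge oo (- n%:Z) g & ~~ vge v 1 (crd n g)].
 move=> [[r hr ef] h1]; pose t c := \poly_(i < size c) if vge v 1 c`_i then 0 else c`_i.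
have tE c i: (t c)`_i = if vge v 1 c`_i then 0 else c`_i.
by rewrite coef_poly; case: ltnP => // le; rewrite nth_default // vge0. pose g := \sum_(i < d) ev (t (r i)) * m i.
have gA: inA g by exists (fun i => t (r i)).
have vg: vA 0 g by exists (fun i => t (r i)) => // i j; rewrite tE; case: ifP; rewrite ?vge0 // => _; apply: hr.
have vfg: vA 1 (f - g). rewrite ef -sumrB; exists (fun i => r i - t (r i)).
by move=> i j; rewrite coefB tE; case: ifP => h; rewrite ?subr0 // subrr vge0.
by apply: eq_bigr => i _; rewrite evxB mulrBl. have g0: g != 0.
by apply: contra_not_neq h1 => g0; move: vfg; rewrite g0 subr0. exists g, `|oo g|%N; have le := oo_inA_le0 gA g0.
have e: oo g = - `|oo g|%N%:Z by move: le; clia. split=> //; first by rewrite vgeE // -e.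
have := crd_oo gA g0 e; rewrite /Crd.crd; case: ifP; rewrite ?eqxx // => _.
rewrite /g (rco_unique C (fun i => t (r i))) ?(lmod_lt C) // tE. by case: ifP; rewrite ?eqxx // => ->.
Qed.
(** Gauss's lemma. After the coefficients divisible by the uniformizer are discarded, the leading
    coefficients at oo are units, and by [crdM] their product is a coefficient of the product. *)
Lemma primM f g: prim f -> prim g -> prim (f * g).
 move=> pf pg; split; first by rewrite -[0]addr0; apply: vAM; [case: pf|case: pg].
have [f' [n [vf' ff' hf uf]]] := prim_leading pf; have [g' [k [vg' gg' hg ug]]] := prim_leading pg.
have [f0 _] := pf; have [g0 _] := pg; move=> h. have /vA_crd[_ /(_ (n + k)%N)]: vA 1 (f' * g').
have ->: f' * g' = f * g - ((f - f') * g + f' * (g - g')) by ring.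
apply: vAB => //; apply: vAD; first by rewrite -[1]addr0; apply: vAM. by rewrite -[1]add0r; apply: vAM.
rewrite crdM //; [|exact: vA_inA vf'|exact: vA_inA vg']. have /vA_crd[_ /(_ n)] := vf'; have /vA_crd[_ /(_ k)] := vg'.
have nz u: ~~ vge v 1 u -> u != 0 by apply: contraNneq => ->; apply: vge0.
have [n1 n2] := (nz _ uf, nz _ ug); move: uf ug. by rewrite !vgeE // dvM //; clia.
Qed.
Lemma exists_prim f: inA f -> f != 0 -> exists u, [/\ u != 0 & prim (cst u * f)].
 move=> Af f0; have [t t0 vt] := dv_surj v.
pose B := (\sum_(i < d) \sum_(j < size (rco C f i)) absz (v (rco C f i)`_j)%R)%N. have low: vA (- B%:Z) f.
exists (fun i => if (i < d)%N then rco C f i else 0) => [i j|]; last first.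
by rewrite {1}(rco_sum Af); apply: eq_bigr => i _; rewrite ltn_ord. case: ifP => lt; last by rewrite coef0 vge0.
have [sj|js] := leqP (size (rco C f i)) j; first by rewrite nth_default ?vge0.
have [->|c0] := eqVneq (rco C f i)`_j 0; first exact: vge0. have : (absz (v ((rco C f i)`_j)%R) <= B)%N.
rewrite /B (bigD1 (Ordinal lt)) //= (bigD1 (Ordinal js)) //= -addnA. exact: leq_addr. by rewrite vgeE //; clia.
have [n hn]: exists n : nat, ~ vA (n%:Z - B%:Z) f.
have le := oo_inA_le0 Af f0; have e: oo f = - `|oo f|%N%:Z by move: le; clia.
have c0 := crd_oo Af f0 e; exists (`|v (crd `|oo f| f)| + B).+1 => /vA_crd[_ /(_ `|oo f|%N)].
by rewrite vgeE //; clia. have ex: exists n : nat, `[< ~ vA (n%:Z - B%:Z) f >] by exists n; apply/asboolP.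
case: (ex_minnP ex) => k /asboolP hk kmin. have k0: (0 < k)%N.
by rewrite lt0n; apply/eqP => k0; apply: hk; rewrite k0 sub0r. have hk1: vA (k.-1%:Z - B%:Z) f.
apply: contrapT => h; have := kmin k.-1 (asboolT h); rewrite leqNgt. by rewrite prednK // leqnn.
pose e : int := B%:Z - k.-1%:Z; have te: t ^ e != 0 by rewrite expfz_neq0.
have vte: v (t ^ e) = e by rewrite dvXz // vt mulr1. exists (t ^ e); split=> //; split.
by have := vA_scale te hk1; rewrite vte; congr (vA _ _); rewrite /e; clia.
move=> h; apply: hk; have := @vA_scale _ (t ^ (- e)) _ (expfz_neq0 _ t0) h.
rewrite dvXz // vt mulr1 mulrA -rmorphM -expfzDr // addNr expr0z rmorph1 mul1r.
by congr (vA _ _); rewrite /e; move: k0; clia.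
Qed.
Lemma exists_gauss: exists w : dval F, forall f, inA f -> forall n, vge w n f <-> vA n f.
 (* [G f n] says that f has Gauss valuation n. Existence follows from [exists_prim] for numerator
    and denominator, uniqueness from Gauss's lemma. *)
 have [t t0 vt] := dv_surj v. pose G f n := exists (b c: F), [/\ prim b, prim c & f = cst t ^ n * b / c].
have GE f: f != 0 -> exists n, G f n. move=> f0; have [w [c c0 [Aw ef]]] := fracA C f.
have w0: w != 0 by apply: contraNneq f0 => w0; rewrite ef w0 mul0r. have ec: ev c != 0 by rewrite ev0.
have [u [u0 pu]] := exists_prim Aw w0; have [u' [u'0 pu']] := exists_prim (inA_ev C c) ec.
have unit s: s != 0 -> v s = 0 -> forall g, prim g -> prim (cst s * g).
move=> s0 vs g [h1 h2]; split; first by have := vA_scale s0 h1; rewrite vs.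
move=> h; apply: h2; have := @vA_scale _ s^-1 _ _ h; rewrite invr_eq0 dvV vs => /(_ s0).
by rewrite mulrA -rmorphM mulVf // rmorph1 mul1r.
pose n := v (u' / u); exists n; exists (cst (u' / u / t ^ n) * (cst u * w)), (cst u' * ev c).
have tn: t ^ n != 0 by []. split=> //; first apply: unit => //. by rewrite dv_div // dvXz // vt mulr1 subrr.
rewrite ef !rmorphM !fmorphV -fmorphXz; field. by rewrite !fmorph_eq0 tn u0 u'0 ec.
have Gle f n k: G f n -> G f k -> n <= k.
move=> [b [c [pb pc e]]] [b' [c' [pb' pc' e']]]; rewrite leNgt; apply/negP => lt.
have [b0 c0 b'0 c'0] := And4 (prim_neq0 pb) (prim_neq0 pc) (prim_neq0 pb') (prim_neq0 pc').
have [_ []] := primM pb' pc. have ->: b' * c = cst t ^+ `|n - k|.-1 * (cst t * (b * c')).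
have tk: cst t ^ k != 0 by []. have eL: cst t ^ k * (b' * c) = f * c' * c.
by rewrite mulrA; congr (_ * _); rewrite e' divfK. have eR: cst t ^ n = cst t ^+ `|n - k|.-1 * cst t * cst t ^ k.
rewrite -exprSr exprnP -expfzDr //; congr (_ ^ _); move: lt; clia. apply: (mulfI tk); rewrite eL e eR. by field.
rewrite -[1]add0r; apply: vAM. by rewrite -rmorphXn; apply: vA_cst; apply: vge0X; rewrite vgeE // vt.
rewrite -[1]addr0; apply: vAM; first by apply: vA_cst; rewrite vgeE // vt.
by rewrite -[0]addr0; apply: vAM; [case: pb|case: pc'].
pose o f : int := if pselect (f != 0) is left f0 then projT1 (cid (GE f f0)) else 0. have oP f: f != 0 -> G f (o f).
by move=> f0; rewrite /o; case: pselect => // f0'; case: (cid _). have oE f n: f != 0 -> G f n -> o f = n.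
by move=> f0 h; apply/eqP; rewrite eq_le (Gle _ _ _ (oP f f0) h) (Gle _ _ _ h (oP f f0)).
have o0: o 0 = 0 by rewrite /o; case: pselect => // n0; exfalso; move: n0; rewrite eqxx.
have oM f g: f != 0 -> g != 0 -> o (f * g) = o f + o g. move=> f0 g0; apply: oE; first by rewrite mulf_neq0.
have [b [c [pb pc e]]] := oP f f0; have [b' [c' [pb' pc' e']]] := oP g g0.
exists (b * b'), (c * c'); split; [exact: primM|exact: primM|].
by rewrite {1}e {1}e' expfzDr //; field; rewrite !prim_neq0. have vA_o f n: inA f -> f != 0 -> n <= o f <-> vA n f.
move=> Af f0; have [b [c [pb pc e]]] := oP f f0; have [u [u0 pu]] := exists_prim Af f0. have oo_: o f = - v u.
apply: oE => //; pose n' := - v u; have tn: t ^ n' != 0 by rewrite expfz_neq0. have s0: (u * t ^ n')^-1 != 0 by [].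
have vs: v (u * t ^ n')^-1 = 0 by rewrite dvV dvM // dvXz // vt /n'; clia. have h1: prim 1. split; first exact: vA1.
by move=> /vA_crd[_ /(_ 0%N)]; rewrite -(rmorph1 cst) crd0_cst vgeE ?oner_neq0 // dv1.
exists (cst (u * t ^ n')^-1 * (cst u * f)), 1; split=> //.
split; first by case: pu => hu _; have := vA_scale s0 hu; rewrite vs. case: pu => _ hu h; apply: hu.
have s1: u * t ^ n' != 0 by []. have := @vA_scale _ (u * t ^ n') _ s1 h; move: vs; rewrite dvV => /eqP.
rewrite oppr_eq0 => /eqP->; rewrite mulrA -rmorphM mulfV // rmorph1 mul1r add0r //.
rewrite fmorphV rmorphM -fmorphXz divr1; field. by rewrite !fmorph_eq0 tn u0. rewrite oo_; split=> [le|h].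
have := @vA_scale _ u^-1 _ _ pu.1; rewrite invr_eq0 dvV addr0 => /(_ u0).
by rewrite mulrA -rmorphM mulVf // rmorph1 mul1r; apply: vAW. rewrite leNgt; apply/negP => lt; case: pu => _; apply.
by apply: vAW (vA_scale u0 h); move: lt; clia.
have oD f g: f != 0 -> g != 0 -> f + g != 0 -> Num.min (o f) (o g) <= o (f + g). move=> f0 g0 fg0.
have [b [c [pb pc e]]] := oP f f0; have [b' [c' [pb' pc' e']]] := oP g g0.
have [b0 c0 b'0 c'0] := And4 (prim_neq0 pb) (prim_neq0 pc) (prim_neq0 pb') (prim_neq0 pc').
have cc: c * c' != 0 by []. have tz (k: int) : vA k (cst t ^ k).
have ->: cst t ^ k = cst (t ^ k) by rewrite fmorphXz. by apply: vA_cst; rewrite vgeE // dvXz // vt mulr1.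
have h1: vA (o f) (f * (c * c')). have ->: f * (c * c') = cst t ^ o f * (b * c') by rewrite {1}e; field.
rewrite -[X in vA X _]addr0; apply: vAM => //; rewrite -[0]addr0. by apply: vAM; [case: pb|case: pc'].
have h2: vA (o g) (g * (c * c')). have ->: g * (c * c') = cst t ^ o g * (b' * c) by rewrite {1}e'; field.
rewrite -[X in vA X _]addr0; apply: vAM => //; rewrite -[0]addr0. by apply: vAM; [case: pb'|case: pc].
have occ: o (c * c') = 0. have pcc := primM pc pc'; have Acc := vA_inA pcc.1; apply/eqP; rewrite eq_le.
apply/andP; split; last by apply/vA_o => //; case: pcc.
rewrite leNgt; apply/negP => lt; case: pcc => _; apply; apply/vA_o => //.
have := oM _ _ fg0 cc; rewrite occ addr0 => <-. have h: vA (Num.min (o f) (o g)) ((f + g) * (c * c')).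
by rewrite mulrDl; apply: vAD; [apply: vAW h1|apply: vAW h2]; rewrite ge_min lexx ?orbT.
apply/vA_o => //; exact: vA_inA h. have oS: exists2 s, s != 0 & o s = 1.
exists (cst t) => //; have At := inA_cst C t; apply/eqP; rewrite eq_le; apply/andP; split.
rewrite leNgt; apply/negP => lt; have : vA 2 (cst t) by apply/vA_o.
by move=> /vA_crd[_ /(_ 0%N)]; rewrite crd0_cst vgeE // vt. by apply/vA_o => //; apply: vA_cst; rewrite vgeE // vt.
exists (@Dval F o o0 oM oD oS) => f Af n. have [->|f0] := eqVneq f 0; first by rewrite vge0; split=> // _; apply: vA0.
by rewrite vgeE //; apply: vA_o.
Qed.

End Gauss.

(** * The reduced curve in the residue field of the Gauss norm *)

Section MakeMorphism.
Variables (R S: nzRingType) (f: R -> S).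
Hypotheses (f1: f 1 = 1) (fD: {morph f: u w / u + w}) (fM: {morph f: u w / u * w}).

Fact make_sub: {morph f: u w / u - w}.
 by move=> u w; apply: (addIr (f w)); rewrite -fD !subrK.
Qed.

Definition as_rmorph: R -> S := f.
HB.instance Definition _ := GRing.isZmodMorphism.Build R S as_rmorph make_sub.
HB.instance Definition _ := GRing.isMonoidMorphism.Build R S as_rmorph (conj f1 fM).

Definition make_rmorph: {rmorphism R -> S} := as_rmorph.
End MakeMorphism.

Section Reduction.
Variables (d a: nat) (K F: fieldType) (C: scurve d a K F) (v: dval K) (w: dval F).
Notation x := (cx C).
Notation y := (cy C).
Notation ev := (evx (cst C) x).
Notation m := (m C).
Notation inA := (inA C).
Implicit Types (f g: F) (c q r: {poly K}) (n k: int).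

(* w is the Gauss extension of v, and B is the reduction of the curve C. *)
Record reduction (B: scurve d a (resf v) (resf w)) := Reduction {
 rd_gauss : forall f, inA f -> forall n, vge w n f <-> vA C v n f;
 rd_d : v d%:R = 0;
 rd_cst : forall u, vge v 0 u -> cst B (rd v u) = rd w (cst C u);
 rd_x : cx B = rd w x;
 rd_y : cy B = rd w y;
 rd_del : forall f, vge w 0 f -> del B (rd w f) = rd w (del C f);
 rd_zet : zet B = rd v (zet C) }.

Section Build.
Hypothesis (hw: forall f, inA f -> forall n, vge w n f <-> vA C v n f) (vd: v d%:R = 0).

Lemma gauss_cst n u: vge w n (cst C u) = vge v n u.
 apply/idP/idP => [/(hw (inA_cst C u) n)/vA_crd[_ /(_ 0%N)]|h]; last first.
by apply/hw; [apply: inA_cst|apply: vA_cst]. by rewrite crd0_cst.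
Qed.
Lemma gauss_m i: vge w 0 (m i).
 by apply/hw; [apply: inA_m|apply: vA_m]. Qed.
Lemma gauss_x: vge w 0 x.
 by rewrite -(evxX (cst C) x) -[ev _]mulr1; apply/hw; [apply: inA_evM (inA1 _)|rewrite -[0]addr0; apply: vA_ev; [apply: vpX|apply: vA1]]. Qed.
Lemma gauss_y: vge w 0 y. Proof. by rewrite -m1 gauss_m. Qed.
Lemma gauss_ev r: vp v 0 r -> vge w 0 (ev r).
 by move=> h; rewrite -[ev r]mulr1; apply/hw; [apply: inA_evM (inA1 _)|rewrite -[0]addr0; apply: vA_ev h (vA1 _ _)]. Qed.
Lemma gauss_ev1 r: vge w 1 (ev r) -> vp v 1 r.
 move=> /(hw (inA_ev C r) 1) [s hs e] i. suff -> : r = s 0%N by apply: hs.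
have := rco_unique C s (d_gt0 C); rewrite -e => <-.
have ->: ev r = \sum_(j < d) ev (if j == 0%N :> nat then r else 0) * m j.
rewrite (bigD1 (Ordinal (d_gt0 C))) //= m0 mulr1 big1 ?addr0 // => j j0.
by rewrite ifN ?evx0 ?mul0r //; apply: contra j0 => /eqP e0; apply/eqP/val_inj.
by rewrite (rco_unique C (fun j => if j == 0%N then r else 0)) ?(d_gt0 C).
Qed.
Lemma gauss_zet: v (zet C) = 0.
 have z0: zet C != 0 by rewrite -(fmorph_eq0 (cst C)) z_unit.
have := congr1 v (prim_expr_order (sc_zet C)); rewrite dvX // dv1 => /eqP.
by rewrite mulf_eq0 eqz_nat eqn0Ngt (d_gt0 C) => /eqP.
Qed.
(** delta multiplies the coefficient of [m i] by the unit zeta^i, so it does not lower valuations on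
    A; having finite order, it preserves them. *)
Lemma gauss_del n f: vge w n (del C f) = vge w n f.
 have A1 g: inA g -> vge w n g -> vge w n (del C g). move=> Ag /(hw Ag n)[r hr e]; apply/hw; first exact: inA_del.
rewrite e rmorph_sum; apply: vA_sum => i _; rewrite rmorphM del_ev del_m mulrCA -rmorphXn.
rewrite -[n]add0r; apply: vAM; first by apply: vA_cst; rewrite vge0X // vgeE ?gauss_zet // -(fmorph_eq0 (cst C)) z_unit.
by rewrite -[n]addr0; apply: vA_ev; [apply: hr|apply: vA_m]. have A2 g: inA g -> g != 0 -> w (del C g) = w g.
move=> Ag g0; have dg (k: nat) : dj C k g != 0 by []. have mono (k j: nat) : w (dj C k g) <= w (dj C (k + j) g).
elim: j => [|j IH]; first by rewrite addn0. apply: le_trans IH _; rewrite addnS djS; set h := dj C _ g.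
have h0: h != 0 by rewrite fmorph_eq0. have Ah: inA h by apply: inA_dj.
have A3 (l: int) : vge w l h -> vge w l (del C h). move=> /(hw Ah l)[r hr e]; apply/hw; first exact: inA_del.
rewrite e rmorph_sum; apply: vA_sum => i _; rewrite rmorphM del_ev del_m mulrCA -rmorphXn.
rewrite -[l]add0r; apply: vAM; first by apply: vA_cst; rewrite vge0X // vgeE ?gauss_zet // -(fmorph_eq0 (cst C)) z_unit.
by rewrite -[l]addr0; apply: vA_ev; [apply: hr|apply: vA_m]. by have := A3 (w h); rewrite !vgeE // lexx => /(_ isT).
apply/eqP; rewrite eq_le; have h1 := mono 0%N 1%N; have h2 := mono 1%N d.-1.
have d1: (1 + d.-1 = d)%N by rewrite add1n prednK ?(d_gt0 C). by rewrite d1 dj_d in h2; rewrite h1 h2.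
rewrite /vge fmorph_eq0; have [//|f0] := eqVneq f 0; rewrite /=.
have [u [c c0 [Au e]]] := fracA C f; have ec: ev c != 0 by rewrite ev0.
have u0: u != 0 by apply: contraNneq f0 => u0; rewrite e u0 mul0r. by rewrite e fmorph_div del_ev !dv_div // A2.
Qed.
Fact cstb_1: rd w (cst C (res_val (1 : resf v))) = 1.
 have h := @res_valP K v 1 (vge1 v); rewrite -[RHS](rd1 w).
by apply/rd_eqP; rewrite ?vge1 // ?gauss_cst ?vge_res // -(rmorph1 (cst C)) -rmorphB gauss_cst.
Qed.
Fact cstb_D: {morph (fun u: resf v => rd w (cst C (res_val u))) : s t / s + t}.
 move=> s t /=; rewrite -rdD ?gauss_cst ?vge_res // -rmorphD.
have hst: vge v 0 (res_val s + res_val t) by rewrite vgeD ?vge_res.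
apply/rd_eqP; rewrite ?gauss_cst ?vge_res // -rmorphB gauss_cst. by apply/rd_eqP; rewrite ?vge_res // // !rdK.
Qed.
Fact cstb_M: {morph (fun u: resf v => rd w (cst C (res_val u))) : s t / s * t}.
 move=> s t /=; rewrite -rdM ?gauss_cst ?vge_res // -rmorphM.
have hst: vge v 0 (res_val s * res_val t) by rewrite vgeM0 ?vge_res.
apply/rd_eqP; rewrite ?gauss_cst ?vge_res // -rmorphB gauss_cst. by apply/rd_eqP; rewrite ?vge_res // // !rdK.
Qed.
Definition cstb: {rmorphism resf v -> resf w} := make_rmorph cstb_1 cstb_D cstb_M.
Lemma cstb_rd u: vge v 0 u -> cstb (rd v u) = rd w (cst C u).
 move=> hu; apply/rd_eqP; rewrite ?gauss_cst ?vge_res // -rmorphB gauss_cst. exact: res_valP.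
Qed.
Fact delb_1: rd w (del C (res_val (1 : resf w))) = 1.
 have h := @res_valP F w 1 (vge1 w); rewrite -[RHS](rd1 w).
by apply/rd_eqP; rewrite ?vge1 // ?gauss_del ?vge_res // -(rmorph1 (del C)) -rmorphB gauss_del.
Qed.
Fact delb_D: {morph (fun u: resf w => rd w (del C (res_val u))) : s t / s + t}.
 move=> s t /=; rewrite -rdD ?gauss_del ?vge_res // -rmorphD.
have hst: vge w 0 (res_val s + res_val t) by rewrite vgeD ?vge_res.
apply/rd_eqP; rewrite ?gauss_del ?vge_res // -rmorphB gauss_del. by apply/rd_eqP; rewrite ?vge_res // // !rdK.
Qed.
Fact delb_M: {morph (fun u: resf w => rd w (del C (res_val u))) : s t / s * t}.
 move=> s t /=; rewrite -rdM ?gauss_del ?vge_res // -rmorphM.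
have hst: vge w 0 (res_val s * res_val t) by rewrite vgeM0 ?vge_res.
apply/rd_eqP; rewrite ?gauss_del ?vge_res // -rmorphB gauss_del. by apply/rd_eqP; rewrite ?vge_res // // !rdK.
Qed.
Definition delb: {rmorphism resf w -> resf w} := make_rmorph delb_1 delb_D delb_M.
Lemma delb_rd f: vge w 0 f -> delb (rd w f) = rd w (del C f).
 move=> hf; apply/rd_eqP; rewrite ?gauss_del ?vge_res // -rmorphB gauss_del. exact: res_valP.
Qed.
Lemma lift_poly (c: {poly resf v}) : exists r, [/\ vp v 0 r, (forall i, rd v r`_i = c`_i),
 (forall i, c`_i = 0 -> r`_i = 0) & size r = size c].
 pose l (u: resf v) := if u == 0 then 0 else res_val u. have lP u: vge v 0 (l u) /\ rd v (l u) = u.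
by rewrite /l; case: eqP => [->|_]; rewrite ?vge0 ?vge_res ?rdK.
have l0 u: l u = 0 -> u = 0 by move=> e; rewrite -[u](lP u).2 e.
exists (\poly_(i < size c) l c`_i); split=> [i|i|i|].
- by rewrite coef_poly; case: ifP; rewrite ?vge0 => _; case: (lP c`_i).
- by rewrite coef_poly; case: ltnP => [_|h]; [case: (lP c`_i)|rewrite nth_default].
- by rewrite coef_poly => ->; rewrite /l eqxx if_same.
- have [->|c0] := eqVneq c 0; first by rewrite size_poly0; apply/eqP; rewrite -leqn0 size_poly.
rewrite size_poly_eq //; apply: contra c0 => /eqP/l0 e. by rewrite -lead_coef_eq0 lead_coefE e.
Qed.
Lemma rd_evE r (c: {poly resf v}) : vp v 0 r -> (forall i, rd v r`_i = c`_i) ->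
 rd w (ev r) = evx cstb (rd w x) c.
 move=> hr hc; have hx := gauss_x; have sc: (size c <= size r)%N.
rewrite leqNgt; apply/negP => lt; have /eqP := hc (size c).-1. rewrite nth_default; last by move: lt; case: (size c).
rewrite eq_sym lead_coef_eq0 => /eqP c0. by move: lt; rewrite c0 size_poly0.
rewrite (evx_coef (cst C)) rd_sum; last first. by move=> i _; rewrite vgeM0 ?vge0X // gauss_cst.
rewrite evx_coef (big_ord_widen _ (fun i => cstb c`_i * rd w x ^+ i) sc) [RHS]big_mkcond.
apply: eq_bigr => i _; rewrite rdM ?vge0X ?gauss_cst // rdX // -cstb_rd // hc.
by case: ltnP => // h; rewrite nth_default // rmorph0 mul0r.
Qed.
(** The residue field of the Gauss norm is generated by the reductions of x and y over the residue
    field of K, with the same equation; as B is again an [scurve], all the preceding theory applies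
    to it. *)
Lemma exists_reduction: exists B, reduction B.
 have zv: vge v 0 (zet C) by rewrite vgeE ?gauss_zet // -(fmorph_eq0 (cst C)) z_unit.
have hx := gauss_x; have hy := gauss_y; have hx1: vge w 0 (x - 1) by rewrite vgeB ?vge1.
have vdb: (d%:R : resf v) != 0. have e: rd v d%:R = d%:R. elim: (d) => [//|k IH]; rewrite !mulrS rdD ?vge1 ?IH //.
by elim: (k) => [|j]; rewrite ?vge0 // mulrS => h; rewrite vgeD ?vge1.
have d0: (d%:R : K) != 0 by rewrite -(fmorph_eq0 (cst C)) rmorph_nat (d_unit C). by rewrite -e rd_eq0 vgeE // vd.
have zb: d.-primitive_root (rd v (zet C)).
have zd: rd v (zet C) ^+ d = 1 by rewrite -rdX // (prim_expr_order (sc_zet C)).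
have [k hk kd] := prim_order_exists (d_gt0 C) zd.
have /primeP[_ /(_ k kd)/orP[/eqP k1|/eqP e]] := sc_prime C; last by rewrite e in hk.
have z1: rd v (zet C) = 1 by have := prim_expr_order hk; rewrite k1 expr1.
(* If zeta reduced to 1, the vanishing sum of its powers would reduce to d, which is a unit. *)
case/eqP: vdb; have : \sum_(j < d) zet C ^+ j = 0. have n1: zet C != 1.
apply/eqP => e; have := sc_zet C; rewrite e => h; have := eq_prim_root_expr h 1 0.
rewrite expr1n eqxx => /esym; have := sc_a C; rewrite eqn_mod_dvd // subn0 dvdn1; clia.
apply: (mulfI (_: zet C - 1 != 0)); first by rewrite subr_eq0.
by rewrite mulr0 -subrX1 (prim_expr_order (sc_zet C)) subrr.
move/(congr1 (rd v)); rewrite rd_sum => [|j _]; last exact: vge0X. under eq_bigr do rewrite rdX // z1 expr1n.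
by rewrite sumr_const card_ord. have trans: forall c : {poly resf v}, evx cstb (rd w x) c = 0 -> c = 0.
move=> c; have [r [hr rc _ _]] := lift_poly c; rewrite -(rd_evE hr rc) => /eqP.
rewrite rd_eq0 ?gauss_ev // => /gauss_ev1 h; apply/polyP => i; rewrite coef0 -rc. by apply/eqP; rewrite rd_eq0.
have eqb: rd w y ^+ d = rd w x ^+ a * (rd w x - 1) ^+ (d + 1 - a).
by rewrite -rdX // sc_eq rdM ?vge0X // !rdX // rdB ?vge1.
have gen: forall f : resf w, exists s : nat -> {poly resf v}, exists2 c, c != 0 &
f * evx cstb (rd w x) c = \sum_(i < d) evx cstb (rd w x) (s i) * rd w y ^+ i. move=> fb; have [f hf <-] := rd_surj fb.
have primP g: inA g -> g != 0 -> exists2 u, u != 0 & [/\ inA (cst C u * g), cst C u * g != 0 & w (cst C u * g) = 0].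
move=> Ag g0; have [u [u0 [p0 p1]]] := exists_prim v Ag g0; exists u => //.
have Aug: inA (cst C u * g) by apply: inAM => //; apply: inA_cst.
split=> //; have := proj2 (hw Aug 0) p0; rewrite vgeE // => h1.
have h2: ~ (1 <= w (cst C u * g)) by move=> h; apply: p1; apply/hw; rewrite ?vgeE. by move: h1 h2; clia.
have [g [c c0 [Ag e]]] := fracA C f; have ec: ev c != 0 by rewrite ev0.
(* The denominator is scaled to Gauss valuation 0, so its reduction is nonzero. The factor x^a (x -
   1)^(d + 1 - a) turns each [m i] of the numerator into a polynomial multiple of y^i. *)
have [u u0 [Auc uc0 wuc]] := primP _ (inA_ev C c) ec. pose r := u *: (c * ('X ^+ a * ('X - 1) ^+ (d + 1 - a))).
have evr: ev r = cst C u * ev c * (x ^+ a * (x - 1) ^+ (d + 1 - a)).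
by rewrite /r -mul_polyC !evxM evxC !evxXn evxX -x1E mulrA. have wx: w x = 0 /\ w (x - 1) = 0.
have h1 := vge_ev; split; apply/eqP; rewrite eq_le; apply/andP; split;
rewrite -?vgeE ?x_unit ?x1_unit // leNgt; apply/negP => lt. have : vge w 1 (ev 'X) by rewrite evxX vgeE.
by move/gauss_ev1/(_ 1%N); rewrite coefX vgeE ?oner_neq0 // dv1.
have : vge w 1 (ev ('X - 1)) by rewrite -x1E vgeE ?x1_unit.
by move/gauss_ev1/(_ 1%N); rewrite coefB coefX coef1 subr0 vgeE ?oner_neq0 // dv1.
have evr0: ev r != 0 /\ w (ev r) = 0.
rewrite evr mulf_neq0 ?mulf_neq0 ?expf_neq0 ?x_unit ?x1_unit ?fmorph_eq0 //; split=> //.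
rewrite dvM ?mulf_neq0 ?expf_neq0 ?x_unit ?x1_unit ?fmorph_eq0 //.
by rewrite wuc dvM ?expf_neq0 ?x_unit ?x1_unit // !dvX ?x_unit ?x1_unit // wx.1 wx.2 !mulr0. have rint: vp v 0 r.
have /(hw (inA_ev C r) 0) [s hs er]: vge w 0 (ev r) by rewrite vgeE ?evr0.1 // evr0.2. suff -> : r = s 0%N by [].
have := rco_unique C s (d_gt0 C); rewrite -er => <-.
have ->: ev r = \sum_(j < d) ev (if j == 0%N :> nat then r else 0) * m j.
rewrite (bigD1 (Ordinal (d_gt0 C))) //= m0 mulr1 big1 ?addr0 // => j j0.
by rewrite ifN ?evx0 ?mul0r //; apply: contra j0 => /eqP e0; apply/eqP/val_inj.
by rewrite (rco_unique C (fun j => if j == 0%N then r else 0)) ?(d_gt0 C).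
have Ah: inA (cst C u * g) by apply: inAM => //; apply: inA_cst.
have fE: f * (cst C u * ev c) = cst C u * g by rewrite {1}e mulrCA divfK.
have /(hw Ah 0)[s hs es]: vge w 0 (cst C u * g). by rewrite -fE; apply: vgeM0 => //; rewrite vgeE // wuc.
pose t i := s i * ('X ^+ (a - a * i %/ d) * ('X - 1) ^+ (d + 1 - a - (d + 1 - a) * i %/ d)). have ht i: vp v 0 (t i).
by rewrite -[0]addr0; apply: vpM => //; rewrite -[0]addr0; apply: vpM; apply: vpXn; [apply: vpX|apply: vpX1].
have main: f * ev r = \sum_(i < d) ev (t i) * y ^+ i. rewrite evr mulrA fE es mulr_suml; apply: eq_bigr => i _.
have le (k: nat) : (k * i %/ d <= k)%N.
by apply: leq_trans (leq_div2r _ (leq_mul (leqnn k) (ltnW (ltn_ord i)))) _; rewrite mulnK ?(d_gt0 C).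
rewrite /t !evxM !evxXn evxX -x1E -!mulrA; congr (_ * _).
have eA: x ^+ a = x ^+ (a - a * i %/ d) * x ^+ (a * i %/ d) by rewrite -exprD subnK.
have eB: (x - 1) ^+ (d + 1 - a) = (x - 1) ^+ (d + 1 - a - (d + 1 - a) * i %/ d) * (x - 1) ^+ ((d + 1 - a) * i %/ d).
by rewrite -exprD subnK. have n1: x ^+ (a * i %/ d) != 0 by rewrite expf_neq0 ?x_unit.
have n2: (x - 1) ^+ ((d + 1 - a) * i %/ d) != 0 by rewrite expf_neq0 ?x1_unit.
rewrite /Curve.m [in LHS]eA [in LHS]eB. move: n1 n2; set X1 := x ^+ (_ %/ _); set X2 := (x - 1) ^+ (_ %/ _) => n1 n2.
by field; rewrite n1 n2. pose P (s: {poly K}) : {poly resf v} := \poly_(i < size s) rd v s`_i.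
have PP (s0: {poly K}) i : rd v s0`_i = (P s0)`_i.
by rewrite coef_poly; case: ltnP => // h; rewrite nth_default // rd0. exists (fun i => P (t i)), (P r).
apply/eqP => z0; have := rd_evE rint (PP r); rewrite z0 evx0 => /eqP. by rewrite rd_eq0 vgeE ?evr0.1 // evr0.2.
rewrite -(rd_evE rint (PP r)) -rdM ?gauss_ev // main rd_sum; last first.
by move=> i _; rewrite vgeM0 ?gauss_ev ?vge0X.
by apply: eq_bigr => i _; rewrite rdM ?gauss_ev ?vge0X // rdX // (rd_evE (ht i) (PP _)).
have dcst u: delb (cstb u) = cstb u.
have [u' hu <-] := rd_surj u; rewrite cstb_rd // delb_rd ?gauss_cst // sc_dcst //.
have dx: delb (rd w x) = rd w x by rewrite delb_rd // sc_dx. have dy: delb (rd w y) = cstb (rd v (zet C)) * rd w y.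
by rewrite delb_rd // sc_dy rdM ?gauss_cst // cstb_rd.
exists (SCurve (sc_prime C) (sc_odd C) (sc_a C) zb eqb dcst dx dy trans gen).
by split=> //; [exact: cstb_rd|exact: delb_rd].
Qed.

End Build.
End Reduction.

(** * Compatibility of reduction with coordinates and pole orders *)

Section ReductionTheory.
Variables (d a: nat) (K F: fieldType) (C: scurve d a K F) (v: dval K) (w: dval F)
 (B: scurve d a (resf v) (resf w)) (R: reduction C B).
Notation x := (cx C).
Notation y := (cy C).
Notation inA := (inA C).
Notation oo := (oo C).
Notation crd := (crd C).
Implicit Types (f g: F) (n: nat).

Lemma wcst (n: int) u : vge w n (cst C u) = vge v n u.
 exact: (gauss_cst (rd_gauss R)). Qed.
Lemma w_cst u: w (cst C u) = v u.
 have [->|u0] := eqVneq u 0; first by rewrite rmorph0 !dv0.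
have h (n: int) := wcst n u; apply/eqP; rewrite eq_le; have cu: cst C u != 0 by [].
by have := h (v u); have := h (w (cst C u)); rewrite !vgeE // !lexx => <- ->.
Qed.
Lemma wdel (n: int) f : vge w n (del C f) = vge w n f.
 exact: (gauss_del (rd_gauss R)). Qed.
Lemma w_del f: w (del C f) = w f.
 have [->|f0] := eqVneq f 0; first by rewrite rmorph0.
have h (n: int) := wdel n f; apply/eqP; rewrite eq_le; have df: del C f != 0 by [].
by have := h (w f); have := h (w (del C f)); rewrite !vgeE // !lexx => <- ->.
Qed.
Lemma w_xy: [/\ w x = 0, w (x - 1) = 0 & w y = 0].
 have [hx hy] := (gauss_x (rd_gauss R), gauss_y (rd_gauss R)). have hx1: vge w 0 (x - 1) by rewrite vgeB ?vge1. split.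
- by apply: (@rd_neq0 _ w _ hx _).2; rewrite -(rd_x R) x_unit.
- by apply: (@rd_neq0 _ w _ hx1 _).2; rewrite rdB ?vge1 // -(rd_x R) x1_unit.
- by apply: (@rd_neq0 _ w _ hy _).2; rewrite -(rd_y R) y_unit.
Qed.
Lemma rd_x1: rd w (x - 1) = cx B - 1.
 by rewrite rdB ?vge1 ?(gauss_x (rd_gauss R)) // -(rd_x R). Qed.
Lemma rd_div f g: vge w 0 f -> g != 0 -> w g = 0 -> rd w (f / g) = rd w f / rd w g.
 by move=> hf g0 wg; rewrite rdM ?rdV // vgeE // dvV wg. Qed.
Lemma w_T: w (T C) = 0.
 by have [h1 _ h2] := w_xy; rewrite dv_div // h1 h2. Qed.
Lemma rd_T: rd w (T C) = T B.
 have [_ _ h] := w_xy; rewrite /T rd_div ?(gauss_x (rd_gauss R)) //. by rewrite -(rd_x R) -(rd_y R).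
Qed.
Lemma rd_m i: rd w (m C i) = m B i.
 have [h1 h2 h3] := w_xy; have [hx hy] := (gauss_x (rd_gauss R), gauss_y (rd_gauss R)).
have hx1: vge w 0 (x - 1) by rewrite vgeB ?vge1.
rewrite /m rd_div ?vge0X // ?mulf_neq0 ?expf_neq0 ?x_unit ?x1_unit //; last first.
by rewrite dvM ?expf_neq0 ?x_unit ?x1_unit // !dvX ?x_unit ?x1_unit // h1 h2 !mulr0.
by rewrite rdM ?vge0X // !rdX // rd_x1 -(rd_x R) -(rd_y R).
Qed.
Lemma w_m i: vge w 0 (m C i). Proof. exact: (gauss_m (rd_gauss R)). Qed.
Lemma w_wb l: vge w 0 (wb C l).
 by apply: vgeM0; [apply: vge0X; apply: (gauss_x (rd_gauss R))|apply: w_m]. Qed.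
Lemma rd_wb l: rd w (wb C l) = wb B l.
 by rewrite rdM ?vge0X ?w_m ?(gauss_x (rd_gauss R)) // rdX ?(gauss_x (rd_gauss R)) // rd_m -(rd_x R). Qed.
Lemma w_crd (n: int) f l : inA f -> vge w n f -> vge v n (crd l f).
 by move=> Af /(rd_gauss R Af)/vA_crd[_]; apply. Qed.
Lemma rd_A f: inA f -> vge w 0 f -> Curve.inA B (rd w f) /\ forall l, Crd.crd B l (rd w f) = rd v (crd l f).
 move=> Af wf; have hr i k: (i < d)%N -> vge v 0 (rco C f i)`_k. move=> lt; have [ng e1 e2] := nongapE C k lt.
by have := w_crd (pm d a i + d * k)%N Af wf; rewrite /Crd.crd ng e2 e1.
pose P (s: {poly K}) : {poly resf v} := \poly_(i < size s) rd v s`_i.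
have PP (s0: {poly K}) i : rd v s0`_i = (P s0)`_i.
by rewrite coef_poly; case: ltnP => // h; rewrite nth_default // rd0.
have e: rd w f = \sum_(i < d) evx (cst B) (cx B) (P (rco C f i)) * m B i.
have hv (i: 'I_d) : vp v 0 (rco C f i) by move=> k; apply: hr. have ge (i: 'I_d) := gauss_ev (rd_gauss R) (hv i).
rewrite {1}(rco_sum Af) rd_sum => [|i _]; last by rewrite vgeM0 ?w_m.
apply: eq_bigr => i _; rewrite rdM ?w_m // rd_m; congr (_ * _).
rewrite (evx_coef (cst C)) rd_sum => [|k _]; last first.
by rewrite vgeM0 ?vge0X ?wcst ?(gauss_x (rd_gauss R)) //; apply: hr.
rewrite evx_coef (big_ord_widen _ (fun k => cst B (P (rco C f i))`_k * cx B ^+ k) (size_poly _ _)).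
rewrite [RHS]big_mkcond; apply: eq_bigr => k _. rewrite rdM ?vge0X ?wcst ?(gauss_x (rd_gauss R)) //; last exact: hr.
rewrite rdX ?(gauss_x (rd_gauss R)) // -(rd_x R) -(rd_cst R); last exact: hr.
by rewrite PP; case: ltnP => // h; rewrite nth_default // rmorph0 mul0r.
split=> [|l]; first by exists (fun i => P (rco C f i)). rewrite /Crd.crd; case: ifP => _; last by [].
by rewrite e (rco_unique B (fun i => P (rco C f i))) ?(lmod_lt C) // PP.
Qed.
Lemma oo_rd f n: inA f -> vge w 0 f -> vge oo (- n%:Z) f -> vge (Inf.oo B) (- n%:Z) (rd w f).
 move=> Af wf /(vge_ooP n Af) h; have [Ab hb] := rd_A Af wf; apply/(vge_ooP n Ab) => l nl. by rewrite hb h // rd0.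
Qed.

End ReductionTheory.

Lemma crd_expand (d a: nat) (K F: fieldType) (D: scurve d a K F) (f: F) (n: nat) : Curve.inA D f -> vge (Inf.oo D) (- n%:Z) f ->
 f = \sum_(l < n.+1) cst D (Crd.crd D l f) * wb D l.
 move=> Af h; apply/eqP; rewrite -subr_eq0; apply/eqP/(@crd_small _ _ _ _ D) => [|l].
apply: inAB => //; apply: inA_sum => i _; apply: inAM; [exact: inA_cst|exact: inA_wb].
have cw k: Crd.crd D l (cst D (Crd.crd D k f) * wb D k) = if l == k then Crd.crd D l f else 0.
have [ng|ng] := boolP (nongap d a k); last first.
rewrite {2}/Crd.crd (negPf ng) rmorph0 mul0r crd0; case: eqP => // ->. by rewrite /Crd.crd (negPf ng).
have wE: wb D k = \sum_(j < d) evx (cst D) (cx D) (if j == (k %% d)%N :> nat then 'X^((k - pm d a (k %% d)) %/ d) else 0) * m D j.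
rewrite (bigD1 (Ordinal (lmod_lt D k))) //= eqxx evxXn evxX big1 ?addr0 // => j j0.
by rewrite ifN ?evx0 ?mul0r //; apply: contra j0 => /eqP e0; apply/eqP/val_inj. rewrite crdZ; last exact: inA_wb.
have ->: Crd.crd D l (wb D k) = (l == k)%:R. rewrite {1}/Crd.crd; have [ngl|ngl] := boolP (nongap d a l); last first.
by case: eqP => // e; rewrite e ng in ngl.
rewrite wE (rco_unique D (fun j => if j == (k %% d)%N then 'X^((k - pm d a (k %% d)) %/ d) else 0)) ?(lmod_lt D) //.
have [->|lk] := eqVneq l k; first by rewrite eqxx coefXn eqxx. case: eqP => e; last by rewrite coef0.
rewrite coefXn e; case: eqP => // e2; case/eqP: lk. by rewrite (nongap_eq D ngl) (nongap_eq D ng) e e2.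
by case: eqP => [->|_]; rewrite ?mulr1 ?mulr0. have Aw k: Curve.inA D (cst D (Crd.crd D k f) * wb D k).
by apply: inAM; [exact: inA_cst|exact: inA_wb].
have sumE (s: seq 'I_n.+1) : Crd.crd D l (f - \sum_(k <- s) cst D (Crd.crd D k f) * wb D k) =
Crd.crd D l f - \sum_(k <- s) (if l == k then Crd.crd D l f else 0).
elim: s => [|k s IH]; first by rewrite !big_nil !subr0. rewrite !big_cons !opprD !addrA [f - _]addrC -addrA addrC.
rewrite -[- (cst D _ * _)]mulN1r -(rmorph1 (cst D)) -rmorphN crd_lin ?IH ?cw //. by rewrite mulN1r; ring.
by apply: inAB => //; apply: inA_sum. rewrite sumE; have [lt|le] := ltnP l n.+1.
rewrite (bigD1 (Ordinal lt)) //= eqxx big1 ?addr0 ?subrr // => k kl.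
by rewrite ifN //; apply: contra_neq kl => e; apply: val_inj.
rewrite big1 ?subr0 => [|k _]; first exact: (proj1 (vge_ooP n Af) h).
by rewrite ifN // neq_ltn (leq_trans _ le) ?orbT.
Qed.

(** * Lifting functions from the reduced curve *)

Section Lifting.
Variables (d a: nat) (K F: fieldType) (C: scurve d a K F) (v: dval K) (w: dval F)
 (B: scurve d a (resf v) (resf w)) (R: reduction C B).
Notation inA := (inA C).
Notation oo := (oo C).
Notation crd := (crd C).
Implicit Types (f g: F) (n: nat).

(** Lift the coordinates in the basis [wb], zero coordinates to zero, so that the pole order does
    not grow. *)
Lemma lift_A fb n: Curve.inA B fb -> vge (Inf.oo B) (- n%:Z) fb ->
 exists f, [/\ inA f, vge w 0 f, rd w f = fb & vge oo (- n%:Z) f].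
 move=> Ab hb; pose c l := if Crd.crd B l fb == 0 then 0 else res_val (Crd.crd B l fb).
have cP l: vge v 0 (c l) /\ rd v (c l) = Crd.crd B l fb.
by rewrite /c; case: eqP => [->|_]; rewrite ?vge0 ?vge_res ?rdK. exists (\sum_(l < n.+1) cst C (c l) * wb C l); split.
- by apply: inA_sum => l _; apply: inAM; [exact: inA_cst|exact: inA_wb].
- by apply: vge_sum => l _; apply: vgeM0; [rewrite (wcst R) (cP l).1|apply: (w_wb R)].
- rewrite rd_sum => [|l _]; last by apply: vgeM0; [rewrite (wcst R) (cP l).1|apply: (w_wb R)].
rewrite [RHS](crd_expand Ab hb); apply: eq_bigr => l _.
rewrite rdM ?(wcst R) ?(cP l).1 ?(w_wb R) // (rd_wb R) -(rd_cst R) ?(cP l).1 //. by rewrite (cP l).2.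
- apply: vge_sum => l _; have [e|ne] := eqVneq (Crd.crd B l fb) 0. by rewrite /c e eqxx rmorph0 mul0r vge0.
apply: vgeM0; first exact: vge_cst. have ng: nongap d a l by move: ne; rewrite /Crd.crd; case: ifP; rewrite ?eqxx.
by rewrite vgeE ?wb_neq0 // oo_wb //; have := ltn_ord l; clia.
Qed.
Lemma normalize f: inA f -> f != 0 -> exists u, [/\ u != 0, cst C u * f != 0, w (cst C u * f) = 0 & inA (cst C u * f)].
 move=> Af f0; have [u [u0 [p0 p1]]] := exists_prim v Af f0; exists u.
have Au: inA (cst C u * f) by apply: inAM => //; apply: inA_cst.
split=> //; have := proj2 (rd_gauss R Au 0) p0; rewrite vgeE // => h1.
have h2: ~ (1 <= w (cst C u * f)) by move=> h; apply: p1; apply/(rd_gauss R Au); rewrite ?vgeE. by move: h1 h2; clia.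
Qed.

(* Dimensions are counted by pole orders. *)
Lemma count_red (V: F -> Prop) (Vb: resf w -> Prop) (M Mb: nat) :
 subsp C V -> (forall f, V f -> inA f) -> (forall f: resf w, Vb f -> Curve.inA B f) ->
 (forall f, V f -> vge w 0 f -> vge oo (1 - M%:Z) f ->
 Vb (rd w f) /\ vge (Inf.oo B) (1 - Mb%:Z) (rd w f)) ->
 (cnt C V M <= cnt B Vb Mb)%N.
 move=> sV VA VbA h; pose s := [seq j <- iota 0 M | `[< pole_of C V j >]].
pose sb := [seq j <- iota 0 Mb | `[< pole_of B Vb j >]].
have cE (kap E: fieldType) (D: scurve d a kap E) (U: E -> Prop) N :
cnt D U N = size [seq j <- iota 0 N | `[< pole_of D U j >]]. elim: N => [|N IH]; first by rewrite /cnt big_ord0.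
by rewrite cntS IH -addn1 iotaD filter_cat size_cat /= add0n; case: asboolP.
rewrite !cE -/s -/sb leqNgt; apply/negP => lt.
have sP (i: 'I_(size s)) : exists f, [/\ V f, f != 0 & oo f = - (nth 0%N s i)%:Z].
have : nth 0%N s i \in s by apply: mem_nth. by rewrite {2}/s mem_filter => /andP[/asboolP]. have [e eP] := choice sP.
(* With more functions than conditions, some combination has zero coordinate at every pole order of
   Vb. Its normalized reduction would be a nonzero element of Vb whose leading coordinate
   vanishes. *)
pose A := \matrix_(i < size s, j < size sb) crd (nth 0%N sb j) (e i). have : kermx A != 0.
rewrite kermx_eq0; apply/negP => /eqP r. by have := rank_leq_col A; rewrite r leqNgt lt.
move/rowV0Pn => [c /sub_kermxP cA c0]. have [i0 ci0]: exists i, c 0 i != 0.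
apply: contrapT => none; case/eqP: c0; apply/rowP => i; rewrite mxE.
by apply: contrapT => /eqP ci; apply: none; exists i. pose f := \sum_i cst C (c 0 i) * e i. have Vf: V f.
rewrite /f; apply: (@subsp_sum _ _ _ _ C V _ _ _ (fun i => cst C (c 0 i) * e i) sV) => i _.
by have [Ve _ _] := eP i; apply: (subspZ _ sV Ve). have f0: f != 0.
have dist (i j: 'I_(size s)) : cst C (c 0 i) * e i != 0 -> cst C (c 0 j) * e j != 0 ->
oo (cst C (c 0 i) * e i) = oo (cst C (c 0 j) * e j) -> i = j. rewrite !mulf_eq0 !negb_or => /andP[ci ei] /andP[cj ej].
rewrite !dvM // !pv_cst; have [_ _ ->] := eP i; have [_ _ ->] := eP j.
rewrite !add0r => /oppr_inj [] /eqP; rewrite nth_uniq //; first by move/eqP/val_inj.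
by rewrite filter_uniq ?iota_uniq. apply/eqP => f0; have h1: vge oo 1 f by rewrite f0 vge0.
have := @vge_distinct _ oo 1 _ (fun i => cst C (c 0 i) * e i) dist h1 i0.
have [_ e0 oe] := eP i0; rewrite vgeE // dvM // pv_cst oe. by clia. have cf l: l \in sb -> crd l f = 0.
move=> lsb; have lt': (index l sb < size sb)%N by rewrite index_mem.
have := congr1 (fun X: 'rV_(size sb) => X 0 (Ordinal lt')) cA; rewrite !mxE => <-.
rewrite /f; have lin (r: seq 'I_(size s)) : crd l (\sum_(i <- r) cst C (c 0 i) * e i) = \sum_(i <- r) c 0 i * crd l (e i).
elim: r => [|i r IH]; first by rewrite !big_nil crd0. have Ae j: inA (e j) by apply: VA; case: (eP j).
rewrite !big_cons addrC crd_lin ?IH 1?addrC //. by apply: inA_sum => j _; apply: inAM => //; apply: inA_cst.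
by rewrite lin; apply: eq_bigr => i _; rewrite mxE /= nth_index. have [u [u0 g0 wg Ag]] := normalize (VA _ Vf) f0.
have Vg: V (cst C u * f) by apply: subspZ. have wg0: vge w 0 (cst C u * f) by rewrite vgeE // wg.
have og: vge oo (1 - M%:Z) (cst C u * f). apply: vgeM0; first exact: vge_cst.
apply: vge_sum => i _; apply: vgeM0; first exact: vge_cst. have [_ e0 oe] := eP i; rewrite vgeE // oe.
have : nth 0%N s i \in s by apply: mem_nth.
by rewrite {2}/s mem_filter mem_iota => /andP[_]; move: (nth _ _ _) => j /andP[_]; clia.
have [Vr or] := h _ Vg wg0 og. have r0: rd w (cst C u * f) != 0 by rewrite rd_eq0 // vgeE // wg.
have Ar := VbA _ Vr; have le := oo_inA_le0 Ar r0.
have e0: Inf.oo B (rd w (cst C u * f)) = - `|Inf.oo B (rd w (cst C u * f))|%N%:Z by move: le; clia.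
have := crd_oo Ar r0 e0; have [_ ->] := rd_A R Ag wg0. rewrite (crdZ _ _ (VA _ Vf)) cf ?mulr0 ?rd0 ?eqxx //.
rewrite mem_filter asboolT; last by exists (rd w (cst C u * f)).
by rewrite mem_iota /=; move: or; rewrite vgeE //; move: le; clia.
Qed.

End Lifting.

(** * Divisors divided by q and their degrees *)

Section DivisorDegrees.
Variables (d a: nat) (kap F: fieldType) (C: scurve d a kap F).
Notation inA := (inA C).
Notation oo := (oo C).
Implicit Types (f g: F) (P Q: place C) (D S: seq (place C)).

Lemma deg_gt0 P: fpl P -> (0 < deg P)%N.
 move=> fP; have [bs [_ h]] := deg_basis fP; rewrite lt0n; apply/eqP => e0.
have [c [hc _]] := h 1 (vge1 P); move: hc; rewrite big1 ?subr0 => [|i _]. by rewrite vgeE ?oner_neq0 // dv1.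
by move: (ltn_ord i); rewrite [X in (_ < X)%N]e0.
Qed.
Lemma degs_count D S: uniq S -> {subset D <= S} ->
 degs D = (\sum_(P <- S) count_mem P D * deg P)%N.
 move=> uS; elim: D => [|Q D IH] sub. by rewrite /degs big_nil big1_seq // => P _; rewrite mul0n.
have QS: Q \in S by apply: sub; rewrite mem_head.
rewrite /degs big_cons -/(degs D) IH => [|P PD]; last by apply: sub; rewrite in_cons PD orbT.
rewrite [in RHS](big_rem Q) //= [in LHS](big_rem Q) //= eqxx addnA mulnDl mul1n; congr (_ + _)%N.
apply: eq_big_seq => P; rewrite mem_rem_uniq // eq_sym => /andP[/negPf/= -> _]. by [].
Qed.
Lemma degs_le D1 D2: (forall P, (count_mem P D1 <= count_mem P D2)%N) -> (degs D1 <= degs D2)%N.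
 move=> h; rewrite (@degs_count D1 (undup (D1 ++ D2))) ?undup_uniq //; last first.
by move=> P; rewrite mem_undup mem_cat => ->. rewrite (@degs_count D2 (undup (D1 ++ D2))) ?undup_uniq //; last first.
by move=> P; rewrite mem_undup mem_cat orbC => ->. by apply: leq_sum => P _; rewrite leq_mul2r h orbT.
Qed.
Lemma degs_eq D1 D2: all (@fpl _ _ _ _ C) D2 ->
 (forall P, (count_mem P D1 <= count_mem P D2)%N) -> degs D1 = degs D2 ->
 forall P, count_mem P D1 = count_mem P D2.
 move=> fD h e P; apply/eqP; rewrite eqn_leq h leqNgt; apply/negP => lt.
have PD: P \in D2 by rewrite -has_pred1 has_count; apply: leq_ltn_trans lt. have fP: fpl P by move/allP: fD; apply.
suff : (degs (P :: D1) <= degs D2)%N.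
by rewrite /degs big_cons -/(degs D1) -/(degs D2) e -{2}[degs D2]add0n leq_add2r leqNgt deg_gt0.
apply: degs_le => Q /=; have [<-|PQ] := eqVneq P Q; first by []. by rewrite h.
Qed.
Lemma degs_mul q D: degs (flatten (nseq q D)) = (q * degs D)%N.
 by elim: q => [|q IH]; rewrite /degs ?big_nil //= big_cat mulSn -IH. Qed.
Lemma count_mul q D P: count_mem P (flatten (nseq q D)) = (q * count_mem P D)%N.
 by elim: q => [|q IH] //=; rewrite count_cat mulSn -IH. Qed.

Definition ceil_div (n q: nat) := ((n + q.-1) %/ q)%N.

Lemma ceil_divP n q k: (0 < q)%N -> (ceil_div n q <= k)%N = (n <= q * k)%N.
 by move=> q0; rewrite -ltnS ltn_divLR // mulnC; move: q0; clia.
Qed.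
Lemma inA_finite_ge0 f P: inA f -> f != 0 -> fpl P -> P f = (`|P f|%N)%:Z.
 by move=> Af f0 fP; have := vge_inA Af fP; rewrite vgeE //; clia. Qed.
(** D is div f / q rounded up, so q deg D is at least the pole order of f, with equality exactly
    when q divides div f. The condition on g^q / f names no point, which lets it be carried to the
    reduced curve. *)
Lemma root_ideal f q: inA f -> f != 0 -> (0 < q)%N -> exists D,
 [/\ all (@fpl _ _ _ _ C) D, forall g, inA (g ^+ q / f) <-> ideal D g,
 (`|oo f| <= q * degs D)%N & (q * degs D)%N = `|oo f|%N <-> forall P, fpl P -> (q %| P f)%Z].
 move=> Af f0 q0; have [|Df fDf hDf] := @exists_divisor _ _ _ _ C f (fun P => `|P f|%N) f0; first by move=> P _ ->.
have [|D fD hD] := @exists_divisor _ _ _ _ C f (fun P => ceil_div `|P f| q) f0.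
by move=> P _ ->; apply/eqP; rewrite -leqn0 ceil_divP.
have dv: divisor_of Df f by split=> // P fP; rewrite hDf // -inA_finite_ge0. have degf := div_degree Af f0 dv.
have cnt0 (S: seq (place C)) P : all (@fpl _ _ _ _ C) S -> ~~ fpl P -> count_mem P S = 0%N.
by move=> /allP fS nP; apply/count_memPn; apply: contra nP => /fS.
have le P: (count_mem P Df <= count_mem P (flatten (nseq q D)))%N.
rewrite count_mul; have [fP|nP] := boolP (fpl P); last by rewrite cnt0. by rewrite hDf // hD // -ceil_divP.
have fqD: all (@fpl _ _ _ _ C) (flatten (nseq q D)).
by apply/allP => P /flattenP[S /nseqP[-> _]]; move/allP: fD; apply. exists D; split=> //.
- move=> g; split=> [h|[Ag h]]. have Ag: inA g. apply: (@inA_root _ _ _ _ C _ q.-1); rewrite prednK //.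
by rewrite -[g ^+ q](divfK f0); apply: inAM.
split=> // P fP; have := vge_inA h fP; have [->|g0] := eqVneq g 0; first by rewrite vge0.
rewrite !vgeE // dv_div // dvX // hD //.
rewrite (inA_finite_ge0 Ag g0 fP) (inA_finite_ge0 Af f0 fP) lez_nat ceil_divP //; clia.
have [->|g0] := eqVneq g 0; first by rewrite expr0n eqn0Ngt q0 mul0r; apply: inA0. apply/inAP => P fP; have := h P fP.
rewrite !vgeE // dv_div // dvX // hD //.
rewrite (inA_finite_ge0 Ag g0 fP) (inA_finite_ge0 Af f0 fP) lez_nat ceil_divP //; clia.
- by have := degs_le le; rewrite degs_mul; move: degf; clia.
- have lE: (`|oo f|%N = degs Df) by move: degf; clia. split=> [e P fP|h].
have := degs_eq fqD le; rewrite degs_mul e lE => /(_ erefl P).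
rewrite count_mul hDf // => e'; rewrite (inA_finite_ge0 Af f0 fP) e'.
by apply/dvdzP; exists (count_mem P D)%:Z; rewrite PoszM mulrC.
have le2 P: (count_mem P (flatten (nseq q D)) <= count_mem P Df)%N.
rewrite count_mul; have [fP|nP] := boolP (fpl P); last by rewrite cnt0 ?muln0.
rewrite hDf // hD //; have := h P fP; rewrite (inA_finite_ge0 Af f0 fP) => /dvdzP[k].
move=> e; have [k' ->]: exists k', `|P f|%N = (q * k')%N.
by exists `|k|%N; have := congr1 absz e; rewrite abszM /= mulnC. by rewrite leq_mul2l ceil_divP // leqnn orbT.
by apply/eqP; rewrite lE -degs_mul eqn_leq !degs_le.
Qed.
Lemma pole_of_nongap j: pole_of C inA j <-> nongap d a j.
 split=> [[f [Af f0 e]]|h]. by have := crd_oo Af f0 e; rewrite /crd; case: ifP; rewrite ?eqxx.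
by exists (wb C j); rewrite wb_neq0 oo_wb //; split=> //; apply: inA_wb.
Qed.

End DivisorDegrees.

(** * Divisibility of the divisor under reduction *)

Section ReducedRoots.
Variables (d a: nat) (K F: fieldType) (C: scurve d a K F) (v: dval K) (w: dval F)
 (B: scurve d a (resf v) (resf w)) (R: reduction C B).
Notation inA := (inA C).
Notation oo := (oo C).
Implicit Types (f g: F).

Lemma cnt_inA_eq M: cnt C inA M = cnt B (Curve.inA B) M.
 apply: eq_bigr => j _; congr nat_of_bool; apply/asboolP/asboolP. by move/pole_of_nongap => h; apply/pole_of_nongap.
by move/pole_of_nongap => h; apply/pole_of_nongap.
Qed.

(* A count of dimensions: the q-divisibility of div f passes to the reduction,
   and every function vanishing to the right orders lifts. *)
Lemma reduce_roots f (q N: nat) : inA f -> f != 0 -> w f = 0 -> (0 < q)%N ->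
 (forall P: place C, fpl P -> (q %| P f)%Z) -> oo f = - (q * N)%N%:Z ->
 exists nb : nat, [/\ Inf.oo B (rd w f) = - (q * nb)%N%:Z, (nb <= N)%N,
 forall Q : place B, fpl Q -> (q %| Q (rd w f))%Z &
 exists M0, forall M, (M0 <= M)%N -> forall gb, Curve.inA B (gb ^+ q / rd w f) ->
 vge (Inf.oo B) (1 - (M - N + nb)%N%:Z) gb ->
 exists g, [/\ inA (g ^+ q / f), vge w 0 g, vge oo (1 - M%:Z) g & rd w g = gb]].
 move=> Af f0 wf q0 hq of_; have wf0: vge w 0 f by rewrite vgeE // wf.
have [Afb cfb] := rd_A R Af wf0; set fb := rd w f in Afb cfb *. have fb0: fb != 0 by rewrite rd_eq0 // vgeE // wf.
have [D [fD ID leD eqD]] := root_ideal Af f0 q0. have [Db [fDb IDb leDb eqDb]] := root_ideal Afb fb0 q0.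
have degD: degs D = N. by have /eqP := proj2 eqD hq; rewrite of_ abszN /= eqn_pmul2l // => /eqP.
pose nb := (`|Inf.oo B fb| %/ q)%N; have ofb_le := oo_inA_le0 Afb fb0.
have ofb: Inf.oo B fb = - `|Inf.oo B fb|%N%:Z by move: ofb_le; clia. have ofbN: (`|Inf.oo B fb| <= q * N)%N.
have : vge (Inf.oo B) (- (q * N)%N%:Z) fb by apply: (oo_rd R) => //; rewrite vgeE // of_.
by rewrite vgeE // ofb; clia. have nbN: (nb <= N)%N by rewrite /nb -(mulKn N q0) leq_div2r.
have nbP: (q * nb <= `|Inf.oo B fb| < q * nb.+1)%N. by rewrite /nb mulnC leq_divM mulnC ltn_ceil.
(* For g of pole order at most M - 1, the q-th power of its reduction has pole order at most q (M -
   1 - N) plus that of [fb], which is less than q (nb + 1); hence the bound M - N + nb. *)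
have mapV M g: (N <= M)%N -> inA (g ^+ q / f) -> vge w 0 g -> vge oo (1 - M%:Z) g ->
Curve.inA B (rd w g ^+ q / fb) /\ vge (Inf.oo B) (1 - (M - N + nb)%N%:Z) (rd w g).
move=> NM Ag wg og; have wgf: vge w 0 (g ^+ q / f) by rewrite vge_div // wf addr0 vge0X.
have e: rd w (g ^+ q / f) = rd w g ^+ q / fb by rewrite (rd_div) ?vge0X // rdX.
have [Agb _] := rd_A R Ag wgf; rewrite e in Agb; split=> //.
have [r0|r0] := eqVneq (rd w g) 0; first by rewrite r0 vge0.
have g0: g != 0 by apply: contraNneq r0 => ->; rewrite rd0. have M0: (0 < M)%N.
rewrite lt0n; apply/eqP => M0; move: og; rewrite M0 subr0 => og.
have := oo_inA_le0 (_: inA g) g0; move: og; rewrite vgeE // => h1 h2. have /h2: inA g by case: (ID g) => /(_ Ag) [].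
by move: h1; clia. have [le1|lt1] := leqP 1 (M - N).
have : vge (Inf.oo B) (- (q * (M - N).-1)%N%:Z) (rd w (g ^+ q / f)). apply: (oo_rd R) => //; rewrite vge_div // of_.
have := vgeX q og; apply: vgeW; rewrite -mulr_natl natz; move: NM le1 M0; cnia.
rewrite e vge_div // ofb !vgeE // dvX //; move: nbP NM le1; cnia. have MN: M = N by move: NM lt1; clia.
have oo1: vge oo 1 (g ^+ q / f).
by rewrite vge_div // of_; have := vgeX q og; apply: vgeW; rewrite -mulr_natl natz; move: MN q0 M0; cnia.
have gf0: g ^+ q / f = 0. apply/eqP; apply: contraTT oo1 => n0; rewrite vgeE // -ltNge.
by have := oo_inA_le0 Ag n0; clia.
by move/eqP: gf0; rewrite mulf_eq0 invr_eq0 (negPf f0) orbF expf_eq0 (negPf g0) andbF.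
have sI: subsp C (ideal D) := @subsp_ideal _ _ _ _ C D. have sIb: subsp B (ideal Db) := @subsp_ideal _ _ _ _ B Db.
have [M1 c1] := cnt_ideal fD; have [M2 c2] := cnt_ideal fDb; have [M3 c3] := pole_of_inA C.
pose Mb M := (M - N + nb)%N. have cle M: (N <= M)%N -> (cnt C (ideal D) M <= cnt B (ideal Db) (Mb M))%N.
move=> NM; apply: (count_red R) => //; [by move=> g []|by move=> g []|].
move=> g /ID Ig wg og; have [h1 h2] := mapV M g NM Ig wg og; split=> //. exact/IDb.
have cA M: (maxn M3 (N + M3) <= M)%N -> cnt C inA M = (cnt C inA (Mb M) + (N - nb))%N.
rewrite geq_max => /andP[h1 h2]. rewrite (cnt_stable c3 h1) (@cnt_stable _ _ _ _ C inA M3 (Mb M) c3).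
by rewrite /Mb; move: h1 h2 nbN; move: (cnt _ _ _); clia. by rewrite /Mb; move: h2; clia.
pose M0 := (M1 + M2 + M3 + N)%N.
(* The count on C is at most that on B, which forces deg Db <= nb. Since Db is rounded up, q deg Db
   is at least the pole order of [fb], hence at least q nb: equality holds throughout and q divides
   div [fb]. *)
have [deg_le cE]: (degs Db <= nb)%N /\ forall M, (M0 <= M)%N -> (cnt B (ideal Db) (Mb M) + degs Db = cnt C (ideal D) M + nb)%N.
have key M: (M0 <= M)%N -> (cnt B (ideal Db) (Mb M) + degs Db = cnt C (ideal D) M + nb)%N /\ (cnt C (ideal D) M <= cnt B (ideal Db) (Mb M))%N.
move=> le; split; last by apply: cle; move: le; rewrite /M0; clia.
rewrite -c2; last by rewrite /Mb; move: le; rewrite /M0; clia.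
have h1 := c1 M; have h3 := cA M; rewrite -cnt_inA_eq; move: h1 h3.
have ->: (M1 <= M)%N by move: le; rewrite /M0; clia.
have ->: (maxn M3 (N + M3) <= M)%N by move: le; rewrite /M0 geq_max; clia.
by move=> /(_ isT) h1 /(_ isT) h3; move: h1 h3 nbN; rewrite degD; clia.
have [h1 h2] := key M0 (leqnn _); split=> [|M /key[]//]. by move: h1 h2; clia. have degE: degs Db = nb.
by apply/eqP; rewrite eqn_leq deg_le /= leqNgt; apply/negP => lt; move: leDb nbP lt; cnia.
have ofbE: (q * degs Db)%N = `|Inf.oo B fb|%N. by apply/eqP; rewrite eqn_leq leDb degE andbT; case/andP: nbP.
exists nb; split=> //; first by rewrite ofb -ofbE degE. exact/eqDb. exists M0 => M leM gb /IDb Igb ogb.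
have NM: (N <= M)%N by move: leM; rewrite /M0; clia.
pose Vr (gb: resf w) := exists g, [/\ inA (g ^+ q / f), vge w 0 g, vge oo (1 - M%:Z) g & rd w g = gb].
have sVr: subsp B Vr. split=> [|u _ _ [g [Ag wg og <-]] [g' [Ag' wg' og' <-]]].
exists 0; rewrite !vge0 rd0; split=> //; apply/ID; exact: sI.1.
have [u' hu <-] := rd_surj u; exists (g + cst C u' * g'). have wc: vge w 0 (cst C u') by rewrite (wcst R). split.
- by apply/ID/sI.2; apply/ID.
- by apply: vgeD => //; apply: vgeM0.
- by apply: vgeD => //; apply: vgeM0 => //; apply: vge_cst.
- by rewrite rdD ?vgeM0 // rdM // (rd_cst R).
have Vrb (g: resf w) : Vr g -> ideal Db g /\ vge (Inf.oo B) (1 - (Mb M)%:Z) g.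
by move=> [g' [Ag' wg' og' <-]]; have [h1 h2] := mapV M g' NM Ag' wg' og'; split=> //; apply/IDb.
(* The counts agree, so the reductions attain every pole order present in [ideal Db]; subtracting
   leading terms then lifts any of its elements. *)
have full j: (j < Mb M)%N -> pole_of B (ideal Db) j -> pole_of B Vr j.
have cr: (cnt C (ideal D) M <= cnt B Vr (Mb M))%N.
apply: (count_red R) => //; [by move=> g []|by move=> g /Vrb[[]]|].
move=> g /ID Ag wg og; have [_ h2] := mapV M g NM Ag wg og; split=> //. by exists g.
have ce: cnt C (ideal D) M = cnt B (ideal Db) (Mb M). by have := cE M leM; rewrite degE => /addIn.
move=> jM hj; apply: contrapT => nj. have : (cnt B Vr (Mb M) < cnt B (ideal Db) (Mb M))%N.
rewrite /cnt (bigD1 (Ordinal jM)) //= [X in (_ < X)%N](bigD1 (Ordinal jM)) //=.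
rewrite (asboolF nj) (asboolT hj) add0n add1n ltnS; apply: leq_sum => i _.
by case: asboolP => // -[g [Vg g0 gi]]; rewrite asboolT //; exists g; split=> //; case: (Vrb _ Vg).
by rewrite ltnNge -ce cr.
have main (n: nat) : forall gb : resf w, ideal Db gb -> vge (Inf.oo B) (1 - n%:Z) gb -> (n <= Mb M)%N -> Vr gb.
elim: n => [|n IH] h Ih oh nM. have ->: h = 0; last exact: sVr.1.
apply/eqP; apply: contraTT oh => h0; rewrite vgeE // -ltNge. by have := oo_inA_le0 Ih.1 h0; clia.
have [h0|h0] := eqVneq h 0; first by rewrite h0; apply: sVr.1.
have [lt|ge] := leP (1 - n%:Z) (Inf.oo B h); first by apply: IH => //; [rewrite vgeE|apply: ltnW].
have oE: Inf.oo B h = - n%:Z by move: oh ge; rewrite vgeE //; clia.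
have [g [Vg g0 gn]]: pole_of B Vr n by apply: full => //; exists h.
have [|u u0 hu] := @leading_sub _ _ _ _ B h g h0 g0; first by rewrite oE gn. have [Ig og] := Vrb _ Vg.
have ->: h = (h - cst B u * g) + cst B u * g by rewrite subrK. apply: (subspD sVr); last exact: (subspZ _ sVr Vg).
apply: IH; [|by apply: vgeW hu; rewrite gn; clia|exact: ltnW]. by apply: (subspB sIb Ih); apply: (subspZ _ sIb Ig).
exact: main Igb ogb (leqnn _).
Qed.

End ReducedRoots.

(** * The derivation x (x - 1) d/dx and p-th roots in characteristic p *)

Section Derivation.
Variables (d a: nat) (kap F: fieldType) (C: scurve d a kap F).
Notation b := (d + 1 - a)%N.
Notation x := (cx C).
Notation ev := (evx (cst C) x).
Notation m := (m C).
Notation inA := (inA C).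
Notation oo := (oo C).
Implicit Types (f g: F) (c r s: {poly kap}) (Q: place C).

(** The d-th power of [m i] is x^u (x - 1)^w with u, w the residues of a i and (d + 1 - a) i, so x
    (x - 1) d/dx multiplies [m i] by (u (x - 1) + w x) / d. *)
Definition thc (i: nat) r : {poly kap} :=
 'X * ('X - 1) * r^`() +
 (d%:R^-1)%:P * r * ((a * i %% d)%:R * ('X - 1) + (b * i %% d)%:R * 'X).

(* The derivation x (x - 1) d/dx of F, on A. *)
Definition theta f: F := \sum_(i < d) ev (thc i (rco C f i)) * m i.

Lemma thcD i r s: thc i (r + s) = thc i r + thc i s.
 by rewrite /thc derivD; ring. Qed.
Lemma thcZ i u r: thc i (u *: r) = u *: thc i r.
 by rewrite /thc derivZ -!mul_polyC; ring. Qed.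
Lemma theta_sum (r: nat -> {poly kap}) :
 theta (\sum_(i < d) ev (r i) * m i) = \sum_(i < d) ev (thc i (r i)) * m i.
 by apply: eq_bigr => i _; rewrite rco_unique. Qed.
Lemma theta_mono r i: theta (ev r * m i) = ev (thc (i %% d) r) * m i.
 have hi := lmod_lt C i; rewrite !(m_mod C i).
have e c: ev c * m (i %% d) = \sum_(j < d) ev (if nat_of_ord j == (i %% d)%N then c else 0) * m j.
rewrite (bigD1 (Ordinal hi)) //= eqxx big1 ?addr0 // => j. by rewrite -val_eqE => /negPf /= ->; rewrite evx0 mul0r.
rewrite e (theta_sum (fun j => if j == (i %% d)%N then r else 0)) e; apply: eq_bigr => j _.
by case: eqP => [->|_] //; rewrite /thc deriv0 !(mulr0, mul0r) addr0.
Qed.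
Lemma inA_theta f: inA (theta f).
 by exists (fun i => thc i (rco C f i)). Qed.
Lemma thetaD f g: inA f -> inA g -> theta (f + g) = theta f + theta g.
 move=> Af Ag; rewrite -big_split; apply: eq_bigr => i _ /=. have := @rco_lin _ _ _ _ C i 1 f g Af Ag (ltn_ord i).
by rewrite rmorph1 mul1r scale1r => ->; rewrite thcD evxD mulrDl.
Qed.
Lemma theta0: theta 0 = 0.
 by have := thetaD (inA0 C) (inA0 C); rewrite addr0 => /eqP; rewrite -subr_eq0 opprD addNKr oppr_eq0 => /eqP. Qed.
Lemma theta_bigsum (I: Type) (l: seq I) (P: pred I) (G: I -> F) : (forall i, P i -> inA (G i)) ->
 theta (\sum_(i <- l | P i) G i) = \sum_(i <- l | P i) theta (G i).
 move=> h; suff [] : inA (\sum_(i <- l | P i) G i) /\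
theta (\sum_(i <- l | P i) G i) = \sum_(i <- l | P i) theta (G i) by [].
elim/big_rec2: _ => [|i f g Pi [Ag e]]; first by split; [apply: inA0|apply: theta0].
by split; [apply: inAD => //; apply: h|rewrite thetaD ?e //; apply: h].
Qed.
(** The exponents are recovered by comparing orders at the branch point over x = 0 and at oo. *)
Lemma mM_exp i j: exists e e', [/\ m i * m j = x ^+ e * (x - 1) ^+ e' * m (i + j),
 (d * e + a * (i + j) %% d = a * i %% d + a * j %% d)%N &
 (d * e' + b * (i + j) %% d = b * i %% d + b * j %% d)%N].
 have [e [e' h]] := mM C i j; exists e, e'.
have E: m i ^+ d * m j ^+ d = (x ^+ e) ^+ d * ((x - 1) ^+ e') ^+ d * m (i + j) ^+ d.
by rewrite -[X in _ = X * _]exprMn -[RHS]exprMn -h [RHS]exprMn.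
have hx := x_unit C; have hx1 := x1_unit C; have [P Px] := exists_branch C.
have [Pd _] := branch_xy Px; have d0 := d_gt0 C. have Px1: P (x - 1) = 0.
have [_]: 1 - x != 0 /\ P (1 - x) = 0; last by rewrite -dvN opprB.
by apply: (@sub1_unit _ P 1) => //; rewrite addrC addKr vgeN vgeE // Pd; move: d0; clia.
have oox1: oo (x - 1) = - d%:Z. by rewrite x1E oo_ev -?size_poly_eq0 -?polyC1 size_XsubC ?muln1.
move: E; rewrite !m_expd -!exprM => E. have E1 := congr1 P E; have E2 := congr1 oo E.
rewrite !dvM // !dvX // Px1 Pd in E1. rewrite !dvM // !dvX // oox1 oo_x in E2. split=> //.
move: E1; rewrite !mulr0 !addr0 -!mulrDl => /mulIf hh.
by have := hh ltac:(by move: d0; clia); move: (_ %% _)%N (_ %% _)%N (_ %% _)%N => u1 u2 u3; clia.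
have h1: forall k : nat, k%:Z * - d%:Z = - (k%:Z * d%:Z) by move=> k; rewrite mulrN.
move: E1 E2; rewrite !mulr0 !addr0 !h1 -!opprD => E1 /oppr_inj; rewrite -!mulrDl => /mulIf hh.
move: E1; rewrite -!mulrDl => /mulIf hh1. have := hh ltac:(by move: d0; clia); have := hh1 ltac:(by move: d0; clia).
by move: ((b * i) %% d)%N ((b * j) %% d)%N ((b * (i + j)) %% d)%N => w1 w2 w3; clia.
Qed.
Lemma thcM (i j k e e': nat) r s : (d%:R : kap) != 0 ->
 (d * e + a * k %% d = a * i %% d + a * j %% d)%N ->
 (d * e' + b * k %% d = b * i %% d + b * j %% d)%N ->
 thc k (r * s * ('X ^+ e * ('X - 1) ^+ e')) =
 'X ^+ e * ('X - 1) ^+ e' * (thc i r * s + r * thc j s).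
 move=> d0 h1 h2; rewrite /thc. have D1: (d%:R^-1)%:P * d%:R = 1 :> {poly kap} by rewrite -polyC_natr -polyCM mulVf.
have dX (c: {poly kap}) n : c * (c ^+ n)^`() = n%:R * c ^+ n * c^`().
by rewrite deriv_exp -mulr_natl; case: n => [|n]; rewrite ?mul0r ?mulr0 //= exprS; ring.
have eX: 'X * ('X ^+ e)^`() = e%:R * 'X ^+ e :> {poly kap} by rewrite dX derivX mulr1.
have eX1: ('X - 1) * (('X - 1) ^+ e')^`() = e'%:R * ('X - 1) ^+ e' :> {poly kap}.
by rewrite dX derivB derivX derivC subr0 mulr1. have cast (u n k' i' j': nat) : (d * n + k' = i' + j')%N ->
n%:R = (d%:R^-1)%:P * (i'%:R + j'%:R - k'%:R) :> {poly kap}.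
by move=> h; rewrite -natrD -h natrD addrK natrM mulrA D1 mul1r.
rewrite !derivM; move: eX eX1; rewrite (cast 0%N _ _ _ _ h1) (cast 0%N _ _ _ _ h2).
move: ((a * i %% d)%:R) ((a * j %% d)%:R) ((a * k %% d)%:R) => a1 a2 a3.
move: ((b * i %% d)%:R) ((b * j %% d)%:R) ((b * k %% d)%:R) => b1 b2 b3. move: ((d%:R^-1)%:P) => D.
move: ('X ^+ e) ('X ^+ e)^`() (('X - 1) ^+ e') (('X - 1) ^+ e')^`() => X1 X2 Y1 Y2 eX eY.
transitivity (('X - 1) * (r * s) * Y1 * ('X * X2) + 'X * (r * s) * X1 * (('X - 1) * Y2) +
'X * ('X - 1) * ((r^`() * s + r * s^`()) * (X1 * Y1)) +
D * (r * s * (X1 * Y1)) * (a3 * ('X - 1) + b3 * 'X)); first by ring. by rewrite eX eY; ring.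
Qed.
Lemma thetaM f g: (d%:R : kap) != 0 -> inA f -> inA g -> theta (f * g) = theta f * g + f * theta g.
 move=> d0 Af Ag; rewrite [X in theta (X * _)](rco_sum Af) [X in theta (_ * X)](rco_sum Ag).
rewrite [X in _ * X + _](rco_sum Ag) [X in _ + X * _](rco_sum Af) [in RHS]/theta.
rewrite mulr_suml [X in _ = _ + X]mulr_suml theta_bigsum => [|i _]; last first.
by apply: inAM; [apply: inA_evM (inA_m _ _)|apply: inA_sum => j _; apply: inA_evM (inA_m _ _)].
rewrite mulr_suml -big_split; apply: eq_bigr => i _ /=.
rewrite !mulr_sumr theta_bigsum => [|j _]; last by apply: inAM; apply: inA_evM (inA_m _ _).
rewrite -big_split; apply: eq_bigr => j _ /=.
have [e [e' [h1 h2 h3]]] := mM_exp i j; set r := rco C f i; set s := rco C g j.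
have ->: ev r * m i * (ev s * m j) = ev (r * s * ('X ^+ e * ('X - 1) ^+ e')) * m (i + j).
by rewrite !evxM !evxXn evxX -x1E mulrACA h1; ring.
have am (c k: nat) : (c * (k %% d) %% d = c * k %% d)%N by rewrite modnMmr.
rewrite theta_mono (@thcM i j _ e e') ?am // !evxM !evxXn evxX -x1E evxD !evxM.
have ->: x ^+ e * (x - 1) ^+ e' * (ev (thc i r) * ev s + ev r * ev (thc j s)) * m (i + j) =
(ev (thc i r) * ev s + ev r * ev (thc j s)) * (m i * m j) by rewrite h1; ring. by ring.
Qed.
Lemma theta1: (d%:R : kap) != 0 -> theta 1 = 0.
 by move=> d0; have := thetaM d0 (inA1 C) (inA1 C); rewrite !(mulr1, mul1r) -{1}[theta 1]addr0 => /addrI.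
Qed.
Lemma thetaX f n: (d%:R : kap) != 0 -> inA f -> theta (f ^+ n) = n%:R * f ^+ n.-1 * theta f.
 move=> d0 Af; elim: n => [|n IH]; first by rewrite theta1 ?mul0r. rewrite exprS thetaM ?IH //; last exact: inAX.
by case: n {IH} => [|n] /=; rewrite ?exprS ?mulrS; ring.
Qed.
Lemma theta_del f: inA f -> theta (del C f) = del C (theta f).
 move=> Af; pose r i := zet C ^+ i *: rco C f i. have ->: del C f = \sum_(i < d) ev (r i) * m i.
rewrite {1}(rco_sum Af) rmorph_sum; apply: eq_bigr => i _.
by rewrite rmorphM del_ev del_m /r -mul_polyC evxM evxC rmorphXn; ring.
rewrite theta_sum rmorph_sum; apply: eq_bigr => i _.
by rewrite rmorphM del_ev del_m /r thcZ -mul_polyC evxM evxC rmorphXn; ring.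
Qed.
(** The derivation raises the degree in x of each coefficient by at most one, and x has pole order
    d. *)
Lemma theta_pole f (n: nat) : inA f -> vge oo (- n%:Z) f -> vge oo (- (n + d)%N%:Z) (theta f).
 move=> Af of_; apply: vge_sum => i _; have := oo_pr of_ (ltn_ord i); rewrite rcoP //.
set r := rco C f i; have [->|r0] := eqVneq r 0; first by rewrite /thc deriv0 !(mulr0, mul0r) addr0 evx0 mul0r !vge0.
have [->|t0] := eqVneq (thc i r) 0; first by rewrite evx0 mul0r !vge0. rewrite !vgeE ?evm_neq0 // !oo_ev_m //.
have : (size (thc i r) <= (size r).+1)%N.
rewrite /thc; apply: leq_trans (size_polyD _ _) _; rewrite geq_max; apply/andP; split.
have sd := lt_size_deriv r0; apply: leq_trans (size_polyMleq _ _) _.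
have : (size ('X * ('X - 1) : {poly kap})%R <= 3)%N.
by apply: leq_trans (size_polyMleq _ _) _; rewrite size_polyX -polyC1 size_XsubC. by move: sd; clia.
rewrite -mulrA mul_polyC; apply: leq_trans (size_scale_leq _ _) _. apply: leq_trans (size_polyMleq _ _) _.
have : (size (((a * i) %% d)%:R * ('X - 1) + ((b * i) %% d)%:R * 'X : {poly kap})%R <= 2)%N.
apply: leq_trans (size_polyD _ _) _; rewrite geq_max -!polyC_natr !mul_polyC.
by rewrite !(leq_trans (size_scale_leq _ _)) // ?size_polyX // -polyC1 size_XsubC.
have h (u1 u2: nat) : (u1 <= 2 -> (u2 + u1).-1 <= u2.+1)%N by clia. exact: h.
by rewrite -size_poly_gt0 in r0; move: r0; cnia.
Qed.
Lemma local_frac Q f: fpl Q -> vge Q 0 f -> exists u, [/\ inA u, u != 0, Q u = 0 & inA (u * f)].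
 move=> fQ hf; have [u [Au u0 Qu hu]] := clear_poles f [::] fQ; exists u; split=> //.
apply/inAP => R fR; have [->|RQ] := eqVneq R Q; last exact: (hu R fR RQ). by apply: vgeM0 => //; rewrite vgeE // Qu.
Qed.

Variable p: nat.
Hypotheses (p_pr: prime p) (pK: (p%:R : kap) = 0) (d0: (d%:R : kap) != 0).

Let pF: (p%:R : F) = 0. Proof. by rewrite -(rmorph_nat (cst C)) pK rmorph0. Qed.
Lemma theta_mulXp f g: inA f -> inA g -> theta (f ^+ p * g) = f ^+ p * theta g.
 by move=> Af Ag; rewrite (thetaM d0 (inAX p Af) Ag) (thetaX p d0 Af) pF !mul0r add0r. Qed.
(** Near Q the function e is a p-th power times a unit, and [theta] treats p-th powers as constants.
    The unit is written c1 / c2 with c1 and c2 in A, where [theta] is defined. *)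
Lemma logder_regular e: inA e -> e != 0 -> (forall Q, fpl Q -> (p %| Q e)%Z) ->
 inA (theta e / e).
 move=> Ae e0 he; apply/inAP => Q fQ; have /dvdzP[k Qe] := he Q fQ. have p0 := prime_gt0 p_pr. have k0: 0 <= k.
by have := vge_inA Ae fQ; rewrite vgeE // Qe; move: p0; cnia. have [t t0 Qt] := dv_surj Q.
have [|u [Au u0 Qu Aut]] := @local_frac Q (t ^+ `|k|) fQ. by rewrite vgeE // dvX // Qt; clia.
have [|c2 [Ac2 c20 Qc2 Ac1]] := @local_frac Q (e / (u * t ^+ `|k|) ^+ p) fQ. rewrite vgeE //.
rewrite dv_div // dvX //. by rewrite dvM // dvX // Qt Qu Qe add0r mulr1 gez0_abs // mulrC subrr.
set s := u * t ^+ `|k| in Aut Ac1; have s0: s != 0 by rewrite mulf_neq0.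
set c1 := c2 * _ in Ac1; have c1E: c2 * e = s ^+ p * c1. by rewrite /c1 mulrCA [_ * (e / _)]mulrC divfK.
have c10: c1 != 0 by rewrite mulf_neq0 // mulf_neq0. have Qc1: Q c1 = 0.
have := congr1 Q c1E; rewrite (dvM _ c20 e0) (dvM _ (expf_neq0 p s0) c10) (dvX _ _ s0) {1}/s (dvM _ u0 (expf_neq0 _ t0)) (dvX _ _ t0) Qt Qu Qc2 Qe.
by rewrite !add0r mulr1 gez0_abs // mulrC => /eqP; rewrite -subr_eq0 opprD addNKr oppr_eq0 => /eqP.
have := congr1 theta c1E; rewrite theta_mulXp // thetaM // => eq.
have ->: theta e / e = theta c1 / c1 - theta c2 / c2. apply: (mulfI (_: c2 * e != 0)); first by [].
transitivity (c2 * theta e); first by field; rewrite e0.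
rewrite -[c2 * theta e](addKr (theta c2 * e)) eq mulrBr {1}c1E. by field; rewrite c10 c20.
by apply: vgeB; rewrite vge_div // ?Qc1 ?Qc2 addr0; apply: vge_inA fQ; apply: inA_theta.
Qed.
(** The eigenfunctions for zeta in A are the polynomials in x times y, and y already has pole order
    d + 1. *)
Lemma eigen_low_zero f: inA f -> del C f = cst C (zet C) * f -> vge oo (- d%:Z) f -> f = 0.
 move=> Af ef of_; rewrite (rco_sum Af); apply: big1 => i _. have e1: rco C f i * ((zet C ^+ i)%:P - (zet C)%:P) = 0.
have := congr1 (fun g => rco C g i) ef; have := @rco_lin _ _ _ _ C i (zet C) 0 f (inA0 C) Af (ltn_ord i).
rewrite add0r => -> /eqP; rewrite -subr_eq0 => /eqP h. have r0: rco C 0 i = 0.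
by have := rco_unique C (fun=> 0) (ltn_ord i); rewrite big1 // => j _; rewrite evx0 mul0r.
have rd: rco C (del C f) i = zet C ^+ i *: rco C f i.
have ->: del C f = \sum_(j < d) ev (zet C ^+ j *: rco C f j) * m j.
rewrite {1}(rco_sum Af) rmorph_sum; apply: eq_bigr => j _.
by rewrite rmorphM del_ev del_m -mul_polyC evxM evxC rmorphXn; ring.
by rewrite (rco_unique C (fun j => zet C ^+ j *: rco C f j)).
by move: h; rewrite rd r0 add0r -!mul_polyC => h; rewrite mulrBr mulrC [X in _ - X]mulrC.
move/eqP: e1; rewrite mulf_eq0 => /orP[/eqP->|]; first by rewrite evx0 mul0r.
rewrite -polyCB polyC_eq0 subr_eq0 -{2}[zet C]expr1 (eq_prim_root_expr (sc_zet C)) => /eqP hi.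
have hd: (1 < d)%N by have := sc_a C; clia. have i1: i = 1%N :> nat by move: hi; rewrite !modn_small.
have := oo_pr of_ (ltn_ord i); rewrite rcoP //; have [->|r0] := eqVneq (rco C f i) 0; first by rewrite evx0 mul0r.
rewrite vgeE ?evm_neq0 // oo_ev_m // i1 => hh; exfalso; move: hh. have ->: pm d a 1 = d.+1.
by rewrite /pm !muln1 mul1n; have [h1 h2 h3 h4] := ad_bounds C; rewrite !divn_small ?muln0 ?subn0.
by move: (d * _)%N => k; clia.
Qed.

Hypotheses (p1d: (p = 1 %[mod d])%N) (perf: forall u : kap, exists w : kap, w ^+ p = u).

Lemma frob_sum (L: comNzRingType) (I: finType) (G: I -> L) : (p%:R : L) = 0 ->
 (\sum_i G i) ^+ p = \sum_i G i ^+ p.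
 move=> pL; have pc: p \in [pchar L] by rewrite inE p_pr pL eqxx.
elim/big_rec2: _ => [|i f g _ <-]; first by rewrite expr0n eqn0Ngt prime_gt0. by rewrite exprDn_pchar // pnatE.
Qed.
Lemma poly_root (c: {poly kap}) : c^`() = 0 -> exists s : {poly kap}, s ^+ p = c.
 move=> c'; have [r hr] := choice perf; exists (\poly_(i < size c) r c`_(p * i)). have p0 := prime_gt0 p_pr.
rewrite poly_def frob_sum -?polyC_natr ?pK //; apply/polyP => k; rewrite coef_sum.
have cz j: ~~ (p %| j)%N -> c`_j = 0.
case: j => [|j]; rewrite ?dvdn0 // => nj; have := congr1 (fun q: {poly kap} => q`_j) c'.
rewrite coef_deriv coef0 -mulr_natr => /eqP; rewrite mulf_eq0 => /orP[/eqP//|].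
have pc: p \in [pchar kap] by rewrite inE p_pr pK eqxx. by rewrite -(dvdn_pcharf pc) (negPf nj).
have term (i: 'I_(size c)) : ((r c`_(p * i) *: 'X^i) ^+ p)`_k = if (p * i == k)%N then c`_k else 0.
by rewrite exprZn hr -exprM coefZ coefXn [(i * p)%N]mulnC eq_sym; case: eqP => [<-|_]; rewrite ?mulr1 ?mulr0.
under eq_bigr do rewrite term; have [pk|npk] := boolP (p %| k)%N; last first.
by rewrite cz // big1 // => i _; case: eqP.
have [lt|ge] := ltnP k (size c); last by rewrite nth_default // big1 // => i _; case: eqP.
have lt': (k %/ p < size c)%N by apply: leq_ltn_trans (leq_div _ _) lt.
rewrite (bigD1 (Ordinal lt')) //= mulnC divnK // eqxx big1 ?addr0 // => i.
rewrite -val_eqE /= => ne; case: eqP => // e; case/eqP: ne; by rewrite -e mulKn.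
Qed.
(** With p = D d + 1 and [m i]^d = x^u (x - 1)^w, one has [m i]^p = x^(D u) (x - 1)^(D w) [m i].
    Since D = -1/d in characteristic p, the hypothesis says that the coefficients of (x (x - 1))^p e
    with respect to the [m i]^p have zero derivative; they are then p-th powers. *)
Lemma theta_root e: inA e -> theta e = 0 -> exists f, f ^+ p = e.
 move=> Ae te; have p0 := prime_gt0 p_pr. have hr (i: 'I_d) : thc i (rco C e i) = 0.
by have := rco_unique C (fun i => thc i (rco C e i)) (ltn_ord i); rewrite -/(theta e) te => <-;
have := rco_unique C (fun=> 0) (ltn_ord i); rewrite big1 // => j _; rewrite evx0 mul0r.
have [D pD]: exists D, p = (D * d).+1.
exists (p.-1 %/ d)%N; rewrite divnK ?prednK //; move: p1d => /eqP; rewrite eqn_mod_dvd ?subn1 //.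
pose al (i: nat) := (D * (a * i %% d))%N; pose be (i: nat) := (D * (b * i %% d))%N.
have le (c i: nat) : (D * (c * i %% d) <= p)%N. by rewrite pD ltnW // ltnS leq_mul2l ltnW ?orbT // (lmod_lt C).
have Dd: (D%:R * d%:R : kap) = -1. by have := pK; rewrite pD -addn1 natrD natrM => /eqP; rewrite addr_eq0 => /eqP.
pose c (i: 'I_d) := 'X ^+ (p - al i) * ('X - 1) ^+ (p - be i) * rco C e i. have dc i: (c i)^`() = 0.
have X0: 'X * ('X - 1) != 0 :> {poly kap} by rewrite mulf_neq0 ?polyX_eq0 ?polyXsubC_eq0.
apply: (mulfI X0); rewrite mulr0. have dX (q: {poly kap}) n : q * (q ^+ n)^`() = n%:R * q ^+ n * q^`().
by rewrite deriv_exp -mulr_natl; case: n => [|n]; rewrite ?mul0r ?mulr0 //= exprS; ring.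
have cn n: (n <= p)%N -> (p - n)%:R = - n%:R :> {poly kap}. by move=> h; rewrite natrB // -[p%:R]polyC_natr pK sub0r.
have eX: 'X * ('X ^+ (p - al i))^`() = - (al i)%:R * 'X ^+ (p - al i) :> {poly kap}.
by rewrite dX derivX mulr1 cn ?le.
have eX1: ('X - 1) * (('X - 1) ^+ (p - be i))^`() = - (be i)%:R * ('X - 1) ^+ (p - be i) :> {poly kap}.
by rewrite dX derivB derivX derivC subr0 mulr1 cn ?le. have Dinv: D%:R = - (d%:R^-1)%:P :> {poly kap}.
by rewrite -polyC_natr -polyCN; congr _%:P; apply: (mulIf d0); rewrite Dd mulNr mulVf.
move: eX eX1; rewrite /c /al /be !natrM Dinv !derivM; have := hr i; rewrite /thc.
move: ((a * i %% d)%:R) ((b * i %% d)%:R) ((d%:R^-1)%:P) => a1 b1 dd.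
move: ('X ^+ _) ('X ^+ _)^`() (('X - 1) ^+ _) (('X - 1) ^+ _)^`() => X1 X2 Y1 Y2 h eX eY.
transitivity (('X - 1) * rco C e i * Y1 * ('X * X2) + 'X * rco C e i * X1 * (('X - 1) * Y2) +
'X * ('X - 1) * (rco C e i)^`() * (X1 * Y1)); first by ring.
rewrite eX eY; transitivity (X1 * Y1 * ('X * ('X - 1) * (rco C e i)^`() +
dd * rco C e i * (a1 * ('X - 1) + b1 * 'X))); first by ring. by rewrite h mulr0.
have [S hS] := choice (fun i => poly_root (dc i)). exists ((\sum_i ev (S i) * m i) / (x * (x - 1))).
rewrite expr_div_n frob_sum //; apply: (mulIf (_: (x * (x - 1)) ^+ p != 0)); first by rewrite expf_neq0 ?mulf_neq0 ?x_unit ?x1_unit.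
rewrite divfK ?expf_neq0 ?mulf_neq0 ?x_unit ?x1_unit // {1}(rco_sum Ae) mulr_suml.
apply: eq_bigr => i _; rewrite [LHS]exprMn -evxXn hS /c !evxM !evxXn evxX -x1E.
have ->: m i ^+ p = x ^+ al i * (x - 1) ^+ be i * m i.
by rewrite pD exprSr mulnC exprM m_expd [in LHS]exprMn -!exprM /al /be ![(D * _)%N]mulnC.
have eA: x ^+ (p - al i) * x ^+ al i = x ^+ p by rewrite -exprD subnK ?le.
have eB: (x - 1) ^+ (p - be i) * (x - 1) ^+ be i = (x - 1) ^+ p by rewrite -exprD subnK ?le.
transitivity ((x ^+ (p - al i) * x ^+ al i) * ((x - 1) ^+ (p - be i) * (x - 1) ^+ be i) * ev (rco C e i) * m i); first by ring.
by rewrite eA eB exprMn; ring.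
Qed.
Lemma frob_inj (f g: F) j : f ^+ (p ^ j) = g ^+ (p ^ j) -> f = g.
 elim: j => [|j IH]; first by []. rewrite expnSr !exprM => h; apply: IH; apply/eqP; rewrite -subr_eq0.
have : (f ^+ (p ^ j) - g ^+ (p ^ j)) ^+ p = 0. have pc: p \in [pchar F] by rewrite inE p_pr pF eqxx.
by rewrite exprDn_pchar ?pnatE // exprNn_pchar ?pnatE // h subrr. by move/eqP; rewrite expf_eq0 => /andP[_].
Qed.
Lemma perf_iter j (u: kap) : exists w : kap, w ^+ (p ^ j) = u.
 elim: j u => [|j IH] u; first by exists u; rewrite expr1.
by have [s <-] := perf u; have [r <-] := IH s; exists r; rewrite expnSr exprM.
Qed.

(* The logarithmic derivative of a root e of f is an eigenvector regular off
   infinity, of pole order at most d, hence zero. *)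
Lemma eigen_power f (n: nat) (u c: F) (z: nat) : inA f -> f != 0 ->
 (forall Q, fpl Q -> ((p ^ n)%N %| Q f)%Z) -> (exists w: kap, c = cst C w) -> c != 0 ->
 del C f = c * f ^+ z * u ^+ (p ^ n) -> (z%:R : kap) = zet C ->
 exists e, e ^+ (p ^ n) = f.
 move=> Af f0 hf [s cE] c0 df zz; have p0 := prime_gt0 p_pr. have step j: (j <= n)%N -> exists e, e ^+ (p ^ j) = f.
elim: j => [_|j IH jn]; first by exists f; rewrite expn0 expr1.
have [e he] := IH (ltnW jn); suff [g hg] : exists g, g ^+ p = e. by exists g; rewrite expnS exprM hg.
have pj0: (0 < p ^ j)%N by rewrite expn_gt0 p0.
have e0: e != 0 by apply: contraNneq f0 => e0; rewrite -he e0 expr0n eqn0Ngt pj0.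
have Ae: inA e by apply: (@inA_root _ _ _ _ C _ (p ^ j).-1); rewrite prednK // he. have pe Q: fpl Q -> (p %| Q e)%Z.
move=> fQ; have := hf Q fQ; rewrite -he dvX // -(subnK jn) addnS -addSn expnD mulnC PoszM.
rewrite dvdz_mul2l -?lt0n //; apply: dvdz_trans. by rewrite expnS PoszM dvdz_mulr.
have Ar := logder_regular Ae e0 pe; apply: theta_root => //.
suff r0 : theta e / e = 0 by apply/eqP; move/eqP: r0; rewrite mulf_eq0 invr_eq0 (negPf e0) orbF.
apply: eigen_low_zero => //; last first. rewrite vge_div //; have := theta_pole Ae (_: vge oo (- `|oo e|%N%:Z) e).
rewrite vgeE // => /(_ _); have := oo_inA_le0 Ae e0; move: (oo e) (theta e) => k t.
by move=> le h; apply: vgeW (h _); move: le; clia. have [s1 hs1] := perf_iter j s; pose u1 := u ^+ (p ^ (n - j.+1)).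
(* The p^j-th power of this relation is the given one for f; injectivity of Frobenius extracts the
   root, and perfection supplies the constant. *)
have de: del C e = cst C s1 * e ^+ z * u1 ^+ p.
apply: (@frob_inj _ _ j); rewrite -rmorphXn he df [RHS]exprMn [X in _ = X * _]exprMn -(rmorphXn (cst C)) hs1 -cE.
congr (_ * _ * _); first by rewrite -exprM mulnC exprM he. by rewrite /u1 -!exprM -mulnA -expnS -expnD subnK.
have u10: u1 != 0. apply: contraTneq (_: del C e != 0) => [u0|]; last by [].
by rewrite de u0 expr0n eqn0Ngt p0 mulr0 eqxx. have s10: cst C s1 != 0.
apply: contraTneq (_: del C e != 0) => [s0|]; last by []. by rewrite de s0 !mul0r eqxx.
(* [theta] is a derivation on A only, so the denominator of u1 is cleared; it enters as a p-th power
   and acts as a constant. *)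
have [w [k k0 [Aw uE]]] := fracA C u1. have kE: ev k != 0 by rewrite ev0.
have : ev k ^+ p * del C e = w ^+ p * (cst C s1 * e ^+ z). by rewrite de uE expr_div_n; field; rewrite expf_neq0.
move/(congr1 theta); rewrite (theta_mulXp (inA_ev C k) (inA_del Ae)) (theta_mulXp Aw (inAM (inA_cst C s1) (inAX z Ae))).
rewrite (thetaM d0 (inA_cst C s1) (inAX z Ae)) (thetaX z d0 Ae) (theta_del Ae). have tc: theta (cst C s1) = 0.
rewrite -[cst C s1]mulr1 -(m0 C) -(evxC (cst C) x) theta_mono mod0n.
by rewrite /thc derivC !muln0 mod0n !(mulr0, mul0r, addr0) evx0 mul0r. rewrite tc mul0r add0r => eq.
have dk: ev k ^+ p * del C e = w ^+ p * (cst C s1 * e ^+ z). by rewrite de uE expr_div_n; field; rewrite expf_neq0.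
rewrite rmorphM fmorphV; apply: (mulfI (_: ev k ^+ p * del C e != 0)); first by [].
transitivity (ev k ^+ p * del C (theta e)); first by field. rewrite eq dk -zz rmorph_nat.
case: (z) => [|z'] /=; first by rewrite mulr0n !mul0r !mulr0. by rewrite exprS; field. exact: step.
Qed.

End Derivation.

(** * Functions whose leading coefficient at infinity is a unit *)

Section UnitLeading.
Variables (d a: nat) (K F: fieldType) (C: scurve d a K F) (v: dval K) (w: dval F)
 (B: scurve d a (resf v) (resf w)) (R: reduction C B).
Notation inA := (inA C).
Notation oo := (oo C).
Implicit Types (f g h: F) (j k n: nat).

(** Functions whose pole order survives reduction; their leading coefficient at oo is a unit, see
    [ul_crd]. As denominators they keep expansions at oo integral. *)
Definition ul j f := [/\ inA f, vge w 0 f, vge oo (- j%:Z) f, rd w f != 0 & Inf.oo B (rd w f) = - j%:Z].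

Lemma ul_neq0 j f: ul j f -> f != 0 /\ w f = 0.
 by move=> [_ wf _ rf _]; apply: rd_neq0. Qed.
Lemma ul_oo j f: ul j f -> oo f = - j%:Z.
 move=> [Af wf of_ rf e]; have f0: f != 0 by apply: contraNneq rf => ->; rewrite rd0.
have le := oo_inA_le0 Af f0; have := oo_rd R Af wf (_: vge oo (- `|oo f|%N%:Z) f).
rewrite !vgeE // e => h; move: of_; rewrite vgeE //. by have := h ltac:(by move: le; clia); move: le; clia.
Qed.
Lemma ulM j k f g: ul j f -> ul k g -> ul (j + k) (f * g).
 move=> hf hg; have [f0 wf] := ul_neq0 hf; have [g0 wg] := ul_neq0 hg.
case: hf hg => [Af vf of_ rf e] [Ag vg og rg e']; split.
- exact: inAM.
- exact: vgeM0.
- by have := vgeM of_ og; apply: vgeW; clia.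
- by rewrite rdM // mulf_neq0.
- by rewrite rdM // dvM // e e'; clia.
Qed.
Lemma ul1: ul 0 1.
 by split; rewrite ?oner_neq0 ?vge1 ?dv1 //; apply: inA1. Qed.
Lemma ulX j n f: ul j f -> ul (n * j) (f ^+ n).
 move=> h; elim: n => [|n IH]; first by rewrite expr0; apply: ul1. by rewrite exprS; apply: ulM.
Qed.
Lemma ul_root j n f: (0 < n)%N -> ul (n * j) (f ^+ n) -> ul j f.
 move=> n0 [Af wf of_ rf e]. have Af': inA f by apply: (@inA_root _ _ _ _ C _ n.-1); rewrite prednK.
have nn (W: dval F) (k: int) : vge W (k *+ n) (f ^+ n) = vge W k f. by rewrite (vgeXr W k n.-1) prednK.
have wf': vge w 0 f by rewrite -nn mul0rn.
split=> //; first by rewrite -nn; move: of_; rewrite -mulr_natl natz; apply: vgeW; clia.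
by apply: contraNneq rf => e0; rewrite rdX // e0 expr0n eqn0Ngt n0.
move: e rf; rewrite rdX // => + rf; have r0: rd w f != 0.
by apply: contraNneq rf => e0; rewrite e0 expr0n eqn0Ngt n0. by rewrite dvX //; move: n0 (Inf.oo B _); cnia.
Qed.
Lemma ul_cst u: u != 0 -> v u = 0 -> ul 0 (cst C u).
 move=> u0 vu; have hu: vge v 0 u by rewrite vgeE // vu. have r0: rd v u != 0 by rewrite rd_eq0 // vgeE // vu.
split; rewrite ?(wcst R) ?vge_cst -?(rd_cst R) ?pv_cst //; exact: inA_cst.
Qed.
Lemma ul_del j f: ul j f -> ul j (del C f).
 move=> [Af wf of_ rf e]; split; first exact: inA_del.
- by rewrite (wdel R).
- by move: of_; rewrite /vge fmorph_eq0 oo_del.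
- by rewrite -(rd_del R) // fmorph_eq0.
- by rewrite -(rd_del R) // oo_del.
Qed.
Lemma ul_x: ul d (cx C).
 split; [exact: inA_x| |by rewrite vgeE ?oo_x| |].
- exact: (gauss_x (rd_gauss R)).
- by rewrite -(rd_x R) x_unit.
- by rewrite -(rd_x R) oo_x.
Qed.
Lemma ul_y: ul d.+1 (cy C).
 split; [exact: inA_y| |by rewrite vgeE ?oo_y //; clia| |].
- exact: (gauss_y (rd_gauss R)).
- by rewrite -(rd_y R) y_unit.
- by rewrite -(rd_y R) oo_y; clia.
Qed.

(** Substitutes for the invertible functions on a formal model of the curve: [cunit] off oo,
    invertible modulo every power of the uniformizer by [cunit_inv], and [funit] near oo. *)
Definition cunit f := [/\ inA f, vge w 0 f & exists2 u, u != 0 & rd w f = cst B u].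
Definition funit f := exists j, exists g, exists2 h, ul j g /\ ul j h & f = g / h.

Lemma cunitM f g: cunit f -> cunit g -> cunit (f * g).
 move=> [Af wf [u u0 e]] [Ag wg [u' u'0 e']]; split; [exact: inAM|exact: vgeM0|exists (u * u')]. exact: mulf_neq0.
by rewrite rdM // e e' rmorphM.
Qed.
Lemma cunit_w f: cunit f -> f != 0 /\ w f = 0.
 by move=> [_ wf [u u0 e]]; apply: rd_neq0 => //; rewrite e fmorph_eq0. Qed.
Lemma cunitX f n: cunit f -> cunit (f ^+ n).
 move=> h; elim: n => [|n IH]; last by rewrite exprS; apply: cunitM.
by rewrite expr0; split; rewrite ?vge1 //; [apply: inA1|exists 1; rewrite ?oner_neq0 // rmorph1].
Qed.
Lemma cunit_del f: cunit f -> cunit (del C f).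
 move=> [Af wf [u u0 e]]; split; [exact: inA_del|by rewrite (wdel R)|exists u => //].
by rewrite -(rd_del R) // e sc_dcst.
Qed.
Lemma funitM f g: funit f -> funit g -> funit (f * g).
 move=> [j [g1 [h1 [? ?] ->]]] [k [g2 [h2 [? ?] ->]]].
by exists (j + k)%N, (g1 * g2), (h1 * h2); [split; apply: ulM|rewrite mulf_div].
Qed.
Lemma funitV f: funit f -> funit f^-1.
 by move=> [j [g [h [? ?] ->]]]; exists j, h, g => //; rewrite invf_div. Qed.
Lemma funit_w f: funit f -> f != 0 /\ w f = 0.
 move=> [j [g [h [/ul_neq0[g0 wg] /ul_neq0[h0 wh]] ->]]]. by rewrite // dv_div // wg wh subrr.
Qed.
Lemma funitX f n: funit f -> funit (f ^+ n).
 move=> h; elim: n => [|n IH]; last by rewrite exprS; apply: funitM.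
by exists 0%N, 1, 1; [split; apply: ul1|rewrite expr0 divr1].
Qed.
Lemma funit_del f: funit f -> funit (del C f).
 by move=> [j [g [h [? ?] ->]]]; exists j, (del C g), (del C h); [split; apply: ul_del|rewrite fmorph_div].
Qed.

(* Division by tau modulo higher and higher powers of the uniformizer. *)
Lemma approximate_factor (V S: F -> Prop) (t: F) : subsp C V -> subsp C S -> t != 0 -> w t = 0 ->
 (forall s, S s -> V (t * s)) ->
 (forall f, V f -> vge w 0 f -> exists s, [/\ S s, vge w 0 s & rd w f = rd w (t * s)]) ->
 forall n f, V f -> vge w 0 f -> exists s, [/\ S s, vge w 0 s & vge w n%:Z (f - t * s)].
 move=> sV sS t0 wt SV h n; elim: n => [|n IH] f Vf wf.
by exists 0; rewrite mulr0 subr0; split=> //; [apply: sS.1|apply: vge0].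
have wts s: vge w 0 s -> vge w 0 (t * s) by move=> hs; apply: vgeM0 => //; rewrite vgeE // wt.
have [s [Ss ws e]] := h f Vf wf; have [pi pi0 vpi] := dv_surj v. have wpi: w (cst C pi) = 1 by rewrite (w_cst R).
have := proj1 (rd_eqP wf (wts _ ws)) e => h1. have [||s' [Ss' ws' h2]] := IH ((cst C pi)^-1 * (f - t * s)).
- by rewrite -fmorphV; apply: (subspZ _ sV); apply: (subspB sV) => //; apply: SV.
- by rewrite mulrC vge_div // wpi. exists (s + cst C pi * s'); split; first exact: sS.2.
by apply: vgeD => //; apply: vgeM0 => //; rewrite vgeE // wpi.
have ->: f - t * (s + cst C pi * s') = cst C pi * ((cst C pi)^-1 * (f - t * s) - t * s').
by rewrite mulrBr mulVKf //; ring. have ->: n.+1%:Z = 1 + n%:Z by []. by apply: vgeM h2; rewrite vgeE // wpi.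
Qed.
Lemma subsp_root (h: F) (q: nat) : h != 0 -> (0 < q)%N ->
 (forall P: place C, fpl P -> (q %| P h)%Z) -> subsp C (fun f => inA (f ^+ q / h)).
 move=> h0 q0 hq; have E f: inA (f ^+ q / h) <-> forall P : place C, fpl P -> vge P (P h %/ q)%Z f.
have X (P: place C) : fpl P -> vge P (P h %/ q)%Z f = vge P (P h) (f ^+ q).
by move=> fP; rewrite (vgeXr P (P h %/ q)%Z q.-1 f) prednK // -mulr_natl natz mulrC divzK ?hq.
by rewrite inAP; split=> H P fP; have := H P fP; rewrite X // vge_div // add0r.
split=> [|u f g /E hf /E hg]; first by apply/E => P _; apply: vge0.
apply/E => P fP; apply: vgeD; [exact: hf|apply: vgeM0; [exact: vge_cst|exact: hg]].
Qed.
Lemma root_mul (h g f: F) (q: nat) : inA g -> inA (f ^+ q / h) -> inA ((f * g) ^+ q / h).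
 by move=> Ag Af; rewrite exprMn mulrAC; apply: inAM => //; apply: inAX. Qed.
(** A power of the uniformizer is moved from u into c; comparison of valuations then makes c a unit
    as well. *)
Lemma unit_eigen (f u: F) (c: K) (z q: nat) : f != 0 -> w f = 0 -> (0 < q)%N ->
 del C f = cst C c * f ^+ z * u ^+ q -> exists c u, [/\ c != 0 /\ v c = 0, u != 0 /\ w u = 0 &
 del C f = cst C c * f ^+ z * u ^+ q].
 move=> f0 wf q0 df0; have df1: del C f != 0 by [].
have u0: u != 0 by apply: contraNneq df1 => u0; rewrite df0 u0 expr0n eqn0Ngt q0 mulr0.
have c0: c != 0 by apply: contraNneq df1 => c0; rewrite df0 c0 rmorph0 !mul0r.
have [pi pi0 vpi] := dv_surj v; pose k := pi ^ (w u). have k0: k != 0 by rewrite expfz_neq0.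
have wk: w (cst C k) = w u by rewrite (w_cst R) dvXz // vpi mulr1.
have wu': w (u / cst C k) = 0 by rewrite dv_div // wk subrr.
have e: del C f = cst C (c * k ^+ q) * f ^+ z * (u / cst C k) ^+ q.
by rewrite df0 rmorphM rmorphXn expr_div_n; field; rewrite expf_neq0.
exists (c * k ^+ q), (u / cst C k); split=> //; first split.
- by [].
- have n1: cst C (c * k ^+ q) != 0 by []. have n2: u / cst C k != 0 by [].
have := congr1 w e; rewrite (w_del R) wf (dvM _ (mulf_neq0 n1 (expf_neq0 z f0)) (expf_neq0 q n2)).
by rewrite (dvM _ n1 (expf_neq0 z f0)) (dvX _ _ f0) (dvX _ _ n2) wf wu' !mulr0 !addr0 (w_cst R).
Qed.

End UnitLeading.

(** * Exchanging f for a function whose pole order survives reduction *)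

Section Model.
Variables (d a: nat) (K F: fieldType) (C: scurve d a K F) (v: dval K) (w: dval F)
 (B: scurve d a (resf v) (resf w)) (R: reduction C B).
Notation inA := (inA C).
Notation oo := (oo C).
Notation T := (T C).
Notation ul := (@ul _ _ _ _ C v w B).
Implicit Types (f g h: F).

(** Up to q-th powers, [md_al] represents the inverse of f. Unlike f it keeps its pole order under
    reduction, where it becomes the q-th power of [md_nu]; so by [md_lift] the multiples of [md_nu]
    lift to functions h with h^q / [md_al] regular, without loss in the pole order. *)
Record model (f: F) (q N: nat) := Model {
 md_g : F; md_al : F; md_nu : resf w; md_m : nat; md_nb : nat;
 md_f0 : f != 0; md_q0 : (0 < q)%N; md_qf : forall P : place C, fpl P -> (q %| P f)%Z;
 md_gE : md_g ^+ q = f * md_al;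
 md_g0 : md_g != 0; md_wg : w md_g = 0; md_og : oo md_g = - (md_m + N)%N%:Z;
 md_obg : Inf.oo B (rd w md_g) = - (md_m + md_nb)%N%:Z;
 md_ul : ul (q * md_m) md_al;
 md_A : Curve.inA B md_nu; md_rg : Curve.inA B (rd w md_g / md_nu);
 md_rd : rd w md_al = md_nu ^+ q;
 md_nu0 : md_nu != 0; md_onu : Inf.oo B md_nu = - md_m%:Z;
 md_lift : exists M0, forall M, (M0 <= M)%N -> forall gb : resf w, Curve.inA B (gb / md_nu) ->
 vge (Inf.oo B) (1 - M%:Z) gb -> exists h,
 [/\ inA (h ^+ q / md_al), vge w 0 h, vge oo (1 - M%:Z) h & rd w h = gb] }.

(** g lifts eb nu, where nu makes the pole order large enough for [reduce_roots]; a second use of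
    that lemma, for g^q / f, gives [md_lift]. *)
Lemma exists_model (f: F) (q N: nat) (eb: resf w) : inA f -> f != 0 -> w f = 0 -> (0 < q)%N ->
 (forall P: place C, fpl P -> (q %| P f)%Z) -> oo f = - (q * N)%N%:Z ->
 eb ^+ q = rd w f -> inhabited (model f q N).
 move=> Af f0 wf q0 hq of_ ebE; have wf0: vge w 0 f by rewrite vgeE // wf.
have [nb [ofb nbN qfb [M0 hM0]]] := reduce_roots R Af f0 wf q0 hq of_.
have fb0: rd w f != 0 by rewrite rd_eq0 // vgeE // wf. have [Afb _] := rd_A R Af wf0.
have Ae: Curve.inA B eb by apply: (@inA_root _ _ _ _ B _ q.-1); rewrite prednK // ebE.
have e0: eb != 0 by apply: contraNneq fb0 => e0; rewrite -ebE e0 expr0n eqn0Ngt q0. have oe: Inf.oo B eb = - nb%:Z.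
by move: ofb; rewrite -ebE dvX //; move: q0 (Inf.oo B eb); cnia. have [M1 hM1] := pole_of_inA B.
pose mm := (M0 + M1)%N; pose M := (mm + N).+1. have [nu [Anu nu0 onu]] := hM1 mm (leq_addl _ _).
have [|||g [Ag wg og rg]] := hM0 M _ (eb * nu).
- by rewrite /M /mm; clia.
- by rewrite exprMn ebE mulrAC divff // mul1r; apply: inAX.
- by rewrite vgeE // dvM // oe onu /M; clia. have rg0: rd w g != 0 by rewrite rg mulf_neq0.
have [g0 wg0] := rd_neq0 wg rg0. pose al := g ^+ q / f; have al0: al != 0 by rewrite mulf_neq0.
have wal: vge w 0 al by rewrite vge_div // wf addr0 vge0X. have ral: rd w al = nu ^+ q.
by rewrite /al (rd_div) ?vge0X // rdX // rg exprMn ebE mulrAC divff // mul1r. have ulal: ul (q * mm) al.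
split=> //; last by rewrite ral dvX // onu; clia.
rewrite /al vge_div // of_; have := vgeX q og; apply: vgeW; rewrite -mulr_natl natz /M; cnia.
by rewrite ral expf_neq0. have oal := ul_oo R ulal. have oge: oo g = - (mm + N)%N%:Z.
by move: oal; rewrite /al dv_div // dvX // of_; move: q0 (oo g); cnia.
have qal (P: place C) : fpl P -> (q %| P al)%Z. by move=> fP; rewrite /al dv_div // dvX // rpredB ?hq // dvdz_mulr.
have [al0' wal0] := ul_neq0 ulal. have [nb2 [onb2 _ _ [M2 hM2]]] := reduce_roots R Ag al0 wal0 q0 qal oal.
have nb2E: nb2 = mm. by move: onb2; rewrite ral dvX // onu; move: q0; cnia. constructor; exists g al nu mm nb => //.
- by rewrite /al mulrC divfK.
- by rewrite rg dvM // oe onu; clia.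
- by rewrite rg mulfK. exists (M2 + mm)%N => M' hM' gb Agb ogb; apply: hM2.
- by move: hM'; clia.
- by rewrite ral -expr_div_n; apply: inAX.
- by rewrite nb2E subnK //; move: hM'; clia.
Qed.

Variables (f: F) (q N: nat) (D: model f q N).
Notation g := (md_g D).
Notation al := (md_al D).
Notation nu := (md_nu D).
Notation mm := (md_m D).

Lemma al_w: al != 0 /\ w al = 0. Proof. exact: ul_neq0 (md_ul D). Qed.
Lemma al_div (P: place C) : fpl P -> (q %| P al)%Z.
 move=> fP; have [al0 _] := al_w; have h := congr1 P (md_gE D). rewrite (dvX _ _ (md_g0 D)) (dvM _ (md_f0 D) al0) in h.
have ->: P al = (P f + P al) - P f by ring. by rewrite rpredB ?(md_qf D fP) // -h dvdz_mulr.
Qed.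
Lemma exists_sigma: exists s, [/\ inA (s ^+ q / al), vge w 0 s & rd w s = nu].
 have [M0 h] := md_lift D; have [|||s [As ws _ rs]] := h (M0 + mm).+1 _ nu.
- by clia.
- by rewrite divff ?md_nu0 //; apply: inA1.
- by rewrite vgeE ?md_nu0 // md_onu; clia. by exists s.
Qed.

Variable s: F.
Hypotheses (As: inA (s ^+ q / al)) (ws: vge w 0 s) (rs: rd w s = nu).

Lemma sigma_w: s != 0 /\ w s = 0. Proof. by apply: rd_neq0; rewrite ?rs ?md_nu0. Qed.

Lemma sigma_eigen (u: F) (c: K) (z: nat) (M: nat) : (0 < z)%N -> (0 < M)%N ->
 del C f = cst C c * f ^+ z * u ^+ q ->
 exists A1, exists2 B1, cunit C B A1 /\ funit C B B1 &
 vge w M%:Z (del C (s * T ^+ mm) - (s * T ^+ mm) ^+ z * (A1 * B1)).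
 move=> z0 Mpos df0; have q0 := md_q0 D; have [al0 wal] := al_w; have [s0 ws0] := sigma_w.
have f0 := md_f0 D; have g0 := md_g0 D. have wf: w f = 0.
have := congr1 w (md_gE D); rewrite dvX // md_wg dvM // wal mulr0 addr0 => <- //.
have {df0} [c' [u' [[c0 vc] [u0 wu] df]]] := unit_eigen R f0 wf q0 df0.
move: c' u' c0 vc u0 wu df => {}c {}u c0 vc u0 wu df. have dg0: del C g != 0 by [].
(* kp is a q-th root of c delta(al) / al^z, so [ul_root] reads its behaviour at oo off that of
   al. *)
pose kp := del C g / (u * g ^+ z); have kp0: kp != 0 by rewrite mulf_neq0. have wkp: w kp = 0.
by rewrite (dv_div w dg0 (mulf_neq0 u0 (expf_neq0 z g0))) (dvM _ u0 (expf_neq0 z g0)) (dvX _ _ g0) (w_del R) md_wg wu mulr0.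
have cc0: cst C c != 0 by []. have kpE: kp ^+ q = cst C c * del C al / al ^+ z.
rewrite expr_div_n exprMn -exprM mulnC exprM -rmorphXn md_gE rmorphM df exprMn. by field; rewrite !expf_neq0.
have wz f': f' != 0 -> w f' = 0 -> forall n : nat, vge w 0 (f' ^+ n).
by move=> h1 h2 n; apply: vge0X; rewrite vgeE // h2. have ulk: ul (mm * (1 + z * q.-1)) (kp * al ^+ z).
apply: (ul_root (n := q)) => //. have ->: (kp * al ^+ z) ^+ q = cst C c * del C al * al ^+ (z * q.-1).
have zq: (z * q = z + z * q.-1)%N by rewrite -mulnS prednK.
by rewrite exprMn kpE -exprM zq exprD; field; rewrite expf_neq0.
have := ulM (ulM (ul_cst R c0 vc) (ul_del R (md_ul D))) (ulX (z * q.-1) (md_ul D)).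
by congr (ul _ _); rewrite add0n; move: (z * q.-1)%N => e; cnia. have alz0: al ^+ z != 0 by rewrite expf_neq0.
have sV: subsp C (fun h => inA (h ^+ q / al ^+ z)).
apply: subsp_root => // P fP; rewrite dvX //; apply: dvdz_mull; exact: al_div.
(* delta(s) / kp lies in the space of h with h^q / al^z in A. That space is generated by s^z modulo
   powers of the uniformizer, because it is so after reduction. *)
have [] := @approximate_factor _ _ _ _ C v w B R (fun h => inA (h ^+ q / al ^+ z)) inA (s ^+ z)
sV _ _ _ _ _ M (del C s / kp).
- by split=> [|k f1 f2 A1 A2]; [apply: inA0|apply: inAD => //; apply: inAM => //; apply: inA_cst].
- by rewrite expf_neq0.
- by rewrite dvX // ws0 mulr0.
- move=> h Ah; apply: root_mul => //; rewrite -exprM mulnC exprM -expr_div_n; exact: inAX.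
- move=> h Ah wh; have nuz: nu ^+ z != 0 by rewrite expf_neq0 ?md_nu0. have Ab: Curve.inA B (rd w h / nu ^+ z).
apply: (@inA_root _ _ _ _ B _ q.-1); rewrite prednK //.
have [] := rd_A R Ah; first by rewrite vge_div // dvX // wal mulr0 addr0 vge0X.
rewrite (rd_div) ?vge0X ?dvX ?wal ?mulr0 // !rdX // ?vgeE ?wal // md_rd expr_div_n. by rewrite -!exprM mulnC.
have [h0|h0] := eqVneq (rd w h) 0. by exists 0; rewrite mulr0 rd0 vge0; split=> //; apply: inA0.
have b0: rd w h / nu ^+ z != 0 by []. have ob := oo_inA_le0 Ab b0.
have [|b [Ab' wb rb _]] := lift_A R Ab (n := `|Inf.oo B (rd w h / nu ^+ z)|%N). by rewrite vgeE //; move: ob; clia.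
by exists b; split=> //; rewrite rdM ?vge0X // rdX // rs rb mulrC divfK.
- rewrite expr_div_n -rmorphXn kpE.
have ->: del C (s ^+ q) / (cst C c * del C al / al ^+ z) / al ^+ z = cst C c^-1 * del C (s ^+ q / al).
have dal0: del C al != 0 by []. rewrite [in RHS]fmorph_div fmorphV; move: alz0 dal0 cc0.
move: (del C (s ^+ q)) (del C al) (al ^+ z) (cst C c) => e1 e2 e3 e4 h1 h2 h3. by field; rewrite ?h1 ?h2 ?h3.
by apply: inAM; [apply: inA_cst|apply: inA_del].
- by rewrite vge_div // wkp addr0 (wdel R). move=> b [Ab wb hb]. have Ub: cunit C B b. split=> //.
have e1: rd w (del C s / kp) = nu ^+ z * rd w b.
have h0: vge w 0 (del C s / kp) by rewrite vge_div // wkp addr0 (wdel R). have h1: vge w 0 (s ^+ z) by apply: vge0X.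
rewrite -rs -rdX // -rdM //; apply/rd_eqP => //; first exact: vgeM0. by apply: vgeW hb; move: Mpos; clia.
have rb: rd w b ^+ q = cst B (rd v c)^-1. have n0 := md_nu0 D; have dn0: del B nu != 0 by rewrite fmorph_eq0.
have vcc: vge v 0 c by rewrite vgeE // vc. have rc0: rd v c != 0 by rewrite rd_eq0 // vgeE // vc.
have ek: rd w kp ^+ q = cst B (rd v c) * del B nu ^+ q / nu ^+ (q * z).
rewrite -rdX ?vgeE ?wkp // kpE (rd_div) ?dvX ?wal ?mulr0 //; last first.
by apply: vgeM0; [rewrite (wcst R)|rewrite (wdel R) vgeE // wal]. have wal0: vge w 0 al by rewrite vgeE // wal.
rewrite rdM ?(wcst R) ?(wdel R) // rdX // md_rd -(rd_cst R) // -(rd_del R) //. by rewrite md_rd rmorphXn exprM.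
have := congr1 (fun t => t ^+ q) e1; rewrite (rd_div) ?(wdel R) // -(rd_del R) // rs expr_div_n ek exprMn -exprM [(q * z)%N]mulnC.
move=> E; have nz: nu ^+ (z * q) != 0 by rewrite expf_neq0. apply: (mulfI nz); rewrite -E fmorphV; field.
by rewrite nz expf_neq0 // fmorph_eq0 rc0. have [Abb _] := rd_A R Ab wb. have rb0: rd w b != 0.
have : rd w b ^+ q != 0 by rewrite rb fmorph_eq0 invr_eq0 rd_eq0 ?vgeE ?vc.
by apply: contraNneq => ->; rewrite expr0n eqn0Ngt q0. have [|k kE] := inA_const Abb.
rewrite vgeE //; have := congr1 (Inf.oo B) rb; rewrite dvX // pv_cst => /eqP.
by rewrite mulf_eq0 eqz_nat eqn0Ngt q0 => /eqP->.
by exists k => //; apply: contraNneq rb0 => k0; rewrite kE k0 rmorph0. pose zm := cst C (zet C ^- mm).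
have zt0: zet C != 0 by rewrite -(fmorph_eq0 (cst C)) z_unit. have T0 := T_unit C.
have dT: del C T = (cst C (zet C))^-1 * T. by rewrite /Inf.T fmorph_div sc_dx sc_dy; field; rewrite y_unit z_unit.
(* The part at oo of the relation: [zm] comes from delta T = zeta^-1 T, and the powers of T balance
   the pole orders, so that B1 is a [funit]. *)
pose B1 := zm * (kp * T ^+ mm / T ^+ (mm * z)). have FB: funit C B B1.
exists (mm * (1 + z * q.-1) + (mm * z.-1) * d.+1)%N, (zm * (kp * al ^+ z) * cy C ^+ (mm * z.-1)),
(al ^+ z * cx C ^+ (mm * z.-1)). split. apply: ulM; last exact: ulX (ul_y R).
rewrite -[(mm * _)%N]add0n; apply: ulM => //; apply: (ul_cst R); first by rewrite invr_eq0 expf_neq0.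
by rewrite dvV dvX // (gauss_zet C v) mulr0.
have ->: (mm * (1 + z * q.-1) + mm * z.-1 * d.+1 = z * (q * mm) + mm * z.-1 * d)%N.
have ar (m' q' z': nat) : (0 < q')%N -> (0 < z')%N ->
(m' * (1 + z' * q'.-1) + m' * z'.-1 * d.+1 = z' * (q' * m') + m' * z'.-1 * d)%N.
by case: q' => // q' _; case: z' => // z' _ /=; ring. exact: ar. exact: ulM (ulX _ (md_ul D)) (ulX _ (ul_x R)).
rewrite /B1 -{1}(prednK z0) mulnS exprD /Inf.T !expr_div_n. have hx n: cx C ^+ n != 0 by rewrite expf_neq0 ?x_unit.
have hy n: cy C ^+ n != 0 by rewrite expf_neq0 ?y_unit.
move: (hx mm) (hx (mm * z.-1)%N) (hy mm) (hy (mm * z.-1)%N) alz0.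
move: (cx C ^+ mm) (cx C ^+ (mm * z.-1)) (cy C ^+ mm) (cy C ^+ (mm * z.-1)) (al ^+ z) (zm) (kp) => e1 e2 e3 e4 e5 e6 e7 h1 h2 h3 h4 h5.
by field; rewrite ?h1 ?h2 ?h3 ?h4 ?h5. have wT := w_T R. have [FB0 wB] := funit_w FB. exists b, B1 => //.
have ->: del C (s * T ^+ mm) - (s * T ^+ mm) ^+ z * (b * B1) = zm * kp * T ^+ mm * (del C s / kp - s ^+ z * b).
have dTm: del C (T ^+ mm) = zm * T ^+ mm. by rewrite rmorphXn dT [LHS]exprMn /zm fmorphV rmorphXn exprVn.
have ez: (s * T ^+ mm) ^+ z = s ^+ z * T ^+ (mm * z) by rewrite [LHS]exprMn -exprM.
rewrite rmorphM dTm ez /B1; have := expf_neq0 (mm * z) T0; move: kp0.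
by move: (zm) (kp) (T ^+ mm) (T ^+ (mm * z)) => e1 e2 e3 e4 h1 h2; field; rewrite ?h1 ?h2.
apply: vgeM0 => //; apply: vgeM0; [apply: vgeM0|by apply: vge0X; rewrite vgeE // wT].
by rewrite (wcst R) vgeE // dvV dvX // (gauss_zet C v) mulr0. by rewrite vgeE // wkp.
Qed.

End Model.

(** * First order expansion of powers of one-units *)

Section OneUnits.
Variables (F: fieldType) (w: dval F).
Implicit Types (f g X: F).

Lemma vge_nat n: vge w 0 n%:R.
 by elim: n => [|n IH]; rewrite ?vge0 // mulrS vgeD ?vge1. Qed.
Lemma vge1_int (s: nat) X : (0 < s)%N -> vge w s%:Z (X - 1) -> vge w 0 X.
 by move=> s0 h; rewrite -(subrK 1 X) vgeD ?vge1 //; apply: vgeW h. Qed.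
Lemma one_unitX (s n: nat) X : (0 < s)%N -> vge w s%:Z (X - 1) ->
 vge w (s.+1)%:Z (X ^+ n - (1 + n%:R * (X - 1))).
 move=> s0 h; have vX := vge1_int s0 h. have ->: X ^+ n - (1 + n%:R * (X - 1)) = (X - 1) * \sum_(i < n) (X ^+ i - 1).
by rewrite sumrB [RHS]mulrBr -subrX1 sumr_const card_ord; ring. have ->: s.+1%:Z = s%:Z + 1 by clia.
apply: vgeM => //; apply: vge_sum => i _; apply: (@vgeW _ _ s%:Z); first by [].
by rewrite -(expr1n F i); apply: vgeX_sub; rewrite ?vge1.
Qed.
Lemma one_unit_pexp (p J: nat) X : vge w 1 (p%:R : F) -> vge w 1 (X - 1) ->
 vge w (J.+1)%:Z (X ^+ (p ^ J) - 1).
 move=> hp h; elim: J => [|J IH]; first by []. rewrite expnSr exprM; move: (X ^+ (p ^ J)) IH => Y hY.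
rewrite subrX1; have ->: J.+2%:Z = J.+1%:Z + 1 by clia. apply: vgeM => //.
have ->: \sum_(i < p) Y ^+ i = p%:R + \sum_(i < p) (Y ^+ i - 1). by rewrite sumrB sumr_const card_ord; ring.
apply: vgeD => //; apply: vge_sum => i _; rewrite -(expr1n F i).
by apply: vgeX_sub; rewrite ?vge1 //; [apply: vge1_int hY|apply: vgeW hY].
Qed.
Lemma one_unit_prod (s: nat) (I: finType) (X: I -> F) (n: I -> nat) : (0 < s)%N ->
 (forall i, vge w s%:Z (X i - 1)) ->
 vge w (s.+1)%:Z (\prod_i X i ^+ n i - (1 + \sum_i (n i)%:R * (X i - 1))).
 move=> s0 h; suff [] : vge w s%:Z (\sum_i (n i)%:R * (X i - 1)) /\
vge w (s.+1)%:Z (\prod_i X i ^+ n i - (1 + \sum_i (n i)%:R * (X i - 1))) by [].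
elim/big_rec2: _ => [|i f g _ [hf hg]]. by rewrite vge0 addr0 subrr vge0.
have hi: vge w s%:Z ((n i)%:R * (X i - 1)) by apply: vgeM0 (h i); apply: vge_nat. split; first exact: vgeD.
have hX := one_unitX (n i) s0 (h i). have ->: X i ^+ n i * g - (1 + ((n i)%:R * (X i - 1) + f)) =
X i ^+ n i * (g - (1 + f)) + (X i ^+ n i - (1 + (n i)%:R * (X i - 1))) * (1 + f)
+ (n i)%:R * (X i - 1) * f by ring. have vf: vge w 0 (1 + f) by rewrite vgeD ?vge1 //; apply: vgeW hf.
apply: vgeD; [apply: vgeD|].
- by apply: vgeM0 hg; apply: vge0X; apply: vge1_int (h i).
- exact: vge0M.
- by have := vgeM hi hf; apply: vgeW; move: s0; clia.
Qed.

End OneUnits.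

(** * First cohomology of the structure sheaf *)

Section LowPolePart.
Variables (d a: nat) (kap F: fieldType) (C: scurve d a kap F).
Notation inA := (inA C).
Notation oo := (oo C).
Notation T := (T C).
Implicit Types f : F.

(** [pm i] is the sum of the residues of a i and (d + 1 - a) i modulo d, hence less than 2 d, and it
    is congruent to i. *)
Lemma pm_or i: (i < d)%N -> pm d a i = i \/ pm d a i = (i + d)%N.
 move=> id; have d0 := d_gt0 C; have h := pm_mod C id. have lt: (pm d a i < 2 * d)%N.
have h1 := ltn_ceil (a * i) d0; have h2 := ltn_ceil ((d + 1 - a) * i) d0.
have e: ((d + 1 - a) * i + a * i = i * d.+1)%N. have ad: (a <= d + 1)%N by have := sc_a C; clia.
by rewrite -mulnDl subnK // addn1 mulnC.
rewrite mulSn mulnC in h1; rewrite mulSn mulnC in h2; move: h1 h2 e; rewrite /pm.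
move: (d * (a * i %/ d))%N (d * ((d + 1 - a) * i %/ d))%N (a * i)%N ((d + 1 - a) * i)%N (i * d.+1)%N. by clia.
have := divn_eq (pm d a i) d; rewrite h. have : (pm d a i %/ d < 2)%N by rewrite ltn_divLR.
case: (_ %/ _)%N => [|[|//]] _ ->; [left|right]; last by rewrite mul1n addnC. by rewrite mul0n.
Qed.
Lemma gap_lt j: ~~ nongap d a j -> (j < d)%N.
 rewrite -ltnNge => lt; rewrite ltnNge; apply/negP => ge; move: lt; rewrite ltnNge => /negP; apply.
have := pm_or (lmod_lt C j); have := divn_eq j d; have := divn_gt0 j (d_gt0 C).
rewrite ge; move: (j %/ d)%N (j %% d)%N (d_gt0 C) ge => k r d0 ge k0 e [->|->]; move: k0 e ge d0; cnia.
Qed.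
(** Descent on the pole order at oo: a leading term is removed by [wb] at a nongap and by a power of
    1 / T at a gap. *)
Lemma polar_decomposition f: exists al, exists2 be, inA al /\ vge oo 0 be &
 exists2 c : nat -> kap, (forall j, nongap d a j -> c j = 0) &
 f = al + be + \sum_(j < d) cst C (c j) * T ^- j.
 have [n hn]: exists n : nat, vge oo (- n%:Z) f. exists `|oo f|%N; have [->|f0] := eqVneq f 0; first exact: vge0.
by rewrite vgeE //; clia. elim: n f hn => [|n IH] f hn. exists 0, f; first by split; [apply: inA0|].
by exists (fun=> 0) => //; rewrite big1 ?addr0 ?add0r // => j _; rewrite rmorph0 mul0r.
have [lt|] := boolP (vge oo (- n%:Z) f); first exact: IH. have [->|f0] := eqVneq f 0; first by rewrite vge0.
move: hn; rewrite !vgeE // => h1 h2; have of_: oo f = - n.+1%:Z by move: h1 h2; clia. have T0 := T_unit C.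
have oTn: oo (T ^- n.+1) = - n.+1%:Z by rewrite dvV dvX // oo_T mulr1.
have vsub h: vge oo (- n.+1%:Z + 1) h -> vge oo (- n%:Z) h by apply: vgeW; clia.
have [ng|gp] := boolP (nongap d a n.+1).
have [|u u0 hu] := leading_sub (C := C) f0 (wb_neq0 C n.+1); first by rewrite of_ oo_wb.
rewrite oo_wb // in hu; have [al [be [Aal obe] [c hc e]]] := IH _ (vsub _ hu). exists (al + cst C u * wb C n.+1), be.
by split=> //; apply: inAD => //; apply: inAM; [apply: inA_cst|apply: inA_wb].
by exists c => //; rewrite -{1}(subrK (cst C u * wb C n.+1) f) e; ring.
have [||u u0 hu] := @leading_sub _ _ _ _ C f (T ^- n.+1) f0; first by rewrite invr_eq0 expf_neq0. by rewrite of_ oTn.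
rewrite oTn in hu; have [al [be [Aal obe] [c hc e]]] := IH _ (vsub _ hu).
exists al, be => //; exists (fun j => c j + (if j == n.+1 then u else 0)).
by move=> j ngj; rewrite hc // add0r; case: eqP => // e'; rewrite -e' ngj in gp.
rewrite -{1}(subrK (cst C u * T ^- n.+1) f) e -addrA; congr (_ + _). have lt := gap_lt gp.
under [RHS]eq_bigr do rewrite rmorphD mulrDl.
rewrite big_split /=; congr (_ + _); rewrite (bigD1 (Ordinal lt)) //= eqxx big1 ?addr0 // => j.
by rewrite -val_eqE => /negPf /= ->; rewrite rmorph0 mul0r.
Qed.
(** The top nonzero term of the sum would be the leading term of -al, an element of A, at a gap. *)
Lemma polar_unique (al be: F) (c: nat -> kap) : inA al -> vge oo 0 be ->
 (forall j, nongap d a j -> c j = 0) -> al + be + \sum_(j < d) cst C (c j) * T ^- j = 0 ->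
 forall j, (j < d)%N -> c j = 0.
 move=> Aal obe hc e; have T0 := T_unit C.
suff main n : (n <= d)%N -> forall j, (n <= j < d)%N -> c j = 0 by move=> j jd; apply: (main 0%N).
elim: {n}(d - n)%N {-2}n (leqnn (d - n)) => [|k IH] n le nd j /andP[nj jd]. by move: le nj jd; clia.
have [lt|] := ltnP n j. by apply: (IH n.+1); rewrite //; move: le lt jd; clia.
move=> jn; have {jn} jn: j = n by apply/eqP; rewrite eqn_leq jn. have [cj|cj] := eqVneq (c j) 0 => //; exfalso.
have hi i: (j < i)%N -> (i < d)%N -> c i = 0.
by move=> ji id; apply: (IH n.+1); rewrite ?id -?jn ?ji //; move: le jd jn; clia. have j0: (0 < j)%N.
by rewrite lt0n; apply: contraNneq cj => j0; rewrite hc // j0 /nongap mod0n /pm muln0 !div0n !muln0.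
have alE: al = - be - \sum_(i < d) cst C (c i) * T ^- i.
have ->: al = (al + be + \sum_(i < d) cst C (c i) * T ^- i) - be - \sum_(i < d) cst C (c i) * T ^- i by ring.
by rewrite e sub0r. have oT i: oo (cst C (c j) * T ^- i) = - i%:Z.
by rewrite dvM // pv_cst dvV dvX // oo_T mulr1 add0r.
have sE: \sum_(i < d) cst C (c i) * T ^- i = cst C (c j) * T ^- j + \sum_(i < d | i != j :> nat) cst C (c i) * T ^- i.
by rewrite (bigD1 (Ordinal jd)).
have low: vge oo (- j%:Z + 1) (- be - \sum_(i < d | i != j :> nat) cst C (c i) * T ^- i).
apply: vgeB; first by rewrite vgeN; apply: vgeW obe; move: j0; clia.
apply: vge_sum => i ij; have [ji|] := ltnP j i; first by rewrite hi // rmorph0 mul0r vge0.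
move=> ij'; apply: vgeM0; first exact: vge_cst. rewrite vgeE // dvV dvX // oo_T mulr1. by move: ij ij'; clia.
have [al0 oal]: al != 0 /\ oo al = - j%:Z.
have ->: al = - (cst C (c j) * T ^- j) + (- be - \sum_(i < d | i != j :> nat) cst C (c i) * T ^- i).
by rewrite alE sE; ring. have n0: - (cst C (c j) * T ^- j) != 0 by []. move: low; move: (- be - _) => lo low.
have low2: vge oo (oo (- (cst C (c j) * T ^- j)) + 1) lo by rewrite dvN oT.
by have [h1 h2] := dvD_lt n0 low2; rewrite h1 h2 dvN oT.
have := crd_oo Aal al0 oal; rewrite /crd; case: ifP => [ng _|]; last by rewrite eqxx. by rewrite hc ?eqxx in cj.
Qed.

(* The first cohomology of the structure sheaf has basis the T^-j, j a gap,
   and only j = 1 has the eigenvalue zeta. *)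
Lemma low_pole_part f (al be: F) : inA al -> vge oo 0 be ->
 del C f - cst C (zet C) * f = al + be ->
 exists al', exists2 be', inA al' /\ vge oo 0 be' & exists c, f = al' + be' + cst C c / T.
 move=> Aal obe e; have [al' [be' [Aal' obe'] [c hc fE]]] := polar_decomposition f.
have hd: (1 < d)%N by have := sc_a C; clia. exists al', be' => //; exists (c 1%N); rewrite fE; congr (_ + _).
have T0 := T_unit C; have z0 := z_unit C. have dT j: del C (T ^- j) = cst C (zet C) ^+ j * T ^- j.
rewrite fmorphV rmorphXn /Inf.T fmorph_div sc_dx sc_dy !expr_div_n !exprMn.
by field; rewrite !expf_neq0 ?x_unit ?y_unit. pose c' j := (zet C ^+ j - zet C) * c j.
have hc' j: nongap d a j -> c' j = 0 by move=> ng; rewrite /c' (hc _ ng) mulr0.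
have eS: del C al' - cst C (zet C) * al' - al + (del C be' - cst C (zet C) * be' - be) +
\sum_(j < d) cst C (c' j) * T ^- j = 0. have ->: \sum_(j < d) cst C (c' j) * T ^- j =
del C (\sum_(j < d) cst C (c j) * T ^- j) - cst C (zet C) * \sum_(j < d) cst C (c j) * T ^- j.
rewrite rmorph_sum mulr_sumr -sumrB; apply: eq_bigr => j _.
by rewrite rmorphM sc_dcst dT /c' rmorphM rmorphB rmorphXn; ring.
transitivity (del C f - cst C (zet C) * f - (al + be)); last by rewrite e subrr. by rewrite fE !rmorphD; ring.
have A1: inA (del C al' - cst C (zet C) * al' - al).
by apply: inAB => //; apply: inAB; [apply: inA_del|apply: inAM => //; apply: inA_cst].
have A2: vge oo 0 (del C be' - cst C (zet C) * be' - be).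
apply: vgeB => //; apply: vgeB; last by apply: vgeM0 => //; apply: vge_cst.
by move: obe'; rewrite /vge fmorph_eq0 oo_del. have cz j: (j < d)%N -> j != 1%N -> c j = 0.
move=> jd j1; have /eqP := polar_unique A1 A2 hc' eS jd; rewrite /c' mulf_eq0 subr_eq0.
rewrite -{2}[zet C]expr1 (eq_prim_root_expr (sc_zet C)) !modn_small // (negPf j1) orFb. by move/eqP.
rewrite (bigD1 (Ordinal hd)) //= expr1 big1 ?addr0 // => j; rewrite -val_eqE /= => j1. by rewrite cz // rmorph0 mul0r.
Qed.

End LowPolePart.

(** * Kummer products and successive approximation *)

Section Kummer.
Variables (d a: nat) (K F: fieldType) (C: scurve d a K F) (v: dval K) (w: dval F)
 (B: scurve d a (resf v) (resf w)) (R: reduction C B).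
Notation inA := (inA C).
Notation oo := (oo C).
Notation T := (T C).
Notation cst := (cst C).
Notation ul := (@ul _ _ _ _ C v w B).
Notation cunit := (@cunit _ _ _ _ C v w B).
Notation funit := (@funit _ _ _ _ C v w B).
Implicit Types (f g h: F) (t e: K).

Variables (p: nat) (pi: K).
Hypotheses (vp: vge v 1 (p%:R : K)) (pi0: pi != 0) (vpi: v pi = 1).

Let cp := cst pi.
Let cp0: cp != 0. Proof. by rewrite fmorph_eq0. Qed.
Let wcp: w cp = 1. Proof. by rewrite (w_cst R). Qed.
Let wcpX s: w (cp ^+ s) = s%:Z. Proof. by rewrite dvX // wcp mulr1. Qed.
Let cpX0 s: cp ^+ s != 0. Proof. by []. Qed.

Let wnat n (m: nat) : vge w n (m%:R : F) = vge v n (m%:R : K).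
 by rewrite -(rmorph_nat cst) (wcst R). Qed.

Let vT: vge w 0 T^-1. Proof. by rewrite vgeE ?invr_eq0 ?T_unit // dvV (w_T R). Qed.

Definition kfac i t: F := 1 - cst (zet C ^+ i * t) / T.

(** Here z^d is 1 modulo a high power of p, so that delta acts as the z-th power ([kum_del]), and d
    z0 is -1 modulo the uniformizer. As z reduces to zeta, the exponents reduce to -zeta^-i / d,
    which normalizes the first order change in t ([kum_step]). *)
Definition kum z0 z t: F := \prod_(i < d) kfac i t ^+ (z0 * z ^ (d - i)).

Let vz i: vge v 0 (zet C ^+ i).
 by apply: vge0X; rewrite vgeE ?(gauss_zet C v) // -(fmorph_eq0 cst) z_unit. Qed.
Lemma kfac1 i t n: vge v n t -> vge w n (kfac i t - 1).
 by move=> ht; rewrite addrC addKr vgeN; apply: vge0M => //; rewrite (wcst R); apply: vgeM0. Qed.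
Lemma kfac_w i t: vge v 1 t -> kfac i t != 0 /\ w (kfac i t) = 0.
 by move=> /(kfac1 i); apply: sub1_unit. Qed.
Lemma kum_w z0 z t: vge v 1 t -> kum z0 z t != 0 /\ w (kum z0 z t) = 0.
 move=> ht; have h i := kfac_w i ht; have n0 i: kfac i t != 0 by case: (h i).
split; first by apply/prodf_neq0 => i _; rewrite expf_neq0. rewrite dv_prod => [|i _]; last by [].
by rewrite big1 // => i _; rewrite dvX //; case: (h i) => _ ->; rewrite mulr0.
Qed.
Lemma del_kum_factor i t: del C (kfac i t) = kfac i.+1 t.
 rewrite /kfac rmorphB fmorph_div sc_dcst /Inf.T fmorph_div sc_dx sc_dy exprS -mulrA [cst (_ * (_ * _))]rmorphM.
by field; rewrite x_unit y_unit z_unit.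
Qed.
(** delta shifts the factors cyclically. Only the one that wraps around has a wrong exponent, and
    the excess is a multiple of p^J, harmless for a one-unit. *)
Lemma kum_del z0 z t J M k: vge v 1 t -> (0 < z)%N -> (z ^ d = 1 + p ^ J * k)%N -> (M <= J)%N ->
 vge w M%:Z (del C (kum z0 z t) - kum z0 z t ^+ z).
 move=> ht z0' zd MJ; have d0 := d_gt0 C.
have vk i: vge w 0 (kfac i t) by have [h0 h1] := kfac_w i ht; rewrite vgeE // h1.
pose G i := kfac i t ^+ (z * (z0 * z ^ (d - i))). have e1: del C (kum z0 z t) = \prod_(i < d) G i.+1.
rewrite /kum rmorph_prod; apply: eq_bigr => i _; rewrite rmorphXn del_kum_factor /G; congr (_ ^+ _).
by rewrite mulnCA -expnS subnSK. have e2: kum z0 z t ^+ z = \prod_(i < d) G i.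
by rewrite /kum -prodrXl; apply: eq_bigr => i _; rewrite /G -exprM mulnC.
have per: kfac d t = kfac 0 t by rewrite /kfac (prim_expr_order (sc_zet C)).
rewrite e1 e2; have := d0; rewrite /G; case: (d) zd per => // n zd per _.
rewrite [X in vge _ _ (X - _)]big_ord_recr [X in vge _ _ (_ - X)]big_ord_recl /= mulrC.
set Q := \prod_(i < n) _; have vQ: vge w 0 Q by apply: vge0_prod => i _; apply: vge0X.
rewrite -mulrBl; apply: vge0M => //; rewrite subnn subn0 expn0 muln1 per zd.
rewrite -[X in X - _]mulr1 mulnA mulnDr muln1 exprD -mulrBr; apply: vgeM0; first exact: vge0X.
rewrite vge_subC -(expr1n F (z * z0 * k)) mulnCA exprM. apply: vgeX_sub; rewrite ?vge1 //; first exact: vge0X.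
apply: (@vgeW _ _ J.+1%:Z); first by move: MJ; clia. by apply: one_unit_pexp; [rewrite wnat|apply: kfac1].
Qed.
(** Replacing t by t - e multiplies factor i by about 1 + zeta^i e / T; weighted by the exponents,
    the coefficient of e / T is sum_i z0 z^(d - i) zeta^i, which is d z0 = -1 modulo the
    uniformizer. *)
Lemma kum_step z0 z t e (s: nat) : vge v 1 t -> (0 < s)%N -> vge v s%:Z e ->
 vge v 1 (z%:R - zet C) -> vge v 1 ((d * z0).+1%:R : K) ->
 vge w s.+1%:Z (kum z0 z (t - e) - kum z0 z t * (1 - cst e / T)).
 move=> ht s0 he hz hz0; pose X (i: 'I_d) := kfac i (t - e) / kfac i t. have hf i := kfac_w i ht.
have XE (i: 'I_d) : X i - 1 = cst (zet C ^+ i * e) / T / kfac i t.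
have [n0 _] := hf i; rewrite /X; apply: (mulIf n0); rewrite mulrBl mul1r !divfK //.
by rewrite /kfac mulrBr rmorphB; ring.
have vze i: vge w s%:Z (cst (zet C ^+ i * e) / T) by apply: vge0M => //; rewrite (wcst R); apply: vgeM0.
have X1 i: vge w s%:Z (X i - 1) by have [n0 w0] := hf i; rewrite XE vge_div // w0 addr0.
have X2 (i: 'I_d) : vge w s.+1%:Z ((X i - 1) - cst (zet C ^+ i * e) / T). have [n0 w0] := hf i; rewrite XE.
have ->: cst (zet C ^+ i * e) / T / kfac i t - cst (zet C ^+ i * e) / T =
(cst (zet C ^+ i * e) / T) * (- (kfac i t - 1)) / kfac i t. by field; rewrite n0 T_unit.
rewrite vge_div // w0 addr0; have ->: s.+1%:Z = s%:Z + 1 by clia. by apply: vgeM => //; rewrite vgeN; apply: kfac1.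
have kE: kum z0 z (t - e) = kum z0 z t * \prod_(i < d) X i ^+ (z0 * z ^ (d - i)).
rewrite /kum -big_split; apply: eq_bigr => i _ /=. by rewrite -exprMn /X mulrC divfK //; case: (hf i).
have [k0 wk] := kum_w z0 z ht. rewrite kE -mulrBr; apply: vgeM0; first by rewrite vgeE // wk.
have := one_unit_prod (fun i: 'I_d => z0 * z ^ (d - i))%N s0 X1; move: (\prod_i _) => Q hQ. apply: (vge_trans hQ).
have ->: 1 + \sum_(i < d) (z0 * z ^ (d - i))%:R * (X i - 1) - (1 - cst e / T) =
\sum_(i < d) (z0 * z ^ (d - i))%:R * ((X i - 1) - cst (zet C ^+ i * e) / T) +
cst ((\sum_(i < d) (z0 * z ^ (d - i))%:R * zet C ^+ i + 1) * e) / T.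
have ->: cst ((\sum_(i < d) (z0 * z ^ (d - i))%:R * zet C ^+ i + 1) * e) / T =
\sum_(i < d) (z0 * z ^ (d - i))%:R * (cst (zet C ^+ i * e) / T) + cst e / T.
rewrite mulrDl mul1r rmorphD mulrDl mulr_suml rmorph_sum mulr_suml; congr (_ + _).
by apply: eq_bigr => i _; rewrite -mulrA rmorphM rmorph_nat; ring. rewrite addrA -big_split /= opprB.
under [X in _ = X + _]eq_bigr do rewrite -mulrDr subrK. by ring.
apply: vgeD; first by apply: vge_sum => i _; apply: vgeM0 => //; apply: vge_nat.
apply: vge0M => //; rewrite (wcst R); have ->: s.+1%:Z = 1 + s%:Z by [].
apply: vgeM => //; have ->: \sum_(i < d) (z0 * z ^ (d - i))%:R * zet C ^+ i + 1 =
(d * z0).+1%:R + \sum_(i < d) z0%:R * ((z%:R ^+ (d - i) - zet C ^+ (d - i)) * zet C ^+ i) :> K.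
rewrite -addn1 natrD natrM [in RHS]addrAC; congr (_ + _).
have ->: d%:R * z0%:R = \sum_(i < d) z0%:R :> K by rewrite sumr_const card_ord mulr_natl.
rewrite -big_split; apply: eq_bigr => i _ /=; rewrite mulrBl -exprD subnK 1?ltnW //.
by rewrite (prim_expr_order (sc_zet C)) natrM natrX; ring.
apply: vgeD => //; apply: vge_sum => i _; apply: vgeM0; first exact: vge_nat.
apply: vge0M => //; apply: vgeX_sub => //; first exact: vge_nat. by have := vz 1; rewrite expr1.
Qed.
Lemma cunit_inv f (M: nat) : cunit f -> exists2 g, cunit g & vge w M%:Z (f * g - 1).
 move=> hf; have [f0 wf] := cunit_w hf; case: (hf) => Af vf [u u0 fu]. have sA: subsp C inA.
by split=> [|k f1 f2 A1 A2]; [apply: inA0|apply: inAD => //; apply: inAM => //; apply: inA_cst].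
have [u' hu' u'E] := rd_surj u^-1. have cu': vge w 0 (cst u') by rewrite (wcst R).
have [||s [As ws hs]] := @approximate_factor _ _ _ _ C v w B R inA inA f sA sA f0 wf _ _ M.+1 1 (inA1 C) (vge1 w).
- by move=> s As; apply: inAM.
- move=> g Ag wg; exists (cst u' * g); split; [by apply: inAM => //; apply: inA_cst|exact: vgeM0|].
by rewrite rdM ?vgeM0 // rdM // fu -(rd_cst R) // u'E mulrA -rmorphM divff // rmorph1 mul1r.
exists s; last by rewrite vge_subC; apply: vgeW hs; clia. split=> //; exists u^-1; first by [].
have : rd w 1 = rd w (f * s) by apply/rd_eqP; rewrite ?vge1 ?vgeM0 //; apply: vgeW hs; clia.
rewrite rdM // fu => h; rewrite fmorphV; apply: (mulfI (_: Curve.cst B u != 0)); first by [].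
by rewrite -h divff // fmorph_eq0.
Qed.
(** The product of a unit off oo and a unit at oo is 1 modulo pi^s. Then the first is constant
    modulo pi^s, since each further digit is regular both off oo and at oo; at level s the relation
    writes the reduction of eta as a coboundary. *)
Lemma unit_relation (s j: nat) (A1 c1 d1 eta: F) : (0 < s)%N -> cunit A1 ->
 ul j c1 -> ul j d1 -> vge w 0 eta -> A1 * c1 = d1 * (1 + cp ^+ s * eta) ->
 exists al, exists2 be, Curve.inA B al /\ vge (Inf.oo B) 0 be & rd w eta = al + be.
 move=> s0 UA hc hd weta rel. have [c10 wc1] := ul_neq0 hc; have [d10 wd1] := ul_neq0 hd.
case: (hc) => Ac vc oc rc0 orc; case: (hd) => Ad vd od rd0' ord'. case: (UA) => AA vA [u u0 rA].
have part i (k: K) (A2: F) : (i <= s)%N -> vge v 0 k -> inA A2 -> vge w 0 A2 -> A1 = cst k + cp ^+ i * A2 ->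
exists d2, [/\ inA d2, vge w 0 d2, vge oo (- j%:Z) d2, d1 - cst k * c1 = cp ^+ i * d2 &
d2 = A2 * c1 - cp ^+ (s - i) * eta * d1]. move=> le hk AA2 vA2 e; exists ((d1 - cst k * c1) / cp ^+ i).
have eq: d1 - cst k * c1 = cp ^+ i * (A2 * c1 - cp ^+ (s - i) * eta * d1).
have ->: cp ^+ i * (A2 * c1 - cp ^+ (s - i) * eta * d1) =
cp ^+ i * A2 * c1 - (cp ^+ (s - i) * cp ^+ i) * eta * d1 by ring.
rewrite -exprD subnK //; have ->: cp ^+ i * A2 = A1 - cst k by rewrite e addrC addKr. by rewrite mulrBl rel; ring.
have eq': (d1 - cst k * c1) / cp ^+ i = A2 * c1 - cp ^+ (s - i) * eta * d1. by rewrite eq mulrC mulKf. split=> //.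
- rewrite -rmorphXn -fmorphV mulrC; apply: inAM; first exact: inA_cst.
by apply: inAB => //; apply: inAM => //; apply: inA_cst.
- rewrite eq'; apply: vgeB; first exact: vgeM0.
by apply: vgeM0 => //; apply: vgeM0 => //; apply: vge0X; rewrite vgeE // wcp.
- rewrite -rmorphXn -fmorphV mulrC; apply: vgeM0; first exact: vge_cst.
by apply: vgeB => //; apply: vgeM0 => //; apply: vge_cst.
- by rewrite [RHS]mulrC divfK.
have const i: (i <= s)%N -> exists k, exists2 A2, [/\ vge v 0 k, inA A2 & vge w 0 A2] & A1 = cst k + cp ^+ i * A2.
elim: i => [_|i IH lt]. by exists 0, A1; [rewrite vge0|rewrite rmorph0 add0r expr0 mul1r].
have [k [A2 [hk AA2 vA2] e]] := IH (ltnW lt). have [d2 [Ad2 vd2 od2 _ d2E]] := part i k A2 (ltnW lt) hk AA2 vA2 e.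
have rd2: rd w d2 = rd w A2 * rd w c1. rewrite -rdM //; apply/rd_eqP; rewrite ?vgeM0 //.
rewrite d2E addrC addKr vgeN; apply: vge0M => //; apply: vge0M => //. by rewrite vgeE // wcpX; move: lt; clia.
have [AA2b _] := rd_A R AA2 vA2; have od2b := oo_rd R Ad2 vd2 od2.
have [k2 k2E]: exists k2, rd w A2 = Curve.cst B k2.
apply: (inA_const AA2b); have ->: rd w A2 = rd w d2 / rd w c1 by rewrite rd2 mulfK. by rewrite vge_div // orc add0r.
have [k3 hk3 rk3] := rd_surj k2. exists (k + pi ^+ i * k3), ((A2 - cst k3) / cp). split.
- by apply: vgeD => //; apply: vgeM0 => //; apply: vge0X; rewrite vgeE // vpi.
- by rewrite mulrC -fmorphV; apply: inAM; [apply: inA_cst|apply: inAB => //; apply: inA_cst].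
- rewrite vge_div // wcp; apply/rd_eqP; rewrite ?(wcst R) // -(rd_cst R) // rk3 //.
by rewrite e rmorphD rmorphM rmorphXn exprSr -/cp; field. have [k [A2 [hk AA2 vA2] e]] := const s (leqnn s).
have [d2 [Ad2 vd2 od2 d2E d2E']] := part s k A2 (leqnn s) hk AA2 vA2 e. rewrite subnn expr0 mul1r in d2E'.
have [AA2b _] := rd_A R AA2 vA2; have od2b := oo_rd R Ad2 vd2 od2.
exists (rd w A2 * (Curve.cst B u)^-1), (- (rd w d2 / rd w d1)).
split; first by rewrite -fmorphV; apply: inAM => //; apply: inA_cst. by rewrite vgeN vge_div // ord' add0r.
have r1: Curve.cst B u * rd w c1 = rd w d1. rewrite -rA -rdM // rel; apply/rd_eqP => //.
by apply: vgeM0 => //; apply: vgeD; rewrite ?vge1 //; apply: vgeM0 => //; apply: vge0X; rewrite vgeE // wcp.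
rewrite mulrDr mulr1 addrC addKr; apply: vgeM0 => //; apply: vge0M => //. by rewrite vgeE // wcpX; move: s0; clia.
have r2: rd w d2 = rd w A2 * rd w c1 - rd w eta * rd w d1 by rewrite d2E' rdB ?vgeM0 // !rdM.
have cu0: Curve.cst B u != 0 by []. by rewrite r2 -r1; field; rewrite cu0 rc0.
Qed.
Lemma lift_fraction be: vge (Inf.oo B) 0 be -> exists j, exists a1, exists2 b1,
 [/\ inA a1, vge w 0 a1 & vge oo (- j%:Z) a1] & ul j b1 /\ be = rd w a1 / rd w b1.
 move=> ob; have [ab [c c0 [Aab bE]]] := fracA B be. have ec0: evx (Curve.cst B) (cx B) c != 0 by rewrite ev0.
have Ae := inA_ev B c; have oe := oo_inA_le0 Ae ec0. pose j := `|Inf.oo B (evx (Curve.cst B) (cx B) c)|%N.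
have oj: Inf.oo B (evx (Curve.cst B) (cx B) c) = - j%:Z by move: oe; rewrite /j; clia.
have [|b1 [Ab1 vb1 rb1 ob1]] := lift_A R Ae (n := j); first by rewrite vgeE // oj.
have [|a1 [Aa1 va1 ra1 oa1]] := lift_A R Aab (n := j).
have ->: ab = be * evx (Curve.cst B) (cx B) c by rewrite bE divfK. by apply: vgeM0 => //; rewrite vgeE // oj.
exists j, a1, b1; first by []. by rewrite ra1 rb1; split=> //; split; rewrite ?rb1.
Qed.
(** One digit at a time, from t = 0. If hh kum(t) / (A B') = 1 + pi^s xi, then delta xi - zeta xi
    reduces to a coboundary by [unit_relation], so by [low_pole_part] xi reduces to a coboundary
    plus c / T. The two parts of the coboundary go into A and B', and c goes into t. *)
Lemma kummer_approximation (hh B0 A1 B1: F) (z0 z J M k: nat) :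
 hh != 0 -> w hh = 0 -> funit B0 -> vge w 1 (hh - B0) ->
 cunit A1 -> funit B1 -> vge w M%:Z (del C hh - hh ^+ z * (A1 * B1)) ->
 (0 < z)%N -> (z ^ d = 1 + p ^ J * k)%N -> (M <= J)%N ->
 vge v 1 (z%:R - zet C) -> vge v 1 ((d * z0).+1%:R : K) ->
 forall s, (0 < s <= M)%N -> exists2 t, vge v 1 t & exists A2, exists2 B2,
 cunit A2 /\ funit B2 & vge w s%:Z (hh * kum z0 z t - A2 * B2).
 move=> hh0 whh FB0 hB0 UA1 FB1 dhh z_gt0 zd MJ hz hz0; case=> // s. elim: s => [|s IH] /andP[_ sM].
exists 0; first exact: vge0; exists 1, B0. by split=> //; rewrite -(expr0 1); apply: cunitX; split; rewrite ?vge1 //;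
[apply: inA1|exists 1; rewrite ?oner_neq0 ?rmorph1]. rewrite mul1r /kum big1 ?mulr1 // => i _.
by rewrite /kfac mulr0 rmorph0 mul0r subr0 expr1n.
have [t ht [A [B' [UA FB] hX]]] := IH (ltnW sM); have sM': (s.+2 <= M)%N by [].
have {IH} s0: (0 < s.+1)%N by []; move: (s.+1) s0 hX sM' => {sM} {}s s0 hX sM.
have [A0 wA] := cunit_w UA; have [B'0 wB] := funit_w FB; have [k0 wk] := kum_w z0 z ht.
have wAB: w (A * B') = 0 by rewrite dvM // wA wB. pose X := hh * kum z0 z t / (A * B'). have X1: vge w s%:Z (X - 1).
have ->: X - 1 = (hh * kum z0 z t - A * B') / (A * B') by rewrite mulrBl divff. by rewrite vge_div // wAB addr0.
have [X0 wX]: X != 0 /\ w X = 0 by apply: sub1_unit X1; move: s0; clia. have vX: vge w 0 X by rewrite vgeE // wX.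
have hhkE: hh * kum z0 z t = A * B' * X by rewrite /X [RHS]mulrC divfK. pose xi := (X - 1) / cp ^+ s.
have vxi: vge w 0 xi by rewrite vge_div // wcpX add0r.
have XE: X = 1 + cp ^+ s * xi by rewrite /xi [cp ^+ s * _]mulrC divfK // addrC subrK.
have UdA := cunit_del R UA; have [dA0 wdA] := cunit_w UdA. have FdB := funit_del R FB; have [dB0 wdB] := funit_w FdB.
(* A4 inverts delta(A) to precision M only; with it delta X becomes X^z times a unit off oo and a
   unit at oo. *)
have [A4 UA4 hA4] := cunit_inv M UdA; have [A40 wA4] := cunit_w UA4.
pose A5 := A ^+ z * A1 * A4; pose B5 := B' ^+ z * B1 * (del C B')^-1.
have UA5: cunit A5 by apply: cunitM => //; apply: cunitM => //; apply: cunitX. have FB5: funit B5.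
by apply: funitM; [apply: funitM => //; apply: funitX|apply: funitV].
have [A50 wA5] := cunit_w UA5; have [B50 wB5] := funit_w FB5.
have vAB5: vge w 0 (A5 * B5) by apply: vgeM0; [rewrite (vgeE _ _ A50) wA5|rewrite (vgeE _ _ B50) wB5].
have [A10 wA1] := cunit_w UA1; have [B10 wB1] := funit_w FB1. have dX: vge w M%:Z (del C X - X ^+ z * (A5 * B5)).
have h1: vge w M%:Z (del C (hh * kum z0 z t) - hh ^+ z * (A1 * B1) * kum z0 z t ^+ z).
rewrite rmorphM; apply: vgeM_sub => //; last exact: kum_del zd MJ. by rewrite (wdel R) vgeE // whh.
by apply: vge0X; rewrite vgeE // wk. pose Y := A ^+ z * A1 * B5 * X ^+ z. have vY: vge w 0 Y.
by apply: vgeM0; [apply: vgeM0; [apply: vgeM0; [apply: vge0X|]|]|apply: vge0X => //]; rewrite vgeE // ?wA ?wA1 ?wB5.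
have ->: del C X - X ^+ z * (A5 * B5) =
(del C (hh * kum z0 z t) - hh ^+ z * (A1 * B1) * kum z0 z t ^+ z) / (del C A * del C B') -
Y * (del C A * A4 - 1) / del C A.
have ->: hh ^+ z * (A1 * B1) * kum z0 z t ^+ z = (A ^+ z * B' ^+ z * X ^+ z) * (A1 * B1).
by rewrite -!exprMn -hhkE exprMn; ring. rewrite /X fmorph_div [del C (A * _)]rmorphM /Y /A5 /B5.
by field; rewrite dA0 dB0. apply: vgeB; first by rewrite vge_div // dvM // wdA wdB addr0.
by rewrite vge_div // wdA addr0; apply: vgeM0. have Xz := one_unitX z s0 X1.
have sw: forall g, vge w s.+1%:Z g -> vge w s%:Z g by move=> g; apply: vgeW; clia.
have dX': vge w s.+1%:Z (del C X - X ^+ z * (A5 * B5)) by apply: vgeW dX; move: sM; clia.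
have dX1: vge w s%:Z (del C X - 1) by rewrite -[1](rmorph1 (del C)) -rmorphB (wdel R).
have Xz1: vge w s%:Z (X ^+ z - 1) by rewrite -(expr1n F z); apply: vgeX_sub; rewrite ?vge1.
have AB1: vge w s%:Z (A5 * B5 - 1).
have ->: A5 * B5 - 1 = - ((X ^+ z - 1) * (A5 * B5)) - (del C X - X ^+ z * (A5 * B5)) + (del C X - 1) by ring.
by apply: vgeD => //; apply: vgeB; [rewrite vgeN; apply: vge0M|apply: sw]. pose eta := (A5 * B5 - 1) / cp ^+ s.
(* Linearization: the neglected terms are of second order in pi^s, hence of order at least s + 1. *)
have veta: vge w 0 eta by rewrite vge_div // wcpX add0r. have etaE: vge w 1 (eta - (del C xi - z%:R * xi)).
have ->: eta - (del C xi - z%:R * xi) = (A5 * B5 - 1 - (del C X - 1) + z%:R * (X - 1)) / cp ^+ s.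
rewrite /eta /xi fmorph_div rmorphB rmorph1 rmorphXn sc_dcst -/cp. by field.
rewrite vge_div // wcpX; have ->: 1 + s%:Z = s.+1%:Z by clia.
have ->: A5 * B5 - 1 - (del C X - 1) + z%:R * (X - 1) =
- (del C X - X ^+ z * (A5 * B5)) - (X ^+ z - (1 + z%:R * (X - 1))) * (A5 * B5)
- z%:R * ((X - 1) * (A5 * B5 - 1)) by ring. apply: vgeB; first by apply: vgeB; [rewrite vgeN|apply: vge0M].
apply: vgeM0; first exact: vge_nat. by have := vgeM X1 AB1; apply: vgeW; move: s0; clia.
case: (FB5) => j [c1 [d1 [ulc uld] B5E]].
have [|al [be [Aal obe] rE]] := unit_relation (eta := eta) s0 UA5 ulc uld veta. have [d10 _] := ul_neq0 uld.
have ->: 1 + cp ^+ s * eta = A5 * B5 by rewrite /eta [cp ^+ s * _]mulrC divfK // addrC subrK. by rewrite B5E; field.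
have vdxi: vge w 0 (del C xi) by rewrite (wdel R). have vz': vge w 0 (z%:R : F) by apply: vge_nat.
have rdz: rd w (z%:R : F) = Curve.cst B (zet B). have vzt: vge v 0 (zet C) by have := vz 1; rewrite expr1.
rewrite (rd_zet R) (rd_cst R) // -(rmorph_nat cst); apply/rd_eqP; rewrite ?(wcst R) ?vge_nat //.
by rewrite -rmorphB (wcst R). have reta: del B (rd w xi) - Curve.cst B (zet B) * rd w xi = al + be.
rewrite -rE (rd_del R) // -rdz -(rdM vz' vxi) -(rdB vdxi (vgeM0 vz' vxi)); symmetry; apply/rd_eqP => //.
by apply: vgeB => //; apply: vgeM0. have [al' [be' [Aal' obe'] [c xiE]]] := low_pole_part Aal obe reta.
have [c' hc' rc'] := rd_surj c. have [nb hnb]: exists n : nat, vge (Inf.oo B) (- n%:Z) al'.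
exists `|Inf.oo B al'|%N; have [->|h0] := eqVneq al' 0; first exact: vge0. by rewrite vgeE //; clia.
have [a2 [Aa2 va2 ra2 _]] := lift_A R Aal' hnb. have [j2 [a1 [b1 [Aa1 va1 oa1] [ulb bE]]]] := lift_fraction obe'.
have [b10 wb1] := ul_neq0 ulb. have vcp: vge w s%:Z (cp ^+ s) by rewrite vgeE // wcpX.
have vcp0: vge w 0 (cp ^+ s) by apply: vgeW vcp. have vcp1: vge w 1 (cp ^+ s) by apply: vgeW vcp; move: s0; clia.
exists (t - pi ^+ s * c'). by apply: vgeB => //; apply: vge0M => //; rewrite vgeE // dvX // vpi mulr1; move: s0; clia.
exists (A * (1 + cp ^+ s * a2)), (B' * ((b1 + cp ^+ s * a1) / b1)). split. apply: cunitM => //; split.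
- by apply: inAD; [apply: inA1|apply: inAM => //; rewrite -rmorphXn; apply: inA_cst].
- by apply: vgeD; rewrite ?vge1 // vgeM0.
exists 1; rewrite ?oner_neq0 // rmorph1 -rd1; apply/rd_eqP; rewrite ?vge1 //. by apply: vgeD; rewrite ?vge1 // vgeM0.
by rewrite addrC addKr; apply: vge0M. apply: funitM => //; exists j2, (b1 + cp ^+ s * a1), b1; last by []; split=> //.
case: ulb => Ab1 vb1 ob1 rb1 orb1. have e: rd w (b1 + cp ^+ s * a1) = rd w b1.
by apply/rd_eqP => //; [apply: vgeD => //; apply: vgeM0|rewrite addrC addKr; apply: vge0M]. split; rewrite ?e //.
- by apply: inAD => //; apply: inAM => //; rewrite -rmorphXn; apply: inA_cst.
- by apply: vgeD => //; apply: vgeM0.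
- by apply: vgeD => //; apply: vgeM0 => //; rewrite -rmorphXn; apply: vge_cst.
have vt': vge v s%:Z (pi ^+ s * c') by apply: vge0M => //; rewrite vgeE // dvX // vpi mulr1.
have step := kum_step ht s0 vt' hz hz0.
have step2: vge w s.+1%:Z (hh * kum z0 z (t - pi ^+ s * c') - hh * (kum z0 z t * (1 - cst (pi ^+ s * c') / T))).
by rewrite -mulrBr; apply: vgeM0 => //; rewrite vgeE // whh.
apply: (vge_trans step2); rewrite mulrA hhkE XE rmorphM rmorphXn -/cp.
have vcc: vge w 0 (cst c' / T) by apply: vgeM0; rewrite // (wcst R).
have vab: vge w 0 (a1 / b1) by rewrite vge_div // wb1 addr0.
have ->: A * B' * (1 + cp ^+ s * xi) * (1 - cp ^+ s * cst c' / T) -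
A * (1 + cp ^+ s * a2) * (B' * ((b1 + cp ^+ s * a1) / b1)) =
A * B' * cp ^+ s * ((xi - (a2 + a1 / b1 + cst c' / T)) - cp ^+ s * (xi * (cst c' / T) + a2 * (a1 / b1))).
by field; rewrite b10 T_unit. have ->: s.+1%:Z = s%:Z + 1 by clia.
apply: vgeM; first by apply: vgeM0 => //; rewrite vgeE // wAB.
apply: vgeB; last by apply: vge0M => //; apply: vgeD; apply: vgeM0.
apply/rd_eqP => //; first by apply: vgeD => //; apply: vgeD. have vc': vge w 0 (cst c') by rewrite (wcst R).
rewrite (rdD (vgeD va2 vab) vcc) (rdD va2 vab) (rd_div va1 b10 wb1) (rd_div vc' (T_unit C) (w_T R)).
by rewrite ra2 -bE -(rd_cst R hc') rc' (rd_T R).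
Qed.

End Kummer.

(** * The case of small t *)

Section SmallParameter.
Variables (d a: nat) (K F: fieldType) (C: scurve d a K F) (v: dval K) (w: dval F)
 (B: scurve d a (resf v) (resf w)) (R: reduction C B).
Notation inA := (inA C).
Notation oo := (oo C).
Notation T := (T C).
Notation cst := (cst C).
Notation crd := (crd C).
Notation ul := (@ul _ _ _ _ C v w B).
Notation cunit := (@cunit _ _ _ _ C v w B).
Notation funit := (@funit _ _ _ _ C v w B).
Implicit Types (f g h: F).

Lemma ul_crd j f: ul j f -> crd j f != 0 /\ v (crd j f) = 0.
 move=> [Af wf of_ rf e]; have [Ab hb] := rd_A R Af wf.
by have := crd_oo Ab rf e; rewrite hb; apply: rd_neq0; apply: (w_crd R).
Qed.
Lemma ul_wb l: nongap d a l -> ul l (wb C l).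
 move=> ng; split; [exact: inA_wb|exact: (w_wb R)|by rewrite vgeE ?wb_neq0 // oo_wb|..]. by rewrite (rd_wb R) wb_neq0.
by rewrite (rd_wb R) oo_wb.
Qed.
Lemma vge_oo_pred f (n: nat) : inA f -> vge oo (- n.+1%:Z) f -> crd n.+1 f = 0 -> vge oo (- n%:Z) f.
 move=> Af /(vge_ooP _ Af) h e; apply/(vge_ooP _ Af) => l nl.
by have [->//|ne] := eqVneq l n.+1; apply: h; move: ne nl; clia.
Qed.
Lemma crd_subZ l u f g: inA f -> inA g -> crd l (f - cst u * g) = crd l f - u * crd l g.
 by move=> Af Ag; rewrite -mulNr -rmorphN crd_lin // mulNr. Qed.
(** f is E / D to the given precision. The leading coefficient of D is a unit and leading
    coefficients multiply, so the top coordinate of f beyond m is small; its term is removed and the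
    pole order drops. *)
Lemma crd_quotient (f D E: F) (n: int) (k m: nat) : inA f -> ul k D -> inA E ->
 vge oo (- (k + m)%N%:Z) E -> vge w n (f * D - E) -> forall l, (m < l)%N -> vge v n (crd l f).
 move=> Af ulD AE oE; have [AD wD oD _ _] := ulD; have [cD0 vcD] := ul_crd ulD.
have [N hN]: exists N : nat, vge oo (- N%:Z) f. exists `|oo f|%N; have [->|f0] := eqVneq f 0; first exact: vge0.
by rewrite vgeE //; clia. elim: N f Af hN => [|N IH] f Af hN h l ml.
by rewrite (proj1 (vge_ooP _ Af) hN) ?vge0 //; move: ml; clia. have [Nm|mN] := leqP N.+1 m.
by rewrite (proj1 (vge_ooP _ Af) hN) ?vge0 //; apply: leq_ltn_trans ml.
have [ng|gp] := boolP (nongap d a N.+1); last first.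
by apply: IH => //; apply: vge_oo_pred => //; rewrite /Crd.crd (negPf gp). have top: vge v n (crd N.+1 f).
have e: crd (N.+1 + k) (f * D - E) = crd N.+1 f * crd k D.
have eE: crd (N.+1 + k) E = 0 by apply: (proj1 (vge_ooP _ AE) oE); rewrite addnC ltn_add2r.
have ->: f * D - E = f * D - cst 1 * E by rewrite rmorph1 mul1r.
by rewrite crd_subZ ?eE ?mulr0 ?subr0 ?crdM //; apply: inAM.
have := w_crd R (N.+1 + k) (inAB (inAM Af AD) AE) h; rewrite e mulrC. by rewrite vgeM_unit.
have ulw := ul_wb ng; have [cw0 vcw] := ul_crd ulw; case: (ulw) => Aw ww ow _ _.
pose c := crd N.+1 f / crd N.+1 (wb C N.+1); have vc: vge v n c by rewrite vge_div // vcw addr0.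
have Acw: inA (cst c * wb C N.+1) by apply: inAM => //; apply: inA_cst.
have Af': inA (f - cst c * wb C N.+1) by apply: inAB.
have ->: crd l f = crd l (f - cst c * wb C N.+1) + c * crd l (wb C N.+1) by rewrite crd_subZ // subrK.
apply: vgeD; last by apply: vge0M => //; apply: (w_crd R). apply: IH => //; last first.
have ->: (f - cst c * wb C N.+1) * D - E = (f * D - E) - cst c * (wb C N.+1 * D) by ring.
by apply: vgeB => //; apply: vge0M; [rewrite (wcst R)|apply: vgeM0].
apply: vge_oo_pred => //; first by apply: vgeB => //; apply: vgeM0 => //; apply: vge_cst.
by rewrite crd_subZ // /c divfK // subrr.
Qed.

Variables (f: F) (q N: nat) (D: model C B f q N).
Notation al := (md_al D).
Notation nu := (md_nu D).
Notation mm := (md_m D).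
Notation I := (fun h => inA (h ^+ q / al)).

Lemma subsp_I: subsp C I.
 by apply: subsp_root; [case: (al_w D)|exact: (md_q0 D)|exact: al_div]. Qed.
Lemma I_inA h: I h -> inA h.
 move=> Ih; apply: (@inA_root _ _ _ _ C _ q.-1); rewrite prednK ?(md_q0 D) //.
have [al0 _] := al_w D; rewrite -[_ ^+ _](divfK al0); apply: inAM => //. by case: (md_ul D).
Qed.

Hypothesis noI: forall h, I h -> vge oo (- mm%:Z) h -> h = 0.

(** By [noI] the coordinates above mm determine h. In the finite-dimensional space of pole order at
    most M they therefore bound the Gauss norm up to a fixed loss; the induction eliminates leading
    terms with one e of each pole order. *)
Lemma coordinate_bound (M: nat) : exists r : nat, forall (n: int) h, I h -> vge oo (- M%:Z) h ->
 (forall l, (mm < l)%N -> vge v n (crd l h)) -> vge w (n - r%:Z) h.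
 elim: M => [|M [r IH]]. exists 0%N => n h Ih oh _; rewrite (noI Ih) ?vge0 //; apply: vgeW oh; clia.
have [le|lt] := leqP M.+1 mm. exists 0%N => n h Ih oh _; rewrite (noI Ih) ?vge0 //; apply: vgeW oh; move: le; clia.
have [[e [Ie e0 oe]]|no] := pselect (exists e, [/\ I e, e != 0 & oo e = - M.+1%:Z]); last first.
exists r => n h Ih oh ch; apply: IH => //; have Ah := I_inA Ih.
apply: vge_oo_pred => //; apply/eqP; apply: contrapT => /negP c0; apply: no.
have h0: h != 0 by apply: contraNneq c0 => ->; rewrite crd0.
exists h; split=> //; apply/eqP; rewrite eq_le -vgeE // oh andbT leNgt; apply/negP => gt.
have : vge oo (- M%:Z) h by rewrite vgeE //; move: gt; clia.
by move/(vge_ooP _ Ah)/(_ M.+1 (ltnSn _))/eqP; rewrite (negPf c0). have Ae := I_inA Ie; have ce0 := crd_oo Ae e0 oe.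
pose k := `|v (crd M.+1 e) - w e|%N; exists (r + k)%N => n h Ih oh ch; have Ah := I_inA Ih.
pose c := crd M.+1 h / crd M.+1 e. have vc: vge v (n - v (crd M.+1 e)) c by rewrite vge_div // subrK; apply: ch.
have vce l: vge v (n - k%:Z) (c * crd l e).
have h1 := w_crd R l Ae (_: vge w (w e) e); have := vgeM vc (h1 _); rewrite vgeE // => /(_ (lexx _)).
by apply: vgeW; rewrite /k; clia. have Ace: inA (cst c * e) by apply: inAM => //; apply: inA_cst.
have wce: vge w (n - k%:Z) (cst c * e). have vee: vge w (w e) e by rewrite vgeE.
have wc: vge w (n - v (crd M.+1 e)) (cst c) by rewrite (wcst R).
by have := vgeM wc vee; apply: vgeW; rewrite /k; clia.
rewrite -(subrK (cst c * e) h); apply: vgeD; last by apply: vgeW wce; clia.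
have ->: n - (r + k)%N%:Z = (n - k%:Z) - r%:Z by clia.
apply: IH; first by apply: (subspB subsp_I) => //; apply: (subspZ _ subsp_I). apply: vge_oo_pred; first exact: inAB.
by apply: vgeB => //; apply: vgeM0; [exact: vge_cst|rewrite vgeE // oe]. by rewrite crd_subZ // /c divfK // subrr.
move=> l ml; rewrite crd_subZ //; apply: vgeB => //. by apply: vgeW (ch l ml); clia.
Qed.
Lemma ul_in_I: exists M1 : nat, forall l, (M1 <= l)%N -> exists2 e, I e & ul l e.
 have [M0 hM0] := md_lift D; have [M2 hM2] := pole_of_inA B. exists (M0 + M2 + mm)%N => l hl.
have [hb [Ahb hb0 ohb]] := hM2 (l - mm)%N ltac:(move: hl; clia).
have n0 := md_nu0 D; have nb0: nu * hb != 0 by rewrite mulf_neq0.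
have onb: Inf.oo B (nu * hb) = - l%:Z by rewrite dvM // md_onu ohb; move: hl; clia.
have [|||h [Ih wh oh rh]] := hM0 l.+1 _ (nu * hb).
- by move: hl; clia.
- by rewrite mulrC mulKf.
- by rewrite vgeE // onb; clia. exists h => //; split; rewrite ?rh //; first exact: I_inA. by apply: vgeW oh; clia.
Qed.
(** From order M1 on, I contains functions with unit leading coefficient, so high terms are removed
    without loss and the bound r does not depend on the pole order of h. *)
Lemma integral_gap: exists r : nat, forall h, I h -> vge w 0 h -> rd w h != 0 ->
 ~ (forall l, (mm < l)%N -> vge v r.+1%:Z (crd l h)).
 have [M1 hM1] := ul_in_I; have [r hr] := coordinate_bound (M1 + mm). exists r => h Ih wh rh ch.
have [L hL]: exists L : nat, vge oo (- (M1 + mm + L)%N%:Z) h.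
exists `|oo h|%N; have [->|h0] := eqVneq h 0; first exact: vge0. by rewrite vgeE //; clia.
elim: L h Ih wh rh ch hL => [|L IH] h Ih wh rh ch hL. have : vge w 1 h.
have := hr r.+1%:Z h Ih; rewrite addn0 in hL; move=> /(_ hL ch). by apply: vgeW; clia.
by rewrite -rd_eq0 // (negPf rh). have Ah := I_inA Ih; pose l := (M1 + mm + L.+1)%N.
have [e Ie ule] := hM1 l ltac:(rewrite /l; clia). have [ce0 vce] := ul_crd ule; case: (ule) => Ae we oe _ _.
pose c := crd l h / crd l e. have vc: vge v r.+1%:Z c by rewrite vge_div // vce addr0; apply: ch; rewrite /l; clia.
have wce: vge w r.+1%:Z (cst c * e) by apply: vge0M => //; rewrite (wcst R).
have Ace: inA (cst c * e) by apply: inAM => //; apply: inA_cst. apply: (IH (h - cst c * e)).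
- by apply: (subspB subsp_I) => //; apply: (subspZ _ subsp_I).
- by apply: vgeB => //; apply: vgeW wce.
- have ->: rd w (h - cst c * e) = rd w h; last by [].
by apply/rd_eqP => //; [apply: vgeB => //|rewrite addrC addKr vgeN]; apply: vgeW wce.
- move=> j mj; rewrite crd_subZ //; apply: vgeB; first exact: ch. by apply: vge0M => //; apply: (w_crd R).
apply: vge_oo_pred; first exact: inAB. have ->: (M1 + mm + L).+1 = l by rewrite /l addnS.
by apply: vgeB => //; apply: vgeM0 => //; apply: vge_cst. have ->: (M1 + mm + L).+1 = l by rewrite /l addnS.
by rewrite crd_subZ // /c divfK // subrr.
Qed.

Variable s: F.
Hypotheses (As: I s) (ws: vge w 0 s) (rs: rd w s = nu).

(** If s T^mm were A2 B2, then s / A2 would be B2 T^-mm, of pole order mm: to precision r + 1 this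
    is an element of I with small coordinates above mm, excluded by [integral_gap]. *)
Lemma small_parameter: exists r : nat, forall A2 B2, cunit A2 -> funit B2 ->
 ~ vge w r.+1%:Z (s * T ^+ mm - A2 * B2).
 have [r hr] := integral_gap; exists r => A2 B2 UA [j [c1 [d1 [ulc uld] B2E]]] hX.
have [A3 UA3 hA3] := cunit_inv R r.+1 UA. have [A30 wA3] := cunit_w UA3; case: (UA3) => AA3 vA3 [u u0 rA3].
apply: (hr (s * A3)); first exact: root_mul.
- exact: vgeM0.
- by rewrite rdM // rs rA3 mulf_neq0 ?md_nu0.
have ulD: ul (j + mm * d) (d1 * cx C ^+ mm) by apply: ulM => //; apply: ulX; apply: ul_x.
have ulE: ul (j + mm * d.+1) (c1 * cy C ^+ mm) by apply: ulM => //; apply: ulX; apply: ul_y.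
case: (ulE) => AE wE oE _ _.
apply: (@crd_quotient _ (d1 * cx C ^+ mm) (c1 * cy C ^+ mm) _ (j + mm * d)%N mm _ ulD AE).
- by apply: inAM => //; apply: I_inA.
- by move: oE; rewrite mulnS addnA addnAC. have [d10 wd1] := ul_neq0 uld; have [c10 wc1] := ul_neq0 ulc.
have [_ _ wy] := w_xy R; have y0 := y_unit C. have ->: s * A3 * (d1 * cx C ^+ mm) - c1 * cy C ^+ mm =
(d1 * cy C ^+ mm) * (A3 * (s * T ^+ mm - A2 * B2) + B2 * (A2 * A3 - 1)).
by rewrite B2E expr_div_n; field; rewrite d10 expf_neq0. have wd: vge w 0 (d1 * cy C ^+ mm).
by apply: vgeM0; [rewrite vgeE // wd1|apply: vge0X; rewrite vgeE // wy].
apply: vgeM0 => //; apply: vgeD; apply: vgeM0 => //. by rewrite B2E vgeE // dv_div // wc1 wd1.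
Qed.

End SmallParameter.

(** * Functions vanishing at the branch point over x = 0 *)

Section ZeroesAtBranch.
Variables (d a: nat) (kap F: fieldType) (C: scurve d a kap F) (e: nat).
Notation b := (d + 1 - a)%N.
Notation x := (cx C).
Notation inA := (inA C).
Notation oo := (oo C).
Hypothesis ed: (e < d)%N.

(** x has order d at P0, so for f in A this is vanishing to order e at P0, in a form that passes to
    the reduction. *)
Definition van (f: F) := inA (f ^+ d / x ^+ e).

(** [m i] has order a i mod d at P0; when this is less than e, one more factor x is required, which
    costs d in the pole order. *)
Definition ngv l := (pm d a (l %% d) + d * (a * (l %% d) %% d < e) <= l)%N.

Lemma pm_sum i: pm d a i = (a * i %% d + b * i %% d)%N.
 have e1 := divn_eq (a * i) d; have e2 := divn_eq (b * i) d. have ad: (a <= d + 1)%N by have := sc_a C; clia.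
have s0: (b * i + a * i = i * d.+1)%N by rewrite -mulnDl subnK // addn1 mulnC.
rewrite /pm -s0 {1}e1 {1}e2 ![(d * _)%N]mulnC.
by move: (_ * d)%N (_ * d)%N (_ %% _)%N (_ %% _)%N => u1 u2 u3 u4; clia.
Qed.
Lemma x_div (P: place C) : fpl P -> (d %| P (x ^+ e))%Z.
 move=> fP; rewrite dvX //; apply: dvdz_mull. have [Px|] := ltP 0 (P x); first by rewrite (branch_xy Px).1.
by move=> le; have ->: P x = 0 by apply/eqP; rewrite eq_le le; apply: fP.
Qed.
Lemma subsp_van: subsp C van.
 by apply: subsp_root; [rewrite expf_neq0 ?x_unit|exact: (d_gt0 C)|exact: x_div]. Qed.
Lemma van_inA f: van f -> inA f.
 move=> h; apply: (@inA_root _ _ _ _ C _ d.-1); rewrite prednK ?(d_gt0 C) //.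
have n0: x ^+ e != 0 by rewrite expf_neq0 ?x_unit.
by rewrite -[_ ^+ _](divfK n0); apply: inAM => //; apply: inAX; apply: inA_x.
Qed.
Lemma vanM f g: inA f -> van g -> van (f * g).
 by move=> Af h; rewrite [f * g]mulrC; apply: root_mul. Qed.
Lemma van_wb l: ngv l -> van (wb C l).
 rewrite /ngv /van /wb => h; set i := (l %% d)%N in h *; set k := (_ %/ _)%N. have k0: ((a * i %% d < e) <= k)%N.
rewrite /k leq_divRL ?(d_gt0 C) //; case: (_ < _)%N h => /= h; move: h; move: (pm d a i) => u; clia.
have le: (e <= k * d + a * i %% d)%N. have := ltnW ed; move: k0; case: ltnP => //= h1 k1 ed'.
by apply: leq_trans ed' _; apply: leq_trans (leq_addr _ _); rewrite leq_pmull.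
by apply: leq_trans h1 _; apply: leq_addl. have x0: x ^+ e != 0 by rewrite expf_neq0 ?x_unit.
have ->: (x ^+ k * m C i) ^+ d / x ^+ e = x ^+ (k * d + a * i %% d - e) * (x - 1) ^+ (b * i %% d).
apply: (mulIf x0); rewrite divfK // mulrAC -exprD subnK // [LHS]exprMn m_expd -exprM exprD; ring.
apply: inAM; apply: inAX; first exact: inA_x. by rewrite x1E; apply: inA_ev.
Qed.
(** The components of f vanish at P0 as much as f does. For a smaller l the coefficient of [m i]
    would have a nonzero constant term, and the order at P0 would be a i mod d < e. *)
Lemma oo_van f l: van f -> f != 0 -> oo f = - l%:Z -> ngv l.
 move=> h f0 of_; have Af := van_inA h; have := crd_oo Af f0 of_; rewrite /crd /ngv.
case: ifP; rewrite ?eqxx // => ng; have := lmod_lt C l; rewrite /nongap in ng.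
set i := (l %% d)%N in ng *; move=> id cn0; case: (ltnP (a * i %% d) e) => ae; last by rewrite muln0 addn0.
rewrite leqNgt; apply/negP => lt. have k0: ((l - pm d a i) %/ d = 0)%N.
by apply: divn_small; move: lt ng; move: (pm d a i) => u; clia.
rewrite k0 in cn0; have [P Px] := exists_branch C; have [Pd _] := branch_xy Px.
have d0 := d_gt0 C; have fP: fpl P by rewrite /fpl ltW. have Pf: vge P e%:Z f.
have := vge_inA h fP; rewrite vge_div ?expf_neq0 ?x_unit // dvX // Pd.
rewrite (vgeXr P e%:Z d.-1 f) prednK // -mulr_natl natz; congr vge; clia. have := branch_pr Px Pf id; rewrite rcoP //.
have r0: rco C f i != 0 by apply: contraNneq cn0 => ->; rewrite coef0.
have er0: evx (cst C) x (rco C f i) != 0 by rewrite ev0.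
rewrite (vgeE _ _ (evm_neq0 _ i r0)) (dvM _ er0 (m_unit C i)). have Pm: P (m C i) = (a * i %% d)%N%:Z.
have Px1: P (x - 1) = 0. have [_]: 1 - x != 0 /\ P (1 - x) = 0; last by rewrite -dvN opprB.
by apply: (@sub1_unit _ P 1) => //; rewrite addrC addKr vgeN vgeE // Pd; move: d0; clia.
have := congr1 P (m_expd C i); rewrite dvX ?m_unit // dvM ?expf_neq0 ?x_unit ?x1_unit //.
rewrite !dvX ?x1_unit // Px1 Pd mulr0 addr0 mulrC => /mulIf; apply. by move: d0; clia.
have Pr: P (evx (cst C) x (rco C f i)) = 0. have cop: coprimep 'X (rco C f i).
by rewrite coprimep_sym -['X]subr0 coprimep_XsubC rootE horner_coef0.
by have [] := @over_cop _ _ _ _ C P 'X (rco C f i) _ cop; first by split=> //; rewrite evxX.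
by rewrite Pr Pm add0r; move: ae; clia.
Qed.
Lemma ngv_shift l k: ngv l -> nongap d a k -> ngv (k + l).
 move=> hl hk. have ngl: nongap d a l. by move: hl; rewrite /nongap; apply: leq_trans; apply: leq_addr.
apply: (@oo_van (wb C k * wb C l)); first by apply: vanM; [apply: inA_wb|apply: van_wb].
by rewrite mulf_neq0 ?wb_neq0. by rewrite dvM ?wb_neq0 // !oo_wb //; clia.
Qed.

End ZeroesAtBranch.

(** * Counting the gaps *)

Section GapCount.
Variables (d a: nat) (kap F: fieldType) (C: scurve d a kap F) (e: nat).
Hypothesis ed: (e < d)%N.

(** For 0 < i < d exactly one of [pm i] = i and [pm (d - i)] = d - i fails, which gives (d - 1) / 2
    gaps; and i -> a i permutes the residues modulo d, so exactly e classes lose one more pole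
    order. *)
Lemma gap_count: (\sum_(j < 2 * d) ~~ ngv d a e j = (d - 1)./2 + e)%N.
 have d0 := d_gt0 C; have [a0 ad b0 bd] := ad_bounds C; have odd_d := sc_odd C.
pose g (i: nat) := (pm d a i != i : nat); pose ep (i: nat) := ((a * i %% d < e)%N : nat).
have cop_a: coprime a d by rewrite coprime_sym prime_coprime ?(sc_prime C) // gtnNdvd.
have step (i: 'I_d) : (~~ ngv d a e i + ~~ ngv d a e (d + i) = g i + ep i)%N.
rewrite /ngv modnDl (modn_small (ltn_ord i)) -!ltnNge /g -/(ep i).
have : (ep i <= 1)%N by rewrite /ep; case: (_ < _)%N.
have [->|->] := pm_or C (ltn_ord i); have := ltn_ord i; move: (nat_of_ord i) (ep _) => k u kd.
by rewrite eqxx; case: u => [|[|//]] _ /=; rewrite ?muln0 ?muln1 ?addn0; move: kd; case: ltnP; case: ltnP; clia.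
case: u => [|[|//]] _ /=; rewrite ?muln0 ?muln1 ?addn0; move: kd d0; case: ltnP; case: ltnP; case: eqP; clia.
rewrite mul2n -addnn big_split_ord /= -big_split /=. under eq_bigr => i _ do rewrite step.
rewrite big_split /=; congr (_ + _)%N. have flip i: (0 < i < d)%N -> (g i + g (d - i) = 1)%N.
move=> /andP[i0 id]; have di: (d - i < d)%N by move: i0 id; clia.
have neg c: (0 < c < d)%N -> (c * (d - i) %% d = d - c * i %% d)%N.
move=> /andP[c0 cd]; have nz: (0 < c * i %% d)%N.
rewrite lt0n -/(dvdn _ _) Euclid_dvdM ?(sc_prime C) // negb_or !gtnNdvd //.
have lt := ltn_mod (c * i) d; rewrite d0 in lt.
have e1: (c * (d - i) + c * i = c * d)%N by rewrite -mulnDr subnK // ltnW.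
have e2: ((c * (d - i) + c * i %% d) %% d = 0)%N by rewrite modnDmr e1 modnMl.
rewrite -(modn_small (_: (d - c * i %% d < d)%N)); last by move: nz lt; clia.
apply/eqP; rewrite -(eqn_modDr (c * i %% d)) e2 subnK ?modnn //; exact: ltnW.
have na: (a * (d - i) %% d = d - a * i %% d)%N by apply: neg; rewrite a0.
have nb: ((d + 1 - a) * (d - i) %% d = d - (d + 1 - a) * i %% d)%N by apply: neg; rewrite b0.
have := pm_sum C (d - i); rewrite na nb; have := pm_sum C i; have h1 := pm_or C id; have h2 := pm_or C di; rewrite /g.
have la := ltn_mod (a * i) d; have lb := ltn_mod ((d + 1 - a) * i) d; rewrite d0 in la lb.
move: h1 h2 i0 id la lb; move: (pm d a i) (pm d a (d - i)) (a * i %% d)%N ((d + 1 - a) * i %% d)%N.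
move=> u1 u2 r1 r2 h1 h2 i0 id la lb e1 e2.
by case: h1 => h1; case: h2 => h2; case: eqP; case: eqP; move: h1 h2 i0 id la lb e1 e2; clia.
have g0: g 0%N = 0%N by []. have e1: (\sum_(i < d) g i = \sum_(1 <= i < d) g i)%N.
by rewrite -(big_mkord xpredT g) big_ltn // g0 add0n.
have e2: (\sum_(1 <= i < d) g i = \sum_(1 <= i < d) g (d - i))%N.
by rewrite [LHS]big_nat_rev; apply: eq_big_nat => j _; congr g; rewrite add1n subSS.
have : ((\sum_(i < d) g i).*2 = d - 1)%N.
rewrite e1 -addnn {2}e2 -big_split /= big_nat (eq_bigr (fun=> 1%N)) => [|j]; last exact: flip.
by rewrite -big_nat sum_nat_const_nat muln1. by move=> <-; rewrite doubleK.
have h_inj: injective (fun i: 'I_d => Ordinal (lmod_lt C (a * i))).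
move=> i j /(congr1 val) /= h; apply: val_inj => /=. wlog le : i j h / (i <= j)%N => [W|].
by have [|/ltnW] := leqP i j; [apply: W|move=> /(W j i) ->].
apply/eqP; rewrite eqn_leq le /=; move/eqP: h; rewrite eq_sym eqn_mod_dvd ?leq_mul2l ?le ?orbT //.
rewrite -mulnBr Gauss_dvdr 1?coprime_sym // => dv.
rewrite -subn_eq0; apply: contraTT dv; rewrite -lt0n => p0; rewrite gtnNdvd //.
by apply: leq_ltn_trans (ltn_ord j); apply: leq_subr.
rewrite [RHS](_: _ = \sum_(i < d) (i < e)%N)%N; first by rewrite [RHS](reindex_inj h_inj).
rewrite -(big_mkord xpredT (fun i => (i < e)%N : nat)) (@big_cat_nat _ _ _ e) ?(ltnW ed) //= big_nat (eq_bigr (fun=> 1%N)).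
rewrite -big_nat sum_nat_const_nat muln1 subn0 [X in (_ + X)%N]big_nat big1 ?addn0 // => i /andP[h _].
by rewrite ltnNge h. by move=> i /andP[_ ->].
Qed.
Lemma gap_van_lt j: ~~ ngv d a e j -> (j < 2 * d)%N.
 rewrite -ltnNge => h; have id := lmod_lt C j; have d0 := d_gt0 C.
have := divn_eq j d; move: h; have [->|->] := pm_or C id; case: (_ < e)%N => /=; rewrite ?muln1;
move: (j %/ d)%N (j %% d)%N id d0 => k r id d0 h e1; case: k e1 => [|[|k]] e1; move: h id d0 e1; cnia.
Qed.

End GapCount.

(** * A nondegenerate linear system with factorial coefficients *)

Section FactorialSystem.
Variables (k: fieldType) (p: nat).
Hypothesis pk: p \in [pchar k].

Lemma natr_inj_small i j: (i < p)%N -> (j < p)%N -> (i%:R : k) = j%:R -> i = j.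
 wlog le : i j / (i <= j)%N => [W ip jp e|ip jp e].
by have [le|/ltnW le] := leqP i j; [exact: (W i j le ip jp e)|exact: esym (W j i le jp ip (esym e))].
apply/eqP; rewrite eqn_leq le /= -subn_eq0; apply: contraTT isT; rewrite -lt0n => lt.
have : (p %| j - i)%N by rewrite (dvdn_pcharf pk) natrB // e subrr.
by rewrite gtnNdvd //; apply: leq_ltn_trans (leq_subr _ _) jp.
Qed.
Lemma fact_unit m: (m < p)%N -> (m`!%:R : k) != 0.
 move=> mp; rewrite -(dvdn_pcharf pk); apply/negP => dv.
have p_pr := pcharf_prime pk; move: dv; elim: m mp => [|m IH] mp; first by rewrite dvdn1 => /eqP e1; rewrite e1 in p_pr.
by rewrite Euclid_dvdM // => /orP[|/(IH (ltnW mp))//]; rewrite gtnNdvd.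
Qed.

(** As a function of J the sum is a polynomial of degree less than n in the basis of falling
    factorials, with at least n distinct roots. Evaluation at J = m then recovers th m, since m! is
    invertible. *)
Lemma falling_vanish (n: nat) (th: nat -> k) (s: seq nat) : (n <= size s)%N -> uniq s -> (n <= p)%N ->
 (forall J, J \in s -> (J < p)%N) ->
 (forall J, J \in s -> \sum_(m < n) th m * (J ^_ m)%:R = 0) -> forall m, (m < n)%N -> th m = 0.
 move=> ns us np sp h. pose ff m : {poly k} := \prod_(l < m) ('X - l%:R%:P).
have ffE m J: (ff m).[J%:R] = (J ^_ m)%:R.
rewrite horner_prod; elim: m => [|m IH]; first by rewrite big_ord0 ffactn0.
rewrite big_ord_recr /= IH ffactnSr natrM !hornerE.
by have [le|lt] := leqP m J; [rewrite natrB|rewrite ffact_small // !mul0r]. pose r := \sum_(m < n) th m *: ff m.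
have rE J: r.[J%:R] = \sum_(m < n) th m * (J ^_ m)%:R.
by rewrite horner_sum; apply: eq_bigr => m _; rewrite hornerZ ffE. have sz: (size r <= n)%N.
apply: leq_trans (size_sum _ _ _) _; apply/bigmax_leqP => m _.
by apply: leq_trans (size_scale_leq _ _) _; rewrite /ff -(big_mkord xpredT (fun l => 'X - l%:R%:P)) size_prod_XsubC size_iota subn0 ltn_ord.
have r0: r = 0. apply/eqP; apply: contraTT ns => r0; rewrite -ltnNge.
have := @max_poly_roots _ r [seq J%:R | J <- s] r0; rewrite size_map => hh. apply: leq_trans (hh _ _) sz.
by apply/allP => y /mapP[J Js ->]; rewrite rootE rE h.
rewrite map_inj_in_uniq // => i j si sj; apply: natr_inj_small; exact: sp.
have z J: \sum_(m < n) th m * (J ^_ m)%:R = 0 by rewrite -rE r0 horner0.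
elim/ltn_ind => m IH mn; have := z m; rewrite (bigD1 (Ordinal mn)) //= ffactnn big1 ?addr0 => [|i].
by move/eqP; rewrite mulf_eq0 (negPf (fact_unit (leq_trans mn np))) orbF => /eqP.
rewrite /= => im; have [lt|ge] := ltnP i m; first by rewrite IH ?mul0r.
by rewrite ffact_small ?mulr0 // ltn_neqAle eq_sym im.
Qed.

Variables (d N N0: nat) (nw: pred nat) (th G: nat -> k) (D: nat).
Hypotheses (dp: (d < p)%N) (Np: (N < p)%N) (G0: G 0%N = 1)
 (GS: forall m, (m < d)%N -> m.+1%:R * G m.+1 = G m)
 (N0P: nw N0) (N0min: forall j, (j < N0)%N -> ~~ nw j)
 (gap_le: forall j, (N0 <= j)%N -> ~~ nw j -> (j < N0 + d)%N)
 (gapD: forall j, ~~ nw j -> (j < D)%N)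
 (cntD: (\sum_(j < D) ~~ nw j = N.+1)%N)
 (sys: forall j, ~~ nw j -> \sum_(i < j.+1) th i * G (j - i)%N = 0)
 (thN: forall i, (N < i)%N -> th i = 0).

Lemma fact_G m: (m <= d)%N -> m`!%:R * G m = 1.
 elim: m => [|m IH] md; first by rewrite G0 mulr1. by rewrite factS mulnC natrM -mulrA GS // IH // ltnW.
Qed.
(** Here G m = 1 / m! for m <= d. Below N0 every index is a gap and the system is triangular. The
    other gaps are N0 + J with J < d; multiplied by J!, their equations are values at J of one
    polynomial of degree less than the number of these gaps. *)
Lemma factorial_system i: th i = 0.
 have low j: (j < N0)%N -> th j = 0.
elim/ltn_ind: j => j IH jN; have := sys (N0min jN); rewrite big_ord_recr /= subnn G0 mulr1 big1 ?add0r //.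
by move=> l _; rewrite IH ?mul0r //; apply: ltn_trans jN. have [|hi] := ltnP i N0; first exact: low.
pose s := [seq (j - N0)%N | j <- iota N0 (D - N0) & ~~ nw j]. have sP J: J \in s -> ~~ nw (N0 + J)%N /\ (J < d)%N.
case/mapP => j; rewrite mem_filter mem_iota => /andP[nj /andP[Nj _]] ->.
by rewrite subnKC //; split=> //; have := gap_le Nj nj; move: Nj; clia. have ND: (N0 <= D)%N.
rewrite leqNgt; apply/negP => lt; have := gapD (N0min lt); by rewrite ltnn. have ss: (size s = N.+1 - N0)%N.
rewrite size_map size_filter -sum1_count -cntD.
have ->: (\sum_(j < D) ~~ nw j = \sum_(0 <= j < N0) ~~ nw j + \sum_(N0 <= j < D) ~~ nw j)%N.
by rewrite -(big_mkord xpredT (fun j => ~~ nw j : nat)) (@big_cat_nat _ _ _ N0).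
have ->: (\sum_(0 <= j < N0) ~~ nw j = N0)%N.
by rewrite big_nat (eq_bigr (fun=> 1%N)) => [|j /andP[_ /N0min ->]//]; rewrite -big_nat sum_nat_const_nat muln1 subn0.
by rewrite addKn [RHS](eq_bigr (fun j => if ~~ nw j then 1%N else 0%N)) -?big_mkcond // => j _; case: (nw j).
have [lt|] := ltnP N i; first exact: thN. move=> iN; have ->: i = (N0 + (i - N0))%N by rewrite subnKC.
apply: (@falling_vanish (N.+1 - N0) (fun m => th (N0 + m)%N) s); rewrite ?ss //.
- rewrite map_inj_in_uniq ?filter_uniq ?iota_uniq // => j1 j2; rewrite !mem_filter !mem_iota.
by move=> /andP[_ /andP[h1 _]] /andP[_ /andP[h2 _]]; move: h1 h2; clia.
- exact: leq_trans (leq_subr _ _) _.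
- by move=> J /sP[_ Jd]; apply: ltn_trans dp.
- move=> J /sP[nJ Jd]; have J0 := sys nJ.
transitivity (J`!%:R * \sum_(i < (N0 + J).+1) th i * G (N0 + J - i)%N); last by rewrite J0 mulr0.
rewrite -[X in _ = _ * X](big_mkord xpredT (fun i => th i * G (N0 + J - i)%N)).
rewrite [in RHS](@big_cat_nat _ _ _ N0) ?leqW ?leq_addr //=.
rewrite [in RHS]big_nat [X in _ * (X + _)]big1 ?add0r => [|j /andP[_ jN]]; last by rewrite low ?mul0r.
have ->: index_iota N0 (N0 + J).+1 = [seq (N0 + m)%N | m <- index_iota 0 J.+1].
by rewrite /index_iota -addnS addKn subn0 -iotaDl addn0. rewrite big_map mulr_sumr.
have ->: \sum_(0 <= m < J.+1) J`!%:R * (th (N0 + m)%N * G (N0 + J - (N0 + m))%N) =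
\sum_(0 <= m < J.+1) th (N0 + m)%N * (J ^_ m)%:R.
apply: eq_big_nat => m /andP[_ mJ]; rewrite subnDl mulrCA; congr (_ * _).
rewrite -(ffact_fact (_: m <= J)%N) // natrM -mulrA fact_G ?mulr1 //. exact: leq_trans (leq_subr _ _) (ltnW Jd).
pose n0 := (N.+1 - N0)%N; pose M := maxn n0 J.+1.
have ext (n: nat) : (n <= M)%N -> (forall m, (n <= m < M)%N -> th (N0 + m)%N * (J ^_ m)%:R = 0) ->
\sum_(0 <= m < n) th (N0 + m)%N * (J ^_ m)%:R = \sum_(0 <= m < M) th (N0 + m)%N * (J ^_ m)%:R.
move=> le hz; rewrite [RHS](@big_cat_nat _ _ _ n) //= [X in _ = _ + X](_: _ = 0) ?addr0 //.
by rewrite big_nat big1 // => m; apply: hz.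
rewrite -(big_mkord xpredT (fun m => th (N0 + m)%N * (J ^_ m)%:R)) !ext ?leq_maxl ?leq_maxr // => m /andP[h _].
by rewrite thN ?mul0r //; move: h iN hi; rewrite /n0; clia. by rewrite ffact_small ?mulr0. by move: iN hi; clia.
Qed.

End FactorialSystem.

(** * Polar parts at infinity with integral coefficients *)

Section PolarParts.
Variables (d a: nat) (K F: fieldType) (C: scurve d a K F) (v: dval K) (w: dval F)
 (B: scurve d a (resf v) (resf w)) (R: reduction C B).
Notation inA := (inA C).
Notation oo := (oo C).
Notation T := (T C).
Notation cst := (cst C).
Notation ul := (@ul _ _ _ _ C v w B).
Notation evT := (evx cst T^-1).
Implicit Types (X Y S: F) (P Q: {poly K}).

(** Denominators with a unit leading coefficient are the ones for which polar parts have
    coefficients as integral as the function, and pole orders do not grow under reduction. *)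
Definition frac X := exists j a1 b1, [/\ inA a1, ul j b1 & X = a1 / b1].

Lemma fracA1 X: inA X -> frac X.
 by move=> AX; exists 0%N, X, 1; split; rewrite ?divr1 //; apply: ul1. Qed.
Lemma fracM X Y: frac X -> frac Y -> frac (X * Y).
 move=> [j [a1 [b1 [Aa ub ->]]]] [k [a2 [b2 [Aa2 ub2 ->]]]].
by exists (j + k)%N, (a1 * a2), (b1 * b2); split; [apply: inAM|apply: ulM|rewrite mulf_div].
Qed.
Lemma fracD X Y: frac X -> frac Y -> frac (X + Y).
 move=> [j [a1 [b1 [Aa ub ->]]]] [k [a2 [b2 [Aa2 ub2 ->]]]].
have [b10 _] := ul_neq0 ub; have [b20 _] := ul_neq0 ub2; case: (ub) (ub2) => Ab _ _ _ _ [Ab2 _ _ _ _].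
exists (j + k)%N, (a1 * b2 + a2 * b1), (b1 * b2); split; [by apply: inAD; apply: inAM|exact: ulM|].
by rewrite addf_div.
Qed.
Lemma fracB X Y: frac X -> frac Y -> frac (X - Y).
 move=> hX hY; apply: fracD => //; rewrite -mulN1r; apply: fracM => //. by apply: fracA1; apply: inAN; apply: inA1.
Qed.
Lemma fracTV: frac T^-1.
 by exists d, (cy C), (cx C); split; [apply: inA_y|apply: ul_x|rewrite invf_div]. Qed.
Lemma fracX X n: frac X -> frac (X ^+ n).
 move=> h; elim: n => [|n IH]; last by rewrite exprS; apply: fracM. by rewrite expr0; apply: fracA1; apply: inA1.
Qed.
Lemma frac_evT P: frac (evT P).
 rewrite evx_coef; elim/big_ind: _ => [|X Y|i _]; [by apply: fracA1; apply: inA0|exact: fracD|].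
by apply: fracM; [apply: fracA1; apply: inA_cst|apply: fracX; apply: fracTV].
Qed.
Lemma frac_rd X (n: int) : frac X -> vge w 0 X -> vge oo n X -> vge (Inf.oo B) n (rd w X).
 move=> [j [a1 [b1 [Aa ub XE]]]] wX oX; have [b10 wb] := ul_neq0 ub; have ob := ul_oo R ub.
case: (ub) => Ab vb _ rb0 orb; have aE: a1 = X * b1 by rewrite XE divfK.
have wa: vge w 0 a1 by rewrite aE; apply: vgeM0.
have oa: vge oo (n - j%:Z) a1 by rewrite aE; apply: vgeM oX _; rewrite vgeE // ob.
have rE: rd w X = rd w a1 / rd w b1 by rewrite aE rdM // mulfK.
rewrite rE vge_div // orb; have [le|lt] := leP (n - j%:Z) 0. have e: n - j%:Z = - `|n - j%:Z|%N%:Z by move: le; clia.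
by rewrite e; apply: (oo_rd R) => //; rewrite -e. have a0: a1 = 0.
apply/eqP; apply: contraTT oa => a0; rewrite vgeE // -ltNge. by have := oo_inA_le0 Aa a0; move: lt; clia.
by rewrite a0 rd0 vge0.
Qed.

Let T0: T != 0. Proof. exact: T_unit. Qed.
Let oTV (i: nat) : oo (T^-1 ^+ i) = - i%:Z.
 by rewrite exprVn dvV dvX // oo_T mulr1. Qed.
Let wTV (i: nat) : vge w 0 (T^-1 ^+ i).
 by apply: vge0X; rewrite vgeE // dvV (w_T R). Qed.
Lemma evT_w n P: vp v n P -> vge w n (evT P).
 by move=> h; rewrite evx_coef; apply: vge_sum => i _; apply: vge0M => //; rewrite (wcst R).
Qed.
Lemma evT_oo (n: nat) P : (size P <= n)%N -> vge oo (1 - n%:Z) (evT P).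
 move=> le; rewrite evx_coef; apply: vge_sum => i _; apply: vgeM0; first exact: vge_cst.
rewrite vgeE // oTV; have := leq_trans (ltn_ord i) le. by move: (nat_of_ord i) => k; clia.
Qed.
Lemma evT_small P: vge oo 1 (evT P) -> P = 0.
 rewrite evx_coef => h; apply/polyP => i; rewrite coef0. have [lt|ge] := ltnP i (size P); last by rewrite nth_default.
apply/eqP; apply: contraT => n0.
have ti (k: 'I_(size P)) : cst P`_k * T^-1 ^+ k != 0 -> oo (cst P`_k * T^-1 ^+ k) = - k%:Z.
by rewrite mulf_eq0 negb_or => /andP[h1 h2]; rewrite dvM // pv_cst add0r.
have := @vge_distinct _ oo 1 _ (fun k: 'I_(size P) => cst P`_k * T^-1 ^+ k) _ h (Ordinal lt).
rewrite vgeE // (ti (Ordinal lt)) //= => hh. suff : 1 <= - i%:Z by clia.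
by apply: hh => k l hk hl; rewrite !ti // => /oppr_inj/eqP; rewrite eqz_nat => /eqP/val_inj.
Qed.

(** The remainder vanishes at oo, so the constant term belongs to the polar part. *)
Definition polar X P := vge oo 1 (X - evT P).

Lemma polar_eq X P Q: polar X P -> polar X Q -> P = Q.
 move=> h1 h2; apply/eqP; rewrite -subr_eq0; apply/eqP/evT_small.
have ->: evT (P - Q) = (X - evT Q) - (X - evT P) by rewrite evxB; ring. exact: vgeB.
Qed.
Lemma polarB X Y P Q: polar X P -> polar Y Q -> polar (X - Y) (P - Q).
 move=> h1 h2; rewrite /polar; have ->: X - Y - evT (P - Q) = (X - evT P) - (Y - evT Q). by rewrite evxB; ring.
exact: vgeB.
Qed.
Lemma polarZ X P u: polar X P -> polar (cst u * X) (u *: P).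
 move=> h; rewrite /polar -mul_polyC evxM evxC -mulrBr; apply: vgeM0 => //; exact: vge_cst.
Qed.
Lemma frac_leading (n: int) (M: nat) X : frac X -> vge w n X -> vge oo (- M%:Z) X ->
 exists2 u, vge v n u & vge oo (1 - M%:Z) (X - cst u * T^-1 ^+ M).
 move=> [j [a1 [b1 [Aa ub XE]]]] wX oM; have [b10 wb] := ul_neq0 ub; have ob := ul_oo R ub.
have aE: a1 = X * b1 by rewrite XE divfK. have [cb0 vcb] := ul_crd R ub; have [Ab vb ob' _ _] := ub.
have wa: vge w n a1 by rewrite aE; apply: vge0M. pose u := crd C (M + j) a1 / crd C j b1; exists u.
by rewrite vge_div // vcb addr0; apply: (w_crd R). have oa: vge oo (- (M + j)%N%:Z) a1.
have ->: - (M + j)%N%:Z = - M%:Z + - j%:Z by clia. by rewrite aE; apply: vgeM.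
have h1 := crd_leading Aa oa; have h2 := crd_leading Ab ob'.
have obT: oo (b1 * T ^+ j) = 0 by rewrite dvM // ob dvX // oo_T; clia.
have ->: X - cst u * T^-1 ^+ M = T^-1 ^+ M * ((a1 * T ^+ (M + j) - cst (crd C (M + j) a1)) -
cst u * (b1 * T ^+ j - cst (crd C j b1))) / (b1 * T ^+ j).
have ->: crd C (M + j) a1 = u * crd C j b1 by rewrite /u divfK.
rewrite XE exprD exprVn; have := expf_neq0 M T0; have := expf_neq0 j T0.
by move: (T ^+ M) (T ^+ j) => t1 t2 h3 h4; field; rewrite b10 h3 h4.
rewrite vge_div // obT addr0; have ->: 1 - M%:Z = - M%:Z + 1 by clia. apply: vgeM; first by rewrite vgeE // oTV.
by apply: vgeB => //; apply: vgeM0 => //; apply: vge_cst.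
Qed.
Lemma exists_polar (n: int) (N: nat) X : frac X -> vge w n X -> vge oo (- N%:Z) X ->
 exists P, [/\ polar X P, vp v n P & (size P <= N.+1)%N].
 elim: N X => [|N IH] X hX wX oX. have [u vu hu] := frac_leading hX wX oX; exists u%:P; split.
- by rewrite /polar evxC; move: hu; rewrite mulr1 subr0.
- by move=> i; rewrite coefC; case: eqP => _; rewrite ?vge0.
- by rewrite size_polyC; case: (u != 0). have [u vu hu] := frac_leading hX wX oX.
have [|||P [pP vP sP]] := IH (X - cst u * T^-1 ^+ N.+1).
- apply: fracB => //; apply: fracM; first by apply: fracA1; apply: inA_cst. by apply: fracX; apply: fracTV.
- by apply: vgeB => //; apply: vge0M => //; rewrite (wcst R).
- by apply: vgeW hu; clia. exists (P + u *: 'X ^+ N.+1); split.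
- move: pP; rewrite /polar evxD -mul_polyC evxM evxC evxXn evxX. by congr vge; ring.
- by move=> i; rewrite coefD coefZ coefXn; apply: vgeD => //; case: eqP => _; rewrite ?mulr1 ?mulr0 ?vge0.
- apply: leq_trans (size_polyD _ _) _; rewrite geq_max (leq_trans sP) //.
by apply: leq_trans (size_scale_leq _ _) _; rewrite size_polyXn.
Qed.
Lemma polar_leading X P (N: nat) : polar X P -> (size P <= N.+1)%N -> vge oo 1 (X * T ^+ N - cst P`_N).
 move=> h sP; have ->: X * T ^+ N - cst P`_N = (X - evT P) * T ^+ N + T ^+ N * evT (P - P`_N *: 'X^N).
rewrite evxB -mul_polyC evxM evxC evxXn evxX exprVn. by field; rewrite expf_neq0.
apply: vgeD; first by apply: vge0M => //; apply: vge0X; rewrite vgeE // oo_T.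
have s2: (size (P - P`_N *: 'X^N)%R <= N)%N. apply/leq_sizeP => i; rewrite leq_eqVlt => /orP[/eqP<-|lt].
by rewrite coefB coefZ coefXn eqxx mulr1 subrr.
by rewrite coefB coefZ coefXn gtn_eqF // mulr0 subr0 nth_default //; apply: leq_trans sP _.
have := evT_oo s2 => h2; apply: (@vgeW _ _ (N%:Z + (1 - N%:Z))); first by clia.
by apply: vgeM => //; rewrite vgeE // dvX // oo_T mulr1.
Qed.

(* At a gap, the coefficients of the polar part are determined by the higher
   ones. *)
Lemma gap_coefficient (e: nat) S Q (phi: nat -> int) : (e < d)%N -> van C e S -> polar S Q ->
 (forall i j, (i <= j)%N -> phi i <= phi j) -> (forall l, vge v (phi l) Q`_l) ->
 forall j, ~~ ngv d a e j -> vge v (phi j.+1) Q`_j.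
 move=> ed + + mono; have [N hN]: exists N : nat, vge oo (1 - N%:Z) S.
exists `|oo S|.+1; have [->|S0] := eqVneq S 0; first exact: vge0. by rewrite vgeE //; clia.
elim: N S Q hN => [|N IH] S Q oS vS pS hQ j gj. have ->: Q = 0; last by rewrite coef0 vge0.
apply: (polar_eq pS); rewrite /polar evx0 subr0; by []. have AS := van_inA vS.
have [lt|] := boolP (vge oo (1 - N%:Z) S); first exact: (IH S). have [->|S0] := eqVneq S 0; first by rewrite vge0.
have oS': vge oo (- N%:Z) S by apply: vgeW oS; clia.
rewrite vgeE // => nlt; have oSE: oo S = - N%:Z by move: oS' nlt; rewrite vgeE //; clia.
have ngN := oo_van vS S0 oSE; have vwb := van_wb C ed ngN. have ng: nongap d a N.
by move: ngN; rewrite /ngv /nongap; apply: leq_trans; apply: leq_addr.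
have ulw := ul_wb R ng; case: (ulw) => Aw ww ow _ _. have [Pw [pw vpw sw]] := exists_polar (fracA1 Aw) ww ow.
have sQ: (size Q <= N.+1)%N. have wSS: vge w (w S) S by rewrite vgeE.
by have [Q' [pQ' _ sQ']] := exists_polar (fracA1 AS) wSS oS'; rewrite (polar_eq pS pQ'). have Pw1: Pw`_N = 1.
apply/eqP; rewrite -subr_eq0; apply/eqP/(@cst_small _ _ _ _ C); rewrite rmorphB rmorph1.
have := vgeB (wb_T C ng) (polar_leading pw sw); congr vge; ring.
(* Removing the leading term changes the other coefficients by multiples of that of index N, bounded
   by phi N; at a gap j < N this is at least phi (j + 1) by monotonicity. *)
pose S' := S - cst Q`_N * wb C N; pose Q' := Q - Q`_N *: Pw.
have Pwb l: (N < l)%N -> Pw`_l = 0 by move=> lt; rewrite nth_default // (leq_trans sw).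
have := IH S' Q' _ _ _ _ j gj; rewrite /Q' coefB coefZ => hh.
have ->: Q`_j = Q`_j - Q`_N * Pw`_j + Q`_N * Pw`_j by rewrite subrK. apply: vgeD; last first.
have [lt|ge] := ltnP N j; first by rewrite Pwb ?mulr0 ?vge0.
have jN: (j < N)%N by rewrite ltn_neqAle ge andbT; apply: contraNneq gj => ->.
by apply: vge0M (vpw j); apply: vgeW (hQ N); apply: mono. apply: hh.
- have h1 := polar_leading pS sQ; have h2 := wb_T C ng. have h3: vge oo 1 (S' * T ^+ N).
have ->: S' * T ^+ N = (S * T ^+ N - cst Q`_N) - cst Q`_N * (wb C N * T ^+ N - 1) by rewrite /S'; ring.
by apply: vgeB => //; apply: vgeM0 => //; apply: vge_cst.
have ->: S' = S' * T ^+ N / T ^+ N by rewrite mulfK // expf_neq0. by rewrite vge_div // dvX // oo_T mulr1 subrK.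
- by apply: (subspB (subsp_van C e)) => //; apply: (subspZ _ (subsp_van C e)).
- by apply: polarB => //; apply: polarZ.
- move=> l; rewrite coefB coefZ; apply: vgeB; first exact: hQ.
have [lt|ge] := ltnP N l; first by rewrite Pwb ?mulr0 ?vge0. by apply: vge0M (vpw l); apply: vgeW (hQ N); apply: mono.
Qed.
Lemma van_lift (e: nat) (sb: resf w) : (e < d)%N -> van B e sb ->
 exists s, [/\ van C e s, vge w 0 s & rd w s = sb].
 move=> ed; have [N hN]: exists N : nat, vge (Inf.oo B) (1 - N%:Z) sb.
exists `|Inf.oo B sb|.+1; have [->|S0] := eqVneq sb 0; first exact: vge0. by rewrite vgeE //; clia.
have sV := subsp_van C e; have sVb := subsp_van B e. elim: N sb hN => [|N IH] sb ob vb.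
exists 0; rewrite vge0 rd0; split=> //; first exact: sV.1.
apply/esym/eqP; apply: contraTT ob => s0; rewrite vgeE // -ltNge. by have := oo_inA_le0 (van_inA vb) s0; clia.
have [lt|] := boolP (vge (Inf.oo B) (1 - N%:Z) sb); first exact: IH.
have [->|S0] := eqVneq sb 0; first by rewrite vge0.
rewrite vgeE // => nlt; have oE: Inf.oo B sb = - N%:Z by move: ob nlt; rewrite vgeE //; clia.
have ngN := oo_van vb S0 oE; have ng: nongap d a N.
by move: ngN; rewrite /ngv /nongap; apply: leq_trans; apply: leq_addr.
have [|u u0 hu] := leading_sub (C := B) S0 (wb_neq0 B N); first by rewrite oE oo_wb.
have [||s [vs ws rs]] := IH (sb - Curve.cst B u * wb B N).
- by apply: vgeW hu; rewrite oo_wb //; clia.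
- by apply: (subspB sVb) => //; apply: (subspZ _ sVb); apply: van_wb.
have [u' hu' ru'] := rd_surj u; have wc: vge w 0 (cst u') by rewrite (wcst R). exists (s + cst u' * wb C N); split.
- by apply: (subspD sV) => //; apply: (subspZ _ sV); apply: van_wb.
- by apply: vgeD => //; apply: vgeM0 => //; apply: (w_wb R).
- rewrite (rdD ws (vgeM0 wc (w_wb R N))) (rdM wc (w_wb R N)) rs (rd_wb R) -(rd_cst R hu') ru'. by rewrite subrK.
Qed.

End PolarParts.

(** * The Kummer product as a polynomial in t / T *)

Section KummerPolynomial.
Variables (d a: nat) (K F: fieldType) (C: scurve d a K F) (v: dval K) (z0 z: nat).
Notation T := (T C).
Notation cst := (cst C).
Notation zt := (zet C).

Definition kum_poly: {poly K} := \prod_(i < d) (1 - (zt ^+ i)%:P * 'X) ^+ (z0 * z ^ (d - i)).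

Lemma kumE t: kum C z0 z t = evx cst (cst t / T) kum_poly.
 rewrite evx_prod; apply: eq_bigr => i _. by rewrite evxXn evxB evx1 evxM evxC evxX mulrA -rmorphM.
Qed.

Definition scale_poly (c: {poly K}) t : {poly K} := \poly_(k < size c) (c`_k * t ^+ k).

Lemma coef_scale_poly c t k: (scale_poly c t)`_k = c`_k * t ^+ k.
 by rewrite coef_poly; case: ltnP => // h; rewrite nth_default ?mul0r. Qed.
Lemma evx_scale_poly c t (y: F) : evx cst y (scale_poly c t) = evx cst (cst t * y) c.
 rewrite [RHS]evx_coef /scale_poly poly_def evx_sum; apply: eq_bigr => i _.
by rewrite -mul_polyC evxM evxC evxXn evxX rmorphM rmorphXn exprMn; ring.
Qed.
Lemma kum_poly_int: vp v 0 kum_poly.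
 rewrite /kum_poly; elim/big_ind: _ => [|c r hc hr|i _]; first exact: vp1. by rewrite -[0]addr0; apply: vpM.
apply: vpXn => k; rewrite coefB coefCM coefX coef1; apply: vgeB; first by case: eqP; rewrite ?vge1 ?vge0.
apply: vgeM0; last by case: eqP; rewrite ?vge1 ?vge0.
by apply: vge0X; rewrite vgeE ?(gauss_zet C v) // -(fmorph_eq0 cst) z_unit.
Qed.
Lemma kum_poly0: kum_poly`_0 = 1.
 rewrite -horner_coef0 horner_prod big1 // => i _. by rewrite !(hornerE, mulr0, subr0, expr1n).
Qed.

Hypotheses (hz: vge v 1 (z%:R - zt)) (hz0: vge v 1 ((d * z0).+1%:R : K)).

Let P (i: 'I_d) : {poly K} := 1 - (zt ^+ i)%:P * 'X.
Let Q (i: 'I_d) : {poly K} := \prod_(j < d | j != i) P j.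
Let D: {poly K} := \prod_j P j.

Let PQ i: P i * Q i = D. Proof. by rewrite /D (bigD1 i). Qed.

Let dP i: (P i)^`() = - (zt ^+ i)%:P.
 by rewrite derivB derivC sub0r derivM derivC mul0r add0r derivX mulr1. Qed.
Lemma log_deriv (n: 'I_d -> nat) :
 D * (\prod_i P i ^+ n i)^`() = (\prod_i P i ^+ n i) * \sum_i (n i)%:R * ((P i)^`() * Q i).
 suff h (s: seq 'I_d) : D * (\prod_(i <- s) P i ^+ n i)^`() =
(\prod_(i <- s) P i ^+ n i) * \sum_(i <- s) (n i)%:R * ((P i)^`() * Q i) by exact: h.
elim: s => [|i s IH]; first by rewrite !big_nil derivC mulr0 mulr0.
rewrite !big_cons derivM mulrDr [D * (P i ^+ n i * _)]mulrCA IH deriv_exp -(PQ i) -mulr_natl.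
by case: (n i) => [|k] /=; rewrite ?exprS; ring.
Qed.

Let DE: D = 1 - 'X^d.
 have zu: zt != 0 by rewrite -(fmorph_eq0 cst) z_unit. have pV: d.-primitive_root zt^-1.
apply/andP; split; first exact: d_gt0 C. apply/forallP => i; have := sc_zet C => /andP[_ /forallP/(_ i)].
by rewrite !unity_rootE exprVn invr_eq1. have PE i: P i = - (zt ^+ i)%:P * ('X - (zt^-1 ^+ i)%:P).
rewrite /P mulrBr mulNr -polyCN -polyCM exprVn mulNr mulfV // polyCN. by rewrite polyC1; ring.
have e: D = (\prod_(i < d) - (zt ^+ i)%:P) * ('X^d - 1).
rewrite /D (eq_bigr _ (fun i _ => PE i)) big_split /=; congr (_ * _). by rewrite -(factor_Xn_sub_1 pV) big_mkord.
have [c cE]: exists c : K, \prod_(i < d) - (zt ^+ i)%:P = c%:P.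
exists (\prod_(i < d) - zt ^+ i); rewrite rmorph_prod; apply: eq_bigr => i _. by rewrite /= polyCN.
have D0: D.[0] = 1. by rewrite /D horner_prod big1 // => i _; rewrite /P !(hornerE, mulr0, subr0). have c1: c = -1.
move: D0; rewrite e cE !hornerE expr0n eqn0Ngt (d_gt0 C) sub0r mulrN1 => h. by rewrite -h opprK.
by rewrite e cE c1 polyCN polyC1; ring.
Qed.

(** Q i is D / P i. From X (P i)' = P i - 1 follows X D' = d D - sum_i Q i, and D is 1 - X^d. *)
Let sumQ: \sum_i Q i = d%:R.
 have D0: D != 0. rewrite /D; apply/prodf_neq0 => i _; apply/eqP => /(congr1 (fun c: {poly K} => c.[0])).
by rewrite /P !(hornerE, mulr0, subr0) => /eqP; rewrite oner_eq0. have e1: D^`() = \sum_i (P i)^`() * Q i.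
have := log_deriv (fun=> 1%N); rewrite (eq_bigr P) => [|i _]; last by [].
rewrite -/D => /(mulfI D0) ->; apply: eq_bigr => i _; by rewrite mul1r. have e2: \sum_i Q i = d%:R * D - 'X * D^`().
rewrite e1 mulr_sumr -[d%:R * D](_: \sum_(i < d) D = _); last by rewrite sumr_const card_ord mulr_natl.
rewrite -sumrB; apply: eq_bigr => i _; rewrite dP -(PQ i) /P; ring.
rewrite e2 DE derivB derivC derivXn sub0r mulrN mulrnAr -exprS prednK ?(d_gt0 C) //. by rewrite -mulr_natl; ring.
Qed.

(* The exponents satisfy z0 z^(d - i) zeta^i = -1/d mod pi, so that kum_poly
   is a solution of (1 - X^d) G' = G mod pi. *)
Lemma kum_poly_rec m: (m < d)%N -> vge v 1 (m.+1%:R * kum_poly`_m.+1 - kum_poly`_m).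
 move=> md; pose n (i: 'I_d) := (z0 * z ^ (d - i))%N. have := log_deriv n; rewrite -/kum_poly; set E := \sum_i _ => e.
have vzt: vge v 0 zt by rewrite vgeE ?(gauss_zet C v) // -(fmorph_eq0 cst) z_unit. have vQ (i: 'I_d) : vp v 0 (Q i).
rewrite /Q; elim/big_ind: _ => [|c r hc hr|j _]; first exact: vp1. by rewrite -[0]addr0; apply: vpM.
move=> k; rewrite coefB coefCM coefX coef1; apply: vgeB; first by case: eqP; rewrite ?vge1 ?vge0.
by apply: vgeM0; [apply: vge0X|case: eqP; rewrite ?vge1 ?vge0]. have hE: vp v 1 (E - 1).
have ->: E - 1 = - ((d * z0).+1%:R)%:P - \sum_i (((n i)%:R * zt ^+ i - z0%:R)%:P * Q i).
have ->: E = - (z0%:R%:P * \sum_i Q i) - \sum_i (((n i)%:R * zt ^+ i - z0%:R)%:P * Q i).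
rewrite mulr_sumr -sumrN -sumrB; apply: eq_bigr => i _. by rewrite dP polyCB -!polyC_natr; ring.
rewrite sumQ -addn1 natrD natrM polyCD polyC1. by move: (\sum_i _) => S; ring.
move=> k; rewrite coefB coefN coefC; apply: vgeB; first by rewrite vgeN; case: eqP; rewrite ?vge0.
rewrite coef_sum; apply: vge_sum => i _; rewrite coefCM; apply: vge0M (vQ i k).
have ->: (n i)%:R * zt ^+ i - z0%:R = z0%:R * ((z%:R ^+ (d - i) - zt ^+ (d - i)) * zt ^+ i).
rewrite mulrBl -exprD subnK 1?ltnW // (prim_expr_order (sc_zet C)) natrM natrX. by ring.
apply: vgeM0; first exact: vge_nat. by apply: vge0M; [apply: vgeX_sub => //; apply: vge_nat|apply: vge0X].
have := congr1 (fun c: {poly K} => c`_m) e.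
rewrite DE mulrBl mul1r coefB [in 'X^d * _]mulrC coefMXn md subr0 coef_deriv mulr_natl => ->.
have ->: kum_poly * E = kum_poly + kum_poly * (E - 1) by ring. rewrite coefD addrC addKr.
have vk := kum_poly_int; by have := vpM vk hE m; rewrite add0r.
Qed.

End KummerPolynomial.

(** * The case of large t *)

Section LargeParameter.
Variables (d a: nat) (K F: fieldType) (C: scurve d a K F) (v: dval K) (w: dval F)
 (B: scurve d a (resf v) (resf w)) (R: reduction C B).
Notation inA := (inA C).
Notation oo := (oo C).
Notation T := (T C).
Notation cst := (cst C).
Notation evT := (evx cst T^-1).
Variables (f: F) (q N e: nat) (Dm: model C B f q N).
Notation al := (md_al Dm).
Notation nu := (md_nu Dm).
Notation mm := (md_m Dm).
Notation g := (md_g Dm).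
Hypotheses (Af: inA f) (ed: (e < d)%N) (Nle: (N.+1 <= (d - 1)./2 + e)%N)
 (vanf: inA (f ^+ d / cx C ^+ (q * e))).
Variable s: F.
Hypotheses (As: inA (s ^+ q / al)) (ws: vge w 0 s) (rs: rd w s = nu).

Lemma model_factor (M: nat) : exists s1, [/\ van C e s1, vge w 0 s1 & vge w M%:Z (g - s * s1)].
 have [al0 wal] := al_w Dm; have [s0 ws0] := sigma_w ws rs; have q0 := md_q0 Dm.
(* h0 puts two conditions into one power condition: (h^q / al)^d / x^(q e) regular means that h / s,
   modulo the uniformizer, is regular off oo and vanishes to order e at P0. *)
pose h0 := al ^+ d * cx C ^+ (q * e); have d0 := d_gt0 C. have x0 n: cx C ^+ n != 0 by rewrite expf_neq0 ?x_unit.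
have h00: h0 != 0 by rewrite mulf_neq0. have qd0: (0 < q * d)%N by rewrite muln_gt0 q0.
have hdiv (P: place C) : fpl P -> ((q * d)%N %| P h0)%Z.
move=> fP; rewrite /h0 (dvM _ (expf_neq0 d al0) (x0 (q * e)%N)) (dvX _ _ al0) [(q * e)%N]mulnC exprM (dvX _ _ (x0 e)) PoszM rpredD //.
by rewrite mulrC dvdz_mul // (al_div Dm). by rewrite dvdz_mul // x_div. have sV := subsp_root h00 qd0 hdiv.
have split_h (h: F) : h ^+ (q * d) / h0 = (h ^+ q / al) ^+ d / cx C ^+ (q * e).
by rewrite expr_div_n -exprM /h0 invfM mulrA.
have [] := @approximate_factor _ _ _ _ C v w B R _ (van C e) s sV (subsp_van C e) s0 ws0 _ _ M g.
- move=> s' vs'; rewrite split_h.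
have ->: ((s * s') ^+ q / al) ^+ d / cx C ^+ (q * e) = (s ^+ q / al) ^+ d * (s' ^+ d / cx C ^+ e) ^+ q.
rewrite !expr_div_n !exprMn -!exprM [(e * q)%N]mulnC [(d * q)%N]mulnC.
by field; rewrite ?(x0 (q * e)%N) ?(expf_neq0 d al0). by apply: inAM; apply: inAX.
- move=> h Vh wh; have n0 := md_nu0 Dm. have vb: van B e (rd w h / nu).
apply: (@inA_root _ _ _ _ B _ q.-1); rewrite prednK //. have wx: vge w 0 (h ^+ (q * d)) by apply: vge0X.
have [wx0 _ _] := w_xy R; have xb0 := x_unit B. have wh0: w h0 = 0.
by rewrite /h0 (dvM _ (expf_neq0 d al0) (x0 (q * e)%N)) (dvX _ _ al0) wal (dvX _ _ (x_unit C)) wx0 !mulr0.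
have [|Arr _] := rd_A R Vh; first by rewrite vge_div // wh0 addr0. move: Arr; rewrite (rd_div) // rdX // /h0.
have hx := gauss_x (rd_gauss R). have wal0: vge w 0 al by rewrite vgeE // wal.
rewrite (rdM (vge0X d wal0) (vge0X (q * e) hx)) !rdX // md_rd -(rd_x R).
congr (Curve.inA B); rewrite !expr_div_n -!exprM [(e * q)%N]mulnC [(d * q)%N]mulnC. by field; rewrite !expf_neq0.
have [s' [vs' ws' rs']] := van_lift R ed vb; exists s'; split=> //. by rewrite rdM // rs rs' mulrC divfK.
- by rewrite split_h md_gE mulfK.
- by rewrite vgeE ?md_g0 // md_wg. by move=> s1 [vs1 ws1 h]; exists s1.
Qed.

Variables (p z0 z r: nat) (t: K) (A2 B2: F) (M: nat).
Hypotheses (pk: p \in [pchar resf v]) (p2d: (2 * d < p)%N)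
 (hz: vge v 1 (z%:R - zet C)) (hz0: vge v 1 ((d * z0).+1%:R : K))
 (ht: vge v 1 t) (t0: t != 0) (tr: v t <= r%:Z) (UA: cunit C B A2) (FB: funit C B B2)
 (Mr: (2 * d * r + 1 <= M)%N) (hM: vge w M%:Z (s * T ^+ mm * kum C z0 z t - A2 * B2)).

(** S = A2 s1 is regular off oo and vanishes to order e at P0, while modulo pi^M it equals Psi
    kum(t), with Psi of pole order N at oo. Its polar part at the gaps of such functions gives at
    least as many equations as Psi has coefficients up to the constant term. *)
Lemma large_parameter: False.
 have [s1 [vs1 ws1 gs1]] := model_factor M. have [A0 wA] := cunit_w UA; have [B0 wB] := funit_w FB.
have [k0 wk] := kum_w R z0 z ht; have wT := w_T R; have T0 := T_unit C.
have oTn n: oo (T^-1 ^+ n) = - n%:Z by rewrite exprVn dvV dvX // oo_T mulr1.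
have wTn n: vge w 0 (T^-1 ^+ n) by apply: vge0X; rewrite vgeE // dvV wT.
have g0 := md_g0 Dm; have wg := md_wg Dm; have q0 := md_q0 Dm. have AA: inA A2 by case: UA.
have [al0 wal] := al_w Dm; have [Aal _ _ _ _] := md_ul Dm. have Ag: inA g.
by apply: (@inA_root _ _ _ _ C _ q.-1); rewrite prednK // md_gE; apply: inAM.
pose S := A2 * s1; have vS: van C e S by apply: vanM. have wS: vge w 0 S by apply: vgeM0; rewrite // vgeE // wA.
pose Psi := g * T ^+ mm / B2. have Psi0: Psi != 0 by rewrite mulf_neq0. have oB: oo B2 = 0.
case: FB => j [c1 [d1 [ulc uld] ->]]; have [c10 _] := ul_neq0 ulc; have [d10 _] := ul_neq0 uld.
by rewrite dv_div // (ul_oo R ulc) (ul_oo R uld) subrr. have oPsi: oo Psi = - N%:Z.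
rewrite dv_div // oB dvM // dvX // oo_T md_og; clia. have wPsi: w Psi = 0.
by rewrite dv_div // wB dvM // dvX // wT wg mulr0. have fPsi: frac C B Psi.
case: FB => j [c1 [d1 [ulc uld] B2E]]; have [c10 _] := ul_neq0 ulc; have [d10 _] := ul_neq0 uld.
exists (j + mm * d.+1)%N, (g * (d1 * cx C ^+ mm)), (c1 * cy C ^+ mm); split.
- apply: inAM => //; apply: inAM; first by case: uld. by apply: inAX; apply: inA_x.
- by apply: ulM => //; apply: ulX; apply: ul_y.
- by rewrite /Psi B2E /Inf.T expr_div_n; field; rewrite c10 d10 expf_neq0 ?y_unit.
have hS: vge w M%:Z (S - Psi * kum C z0 z t). have ->: S - Psi * kum C z0 z t =
- (s1 * (s * T ^+ mm * kum C z0 z t - A2 * B2) + (g - s * s1) * (T ^+ mm * kum C z0 z t)) / B2.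
by rewrite /S /Psi; field. rewrite vge_div // wB addr0 vgeN; apply: vgeD; first exact: vgeM0.
by apply: vge0M => //; apply: vgeM0; [apply: vge0X; rewrite vgeE // wT|rewrite vgeE // wk].
(* The factor T^-n1 brings into the polar part P all coefficients of Psi that Gt, of degree less
   than n1 in 1 / T, can carry into the polar part of the product. *)
set G := kum_poly C z0 z; pose n1 := size G; pose Gt := scale_poly G t.
have kE: kum C z0 z t = evT Gt by rewrite kumE evx_scale_poly. pose X1 := Psi * T^-1 ^+ n1.
have X10: X1 != 0 by rewrite mulf_neq0. have fX1: frac C B X1 by apply: fracM => //; apply: fracX; apply: fracTV.
have wX1: vge w 0 X1 by apply: vgeM0 => //; rewrite vgeE // wPsi. have oX1: vge oo (- (N + n1)%N%:Z) X1.
by rewrite vgeE // /X1 dvM // oPsi oTn; clia. have [P [pP vP sP]] := exists_polar R fX1 wX1 oX1. pose H := Gt * P.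
have sGt: (size Gt <= n1)%N by apply: size_poly. have pH: polar C (Psi * kum C z0 z t) (drop_poly n1 H).
have XE: Psi = X1 * T ^+ n1 by rewrite /X1 exprVn divfK.
have eH: evT Gt * evT P = evT (take_poly n1 H) + evT (drop_poly n1 H) * T^-1 ^+ n1.
by rewrite -evxM -/H -{1}(poly_take_drop n1 H) evxD evxM evxXn evxX. rewrite /polar kE.
have ->: Psi * evT Gt - evT (drop_poly n1 H) = T ^+ n1 * evT (take_poly n1 H) + T ^+ n1 * evT Gt * (X1 - evT P).
have e2: T ^+ n1 * (evT Gt * evT P) = T ^+ n1 * evT (take_poly n1 H) + evT (drop_poly n1 H).
by rewrite eH exprVn; field; rewrite expf_neq0.
have ->: evT (drop_poly n1 H) = T ^+ n1 * (evT Gt * evT P) - T ^+ n1 * evT (take_poly n1 H).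
by rewrite e2 [_ + evT (drop_poly n1 H)]addrC addrK. by rewrite {1}XE; move: (X1) => X1'; ring.
have oT (Q: {poly K}) : (size Q <= n1)%N -> vge oo 1 (T ^+ n1 * evT Q).
move=> sQ; apply: (@vgeW _ _ (n1%:Z + (1 - n1%:Z))); first by clia.
by apply: vgeM (evT_oo C sQ); rewrite vgeE // dvX // oo_T mulr1.
apply: vgeD; first by apply: oT; apply: size_take_poly. by apply: vgeM0 => //; apply: vgeW (oT _ sGt).
have AS := van_inA vS. have [NS hNS]: exists n : nat, vge oo (- n%:Z) S.
exists `|oo S|%N; have [->|S0] := eqVneq S 0; first exact: vge0. by rewrite vgeE //; clia.
have [Q [pQ vQ sQ]] := exists_polar R (fracA1 B AS) wS hNS. have QH l: vge v M%:Z (Q`_l - H`_(l + n1)).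
have fk: frac C B (kum C z0 z t) by rewrite kE; apply: frac_evT.
have fD: frac C B (S - Psi * kum C z0 z t) by apply: fracB; [apply: fracA1|apply: fracM].
have [ND hND]: exists n : nat, vge oo (- n%:Z) (S - Psi * kum C z0 z t). exists (absz (oo (S - Psi * kum C z0 z t))).
by have [->|S0] := eqVneq (S - Psi * kum C z0 z t) 0; [exact: vge0|rewrite vgeE //; clia].
have [P3 [pP3 vP3 _]] := exists_polar R fD hS hND.
by have := vP3 l; rewrite (polar_eq pP3 (polarB pQ pH)) coefB coef_drop_poly.
(* The reduction of X1 has pole order at least n1, by the pole order of the reduction of g; so some
   coefficient of index at least n1 is a unit. *)
have [k1 [k1n [Pk10 vk1]]]: exists k1, (n1 <= k1)%N /\ P`_k1 != 0 /\ v P`_k1 = 0. apply: contrapT => no.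
have hP k: (n1 <= k)%N -> vge v 1 P`_k. move=> nk; have [->|P0] := eqVneq P`_k 0; first exact: vge0.
rewrite vgeE //; have := vP k; rewrite vgeE // => h; rewrite leNgt; apply/negP => lt.
by apply: no; exists k; split=> //; split=> //; move: h lt; clia. have wev := evT_w R vP.
have rX: vge (Inf.oo B) (1 - n1%:Z) (rd w X1). rewrite -(subrK (evT P) X1) rdD //; last exact: vgeB. apply: vgeD.
apply: (@vgeW _ _ 1); first by clia. apply: (frac_rd R); [|exact: vgeB|exact: pP].
by apply: fracB => //; apply: frac_evT.
rewrite evx_coef rd_sum => [|i _]; last by apply: vgeM0 => //; rewrite (wcst R).
apply: vge_sum => i _; have wc: vge w 0 (cst P`_i) by rewrite (wcst R).
rewrite rdM // -(rd_cst R) //; have [lt|ge] := ltnP i n1; last first.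
have ->: rd v P`_i = 0 by apply/eqP; rewrite rd_eq0 // hP. by rewrite rmorph0 mul0r vge0.
apply: vgeM0; first exact: vge_cst. have wTV: vge w 0 T^-1 by have := wTn 1%N; rewrite expr1.
rewrite rdX // rdV // (rd_T R) vgeE ?expf_neq0 ?invr_eq0 ?T_unit // exprVn dvV dvX ?T_unit // oo_T. by move: lt; clia.
move: rX; have rd_ne (h: F) : h != 0 -> w h = 0 -> rd w h != 0 by move=> h1 h2; rewrite rd_eq0 vgeE // h2.
have oBb: Inf.oo B (rd w B2) = 0. case: FB => j [c1 [d1 [ulc uld] ->]]; have [d10 wd1] := ul_neq0 uld.
case: ulc => _ vc _ rc oc; case: uld => _ _ _ rd1' od. by rewrite rd_div // dv_div // oc od subrr.
have XE: X1 * B2 * T ^+ n1 = g * T ^+ mm. by rewrite /X1 /Psi exprVn; field; rewrite B0 expf_neq0.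
have vT n: vge w 0 (T ^+ n) by apply: vge0X; rewrite vgeE // wT. have vB: vge w 0 B2 by rewrite vgeE // wB.
have vg: vge w 0 g by rewrite vgeE // wg. have wX10: w X1 = 0 by rewrite dvM // wPsi exprVn dvV dvX // wT mulr0.
have rT n: rd w (T ^+ n) = Inf.T B ^+ n by rewrite rdX ?(rd_T R) // vgeE // wT.
have TB0 n: Inf.T B ^+ n != 0 by rewrite expf_neq0 ?T_unit. have := congr1 (fun h => Inf.oo B (rd w h)) XE.
rewrite (rdM (vgeM0 wX1 vB) (vT _)) (rdM wX1 vB) (rdM vg (vT _)) !rT.
rewrite (dvM _ (mulf_neq0 (rd_ne _ X10 wX10) (rd_ne _ B0 wB)) (TB0 _)) (dvM _ (rd_ne _ X10 wX10) (rd_ne _ B0 wB)).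
rewrite (dvM _ (rd_ne _ g0 wg) (TB0 _)) !dvX ?T_unit // oo_T oBb (md_obg Dm).
rewrite vgeE ?rd_ne //; move: (Inf.oo B (rd w X1)) => o1; clia.
(* Newton polygon of slope tau: rescaling by powers of t turns Gt into G, whose reduction is known,
   and dividing by pi^mu makes the rescaled P integral with nonzero reduction. *)
pose tau := v t; have tau1: 1 <= tau by move: ht; rewrite vgeE. pose val k := v P`_k - (k%:Z - n1%:Z) * tau.
have [k2 [Pk20 k2min]]: exists k2, P`_k2 != 0 /\ forall k, P`_k != 0 -> val k2 <= val k.
have lt k: P`_k != 0 -> (k < size P)%N by move=> h; rewrite ltnNge; apply: contra h => le; rewrite nth_default.
have [j hj jmin] := @arg_minP _ _ 'I_(size P) (Ordinal (lt _ Pk10)) (fun k => P`_k != 0) (fun k => val k) Pk10.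
by exists j; split=> // k hk; have := jmin (Ordinal (lt _ hk)) hk. pose mu := val k2. have mu0: mu <= 0.
have := k2min k1 Pk10; rewrite -/mu /val vk1; move: k1n tau1; move: (mu) (tau) => m1 t1; cnia.
have [pi pi0 vpi] := dv_surj v. pose pk' k := P`_k * (pi ^ (- mu) * t ^ (n1%:Z - k%:Z)).
have wt0 k: pi ^ (- mu) * t ^ (n1%:Z - k%:Z) != 0 by [].
have vwt k: v (pi ^ (- mu) * t ^ (n1%:Z - k%:Z)) = - mu + (n1%:Z - k%:Z) * tau. by rewrite dvM // !dvXz // vpi mulr1.
have vpk k: vge v 0 (pk' k). rewrite /pk'; have [->|P0] := eqVneq P`_k 0; first by rewrite mul0r vge0.
rewrite (vgeE _ _ (mulf_neq0 P0 (wt0 k))) (dvM _ P0 (wt0 k)) vwt; have := k2min k P0; rewrite -/mu /val.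
by move: (v _) (mu) (tau) => v1 m1 t1; cnia. have vpk1 k: (k < n1)%N -> vge v 1 (pk' k).
move=> lt; rewrite /pk'; have [->|P0] := eqVneq P`_k 0; first by rewrite mul0r vge0.
rewrite (vgeE _ _ (mulf_neq0 P0 (wt0 k))) (dvM _ P0 (wt0 k)) vwt; have := vP k; rewrite vgeE //.
by move: mu0 tau1 lt; move: (v _) (mu) (tau) => v1 m1 t1; cnia. have vG := kum_poly_int C v z0 z; rewrite -/G in vG.
have HE j: H`_(j + n1) * (pi ^ (- mu) * t ^ (- j%:Z)) = \sum_(k < (j + n1).+1) pk' k * G`_(j + n1 - k).
rewrite /H coefMr mulr_suml; apply: eq_bigr => k _; rewrite coef_scale_poly /pk'.
have ->: n1%:Z - k%:Z = - j%:Z + (j + n1 - k)%N%:Z by have := ltn_ord k; move: (nat_of_ord k) => u; clia.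
by rewrite (expfzDr _ _ t0) -exprnP; ring. have vsum j: vge v 0 (\sum_(k < (j + n1).+1) pk' k * G`_(j + n1 - k)).
by apply: vge_sum => k _; apply: vgeM0. have vwtj j: v (pi ^ (- mu) * t ^ (- j%:Z)) = - mu - j%:Z * tau.
by rewrite dvM // !dvXz // vpi mulr1 mulNr.
have vH j n: vge v n (H`_(j + n1) * (pi ^ (- mu) * t ^ (- j%:Z))) = vge v (n + mu + j%:Z * tau) H`_(j + n1).
have ->: H`_(j + n1) * (pi ^ (- mu) * t ^ (- j%:Z)) = H`_(j + n1) / (pi ^ (- mu) * t ^ (- j%:Z))^-1 by rewrite invrK.
rewrite vge_div // dvV vwtj; congr vge; ring. pose phi (j: nat) := Num.min M%:Z (mu + j%:Z * tau).
have phi_mono i j: (i <= j)%N -> phi i <= phi j.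
move=> le; rewrite /phi le_min ge_min lexx /= ge_min; apply/orP; right.
by rewrite lerD2l ler_pM2r ?lez_nat //; move: tau1; clia. have Qphi l: vge v (phi l) Q`_l.
have ->: Q`_l = (Q`_l - H`_(l + n1)) + H`_(l + n1) by rewrite subrK.
apply: vgeD; first by apply: vgeW (QH l); rewrite /phi ge_min lexx.
have := vH l 0; rewrite HE vsum add0r => /esym; apply: vgeW; by rewrite /phi ge_min lexx orbT.
have gapH j: ~~ ngv d a e j -> vge v 1 (\sum_(k < (j + n1).+1) pk' k * G`_(j + n1 - k)).
move=> gj; rewrite -HE vH; have h1 := gap_coefficient R ed vS pQ phi_mono Qphi gj. have j2 := gap_van_lt C gj.
(* The origin of 2 d r + 1 <= M: at a gap j < 2 d, while tau <= r and mu <= 0. *)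
have h2: 1 + mu + j%:Z * tau <= M%:Z. have tr': tau <= r%:Z := tr.
by move: j2 tr' mu0 Mr tau1; move: (d) (r) (mu) (tau) => d' r' m1 t1; cnia.
have ->: H`_(j + n1) = - (Q`_j - H`_(j + n1)) + Q`_j by ring. apply: vgeD; first by rewrite vgeN; apply: vgeW (QH j).
by apply: vgeW h1; rewrite /phi le_min h2 /=; move: tau1; move: (mu) (tau) => m1 t1; cnia.
(* Coefficients of index below n1 reduce to zero because tau >= 1; the others satisfy the factorial
   system. *)
pose th i := rd v (pk' (n1 + i)%N); pose Gb m := rd v G`_m. have ex: exists j, ngv d a e j.
exists (2 * d)%N; apply: contraT => /(gap_van_lt C); by rewrite ltnn. pose N0 := ex_minn ex.
have [nN0 N0min]: ngv d a e N0 /\ forall j, ngv d a e j -> (N0 <= j)%N. by rewrite /N0; case: ex_minnP.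
pose N' := ((d - 1)./2 + e).-1; have N'E: N'.+1 = ((d - 1)./2 + e)%N by rewrite /N' prednK //; apply: leq_trans Nle.
have half_d: ((d - 1)./2 <= d - 1)%N by rewrite -divn2 leq_div.
have thz := @factorial_system (resf v) p pk d N' N0 (ngv d a e) th Gb (2 * d). have d0 := d_gt0 C.
have : forall i, th i = 0. apply: thz => //.
- by move: p2d; clia.
- by move: p2d N'E ed half_d d0; clia.
- by rewrite /Gb /G kum_poly0 rd1.
- move=> m md; have := kum_poly_rec hz hz0 md; rewrite -/G => h. have vm: vge v 0 (m.+1%:R : K) := vge_nat v m.+1.
have rm: rd v m.+1%:R = m.+1%:R. elim: (m.+1) => [|k IH]; first by rewrite rd0.
by rewrite !mulrS rdD ?vge1 ?vge_nat // IH rd1. by rewrite /Gb -rm -rdM //; apply/rd_eqP => //; apply: vgeM0.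
- by move=> j jN; apply: contraL jN => /N0min; rewrite -leqNgt.
- move=> j jN gj; have gp: ~~ nongap d a (j - N0).
by apply: contra gj => ng; have := ngv_shift C ed nN0 ng; rewrite subnK. by have := gap_lt C gp; move: jN; clia.
- by move=> j /(gap_van_lt C).
- by rewrite N'E; apply: (gap_count C).
- move=> j gj; have := gapH j gj; rewrite -rd_eq0 // => /eqP.
rewrite -(big_mkord xpredT (fun k => pk' k * G`_(j + n1 - k))) (@big_cat_nat _ _ _ n1) ?leqW ?leq_addl //=.
have v0: vge v 1 (\sum_(0 <= i < n1) pk' i * G`_(j + n1 - i)).
rewrite big_nat; apply: vge_sum => i /andP[_ lt]; apply: vge0M => //; exact: vpk1.
have ->: index_iota n1 (j + n1).+1 = [seq (n1 + i)%N | i <- index_iota 0 j.+1].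
by rewrite /index_iota -addSn addnK subn0 -iotaDl addn0.
rewrite big_map rdD; [|exact: vgeW v0|by apply: vge_sum => i _; apply: vgeM0].
have ->: rd v (\sum_(0 <= i < n1) pk' i * G`_(j + n1 - i)) = 0. by apply/eqP; rewrite rd_eq0 //; apply: vgeW v0.
rewrite add0r rd_sum => [e0|i _]; last exact: vgeM0.
rewrite -[RHS]e0 big_mkord; apply: eq_bigr => i _; rewrite rdM // /th /Gb [(j + n1)%N]addnC subnDl //.
- move=> i iN; rewrite /th /pk' nth_default ?mul0r ?rd0 //; apply: leq_trans sP _.
by move: iN N'E Nle; rewrite addnC; clia. move=> thE; have k2n: (n1 <= k2)%N.
rewrite leqNgt; apply/negP => lt; have := vpk1 _ lt; rewrite /pk' (vgeE _ _ (mulf_neq0 Pk20 (wt0 k2))) (dvM _ Pk20 (wt0 k2)) vwt.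
by rewrite /mu /val; move: (v P`_k2) (tau) => v1 t1; cnia.
have := thE (k2 - n1)%N; rewrite /th subnKC // => /eqP; rewrite rd_eq0 // /pk' (vgeE _ _ (mulf_neq0 Pk20 (wt0 k2))) (dvM _ Pk20 (wt0 k2)) vwt.
by rewrite /mu /val; move: (v P`_k2) (tau) => v1 t1; cnia.
Qed.

End LargeParameter.

(** * Extraction of the root of f *)

Section TorsionPrincipal.
Variables (d a: nat) (K F: fieldType) (C: scurve d a K F) (v: dval K).
Notation inA := (inA C).
Notation oo := (oo C).
Notation T := (T C).

Lemma kum_near1 (w: dval F) (B: scurve d a (resf v) (resf w)) (R: reduction C B) z0 z t (n: nat) :
 (0 < n)%N -> vge v n%:Z t -> vge w n%:Z (kum C z0 z t - 1).
 move=> n0 ht; have h (i: 'I_d) := kfac1 R i ht.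
have := one_unit_prod (fun i: 'I_d => z0 * z ^ (d - i))%N n0 h; rewrite -/(kum C z0 z t) => h1.
rewrite -(subrK (\sum_(i < d) (z0 * z ^ (d - i))%:R * (kfac C i t - 1)) (kum C z0 z t - 1)).
apply: vgeD; last by apply: vge_sum => i _; apply: vgeM0 (h i); apply: vge_nat.
by apply: (@vgeW _ _ n.+1%:Z); [clia|move: h1; congr vge; ring].
Qed.

Variables (p n: nat) (f: F) (N e: nat).
Hypotheses (p_pr: prime p) (p2d: (2 * d < p)%N) (p1d: (p = 1 %[mod d])%N) (vp: vge v 1 (p%:R : K))
 (vd: v d%:R = 0) (perf: forall u : resf v, exists u' : resf v, u' ^+ p = u).
Hypotheses (Af: inA f) (f0: f != 0)
 (qf: forall P : place C, fpl P -> ((p ^ n)%N %| P f)%Z) (of_: oo f = - (p ^ n * N)%N%:Z)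
 (Nle: (N.+1 <= (d - 1)./2 + e)%N) (ed: (e < d)%N)
 (vanf: inA (f ^+ d / cx C ^+ (p ^ n * e))).
Hypothesis eig: forall J, exists z z0 k u c, [/\ (0 < z)%N, (z ^ d = 1 + p ^ J * k)%N,
 vge v 1 (z%:R - zet C), vge v 1 ((d * z0).+1%:R : K) & del C f = cst C c * f ^+ z * u ^+ (p ^ n)].

Lemma torsion_principal: exists c g, g != 0 /\ f = cst C c * g ^+ (p ^ n).
 have [w hw] := exists_gauss C v; have [B R] := exists_reduction hw vd.
move: qf of_ vanf eig; set q := (p ^ n)%N => qfq ofq vanfq eigq; have q0: (0 < q)%N by rewrite expn_gt0 prime_gt0.
have [l [l0 lf0 wlf Alf]] := normalize R Af f0; set F1 := cst C l * f in lf0 wlf Alf. have cl0: cst C l != 0 by [].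
suff [c [g [g0 e1]]] : exists c g, g != 0 /\ F1 = cst C c * g ^+ q.
exists (l^-1 * c), g; split=> //; apply: (mulfI cl0); rewrite -/F1 e1 rmorphM fmorphV. by field.
have qF1 (P: place C) : fpl P -> (q %| P F1)%Z by move=> fP; rewrite /F1 dvM // pv_cst add0r qfq.
have oF1: oo F1 = - (q * N)%N%:Z by rewrite /F1 dvM // pv_cst add0r. have vanF1: inA (F1 ^+ d / cx C ^+ (q * e)).
by rewrite /F1 exprMn -mulrA -rmorphXn; apply: inAM => //; apply: inA_cst.
have eig1 J: exists z z0 k u c, [/\ (0 < z)%N, (z ^ d = 1 + p ^ J * k)%N,
vge v 1 (z%:R - zet C), vge v 1 ((d * z0).+1%:R : K) & del C F1 = cst C c * F1 ^+ z * u ^+ q].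
have [z [z0 [k [u [c [h1 h2 h3 h4 h5]]]]]] := eigq J. exists z, z0, k, u, (l * c / l ^+ z); split=> //.
rewrite /F1 rmorphM sc_dcst h5 exprMn !rmorphM fmorphV rmorphXn. by field; rewrite expf_neq0.
have pk: p \in [pchar resf v]. have rp m: rd v m%:R = m%:R.
by elim: m => [|m IH]; [rewrite rd0|rewrite !mulrS rdD ?vge1 ?vge_nat // IH rd1].
by rewrite inE p_pr -rp rd_eq0 //; apply: vge_nat. have pk0: (p%:R : resf v) = 0 by apply: pcharf0.
have rn m: rd v m%:R = m%:R. by elim: m => [|m IH]; [rewrite rd0|rewrite !mulrS rdD ?vge1 ?vge_nat // IH rd1].
have d0: (d%:R : K) != 0 by rewrite -(fmorph_eq0 (cst C)) rmorph_nat (d_unit C).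
have db0: (d%:R : resf v) != 0 by rewrite -rn rd_eq0 // vgeE // vd. have wF1: vge w 0 F1 by rewrite vgeE // wlf.
have [eb ebE]: exists eb, eb ^+ q = rd w F1. have [z [z0 [k [u0 [c0 [h1 _ h3 _ h5]]]]]] := eig1 0%N.
have [c [u [[c1 vc] [u1 wu] df]]] := unit_eigen R lf0 wlf q0 h5.
have [nb [_ _ qb _]] := reduce_roots R Alf lf0 wlf q0 qF1 oF1. have [AFb _] := rd_A R Alf wF1.
have vu: vge w 0 u by rewrite vgeE // wu. have vcc: vge v 0 c by rewrite vgeE // vc.
have wc: vge w 0 (cst C c) by rewrite (wcst R).
have vz: vge v 0 (zet C) by rewrite vgeE ?(gauss_zet C v) // -(fmorph_eq0 (cst C)) z_unit.
apply: (@eigen_power _ _ _ _ B p p_pr pk0 db0 p1d perf (rd w F1) n (rd w u) (Curve.cst B (rd v c)) z) => //.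
- by rewrite rd_eq0 // vgeE // wlf.
- by exists (rd v c).
- by rewrite fmorph_eq0 rd_eq0 // vgeE // vc.
- rewrite (rd_del R) // df (rd_cst R) // rdM ?vge0X //; last by apply: vgeM0; rewrite ?vge0X.
by rewrite rdM ?vge0X // !rdX.
- by rewrite (rd_zet R) -rn; apply/rd_eqP => //; apply: vge_nat.
have [D] := exists_model R Alf lf0 wlf q0 qF1 oF1 ebE.
have [s [As ws rs]] := exists_sigma D; have [s0 ws0] := sigma_w ws rs. have [al0 wal] := al_w D.
(* A nonzero h excluded by [noI] would make h^q / al regular everywhere, hence constant, and g / h
   would be the required root. *)
apply: contrapT => nosol. have noI h: inA (h ^+ q / md_al D) -> vge oo (- (md_m D)%:Z) h -> h = 0.
move=> Ih oh; apply/eqP; apply: contraT => h0; exfalso; apply: nosol. have [|c cE] := inA_const Ih.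
rewrite vge_div // (ul_oo R (md_ul D)); have := vgeX q oh; apply: vgeW. by rewrite -mulr_natl natz; clia.
have hq0: h ^+ q != 0 by []. exists c, (md_g D / h); split; first by rewrite mulf_neq0 ?(md_g0 D).
rewrite expr_div_n md_gE -cE; field; by rewrite hq0. have [r hr] := small_parameter R noI As ws rs.
(* r depends on the model only, so the precision M and the integer z are chosen after it: r + 1
   serves the small case and 2 d r + 1 the large one. *)
pose M := (2 * d * r + r + 1)%N; have M0: (0 < M)%N by rewrite /M addn1.
have [z [z0 [k [u [c [z_gt0 zd hz hz0 df]]]]]] := eig1 M.
have [A1 [B1 [UA1 FB1] hd]] := sigma_eigen R As ws rs z_gt0 M0 df. pose hh := s * T ^+ md_m D.
have T0 := T_unit C; have wT := w_T R. have hh0: hh != 0 by rewrite mulf_neq0.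
have whh: w hh = 0 by rewrite dvM // ws0 dvX // wT mulr0.
(* Starting value of the approximation: s reduces to nu, and a lift of nu with the same pole order,
   times T^m, is a [funit]. *)
have [B0 FB0 hB0]: exists2 B0, funit C B B0 & vge w 1 (hh - B0).
have onu: vge (Inf.oo B) (- (md_m D)%:Z) (md_nu D) by rewrite vgeE ?(md_nu0 D) // md_onu.
have [nu' [An wn rn' on]] := lift_A R (md_A D) onu.
have uln: ul C B (md_m D) nu' by split=> //; rewrite rn' ?(md_nu0 D) ?md_onu. exists (nu' * T ^+ md_m D).
exists (md_m D + md_m D * d)%N, (nu' * cx C ^+ md_m D), (cy C ^+ md_m D).
split; first by apply: ulM => //; apply: ulX; apply: ul_x.
by have := ulX (md_m D) (ul_y R); congr (ul _ _ _); rewrite mulnS. by rewrite /Inf.T expr_div_n mulrA.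
rewrite -mulrBl; apply: vge0M; last by apply: vge0X; rewrite vgeE // wT. by apply/rd_eqP => //; rewrite rs rn'.
have [pi pi0 vpi] := dv_surj v. have M1: (0 < M <= M)%N by rewrite M0 leqnn. have [t ht [A2 [B2 [UA FB] hX]]] :=
kummer_approximation R vp pi0 vpi hh0 whh FB0 hB0 UA1 FB1 hd z_gt0 zd (leqnn M) hz hz0 M1.
(* If pi^(r+1) divides t, the Kummer product is 1 to that precision and [small_parameter]
   applies. *)
have [rt|] := boolP (vge v r.+1%:Z t). apply: (hr A2 B2 UA FB); rewrite -/hh.
have ->: hh - A2 * B2 = (hh * kum C z0 z t - A2 * B2) - hh * (kum C z0 z t - 1) by ring.
apply: vgeB; first by apply: vgeW hX; rewrite /M; clia.
by apply: vgeM0; [rewrite vgeE // whh|apply: kum_near1 R _ _ _ _ _ rt].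
have [->|t0] := eqVneq t 0; first by rewrite vge0. rewrite vgeE // -ltNge => tr.
apply: (large_parameter R Alf ed Nle vanF1 As ws rs pk p2d hz hz0 ht t0 (r := r) _ UA FB _ hX). by move: tr; clia.
by rewrite /M; clia.
Qed.

End TorsionPrincipal.

(** * The symmetry x -> 1 - x *)

Section Reflection.
Variables (d a: nat) (kap F: fieldType) (C: scurve d a kap F).
Notation x := (cx C).
Notation y := (cy C).
Notation ev := (evx (cst C) x).

Lemma evx_reflect c: evx (cst C) (1 - x) c = ev (c \Po (1 - 'X)).
 rewrite comp_polyE evx_sum evx_coef; apply: eq_bigr => i _. by rewrite -mul_polyC evxM evxC evxXn evxB evx1 evxX.
Qed.
Lemma reflectK (c: {poly kap}) : (c \Po (1 - 'X)) \Po (1 - 'X) = c.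
 rewrite -comp_polyA; have ->: (1 - 'X) \Po (1 - 'X) = 'X :> {poly kap}; last exact: comp_polyXr.
by rewrite comp_polyB comp_polyX comp_polyC polyC1; ring.
Qed.

(* x -> 1 - x exchanges the roles of a and d + 1 - a. *)
Lemma exists_reflection: exists C' : scurve d (d + 1 - a) kap F,
 [/\ cst C' = cst C, cx C' = 1 - x & cy C' = y].
 have h1: (1 < d + 1 - a < d)%N by have := sc_a C; clia.
have h2: y ^+ d = (1 - x) ^+ (d + 1 - a) * ((1 - x) - 1) ^+ (d + 1 - (d + 1 - a)).
have e: (d + 1 - (d + 1 - a) = a)%N by have := sc_a C; clia. have ->: 1 - x - 1 = -1 * x by ring.
have ->: 1 - x = -1 * (x - 1) by ring.
rewrite e sc_eq [(-1 * x) ^+ a]exprMn [(-1 * (x - 1)) ^+ _]exprMn mulrACA -exprD.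
have ->: (d + 1 - a + a = d.+1)%N by have := sc_a C; clia. by rewrite -signr_odd /= (sc_odd C) mul1r mulrC.
have h3: del C (1 - x) = 1 - x by rewrite rmorphB rmorph1 sc_dx. have h4 c: evx (cst C) (1 - x) c = 0 -> c = 0.
by rewrite evx_reflect => /sc_trans e; rewrite -[c]reflectK e comp_poly0.
have h5 f: exists s : nat -> {poly kap}, exists2 c, c != 0 &
f * evx (cst C) (1 - x) c = \sum_(i < d) evx (cst C) (1 - x) (s i) * y ^+ i.
have [s [c c0 e]] := sc_gen C f; exists (fun i => s i \Po (1 - 'X)), (c \Po (1 - 'X)).
by apply: contraNneq c0 => e0; rewrite -[c]reflectK e0 comp_poly0.
rewrite evx_reflect reflectK e; apply: eq_bigr => i _; by rewrite evx_reflect reflectK.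
by exists (SCurve (sc_prime C) (sc_odd C) h1 (sc_zet C) h2 (sc_dcst C) h3 (sc_dy C) h4 h5).
Qed.
Lemma branch1_xy (P: place C) : 0 < P (x - 1) -> P (x - 1) = d%:Z /\ P y = (d + 1 - a)%N%:Z.
 have [C' [e1 e2 e3]] := exists_reflection => h. have c0 u: P (cst C' u) = 0 by rewrite e1 pv_cst.
have := @branch_xy _ _ _ _ C' (Place c0); rewrite /= e2 e3 -dvN opprB; exact.
Qed.
Lemma branch1_unique (P Q: place C) : 0 < P (x - 1) -> 0 < Q (x - 1) -> P = Q.
 have [C' [e1 e2 e3]] := exists_reflection => h1 h2. have cP u: P (cst C' u) = 0 by rewrite e1 pv_cst.
have cQ u: Q (cst C' u) = 0 by rewrite e1 pv_cst.
apply: place_inj; have := @branch_unique _ _ _ _ C' (Place cP) (Place cQ).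
rewrite /= e2 -(dvN P) -(dvN Q) !opprB => /(_ h1 h2) e; exact: (congr1 (@pv _ _ _ _ C') e).
Qed.

End Reflection.

(** * Divisor classes fixed by delta *)

Section FixedClasses.
Variables (d a: nat) (kap F: fieldType) (C: scurve d a kap F).
Notation x := (cx C).
Notation y := (cy C).
Notation ev := (evx (cst C) x).
Notation oo := (oo C).
Implicit Types (f h k: F) (P Q: place C).

Lemma place_ext P Q: (forall f, P f = Q f) -> P = Q.
 by move=> h; apply: place_inj; apply: dval_eqP. Qed.
Lemma pconj_add i j P: pconj i (pconj j P) = pconj (j + i) P.
 by apply: place_ext => f; rewrite pconj_conj pconjE. Qed.
Lemma pconj_d P: pconj d P = P.
 by apply: place_ext => f; rewrite pconjE dj_d. Qed.
Lemma pconj_oo j: pconj j oo = oo.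
 by apply: oo_unique; rewrite pconjE dj_x oo_x; have := d_gt0 C; clia. Qed.
Lemma finite_x P: fpl P -> 0 < P x \/ P x = 0.
 by rewrite /fpl le_eqVlt => /orP[/eqP<-|]; [right|left]. Qed.
Lemma multiple_over P q c: irreducible_poly q -> over P q -> c != 0 -> (P (ev q) %| P (ev c))%Z.
 move=> iq oq; have q0 := irredp_neq0 iq; have [s1 _] := iq. have [n] := ubnP (size c); elim: n c => // n IH c lt c0.
have [dv|nd] := boolP (q %| c); last first. have cop: coprimep q c by rewrite irreducible_poly_coprime.
by have [_ ->] := over_cop oq cop; apply: dvdz0.
have e := divpK dv; have c1: c %/ q != 0 by apply: contraNneq c0 => e0; rewrite -e e0 mul0r.
rewrite -e evxM dvM ?ev0 // rpredD // IH // -ltnS; apply: leq_trans lt; rewrite ltnS.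
by rewrite -[in X in (_ < X)%N]e; apply: size_mul_lt.
Qed.
(** A function of order 1 at P with zeros at all conjugates of P has components of positive order.
    Away from the branch points y is a unit, so these orders are multiples of P(q), hence P(q)
    cannot exceed 1. *)
Lemma unramified P q: irreducible_poly q -> over P q -> P x = 0 -> P (x - 1) = 0 -> P (ev q) = 1.
 move=> iq oq Px Px1; have [fP pq] := oq; set e := P (ev q) in pq *. have y0: P y = 0.
have := congr1 P (sc_eq C); rewrite dvM ?expf_neq0 ?x_unit ?x1_unit // !dvX ?x_unit ?x1_unit ?y_unit //.
by rewrite Px Px1 !mulr0 addr0 => /eqP; rewrite mulf_eq0 eqz_nat eqn0Ngt (d_gt0 C) => /eqP.
apply: contrapT => e1; have e2: 2 <= e by move: pq e1; clia. have [t0 t00 Pt0] := dv_surj P.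
pose s := [seq (Q: dval F) | Q <- orbit P & Q != P]. have Ps: (P: dval F) \notin s.
apply/mapP => -[Q]; rewrite mem_filter => /andP[QP _] /place_inj eq; by rewrite eq eqxx in QP.
have [m hm]: exists m : nat, forall Q, Q \in orbit P -> 1 - Q t0 <= m%:Z.
elim: (orbit P) => [|Q l [m IH]]; first by exists 0%N.
exists (m + `|1 - Q t0|)%N => Q'; rewrite inE => /orP[/eqP->|/IH]; clia.
have [u [hu hs]] := weak_approximation m.+1 Ps. have hu1: vge P 1 (u - 1) by apply: vgeW hu; clia.
have [u0 Pu] := @sub1_unit _ P 1 u isT hu1. have Pt: P (t0 * u) = 1 by rewrite dvM // Pt0 Pu.
have all1 j: vge (pconj j P) 1 (t0 * u).
have ->: pconj j P = pconj (j %% d) P by apply: place_ext => f; rewrite !pconjE dj_mod.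
have [->|ne] := eqVneq (pconj (j %% d) P) P; first by rewrite vgeE // Pt. have Qo: pconj (j %% d) P \in orbit P.
by apply: map_f; rewrite mem_iota /= add0n ltn_mod (d_gt0 C).
have := hs (pconj (j %% d) P); rewrite map_f ?mem_filter ?ne ?Qo // => /(_ isT).
rewrite !vgeE // dvM //; have := hm _ Qo; clia. have : vge P e (t0 * u).
rewrite -(sum_pr C (t0 * u)); apply: vge_sum => i _. have [->|pr0] := eqVneq (pr C i (t0 * u)) 0; first exact: vge0.
have p1: vge P 1 (pr C i (t0 * u)) by apply: vge_pr. have [r [c c0 prE]] := inKx_pr C i (t0 * u).
have yi0: y ^+ i != 0 by rewrite expf_neq0 ?y_unit. have r0: r != 0.
apply: contraNneq pr0 => r0; move/eqP: prE; rewrite r0 evx0 mul0r mulf_eq0 invr_eq0 (negPf yi0) orbF. by [].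
have := congr1 P prE; rewrite !dv_div ?ev0 // dvX // y0 mulr0 subr0.
have /dvdzP[k1 ->] := multiple_over iq oq r0; have /dvdzP[k2 ->] := multiple_over iq oq c0.
rewrite -/e -mulrBl => pe; move: p1; rewrite !vgeE // pe; move: e2; move: (k1 - k2) (e) => k3 e3 h1 h2.
have k31: 1 <= k3 by move: h1 h2; cnia. by rewrite ler_peMl //; move: h1; clia.
by rewrite vgeE // Pt; move: e2; clia.
Qed.

Definition invariant (D: place C -> int) := forall P, D (pconj 1 P) = D P.

Lemma invariant_pconj D j P: invariant D -> D (pconj j P) = D P.
 move=> h; elim: j => [|j IH]; first by congr D; apply: place_ext => f; rewrite pconjE. by rewrite -addn1 -pconj_add h.
Qed.
(** An invariant divisor is constant on the orbit over q, and off the branch points q vanishes to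
    order one there; a power of q removes that orbit and shortens the support. *)
Lemma kill_unramified (s: seq (place C)) (D: place C -> int) : invariant D ->
 (forall P, fpl P -> P x = 0 -> P (x - 1) = 0 -> D P != 0 -> P \in s) ->
 exists2 k, k != 0 & (forall P, fpl P -> P x = 0 -> P (x - 1) = 0 -> D P + P k = 0) .
 move: {2}(size s) (leqnn (size s)) => n; elim: n s D => [|n IH] s D le hD hs.
exists 1; rewrite ?oner_neq0 // => P fP Px Px1; rewrite dv1 addr0.
apply/eqP; apply: contraT => h; have := hs P fP Px Px1 h. by move: le; rewrite leqn0 size_eq0 => /eqP ->.
have [[P [fP [Px Px1]] DP]|none] := pselect (exists2 P, fpl P /\ P x = 0 /\ P (x - 1) = 0 & D P != 0); last first.
exists 1; rewrite ?oner_neq0 // => P fP Px Px1; rewrite dv1 addr0.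
by apply/eqP; apply: contraT => h; case: none; exists P.
have [q iq oq] := over_irreducible fP; have q0 := irredp_neq0 iq. have eq0: ev q != 0 by rewrite ev0.
pose k1 := ev q ^ (- D P); have k10: k1 != 0 by rewrite expfz_neq0.
have vk1 Q: Q k1 = - D P * Q (ev q) by rewrite dvXz. pose D1 Q := D Q + Q k1.
have hD1: invariant D1 by move=> Q; rewrite /D1 hD !vk1 pconjE dj_ev.
have hs1 Q: fpl Q -> Q x = 0 -> Q (x - 1) = 0 -> D1 Q != 0 -> Q \in [seq Q <- s | Q != P].
move=> fQ Qx Qx1; rewrite /D1 vk1; have [oQ|nQ] := pselect (over Q q). have /mapP[j _ ->] := over_orbit iq oq oQ.
by rewrite (invariant_pconj j P hD) pconjE dj_ev (unramified iq oq Px Px1) mulr1 addrN eqxx. have z: Q (ev q) = 0.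
have := vge_ev q fQ; rewrite vgeE // le_eqVlt => /orP[/eqP<-//|lt]. by case: nQ.
rewrite z mulr0 addr0 => DQ; rewrite mem_filter (hs Q) // andbT. by apply/eqP => e; case: nQ; rewrite e.
have [|k k0 hk] := IH _ D1 _ hD1 hs1.
have Ps := hs P fP Px Px1 DP; have := count_predC (pred1 P) s; rewrite size_filter.
have : (0 < count_mem P s)%N by rewrite -has_count has_pred1. move=> h1 h2; rewrite -ltnS; apply: leq_trans le.
by rewrite -h2 -[X in (X < _)%N]add0n ltn_add2r; apply: h1.
by exists (k1 * k) => [|Q fQ Qx Qx1]; rewrite // dvM // addrA; apply: hk.
Qed.

(* Hilbert's theorem 90, after normalizing the cocycle at infinity. *)
Lemma fixed_invariant (D: place C -> int) h : h != 0 -> (forall P, D (pconj 1 P) = D P + P h) ->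
 exists2 k, k != 0 & invariant (fun P => D P + P k).
 move=> h0 hh; have oh: oo h = 0 by have := hh oo; rewrite pconj_oo; clia.
have [|u hu] := @oo_residue _ _ _ _ C h; first by rewrite vgeE // oh. have u0: u != 0.
by apply: contraTneq hu => ->; rewrite rmorph0 subr0 vgeE // oh.
pose g := h / cst C u; have g0: g != 0 by rewrite mulf_neq0. have Pg P: P g = P h by rewrite dv_div // pv_cst subr0.
have g1: vge oo 1 (g - 1). have ->: g - 1 = (h - cst C u) / cst C u by rewrite mulrBl divff.
by rewrite vge_div // pv_cst addr0. have odj j f: oo (dj C j f) = oo f by elim: j => // j IH; rewrite djS oo_del.
have nrm1: nrm C g = 1. have n0 := nrm_neq0 C g0. have Pn P: P (nrm C g) = 0.
rewrite /nrm dv_prod => [|j _]; last by []. have step (j: nat) : P (dj C j g) = D (pconj j.+1 P) - D (pconj j P).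
by rewrite -pconjE Pg -addn1 -pconj_add hh [in RHS]addrC addKr. under eq_bigr do rewrite step.
have ->: \sum_(j < d) (D (pconj j.+1 P) - D (pconj j P)) = D (pconj d P) - D (pconj 0 P).
by rewrite -(big_mkord xpredT (fun j => D (pconj j.+1 P) - D (pconj j P))) telescope_sumr.
by rewrite pconj_d (_: pconj 0 P = P) ?subrr //; apply: place_ext => f; rewrite pconjE.
have [||c cE] := @inA_const _ _ _ _ C (nrm C g).
- by apply/inAP => P _; rewrite vgeE // Pn.
- by rewrite vgeE // Pn. have n1: vge oo 1 (nrm C g - 1). have dg j: vge oo 1 (dj C j g - 1).
by rewrite -(rmorph1 (dj C j)) -rmorphB; move: g1; rewrite /vge fmorph_eq0 odj.
have v1 j: vge oo 0 (dj C j g) by rewrite -(subrK 1 (dj C j g)) vgeD ?vge1 //; apply: vgeW (dg j).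
rewrite /nrm; elim/big_rec: _ => [|j f _ hf]; first by rewrite subrr vge0.
by have := vgeM_sub (v1 j) (vge1 oo) (dg j) hf; rewrite mulr1.
by apply/eqP; rewrite -subr_eq0; move: n1; rewrite cE -(rmorph1 (cst C)) -rmorphB => /cst_small ->; rewrite rmorph0.
pose H (i: nat) := \prod_(l < i) dj C l g. have HS i: g * del C (H i) = H i.+1.
rewrite /H big_ord_recl /= rmorph_prod; congr (_ * _); by []. pose k j := \sum_(i < d) H i * dj C i (y ^+ j).
have dk j: g * del C (k j) = k j. rewrite /k rmorph_sum mulr_sumr.
have e (i: 'I_d) : g * del C (H i * dj C i (y ^+ j)) = H i.+1 * dj C i.+1 (y ^+ j). by rewrite rmorphM mulrA HS djS.
under eq_bigr do rewrite e. apply: (shift_sum (G := fun i => H i * dj C i (y ^+ j))).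
by rewrite dj_d /H big_ord0 -/(nrm C g) nrm1. have [j kj0]: exists j, k j != 0.
(* The resolvents k j, divided by y^j and summed over j, give d; so they are not all zero. *)
apply: contrapT => none; have z j: k j = 0 by apply/eqP; apply: contraT => kj; case: none; exists j.
have : \sum_(j < d) k j / y ^+ j = 0 by apply: big1 => j _; rewrite z mul0r.
have ->: \sum_(j < d) k j / y ^+ j = \sum_(i < d) H i * \sum_(j < d) (cst C (zet C) ^+ i) ^+ j.
under [RHS]eq_bigr do rewrite mulr_sumr.
rewrite exchange_big; apply: eq_bigr => j _; rewrite /k mulr_suml; apply: eq_bigr => i _.
rewrite rmorphXn dj_y -exprM exprMn -exprM; field. by rewrite expf_neq0 ?y_unit.
have d0 := d_gt0 C; rewrite (bigD1 (Ordinal d0)) //= sum_z dvdn0 /H big_ord0 mul1r big1 ?addr0.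
by move/eqP; rewrite (negPf (d_unit C)). move=> i; rewrite -val_eqE /= => i0; rewrite sum_z gtnNdvd ?mulr0 // lt0n //.
exists (k j) => // P; have dk0: del C (k j) != 0 by [].
have ->: pconj 1 P (k j) = P (del C (k j)) by rewrite pconjE. by have := congr1 P (dk j); rewrite dvM // Pg hh; clia.
Qed.
(** Unramified points are removed by polynomials in x. At the point over x = 1 a product of powers
    of y and x - 1 suffices, as y has order d + 1 - a there, prime to d. At P0 powers of x then
    bring the coefficient between -(d - 1) and 0. *)
Lemma fixed_class (D: place C -> int) h (s: seq (place C)) : h != 0 ->
 (forall P, D (pconj 1 P) = D P + P h) -> (forall P, D P != 0 -> P \in s) ->
 exists k e, [/\ k != 0, (e < d)%N & forall P, fpl P -> D P + P k = if 0 < P x then - e%:Z else 0].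
 move=> h0 hh hs; have [k1 k10 inv1] := fixed_invariant h0 hh. have [sk hk] := support C k10.
have [|k2 k20 hk2] := @kill_unramified (s ++ sk) _ inv1.
move=> P fP _ _ ne; rewrite mem_cat; have [z|n] := eqVneq (D P) 0; last by rewrite (hs _ n).
by rewrite orbC hk //; apply: contraNneq ne => e; rewrite z e.
pose D2 P := D P + P (k1 * k2); have k120: k1 * k2 != 0 by [].
have h2 P: fpl P -> P x = 0 -> P (x - 1) = 0 -> D2 P = 0. by move=> fP Px Px1; rewrite /D2 dvM // addrA; apply: hk2.
have [P0 hP0] := exists_branch C; have [P0x P0y] := branch_xy hP0; have d0 := d_gt0 C.
have [a0 ad b0 bd] := ad_bounds C. have x0 := x_unit C; have x10 := x1_unit C; have y0 := y_unit C.
have sub0 P: 0 < P x -> P (x - 1) = 0. move=> Px; have [_]: 1 - x != 0 /\ P (1 - x) = 0; last by rewrite -dvN opprB.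
by apply: (@sub1_unit _ P 1) => //; rewrite addrC addKr vgeN vgeE //; move: Px; clia.
have [k3 k30 hk3]: exists2 k3, k3 != 0 & forall P, fpl P -> D2 P + P k3 = if 0 < P x then D2 P + P k3 else 0.
have [[P1 hP1]|none] := pselect (exists P: place C, 0 < P (x - 1)); last first.
exists 1; rewrite ?oner_neq0 // => P fP; case: ifP => // nx; rewrite dv1 addr0; apply: h2 => //.
by case: (finite_x fP) => //; rewrite nx.
have := vge_x1 fP; rewrite vgeE // le_eqVlt => /orP[/eqP//|lt]; by case: none; exists P.
have [P1x P1y] := branch1_xy hP1.
have cop: coprime (d + 1 - a) d by rewrite coprime_sym prime_coprime ?(sc_prime C) // gtnNdvd.
have [u [w uw]]: exists u w : int, u * (d + 1 - a)%N%:Z + w * d%:Z = 1.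
by have /coprimezP[[u w] e]: coprimez (d + 1 - a)%N d; [exact: cop|exists u, w].
pose n1 := D2 P1; pose k3 := y ^ (- n1 * u) * (x - 1) ^ (- n1 * w). have k30: k3 != 0 by rewrite mulf_neq0.
have vk3 P: P k3 = - n1 * u * P y + - n1 * w * P (x - 1) by rewrite dvM // !dvXz.
exists k3 => // P fP; case: ifP => // nx; have Px: P x = 0 by case: (finite_x fP) => //; rewrite nx.
have := vge_x1 fP; rewrite vgeE // le_eqVlt => /orP[/eqP/esym z|lt].
rewrite h2 // vk3 z mulr0 addr0 add0r; have := congr1 P (sc_eq C).
rewrite dvM // !dvX // Px z !mulr0 addr0 => /eqP; rewrite mulf_eq0 eqz_nat eqn0Ngt d0 /=.
by move/eqP ->; rewrite mulr0. have ->: P = P1 by apply: branch1_unique.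
rewrite vk3 P1x P1y -/n1; have ->: - n1 * u * (d + 1 - a)%N%:Z + - n1 * w * d%:Z = - n1 by rewrite -!mulrA -mulrDr uw mulr1.
by rewrite subrr. pose n0 := D2 P0 + P0 k3; pose l := (- n0 %/ d)%Z. have dz: d%:Z != 0 by rewrite eqz_nat -lt0n.
have el := divz_eq (- n0) d; have m0 := modz_ge0 (- n0) dz; have m1 := ltz_mod (- n0) dz.
exists (k1 * k2 * (k3 * x ^ l)), (absz (- n0 %% d)%Z); split.
- by [].
- by move: m1 m0; clia. have xl0: x ^ l != 0 by [].
move=> P fP; rewrite (dvM _ k120 (mulf_neq0 k30 xl0)) (dvM _ k30 xl0) (dvXz _ _ x0) !addrA -/(D2 P).
rewrite hk3 //; case: ifP => [Px|nx]; last first. by have [|->] := finite_x fP; rewrite ?nx // mulr0 addr0.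
have ->: P = P0 by apply: branch_unique.
rewrite P0x -/n0 /l gez0_abs //; move: el; move: (- n0 %/ d)%Z (- n0 %% d)%Z => u1 u2; clia.
Qed.

End FixedClasses.

(** * The p-adic field K, its valuation and its residue field *)

Lemma fracE (R: idomainType) (r: {fraction R}) : exists u w : R, w != 0 /\ r = tofrac u / tofrac w.
 elim/quotW: r => x; exists (\n_x), (\d_x); split; first exact: denom_ratioP. have d0: \d_x != 0 := denom_ratioP x.
apply: (canRL (mulfK _)); first by rewrite tofrac_eq0. rewrite -[LHS]/(FracField.mul _ _) !piE; apply/eqmodP.
by rewrite /= /FracField.equivf /= !numden_Ratio ?oner_eq0 ?mulf_neq0 ?oner_neq0 //; apply/eqP; ring.
Qed.

Section PadicField.
Variables (p: nat) (p_pr: prime p).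
Notation Zp := (padic_int p_pr).
Notation Qp := (padic p_pr).
Implicit Types u w : Zp.

Fact padic_shift_subproof u m n: (m <= n)%N -> u 1%N = 0%N ->
 ((u n.+1 %/ p) %% p ^ m = u m.+1 %/ p)%N.
 move=> mn u1; have p0 := prime_gt0 p_pr.
have dv k: (p %| u k.+1)%N by rewrite /dvdn -[p in X in (_ %% X)%N]expn1 presP // u1.
have e := presP u (_: m.+1 <= n.+1)%N; rewrite -e //.
have /dvdnP[a aE] := dv n; rewrite aE mulnK // expnS mulnC -muln_modr mulKn //.
Qed.
Lemma padic_natE n k: ((n%:R : Zp) k = n %% p ^ k)%N.
 elim: n => [|n IH]; first by []. by rewrite mulrS /= IH modnDml modnDmr.
Qed.
Lemma padic_div_p u: u 1%N = 0%N -> exists w, u = p%:R * w.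
 move=> u1; have p0 := prime_gt0 p_pr.
exists (@PadicInt p p_pr (fun n => u n.+1 %/ p)%N (fun m n mn => padic_shift_subproof mn u1)).
apply: padic_eqP => n /=; rewrite padic_natE modnMml.
have dv: (p %| u n.+1)%N by rewrite /dvdn -[p in X in (_ %% X)%N]expn1 presP // u1. by rewrite mulnC divnK // presP.
Qed.
Lemma padic_factor u: u != 0 -> exists i w, u = p%:R ^+ i * w /\ w 1%N != 0%N.
 move=> /padic_neq0[k /(_ k (leqnn k))]; elim: k u => [|k IH] u; first by rewrite expn0 dvd1n.
have [u1|u1] := eqVneq (u 1%N) 0%N; last by exists 0%N, u; rewrite expr0 mul1r.
have [w wE] := padic_div_p u1; move=> nd. have [|i [w' [w'E h]]] := IH w.
apply: contra nd => dv; rewrite wE /= padic_natE modnMml. have wk: (w k.+1 %% p ^ k = w k)%N by apply: presP.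
have dv': (p ^ k %| w k.+1)%N by move: dv; rewrite /dvdn wk pres_mod.
by rewrite /dvdn modn_mod -/(dvdn _ _) expnS dvdn_mul. by exists i.+1, w'; rewrite wE {1}w'E exprS mulrA.
Qed.
Lemma padic_p1 w: (p%:R * w) 1%N = 0%N.
 by rewrite /= padic_natE expn1 modnn mul0n mod0n. Qed.

Variable K: fieldExtType Qp.
Notation inj := (of_padic_int K).

Fact of_padicD u w: inj (u + w) = inj u + inj w.
 by rewrite /of_padic_int rmorphD scalerDl. Qed.
Fact of_padicM u w: inj (u * w) = inj u * inj w.
 by rewrite /of_padic_int rmorphM -scalerAl mul1r scalerA. Qed.
Fact of_padicN u: inj (- u) = - inj u.
 by rewrite /of_padic_int rmorphN scaleNr. Qed.
Fact of_nat n: inj n%:R = n%:R.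
 by rewrite /of_padic_int rmorph_nat scaler_nat. Qed.
Fact of_padicX u n: inj (u ^+ n) = inj u ^+ n.
 by elim: n => [|n IH]; rewrite ?expr0 ?(of_nat 1) // !exprS of_padicM IH. Qed.
Fact of_eq0 u: (inj u == 0) = (u == 0).
 by rewrite /of_padic_int scaler_eq0 oner_eq0 orbF tofrac_eq0. Qed.

(** The image of Z_p in K, written with denominators of nonzero residue so that inverses of units of
    Z_p need not be constructed. *)
Definition ploc (f: K) := exists u w, w 1%N != 0%N /\ f = inj u / inj w.
Definition padic_scalar (f: K) := exists r : Qp, f = r%:A.

Lemma unit_res u w: u 1%N != 0%N -> w 1%N != 0%N -> (u * w) 1%N != 0%N.
 move=> hu hw; rewrite /= -/(dvdn _ _) expn1 -lt0n lt0n -/(dvdn p _).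
have h (a: Zp) : (a 1 != 0)%N -> ~~ (p %| a 1)%N. by move=> a0; have := pres_mod a 1; rewrite expn1 /dvdn => ->.
by rewrite Euclid_dvdM // negb_or !h.
Qed.
Lemma res_neq0 w: w 1%N != 0%N -> inj w != 0.
 by rewrite of_eq0; apply: contraNneq => ->; rewrite /= mod0n.
Qed.
Lemma p_neq0: (p%:R : K) != 0.
 rewrite -of_nat of_eq0; apply/eqP => e. have := congr1 (fun w: Zp => w 2%N) e => /=; rewrite mod0n.
have p1 := prime_gt1 p_pr. rewrite padic_natE modn_small; last by rewrite -[X in (X < _)%N]expn1 ltn_exp2l.
by move=> p0; rewrite p0 in p1.
Qed.
Lemma padic_algebraic f: exists c : 'I_(\dim {:K}).+1 -> K,
 [/\ forall i, padic_scalar (c i), exists i, c i != 0 & \sum_i c i * f ^+ i = 0].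
 pose X := [tuple f ^+ i | i < (\dim {:K}).+1]. have : ~~ free X. rewrite /free size_tuple; apply/eqP => e.
by have := dimvS (subvf <<X>>%VS); rewrite e ltnn. move=> nf; apply: contrapT => none; case/negP: nf.
apply/freeP => k sk i; apply/eqP; apply: contraT => ki; case: none.
exists (fun i => (k i)%:A); split; first by move=> j; exists (k j). by exists i; rewrite scaler_eq0 oner_eq0 orbF.
rewrite -[RHS]sk; apply: eq_bigr => j _. by rewrite -scalerAl mul1r (nth_map j) ?size_enum_ord // nth_ord_enum.
Qed.
(** The extension theorem over the fraction field of Z_p; the last clause is what determines
    residues of p-adic scalars in [residue_algebraic]. *)
Lemma exists_padic_dval: exists v : dval K, [/\ forall u, vge v 0 (inj u), 0 < v p%:R &
 forall c, padic_scalar c -> vge v 0 c -> ploc c].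
 have L1: ploc 1. exists 1, 1; split; first by rewrite /= expn1 modn_small ?prime_gt1. by rewrite (of_nat 1) divr1.
have LB f g: ploc f -> ploc g -> ploc (f - g).
move=> [u [w [hw ->]]] [u' [w' [hw' ->]]]; exists (u * w' - u' * w), (w * w'). split; first exact: unit_res.
rewrite of_padicD of_padicN !of_padicM; field. by rewrite (res_neq0 hw) (res_neq0 hw').
have LM f g: ploc f -> ploc g -> ploc (f * g). move=> [u [w [hw ->]]] [u' [w' [hw' ->]]]; exists (u * u'), (w * w').
by split; [exact: unit_res|rewrite !of_padicM mulf_div]. have Lu u: ploc (inj u).
exists u, 1; split; first by rewrite /= expn1 modn_small ?prime_gt1. by rewrite (of_nat 1) divr1.
have Lp: ploc p%:R by rewrite -of_nat. have p0 := p_neq0. have LV: ~ ploc (p%:R)^-1.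
move=> [u [w [hw e]]]; have w0 := res_neq0 hw; case/eqP: hw. have ->: w = p%:R * u; last exact: padic_p1.
apply/eqP; rewrite -subr_eq0 -of_eq0 of_padicD of_padicN of_padicM of_nat subr_eq0.
by rewrite -(divfK w0 (inj u)) -e mulrA divff // mul1r. have Epi c: padic_scalar c -> c != 0 ->
exists k : int, ploc (c * p%:R ^ (- k)) /\ ploc (c^-1 * p%:R ^ k).
move=> [r ->] r0; have {r0} r0: r != 0 by apply: contraNneq r0 => ->; rewrite scale0r.
have [n [m [m0 rE]]] := fracE r; have n0: n != 0. by apply: contraNneq r0 => n0; rewrite rE n0 rmorph0 mul0r.
have cE: r%:A = inj n / inj m :> K. have im0: inj m != 0 by rewrite of_eq0.
apply: (mulIf im0); rewrite divfK // /of_padic_int -scalerAl mul1r scalerA; congr (_ *: _).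
by rewrite rE divfK // tofrac_eq0. have [i [u [uE hu]]] := padic_factor n0; have [j [w [wE hw]]] := padic_factor m0.
have u0 := res_neq0 hu; have w0 := res_neq0 hw; exists (i%:Z - j%:Z).
have e: p%:R ^ (i%:Z - j%:Z) = p%:R ^+ i / p%:R ^+ j :> K by rewrite expfzDr // -exprnN.
have pi0: p%:R ^+ i != 0 :> K by rewrite expf_neq0. have pj0: p%:R ^+ j != 0 :> K by rewrite expf_neq0.
rewrite -invr_expz e cE uE wE !of_padicM !of_padicX of_nat; split.
by exists u, w; split=> //; field; rewrite pi0 pj0 w0. by exists w, u; split=> //; field; rewrite pi0 pj0 w0 u0.
have [v [hv vp]] := dval_extension L1 LB LM Lp p0 LV Epi padic_algebraic.
exists v; split=> [u||c Ec vc] //; first exact: hv.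
have [->|c0] := eqVneq c 0; first by rewrite -(subrr 1); apply: LB. have [k [h1 h2]] := Epi c Ec c0.
have hk: v c = k * v p%:R. have qk m: p%:R ^ m != 0 :> K by apply: expfz_neq0.
have cV: c^-1 != 0 by rewrite invr_eq0.
have := hv _ h1; have := hv _ h2; rewrite (vgeE _ _ (mulf_neq0 cV (qk _))) (vgeE _ _ (mulf_neq0 c0 (qk _))).
rewrite (dvM _ cV (qk _)) (dvM _ c0 (qk _)) !(dvXz _ _ p0) dvV. by rewrite mulNr; move: (v c) (k * _) => v1 v2; clia.
have k0: 0 <= k by move: vc; rewrite vgeE // hk pmulr_lge0. have ->: c = (c * p%:R ^ (- k)) * p%:R ^+ `|k|.
by rewrite -mulrA exprnP gez0_abs // -expfzDr // addNr mulr1.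
apply: (LM) => //; elim: `|k|%N => [|m IH]; first by rewrite expr0. by rewrite exprS; apply: LM.
Qed.

Variable v: dval K.
Hypotheses (vZ: forall u, vge v 0 (inj u)) (vp: 0 < v p%:R)
 (vL: forall c, padic_scalar c -> vge v 0 c -> ploc c).

Lemma rd_nat n: rd v n%:R = n%:R.
 elim: n => [|n IH]; first exact: rd0. by rewrite !mulrS rdD ?IH ?rd1 // ?vge1 // -of_nat.
Qed.
Lemma pchar_resf: p \in [pchar resf v].
 rewrite inE p_pr /= -rd_nat rd_eq0 -?of_nat //. by rewrite of_nat vgeE ?p_neq0 //; move: vp; clia.
Qed.
Lemma rd_padic w: rd v (inj w) = (w 1%N)%:R.
 have [|z zE] := @padic_div_p (w - (w 1%N)%:R). have := congr1 (fun z: Zp => z 1%N) (subrK (w 1%N)%:R w).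
move: (w - _) => z; rewrite /= padic_natE expn1 modnDmr => e.
have := pres_mod w 1; have := pres_mod z 1; rewrite expn1 => <- e'.
by apply/eqP; rewrite -[X in _ == X](mod0n p) -(eqn_modDr (w 1%N)) e add0n e'.
move: (w 1%N) zE => n zE; have ->: w = p%:R * z + n%:R by rewrite -zE subrK.
rewrite of_padicD of_padicM !of_nat rdD -?of_nat //; last by rewrite -of_padicM.
rewrite of_nat rdM -?of_nat // !of_nat !rd_nat. by rewrite (pcharf0 pchar_resf) mul0r add0r.
Qed.
Lemma rd_padic_local c: ploc c -> exists n, rd v c = n%:R.
 move=> [a [b [hb ->]]]; have b0 := res_neq0 hb. have b1: (0 < b 1%N)%N by rewrite lt0n.
have [k l kl _] := egcdnP p b1. have cop: (gcdn (b 1%N) p = 1)%N.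
apply/eqP; rewrite -/(coprime _ _) coprime_sym prime_coprime //. by have := pres_mod b 1; rewrite expn1 /dvdn => ->.
have kb: k%:R * rd v (inj b) = 1. by rewrite rd_padic -natrM kl cop natrD natrM (pcharf0 pchar_resf) mulr0 add0r.
have rb0: rd v (inj b) != 0 by apply: contraTneq (oner_neq0 (resf v)) => r0; rewrite -kb r0 mulr0 eqxx.
have [_ vb] := rd_neq0 (vZ b) rb0. exists (a 1%N * k)%N; rewrite rdM // ?rdV // ?vgeE ?invr_eq0 ?dvV ?vb //.
by rewrite rd_padic natrM; congr (_ * _); apply: (mulIf rb0); rewrite mulVf.
Qed.
(** Divide a relation over the p-adic scalars by its coefficient of least valuation and reduce. *)
Lemma residue_algebraic (u: resf v) : exists t (c: 'I_t -> nat),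
 (exists i, ((c i)%:R : resf v) != 0) /\ \sum_i (c i)%:R * u ^+ i = 0.
 have [f vf <-] := rd_surj u; have [c [cs [i0 ci0] sc]] := padic_algebraic f.
have [j cj jmin] := @arg_minP _ _ _ i0 (fun i => c i != 0) (fun i => v (c i)) ci0. have loc i: ploc (c i / c j).
have [->|ci] := eqVneq (c i) 0. rewrite mul0r; exists 0, 1; split; first by rewrite /= expn1 modn_small ?prime_gt1.
by rewrite (of_nat 0) mul0r. apply: vL; last by rewrite vge_div // vgeE // add0r; apply: jmin.
have [r rE] := cs i; have [s sE] := cs j. have s0: s != 0 by apply: contraNneq cj => s0; rewrite sE s0 scale0r.
exists (r / s); apply: (mulIf cj); rewrite divfK // rE sE -scalerAl mul1r scalerA divfK //.
have vi i: vge v 0 (c i / c j).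
by have [->|ci] := eqVneq (c i) 0; rewrite ?mul0r ?vge0 // vge_div // vgeE // add0r; apply: jmin.
have [k kE] := choice (fun i => rd_padic_local (loc i)).
exists _, k; split; first by exists j; rewrite -kE divff // rd1 oner_eq0.
transitivity (rd v (\sum_i c i / c j * f ^+ i)). rewrite rd_sum => [|i _]; last by rewrite vge0M ?vge0X.
by apply: eq_bigr => i _; rewrite rdM ?vge0X // kE rdX.
rewrite -[RHS]rd0 -[X in rd v X = _]mul1r -(divff cj) mulrC mulrA mulr_suml; congr rd.
transitivity ((\sum_i c i * f ^+ i) / c j); last by rewrite sc mul0r.
rewrite mulr_suml mulr_suml; apply: eq_bigr => i _; field; exact: cj.
Qed.
(** u is algebraic over the prime field, so its iterated p-th powers lie in a finite set and repeat;
    injectivity of Frobenius turns a repetition into a p-th root. *)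
Lemma residue_perfect (u: resf v) : exists u' : resf v, u' ^+ p = u.
 have chp := pchar_resf; have [t [c [[i0 ci0] sc]]] := residue_algebraic u.
pose A := pPrimeCharType chp; pose h : {poly 'F_p} -> A := horner_alg (u: A).
pose q : {poly 'F_p} := \poly_(i < t) (if insub i is Some j then (c j)%:R else 0). have q0: q != 0.
apply: contraNneq ci0 => q0; have := coef0 'F_p i0.
rewrite -q0 coef_poly ltn_ord valK => e; have := congr1 (in_alg A) e. by rewrite rmorph_nat rmorph0 => ->.
have hq: h q = 0. rewrite -[RHS]sc /h /q poly_def rmorph_sum; apply: eq_bigr => i _.
by rewrite valK -mul_polyC rmorphM /= rmorphXn /= horner_algX horner_algC scaler_nat mulr_natl.
have hmod r: h r = h (r %% q). have hD a b: h (a + b) = h a + h b by apply: rmorphD.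
have hM a b: h (a * b) = h a * h b by apply: rmorphM. by rewrite {1}(divp_eq r q) hD hM hq mulr0 add0r.
pose T := {ffun 'I_(size q) -> 'F_p}. pose g (i: 'I_(#|T|.+1)) : T := [ffun j : 'I__ => ('X^(p ^ i) %% q)`_j].
have /injectivePn[i [j ij gij]]: ~~ injectiveb g. by apply/negP => /injectiveP/leq_card; rewrite card_ord ltnn.
have uE (k: nat) : u ^+ (p ^ k) = h ('X^(p ^ k) %% q). by rewrite -hmod /h rmorphXn /= horner_algX.
have {}gij: u ^+ (p ^ i) = u ^+ (p ^ j). rewrite !uE; congr h; apply/polyP => k.
have [kq|qk] := ltnP k (size q); first by have := congr1 (fun f: T => f (Ordinal kq)) gij; rewrite !ffunE.
by rewrite !nth_default // (leq_trans _ qk) // ltnW // ltn_modp. have finj (a b: resf v) : a ^+ p = b ^+ p -> a = b.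
by rewrite -!(pFrobenius_autE chp); apply: fmorph_inj.
have pinj k (a b: resf v) : a ^+ (p ^ k) = b ^+ (p ^ k) -> a = b.
by elim: k a b => [|k IH] a b; rewrite ?expr1 // !expnSr !exprM => /finj/IH. wlog lt : i j ij gij / (i < j)%N.
move=> W; have [lt|le] := ltnP i j; first exact: W lt.
by apply: (W j i) => //; rewrite 1?eq_sym // ltn_neqAle le andbT eq_sym.
exists (u ^+ (p ^ (j - i).-1)); apply: (pinj i).
rewrite gij -!exprM -expnS -expnD; congr (_ ^+ (_ ^ _)); move: lt; clia.
Qed.

End PadicField.

(** * Invertible sheaves and their divisors *)

Section Sheaves.
Local Open Scope classical_set_scope.
Variables (K: fieldType) (F: fieldExtType (ratfun K)).
Notation X := (closed_point F).
Implicit Types (M N T: sheaf F) (U V W: set X) (f g h: F) (D E: X -> int).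

Lemma zopenI U V: zopen U -> zopen V -> zopen (U `&` V).
 by rewrite /zopen setCI finite_setU. Qed.
Lemma zopenT: zopen [set: X].
 by rewrite /zopen setCT; apply: finite_set0. Qed.
Lemma resK M U V W s: zopen U -> zopen V -> zopen W -> V `<=` U -> W `<=` V ->
 res M V W (res M U V s) = res M U W s.
 by move=> *; apply: (@res_comp _ _ M U V W). Qed.
Lemma res0 M U V: zopen U -> zopen V -> V `<=` U -> res M U V 0 = 0.
 move=> Uo Vo VU; apply: (addrI (res M U V 0)). by rewrite -(resD Uo Vo VU) !addr0.
Qed.
Lemma sheaf_separated M (W: X -> set X) U (s t: M U) : zopen U -> inhabited X ->
 (forall P, zopen (W P)) -> (forall P, W P P) ->
 (forall P, res M U (U `&` W P) s = res M U (U `&` W P) t) -> s = t.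
 move=> Uo i Wo WP; apply: sheaf_local => //; first by move=> P; apply: zopenI.
apply/seteqP; split=> [P [Q _ []]//|P UP]; exists P => //; split=> //; exact: WP.
Qed.
(** A morphism may be given on the opens inside a cover; this is needed because a section of O(D +
    E) is a product of sections only locally. *)
Lemma glue_hom M T (W: X -> set X) (loc: X -> forall U, M U -> T U) : inhabited X ->
 (forall P, zopen (W P)) -> (forall P, W P P) ->
 (forall P U, zopen U -> U `<=` W P -> {morph loc P U: s t / s + t}) ->
 (forall P U f s, zopen U -> U `<=` W P -> regular_on U f ->
 loc P U (sact M U f s) = sact T U f (loc P U s)) ->
 (forall P U V s, zopen U -> zopen V -> V `<=` U -> U `<=` W P ->
 loc P V (res M U V s) = res T U V (loc P U s)) ->
 (forall P Q U s, zopen U -> U `<=` W P -> U `<=` W Q -> loc P U s = loc Q U s) ->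
 exists2 phi : forall U, M U -> T U, is_hom phi &
 forall P U s, zopen U -> U `<=` W P -> phi U s = loc P U s.
 move=> i Wo WP lD lZ lR lE. have Io U P: zopen U -> zopen (U `&` W P) by move=> Uo; apply: zopenI.
have Il U P: U `&` W P `<=` U by []. have Ir U P: U `&` W P `<=` W P by []. pose spec U (s: M U) : set (T U) :=
[set t | forall P, res T U (U `&` W P) t = loc P (U `&` W P) (res M U (U `&` W P) s)].
pose phi U (s: M U) := xget 0 (spec U s). have phiP U (s: M U) : zopen U -> spec U s (phi U s).
move=> Uo; apply: xgetPex; apply: sheaf_glue => //; first by move=> P; apply: Io.
apply/seteqP; split=> [P [Q _ []]//|P UP]; exists P => //; split=> //; exact: WP.
move=> P Q; have Jo: zopen (U `&` W P `&` (U `&` W Q)) by apply: zopenI; apply: Io.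
have Jl: U `&` W P `&` (U `&` W Q) `<=` U `&` W P by []. have Jr: U `&` W P `&` (U `&` W Q) `<=` U `&` W Q by [].
rewrite -(lR _ _ _ _ (Io U P Uo) Jo Jl (Ir U P)) -(lR _ _ _ _ (Io U Q Uo) Jo Jr (Ir U Q)).
rewrite !resK //; try exact: Io; apply: lE => //; exact: subset_trans (Ir _ _).
have uniq U (s t: T U) := @sheaf_separated T W U s t. exists phi; last first.
move=> P U s Uo UW; apply: (uniq) => // Q; rewrite phiP //. rewrite -(lR P U (U `&` W Q)) //; last exact: Io.
by apply: lE; [exact: Io|exact: Ir|exact: subset_trans UW].
split=> [U Uo s t|U f s Uo rf|U V s Uo Vo VU]; apply: (uniq) => // P.
- by rewrite !(resD Uo (Io U P Uo) (Il U P)) !phiP // (resD Uo (Io U P Uo) (Il U P)) lD //; apply: Io.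
- have rf': regular_on (U `&` W P) f by apply: regularS rf.
by rewrite !phiP // !(res_sact _ Uo (Io U P Uo) (Il U P) rf) lZ ?phiP //; apply: Io.
have VW: V `&` W P `<=` U `&` W P by move=> Q [/VU].
rewrite phiP // (resK _ Uo Vo (Io V P Vo)) // (resK _ Uo Vo (Io V P Vo)) //.
rewrite -[RHS](resK (phi U s) Uo (Io U P Uo) (Io V P Vo) (Il U P) VW) phiP //.
rewrite -(lR P (U `&` W P)) //; try exact: Io. by rewrite resK //; apply: Io.
Qed.
Lemma hom_eq_local M T (phi psi: forall U, M U -> T U) (W: X -> set X) : inhabited X ->
 (forall P, zopen (W P)) -> (forall P, W P P) -> is_hom phi -> is_hom psi ->
 (forall P U s, zopen U -> U `<=` W P -> phi U s = psi U s) ->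
 forall U, zopen U -> phi U =1 psi U.
 move=> i Wo WP [_ _ hR] [_ _ hR'] e U Uo s; apply: (sheaf_separated Uo i Wo WP) => P.
have Io: zopen (U `&` W P) by apply: zopenI. by rewrite -hR // -hR' //; apply: (e P) => // Q [].
Qed.

(* [V] identifies M with the sheaf O(D) of rational functions. *)
Definition embedding M D (v: forall U, M U -> F) :=
 [/\ forall U, zopen U -> {morph v U: s t / s + t} /\ injective (v U),
 forall U f, zopen U -> f \in div_pred D U <-> exists s, v U s = f,
 forall U f s, zopen U -> regular_on U f -> v U (sact M U f s) = f * v U s
 & forall U U' s, zopen U -> zopen U' -> U' `<=` U -> v U' (res M U U' s) = v U s].

Definition class M D := exists v, @embedding M D v.

Lemma class_div D: class (div_sheaf D) D.
 exists (fun U (s: div_sec D U) => val s); split.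
- by [].
- move=> U f _; split=> [fD|[s <-]]; last exact: valP. by exists (DivSec fD).
- by move=> U f s _ rf; rewrite /= div_actE.
- by move=> U U' s _ _ UU'; rewrite /= div_resE.
Qed.
Lemma class_iso M N D: sheaf_iso M N -> class N D -> class M D.
 move=> [phi [pD pZ pR] pb] [V [V1 V2 V3 V4]]; exists (fun U s => V U (phi U s)); split.
- move=> U Uo; have [VD Vi] := V1 U Uo; split=> [s t|]; first by rewrite pD // VD.
exact: inj_comp (bij_inj (pb U Uo)).
- move=> U f Uo; rewrite V2 //; split=> [[s <-]|[s <-]]; last by exists (phi U s).
by have [q _ qK] := pb U Uo; exists (q s); rewrite qK.
- by move=> U f s Uo rf; rewrite pZ // V3.
- by move=> U U' s Uo Uo' UU'; rewrite pR // V4.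
Qed.
Lemma class_principal M D k: k != 0 -> (forall P: X, ordp P k = D P) -> class M D ->
 sheaf_iso M (OX F).
 move=> k0 kD [V [V1 V2 V3 V4]]. have kV U s: zopen U -> k * V U s \in div_pred (fun=> 0) U.
move=> Uo; apply/div_predP; have [->|s0] := eqVneq (V U s) 0; first by rewrite mulr0; left.
right=> P UP; rewrite oppr0 ordpM // kD.
have /(V2 U _ Uo)/div_predP[e|/(_ P UP)]: exists s', V U s' = V U s by exists s. by rewrite e eqxx in s0.
by rewrite -subr_ge0 opprK addrC. pose phi U (s: M U) : OX F U := insubd 0 (k * V U s).
have phiE U s: zopen U -> val (phi U s) = k * V U s by move=> Uo; rewrite insubdK ?kV. exists phi; first split.
- move=> U Uo s t; apply: val_inj; have [VD _] := V1 U Uo. by rewrite raddfD /= !phiE // VD mulrDr.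
- by move=> U f s Uo rf; apply: val_inj; rewrite div_actE // !phiE // V3 // mulrCA.
- by move=> U U' s Uo Uo' UU'; apply: val_inj; rewrite div_resE // !phiE // V4. move=> U Uo; have [_ Vi] := V1 U Uo.
have sur (u: OX F U) : exists s, V U s = k^-1 * val u.
apply/V2 => //; apply/div_predP; have [->|u0] := eqVneq (val u) 0; first by rewrite mulr0; left.
have k0': k^-1 != 0 by []. right=> P UP; have /div_predP[e|/(_ P UP)] := valP u; first by rewrite e eqxx in u0.
rewrite oppr0 ordpM // -kD => u1; have := ordpM P k0 k0'; rewrite divff // ordp1. by move: u1; clia.
have [psi psiE] := choice sur; exists psi => [s|u]. by apply: Vi; rewrite psiE phiE // mulKf.
by apply: val_inj; rewrite phiE // psiE mulVKf.
Qed.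
Lemma tensor_unique L M N N': is_tensor L M N -> is_tensor L M N' -> sheaf_iso N N'.
 have hc (A B C: sheaf F) (p: forall U, A U -> B U) (q: forall U, B U -> C U) :
is_hom p -> is_hom q -> is_hom (fun U s => q U (p U s)). move=> [pD pZ pR] [qD qZ qR]; split.
- by move=> U Uo s t; rewrite pD // qD.
- by move=> U f s Uo rf; rewrite pZ // qZ.
- by move=> U V s Uo Vo VU; rewrite pR // qR.
move=> [b hb ub] [b' hb' ub']; have [[p hp pE] _] := ub _ _ hb'; have [[q hq qE] _] := ub' _ _ hb.
exists p => // U Uo; exists (q U).
have [_ un] := ub _ _ hb; apply: (un (fun U s => q U (p U s)) (fun U s => s)) => //; first exact: hc.
by move=> V s t Vo; rewrite pE // qE.
have [_ un] := ub' _ _ hb'; apply: (un (fun U s => p U (q U s)) (fun U s => s)) => //; first exact: hc.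
by move=> V s t Vo; rewrite qE // pE.
Qed.
Lemma class_pullback (delta: 'AEnd(F)) M D : class M D ->
 class (pullback delta M) (D \o aut_point delta).
 move=> [V [V1 V2 V3 V4]]; pose s' := inv_ahom delta.
have dK f: delta (s' f) = f by rewrite -[s' f]/((delta^-1)%VF f) aut_invK.
have sK f: s' (delta f) = f by apply: (fmorph_inj delta); apply: dK.
have pK P: aut_point s' (aut_point delta P) = P by apply: point_eqP => f /=; rewrite dK.
have pK' P: aut_point delta (aut_point s' P) = P by apply: point_eqP => f /=; rewrite sK.
exists (fun U s => delta (V (aut_point s' @^-1` U) s)); split.
- move=> U Uo; have [VD Vi] := V1 _ (aut_open s' Uo); split=> [s t|]. by rewrite VD rmorphD.
by move=> s t /fmorph_inj/Vi.
- move=> U f Uo; split=> [/div_predP fD|[s <-]].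
have [|s sE] := (V2 _ (s' f) (aut_open s' Uo)).1; last by exists s; rewrite sE dK.
apply/div_predP; case: fD => [->|fD]; first by left; rewrite linear0. by right=> P /fD /=; rewrite pK'.
have : V _ s \in div_pred D (aut_point s' @^-1` U) by apply/V2; [exact: aut_open|exists s]. move=> /div_predP[->|h].
by apply/div_predP; left; rewrite linear0. apply/div_predP; right=> P UP; apply: (h (aut_point delta P)).
by rewrite /preimage /= pK.
- move=> U f s Uo rf; rewrite -{2}[f]dK -rmorphM V3 //; first exact: aut_open. exact: aut_regular.
- move=> U U' s Uo Uo' UU'; rewrite V4 //; [exact: aut_open..|exact: preimage_subset].
Qed.

Section Rational.
Variables (M: sheaf F) (U0: set X) (r: M U0) (D: X -> int).
Hypotheses (X0: X) (U0o: zopen U0) (rD: forall P, has_ord r P (D P)).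

(** A section s is sent to the rational function s / r: with local generators e_P and r = f_P e_P, s
    = c e_P goes to c / f_P, which is independent of P. *)
Lemma class_ord: class M D.
 have i: inhabited X by exists; apply: X0. have [W WE] := choice rD. have Wo P: zopen (W P) by have [] := WE P.
have WP P: W P P by have [] := WE P. pose H P := cid (let: And3 _ _ h := WE P in h); pose e P := projT1 (H P).
have eg P: is_generator (e P) by have [] := projT2 (H P).
have [f fE] := choice (fun P => let: conj _ h := projT2 (H P) in h). have f0 P: f P != 0 by have [] := fE P.
have rE P A: zopen A -> A `<=` U0 -> A `<=` W P ->
regular_on A (f P) /\ res M U0 A r = sact M A (f P) (res M (W P) A (e P)).
move=> Ao AU AW; have [rf _ rs _] := fE P; rewrite -/(e P) in rs. have Jo: zopen (U0 `&` W P) by apply: zopenI.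
have AJ: A `<=` U0 `&` W P by move=> Q AQ; split; auto. split; first exact: regularS rf.
have JU: U0 `&` W P `<=` U0 by move=> Q []. by rewrite -(resK r U0o Jo Ao JU AJ) rs (res_sact _ Jo Ao AJ rf) resK.
pose co P U (s: M U) := xget 0 [set g | regular_on U g /\ s = sact M U g (res M (W P) U (e P))].
have coP P U (s: M U) : zopen U -> U `<=` W P ->
regular_on U (co P U s) /\ s = sact M U (co P U s) (res M (W P) U (e P)).
by move=> Uo UW; have [g [gP _]] := eg P U s Uo UW; exact: (@xgetPex _ 0 [set _ | _] (ex_intro _ g gP)).
have coU P U (s: M U) g : zopen U -> U `<=` W P -> regular_on U g ->
s = sact M U g (res M (W P) U (e P)) -> co P U s = g. move=> Uo UW rg sE; have [h [hP hu]] := eg P U s Uo UW.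
by rewrite -(hu _ (coP P U s Uo UW)); apply: hu.
have coR P U U' (s: M U) : zopen U -> zopen U' -> U' `<=` U -> U `<=` W P -> co P U' (res M U U' s) = co P U s.
move=> Uo Uo' UU UW; have [rc sE] := coP P U s Uo UW. apply: coU => //; [exact: subset_trans UW|exact: regularS rc|].
by rewrite {1}sE (res_sact _ Uo Uo' UU rc) resK.
have tr P Q: exists w, [/\ regular_on (W P `&` W Q) w, f Q = f P * w &
forall A, zopen A -> A `<=` W P -> A `<=` W Q -> res M (W P) A (e P) = sact M A w (res M (W Q) A (e Q))].
have Jo: zopen (W P `&` W Q) by apply: zopenI. have JP: W P `&` W Q `<=` W P by move=> R [].
have JQ: W P `&` W Q `<=` W Q by move=> R []. pose w := co Q _ (res M (W P) (W P `&` W Q) (e P)).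
have [rw wE] := coP Q _ (res M (W P) (W P `&` W Q) (e P)) Jo JQ. have wA A: zopen A -> A `<=` W P -> A `<=` W Q ->
res M (W P) A (e P) = sact M A w (res M (W Q) A (e Q)).
move=> Ao AP AQ; have AJ: A `<=` W P `&` W Q by move=> R AR; split; auto.
by rewrite -(resK (e P) (Wo P) Jo Ao JP AJ) wE (res_sact _ Jo Ao AJ rw) resK.
exists w; split=> //; pose A := U0 `&` (W P `&` W Q). have Ao: zopen A by apply: zopenI.
have AU: A `<=` U0 by move=> R []. have AP: A `<=` W P by move=> R [_ []]. have AQ: A `<=` W Q by move=> R [_ []].
have [rf rfE] := rE P A Ao AU AP; have [rf' rfE'] := rE Q A Ao AU AQ.
have rw': regular_on A w by apply: regularS rw => R [].
rewrite -(coU _ _ _ _ Ao AQ rf' rfE'); apply: coU => //; first exact: regularM. by rewrite rfE wA // sactM.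
have fD P R: W P R -> ordp R (f P) = D R. have fR: ordp R (f R) = D R by have [] := fE R.
move=> PR; apply/eqP; rewrite eq_le -{1}fR -fR; apply/andP; split. have [w [rw wE _]] := tr P R; have w0: w != 0.
by apply: contraNneq (f0 R) => w0; rewrite wE w0 mulr0. by rewrite wE ordpM // lerDl; apply: rw; split.
have [w [rw wE _]] := tr R P; have w0: w != 0. by apply: contraNneq (f0 P) => w0; rewrite wE w0 mulr0.
by rewrite wE ordpM // lerDl; apply: rw; split. have cmp P Q U (s: M U) : zopen U -> U `<=` W P -> U `<=` W Q ->
co Q U s / f Q = co P U s / f P. move=> Uo UP UQ; have [w [rw wE wA]] := tr P Q; have [rc sE] := coP P U s Uo UP.
have rw': regular_on U w by apply: regularS rw => R UR; split; auto.
rewrite (coU Q U s (co P U s * w) Uo UQ (regularM rc rw')); last by rewrite sactM // -wA.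
have w0: w != 0 by apply: contraNneq (f0 Q) => w0; rewrite wE w0 mulr0. by rewrite wE -mulf_div divff // mulr1.
have Io U P: zopen U -> zopen (U `&` W P) by move=> Uo; apply: zopenI. have Il U P: U `&` W P `<=` U by move=> Q [].
have Ir U P: U `&` W P `<=` W P by move=> Q [].
pose v U (s: M U) := co X0 (U `&` W X0) (res M U (U `&` W X0) s) / f X0.
have vE Q U (s: M U) : zopen U -> v U s = co Q (U `&` W Q) (res M U (U `&` W Q) s) / f Q.
move=> Uo; have Ao: zopen (U `&` (W X0 `&` W Q)) by apply: zopenI => //; apply: zopenI.
have cA P: U `&` (W X0 `&` W Q) `<=` U `&` W P -> co P (U `&` W P) (res M U (U `&` W P) s) =
co P _ (res M U (U `&` (W X0 `&` W Q)) s).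
move=> AP; rewrite -(coR P _ _ (res M U (U `&` W P) s) (Io U P Uo) Ao AP (Ir U P)) resK //. exact: Io.
by rewrite /v !cA //; first apply: cmp => //; move=> R [? []]. exists v; split.
- move=> U Uo; split=> [s t|s t st]. have [rs sE] := coP _ _ (res M U (U `&` W X0) s) (Io U X0 Uo) (Ir U X0).
have [rt tE] := coP _ _ (res M U (U `&` W X0) t) (Io U X0 Uo) (Ir U X0).
rewrite -mulrDl; congr (_ / _); apply: coU; [exact: Io|exact: Ir|exact: regularD|].
by rewrite (resD Uo (Io U X0 Uo) (Il U X0)) {1}sE {1}tE sactDl //; apply: Io.
apply: (sheaf_separated Uo i Wo WP) => Q. have := st; rewrite !(vE Q) // => /(divIf (f0 Q)) e1.
have [_ ->] := coP Q _ (res M U (U `&` W Q) s) (Io U Q Uo) (Ir U Q).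
by rewrite e1; have [_ <-] := coP Q _ (res M U (U `&` W Q) t) (Io U Q Uo) (Ir U Q).
- move=> U g Uo; split=> [/div_predP gD|[s <-]]; last first.
apply/div_predP; have [->|v0] := eqVneq (v U s) 0; [by left|right=> Q UQ].
have [rc _] := coP Q _ (res M U (U `&` W Q) s) (Io U Q Uo) (Ir U Q).
have c0: co Q (U `&` W Q) (res M U (U `&` W Q) s) != 0. by apply: contraNneq v0 => c0; rewrite (vE Q) // c0 mul0r.
have := rc Q (conj UQ (WP Q)). have := ordpM Q v0 (f0 Q); rewrite {1}(vE Q) // divfK // fD //.
move: (ordp Q _) (ordp Q _) (D Q) => a b c; clia. have rg Q: regular_on (U `&` W Q) (g * f Q).
case: gD => [->|gD R [UR WR]]; first by move=> R _; rewrite mul0r ordp0.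
have [->|g0] := eqVneq g 0; first by rewrite mul0r ordp0. by rewrite ordpM // fD // -(subrr (D R)) addrC lerD2r gD.
have [P||P Q|t tE] := @sheaf_glue _ _ M X U (fun Q => U `&` W Q)
(fun Q => sact M _ (g * f Q) (res M (W Q) _ (e Q))) Uo i.
+ exact: Io.
+ apply/seteqP; split=> [P [Q _ []]//|P UP]; exists P => //; split=> //; exact: WP.
+ have Ao: zopen (U `&` W P `&` (U `&` W Q)) by apply: zopenI; apply: Io.
have AP: U `&` W P `&` (U `&` W Q) `<=` U `&` W P by move=> R [].
have AQ: U `&` W P `&` (U `&` W Q) `<=` U `&` W Q by move=> R [].
rewrite (res_sact _ (Io U P Uo) Ao AP (rg P)) (res_sact _ (Io U Q Uo) Ao AQ (rg Q)).
rewrite (resK (e P) (Wo P) (Io U P Uo) Ao) // (resK (e Q) (Wo Q) (Io U Q Uo) Ao) //.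
have [w [rw wE wA]] := tr P Q; rewrite (wA _ Ao (subset_trans AP (Ir U P)) (subset_trans AQ (Ir U Q))).
rewrite wE mulrA [RHS]sactM //; first exact: regularS (rg P). by apply: regularS rw => R [[_ RP] [_ RQ]].
exists t; rewrite /v tE (coU _ _ _ (g * f X0)) ?mulfK //; exact: Io.
- move=> U g s Uo rg; have [rc sE] := coP _ _ (res M U (U `&` W X0) s) (Io U X0 Uo) (Ir U X0).
have rg': regular_on (U `&` W X0) g by apply: regularS rg.
rewrite /v mulrA; congr (_ / _); apply: coU; [exact: Io|exact: Ir|exact: regularM|].
by rewrite (res_sact _ Uo (Io U X0 Uo) (Il U X0) rg) {1}sE sactM //; apply: Io.
move=> U U' s Uo Uo' UU'; rewrite /v; congr (_ / _). have UW: U' `&` W X0 `<=` U `&` W X0 by move=> R [/UU'].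
rewrite resK //; last exact: Io. rewrite -(resK s Uo (Io U X0 Uo) (Io U' X0 Uo') (Il U X0) UW).
by apply: coR; [exact: Io|exact: Io|exact: UW|exact: Ir].
Qed.

End Rational.

Section Comparison.
Variable X0: X.
Hypothesis fin: forall f, f != 0 -> finite_set [set P : X | ordp P f != 0].
Let i: inhabited X := inhabits X0.

(** A function with the right order at P has the right order off finitely many points, since both
    its divisor and D have finite support; those points are removed. *)
Lemma exact_generator D P: finite_set [set Q | D Q != 0] -> exists tW : F * set X,
 [/\ tW.1 != 0, zopen tW.2, tW.2 P & forall Q, tW.2 Q -> ordp Q tW.1 = - D Q].
 move=> Df; have [u u0 Pu] := ordp_surj P. have oX Q (k: nat) : ordp Q (u ^+ k) = k%:Z * ordp Q u.
by elim: k => [|k IH]; rewrite ?ordp1 ?mul0r // exprS ordpM // IH; lia.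
have oV Q (k: F) : k != 0 -> ordp Q k^-1 = - ordp Q k. move=> k0; have kV: k^-1 != 0 by [].
by have := ordpM Q k0 kV; rewrite divff // ordp1; lia. have [t t0 tP]: exists2 t, t != 0 & ordp P t = - D P.
case: (D P) => k. by exists (u ^+ k)^-1; rewrite ?oV // oX Pu mulr1. by exists (u ^+ k.+1); rewrite // oX Pu; lia.
exists (t, [set Q | ordp Q t = - D Q]); split=> //=.
rewrite /zopen; apply: (@sub_finite_set _ _ ([set Q | ordp Q t != 0] `|` [set Q | D Q != 0])).
by move=> Q /= tD; have [DQ|] := eqVneq (D Q) 0; [left; apply/eqP => e; apply: tD; rewrite e DQ|right].
by rewrite finite_setU; split=> //; apply: fin.
Qed.
(** Two embeddings of M in F differ by a rational function k, the image under the second of a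
    section that the first sends to 1. Exact local generators then give both inequalities between
    orders. *)
Lemma class_unique M D E: finite_set [set P | D P != 0] -> finite_set [set P | E P != 0] ->
 class M D -> class M E -> exists2 k, k != 0 & forall P : X, ordp P k = D P - E P.
 move=> Df Ef [V [V1 V2 V3 V4]] [V' [V1' V2' V3' V4']]. pose U0 : set X := [set P | D P = 0].
have U0o: zopen U0 by apply: sub_finite_set Df => P /= /eqP.
have [|s0 s0E] := (V2 U0 1 U0o).1; first by apply/div_predP; right=> P /= ->; rewrite ordp1. pose k := V' U0 s0.
have kE U s: zopen U -> V' U s = k * V U s. move=> Uo; pose f := V U s; have [f0|f0] := eqVneq f 0.
have [VD Vi] := V1 U Uo; have [VD' _] := V1' U Uo. have z (h: M U -> F) : {morph h: x y / x + y} -> h 0 = 0.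
by move=> hD; apply: (addrI (h 0)); rewrite -hD !addr0. by rewrite -/f f0 mulr0 (Vi s 0) ?z // -/f f0.
pose A := U `&` (U0 `&` [set P | 0 <= ordp P f]). have Ao: zopen A.
apply: zopenI => //; apply: zopenI => //; apply: sub_finite_set (fin f0) => P /=.
by move=> nf; apply/eqP => e; apply: nf; rewrite e. have AU: A `<=` U by move=> P [].
have AU0: A `<=` U0 by move=> P [_ []]. have rf: regular_on A f by move=> P [_ []].
have e: res M U A s = sact M A f (res M U0 A s0).
by have [_ Vi] := V1 A Ao; apply: Vi; rewrite V3 // !V4 // s0E mulr1. by rewrite -(V4' U A) // e V3' // V4' // mulrC.
have k0: k != 0. apply/eqP => k0; have := oner_neq0 F; rewrite -s0E.
have [VD Vi] := V1' U0 U0o; have [VD0 _] := V1 U0 U0o.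
have e: s0 + s0 = s0 by apply: Vi; rewrite VD kE // k0 mul0r addr0. have := VD0 s0 s0; rewrite e s0E => /eqP.
by rewrite -subr_eq0 opprD addrA subrr sub0r oppr_eq0 => /eqP ->; rewrite eqxx. have kV: k^-1 != 0 by [].
exists k => // P; apply/eqP; rewrite eq_le; apply/andP; split. have [[t W] /= [t0 Wo WP tE]] := exact_generator P Ef.
have [|s sE] := (V2' W t Wo).1; first by apply/div_predP; right=> Q WQ; rewrite tE. have tk: t / k \in div_pred D W.
by apply/V2 => //; exists s; apply: (mulfI k0); rewrite mulrCA divff // mulr1 -kE // sE.
move: tk => /div_predP[/eqP|/(_ P WP)]; first by rewrite mulf_eq0 (negPf t0) (negPf kV).
have := ordpM P k0 kV; rewrite divff // ordp1 ordpM // tE //.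
by move: (ordp P k) (ordp P _) (D P) (E P) => x y z w; clia. have [[t W] /= [t0 Wo WP tE]] := exact_generator P Df.
have [|s sE] := (V2 W t Wo).1; first by apply/div_predP; right=> Q WQ; rewrite tE.
have : k * t \in div_pred E W by apply/V2' => //; exists s; rewrite kE // sE.
move=> /div_predP[/eqP|/(_ P WP)]; first by rewrite mulf_eq0 (negPf t0) (negPf k0).
by rewrite ordpM // tE //; move: (ordp P k) (D P) (E P) => x z w; clia.
Qed.
(** Near P a section f of O(D + E) is (f / t) t with t a generator of O(E). Linearity over regular
    functions makes the value of a bilinear map independent of the factorization, and the values
    glue. *)
Lemma div_tensor L M D E: finite_set [set P | E P != 0] -> class L D -> class M E ->
 is_tensor L M (div_sheaf (fun P => D P + E P)).
 move=> Ef [v [v1 v2 v3 v4]] [w [w1 w2 w3 w4]]; pose G P := D P + E P.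
have vD U s: zopen U -> v U s \in div_pred D U by move=> Uo; apply/v2 => //; exists s.
have wE U s: zopen U -> w U s \in div_pred E U by move=> Uo; apply/w2 => //; exists s.
have Gp U f g: f \in div_pred D U -> g \in div_pred E U -> f * g \in div_pred G U.
have [->|f0] := eqVneq f 0; first by move=> *; apply/div_predP; left; rewrite mul0r.
have [->|g0] := eqVneq g 0; first by move=> *; apply/div_predP; left; rewrite mulr0.
move=> /div_predP[/eqP|hf]; first by rewrite (negPf f0). move=> /div_predP[/eqP|hg]; first by rewrite (negPf g0).
by apply/div_predP; right=> P UP; rewrite ordpM // opprD lerD ?hf ?hg.
pose b U (s: L U) (t: M U) : div_sec G U := insubd 0 (v U s * w U t).
have bE U s t: zopen U -> val (b U s t) = v U s * w U t. by move=> Uo; rewrite insubdK ?Gp ?vD ?wE.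
exists b; first split.
- by move=> U s Uo t t'; apply: val_inj; rewrite raddfD /= !bE // (w1 U Uo).1 mulrDr.
- by move=> U t Uo s s'; apply: val_inj; rewrite raddfD /= !bE // (v1 U Uo).1 mulrDl.
- move=> U f s t Uo rf; split; apply: val_inj; rewrite div_actE // !bE //. by rewrite v3 // mulrA.
by rewrite w3 // mulrCA.
- by move=> U V s t Uo Vo VU; apply: val_inj; rewrite div_resE // !bE // v4 // w4. move=> T c [cr cl cZ cR].
have [tW tWE] := choice (fun P => exact_generator P Ef). pose t P := (tW P).1; pose W P := (tW P).2.
have t0 P: t P != 0 by case: (tWE P). have Wo P: zopen (W P) by case: (tWE P). have WP P: W P P by case: (tWE P).
have tE P Q: W P Q -> ordp Q (t P) = - E Q by case: (tWE P) => _ _ _; apply.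
pose A U f : L U := xget 0 [set s | v U s = f]. pose B U f : M U := xget 0 [set s | w U s = f].
have AE U f: zopen U -> f \in div_pred D U -> v U (A U f) = f.
by move=> Uo fD; have [s sE] := (v2 U f Uo).1 fD; exact: (@xgetPex _ 0 [set _ | _] (ex_intro _ s sE)).
have BE U f: zopen U -> f \in div_pred E U -> w U (B U f) = f.
by move=> Uo fD; have [s sE] := (w2 U f Uo).1 fD; exact: (@xgetPex _ 0 [set _ | _] (ex_intro _ s sE)).
have tp P U: U `<=` W P -> t P \in div_pred E U. by move=> UW; apply/div_predP; right=> Q /UW WQ; rewrite tE.
have oV Q (k: F) : k != 0 -> ordp Q k^-1 = - ordp Q k. move=> k0; have kV: k^-1 != 0 by rewrite invr_eq0.
by have := ordpM Q k0 kV; rewrite divff // ordp1; lia. have tV P: (t P)^-1 != 0 by [].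
have fp P U f: U `<=` W P -> f \in div_pred G U -> f / t P \in div_pred D U.
move=> UW /div_predP[->|fG]; first by apply/div_predP; left; rewrite mul0r.
have [->|f0] := eqVneq f 0; first by apply/div_predP; left; rewrite mul0r.
apply/div_predP; right=> Q UQ; rewrite (ordpM Q f0 (tV P)) (oV Q _ (t0 P)) tE; auto.
by have := fG Q UQ; rewrite /G; lia. pose loc P U (f: div_sec G U) := c U (A U (val f / t P)) (B U (t P)).
have locE P U (f: div_sec G U) g h : zopen U -> U `<=` W P -> g \in div_pred D U -> h \in div_pred E U ->
val f = g * h -> loc P U f = c U (A U g) (B U h). move=> Uo UW gD hE fE; have rh: regular_on U (h / t P).
move=> Q UQ; case/div_predP: hE => [->|/(_ Q UQ)]; first by rewrite mul0r ordp0.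
have [->|h0] := eqVneq h 0; first by rewrite mul0r ordp0. rewrite (ordpM Q h0 (tV P)) (oV Q _ (t0 P)) tE; auto; lia.
have ->: B U h = sact M U (h / t P) (B U (t P)).
have [_ wi] := w1 U Uo; apply: wi; rewrite w3 // !BE ?divfK //; exact: tp.
have [_ ->] := cZ U (h / t P) (A U g) (B U (t P)) Uo rh.
have [<- _] := cZ U (h / t P) (A U g) (B U (t P)) Uo rh; congr c.
have [_ vi] := v1 U Uo; apply: vi; rewrite v3 // (AE U g) // (AE U (val f / t P)) //. by rewrite fE; ring.
by apply: fp => //; apply: (valP f). have lp P U (f: div_sec G U) : U `<=` W P -> val f / t P \in div_pred D U.
by move=> UW; apply: fp => //; apply: (valP f). have [||||phi hphi phiE] := @glue_hom (div_sheaf G) T W loc i Wo WP.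
- move=> P U Uo UW f g; rewrite /loc -cl //; congr (c U _ _).
have [vA vi] := v1 U Uo; apply: vi; rewrite vA !AE ?lp // raddfD /= mulrDl //.
- move=> P U f s Uo UW rf; have [<- _] := cZ U f (A U (val s / t P)) (B U (t P)) Uo rf.
congr (c U _ _); have [_ vi] := v1 U Uo; apply: vi; rewrite v3 // !AE ?lp // div_actE // mulrA //.
- move=> P U V s Uo Vo VU UW; have VW := subset_trans VU UW; rewrite /loc -cR //; congr (c V _ _).
have [_ vi] := v1 V Vo; apply: vi; rewrite v4 // !AE ?lp // div_resE //.
by have [_ wi] := w1 V Vo; apply: wi; rewrite w4 // !BE ?tp.
- by move=> P Q U s Uo UP UQ; apply: locE => //; rewrite ?lp ?tp ?divfK.
have Av U s: zopen U -> A U (v U s) = s by move=> Uo; have [_ vi] := v1 U Uo; apply: vi; rewrite AE ?vD.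
have Bw U s: zopen U -> B U (w U s) = s by move=> Uo; have [_ wi] := w1 U Uo; apply: wi; rewrite BE ?wE. split.
exists phi => // U s u Uo; apply: (sheaf_separated Uo i Wo WP) => P. have Io: zopen (U `&` W P) by apply: zopenI.
have Il: U `&` W P `<=` U by move=> Q []. have [_ _ pR] := hphi; rewrite -pR // (phiE P) //.
have Ir: U `&` W P `<=` W P by move=> Q [].
have sD: v U s \in div_pred D (U `&` W P) by rewrite -(v4 U _ s Uo Io Il) vD.
have uE: w U u \in div_pred E (U `&` W P) by rewrite -(w4 U _ u Uo Io Il) wE.
rewrite -cR // (locE P _ _ _ _ Io Ir sD uE); last by rewrite div_resE // bE.
by rewrite -(v4 U _ s Uo Io Il) -(w4 U _ u Uo Io Il) Av // Bw.
move=> p q hp hq pq U Uo; apply: (hom_eq_local i Wo WP hp hq) => // P {Uo}U f Uo UW.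
have ->: f = b U (A U (val f / t P)) (B U (t P)). by apply: val_inj; rewrite bE // AE ?lp // BE ?tp // divfK.
exact: pq.
Qed.
Lemma class_tensor L M N D E: finite_set [set P | E P != 0] -> class L D -> class M E ->
 is_tensor L M N -> class N (fun P => D P + E P).
 move=> Ef cL cM tN; apply: class_iso (class_div _). exact: tensor_unique tN (div_tensor Ef cL cM).
Qed.
Lemma class_multiple M m N D: finite_set [set P | D P != 0] -> class M D -> is_multiple M m N ->
 class N (fun P => m%:Z * D P).
 move=> Df cM; elim: m N => [|m IH] N /=.
by move=> /class_iso; apply; rewrite (_: (fun P => _) = fun=> 0); [exact: class_div|apply/funext => P; rewrite mul0r].
move=> [N' /IH cN' tN]; rewrite (_: (fun P => _) = fun P => D P + m%:Z * D P); last first.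
by apply/funext => P; rewrite intS mulrDl mul1r. apply: class_tensor cM cN' tN; apply: sub_finite_set Df => P /=.
by apply: contraNN => /eqP ->; rewrite mulr0.
Qed.

End Comparison.

End Sheaves.

(** * Degrees of principal divisors *)

Section PrincipalDegree.
Variables (d a: nat) (kap F: fieldType) (C: scurve d a kap F).
Notation x := (cx C).
Notation ev := (evx (cst C) x).
Notation oo := (oo C).
Notation inA := (inA C).
Notation degP P := ((deg P)%:Z).
Implicit Types (P: place C) (s: seq (place C)).

Lemma deg_oo: deg oo = 1%N.
 have o0: ~~ vge oo 1 1 by rewrite vgeE ?oner_neq0 // dv1. have nc u: vge oo 1 (cst C u) -> u = 0.
apply: contraTeq => u0; rewrite vgeE // pv_cst //. have b1: res_basis oo (fun i: 'I_1 => 1).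
split=> [i|f vf]; first exact: vge1. have [u hu] := oo_residue vf; exists [ffun=> u]; split=> [|c hc].
by rewrite big_ord1 ffunE mulr1. apply/ffunP => i; rewrite ord1 ffunE; move: hc; rewrite big_ord1 mulr1 => hc.
apply/eqP; rewrite -subr_eq0; apply/eqP/nc; rewrite rmorphB. by apply: vge_trans hc; rewrite vge_subC.
have [bs [hb hu]]: exists bs, @res_basis _ _ _ _ C oo (deg oo) bs.
exact: (@xgetPex _ 0%N [set n | exists bs : 'I_n -> F, res_basis oo bs]%classic (ex_intro _ 1%N (ex_intro _ _ b1))).
move: (deg oo) bs hb hu => [|[|n]] bs hb hu //. by have [c [+ _]] := hu 1 (vge1 _); rewrite big_ord0 subr0 (negPf o0).
pose i0 : 'I_n.+2 := ord0; pose i1 : 'I_n.+2 := lift ord0 ord0.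
have [u0 h0] := oo_residue (hb i0); have [u1 h1] := oo_residue (hb i1). have [c [_ cu]] := hu 0 (vge0 _ _).
have z0: [ffun=> 0] = c by apply/esym/cu; rewrite big1 ?subr0 ?vge0 // => i _; rewrite ffunE rmorph0 mul0r.
pose e (v w: kap) := [ffun i => if i == i0 then v else if i == i1 then w else 0].
have e0 v w: vge oo 1 (cst C v * bs i0 + cst C w * bs i1) -> v = 0 /\ w = 0.
move=> h; have := cu (e v w); rewrite -z0 => H. have {}H: [ffun=> 0] = e v w.
symmetry; rewrite -H //; rewrite sub0r vgeN (bigD1 i0) // (bigD1 i1) //= !ffunE eqxx /= addrA.
by rewrite big1 ?addr0 // => i /andP[/negPf n0 /negPf n1]; rewrite ffunE n0 n1 rmorph0 mul0r.
by split; [have := congr1 (fun f: {ffun _ -> _} => f i0) H|have := congr1 (fun f: {ffun _ -> _} => f i1) H];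
rewrite !ffunE. have [u10 u00]: - u1 = 0 /\ u0 = 0.
apply: e0; rewrite (_: _ + _ = cst C u0 * (bs i1 - cst C u1) - cst C u1 * (bs i0 - cst C u0)); last by rewrite rmorphN; ring.
by apply: vgeB; apply: vgeM0 => //; apply: vge_cst.
have [/eqP]: (1 : kap) = 0 /\ (0 : kap) = 0; last by rewrite oner_eq0.
by apply: e0; rewrite rmorph0 mul0r addr0 rmorph1 mul1r -[bs i0]subr0 -(rmorph0 (cst C)) -u00.
Qed.
Lemma degree_inA f s: inA f -> f != 0 -> uniq s -> (forall P, fpl P -> P f != 0 -> P \in s) ->
 \sum_(P <- s | fpl P) P f * degP P = - oo f.
 move=> Af f0 us hs; have [|D Dfin hD] := @exists_divisor _ _ _ _ C f (fun P => `|P f|%N) f0. by move=> P fP ->.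
have hD' P: fpl P -> P f = (count_mem P D)%:Z.
by move=> fP; rewrite hD // gez0_abs //; have := (inAP C f).1 Af P fP; rewrite vgeE. have sD P: P \in D -> P \in s.
move=> PD; have fP := allP Dfin P PD; apply: hs => //; rewrite hD' //. by rewrite -lt0n -has_count has_pred1.
rewrite -(div_degree Af f0 (conj Dfin hD')) (degs_count us sD).
rewrite (big_morph Posz PoszD (erefl 0%:Z)) big_mkcond /=; apply: eq_bigr => P _; rewrite PoszM.
case: ifP => fP; first by rewrite hD'. by rewrite (count_memPn _) //; apply: contraFN fP => /(allP Dfin).
Qed.
Lemma principal_degree f s: f != 0 -> uniq s -> (forall P, P f != 0 -> P \in s) ->
 \sum_(P <- s | fpl P) P f * degP P = - oo f.
 move=> f0 us hs; have [w [c c0 [Aw fE]]] := fracA C f. have ec: ev c != 0 by rewrite ev0.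
have w0: w != 0 by apply: contraNneq f0 => w0; rewrite fE w0 mul0r.
have [s1 h1] := support C w0; have [s2 h2] := support C ec.
pose S := undup (s ++ s1 ++ s2); have uS: uniq S := undup_uniq _.
have sS P: P \in S = [|| P \in s, P \in s1 | P \in s2] by rewrite mem_undup !mem_cat.
have e1: \sum_(P <- S | fpl P) P w * degP P = - oo w. by apply: degree_inA => // P fP Pw; rewrite sS h1 ?orbT.
have e2: \sum_(P <- S | fpl P) P (ev c) * degP P = - oo (ev c).
by apply: degree_inA => // [|P fP Pw]; [exact: inA_ev|rewrite sS h2 ?orbT].
transitivity (\sum_(P <- S | fpl P) P f * degP P); last first.
by rewrite fE dv_div // opprB -[oo (ev c)]opprK -e2 addrC -e1 -sumrB; apply: eq_bigr => P _; rewrite dv_div // mulrBl.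
rewrite [RHS](bigID (mem s)) /= [X in _ = _ + X]big1 ?addr0 => [|P /andP[_ nP]]; last first.
by apply/eqP; rewrite mulf_eq0; apply/orP; left; apply: contraNT nP; apply: hs.
rewrite -big_filter -[RHS]big_filter; apply: perm_big; apply: uniq_perm; rewrite ?filter_uniq //.
by move=> P; rewrite !mem_filter sS; case: (P \in s); rewrite ?andbT ?andbF.
Qed.
(** x has divisor d P - d oo, and oo has degree one. *)
Lemma deg_branch P: 0 < P x -> deg P = 1%N.
 move=> Px; have [Pd _] := branch_xy Px; have d0 := d_gt0 C. have := @principal_degree x [:: P; oo] (x_unit C).
rewrite /= !inE; case: eqVneq => [e|n] H; first by move: Px; rewrite e oo_x; move: d0; clia.
have := H isT _; rewrite !big_cons big_nil fplE n fplE eqxx /= Pd oo_x. move=> h; have : d%:Z * degP P + 0 = - - d%:Z.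
apply: h => Q; rewrite !inE => Q0. have [fQ|] := boolP (fpl Q); last by rewrite fplE negbK => ->; rewrite orbT.
have [Qx|e] := finite_x fQ; last by rewrite e in Q0. by rewrite (branch_unique Qx Px) eqxx.
by move: (deg P) => m; move: d0; cnia.
Qed.

End PrincipalDegree.

(** * From divisors to the function f *)

Section TorsionClass.
Variables (d a: nat) (K F: fieldType) (C: scurve d a K F) (v: dval K).
Notation x := (cx C).
Notation oo := (oo C).
Notation degP P := ((deg P)%:Z).
Implicit Types P : place C.
Variables (p n: nat) (D E: place C -> int) (s: seq (place C)) (f0 h h0: F).
Hypotheses (p_pr: prime p) (p2d: (2 * d < p)%N) (p1d: (p = 1 %[mod d])%N) (vp: vge v 1 (p%:R : K))
 (vd: v d%:R = 0) (perf: forall u : resf v, exists u' : resf v, u' ^+ p = u).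
Hypotheses (us: uniq s) (Ds: forall P, D P != 0 -> P \in s) (Es: forall P, E P != 0 -> P \in s)
 (D0: \sum_(P <- s) D P * degP P = 0) (E0: \sum_(P <- s) E P * degP P = 0)
 (f00: f0 != 0) (f0D: forall P, P f0 = (p ^ n)%N%:Z * D P)
 (h00: h0 != 0) (Eh0: forall P, E (pconj 1 P) = E P + P h0)
 (hn0: h != 0) (hDE: forall P, 0 <= D P + E P + P h + ((d - 1)./2%:Z - 1) *+ (P == oo))
 (eigD: forall J, exists z z0 k u, [/\ (0 < z)%N, (z ^ d = 1 + p ^ J * k)%N,
 vge v 1 (z%:R - zet C), vge v 1 ((d * z0).+1%:R : K) & u != 0 /\
 forall P, D (pconj 1 P) = z%:Z * D P + P u]).

Lemma torsion_class: exists2 k, k != 0 & forall P, P k = D P.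
 have [k [e [k0 ed Ek]]] := fixed_class h00 Eh0 Es. have [P0 P0x] := exists_branch C.
have P0u P: fpl P -> (0 < P x) = (P == P0). by move=> fP; apply/idP/eqP => [Px|-> //]; apply: branch_unique.
have fP0: fpl P0 by rewrite /fpl ltW. have deg_fin (G: place C -> int) t : uniq t -> oo \in t ->
\sum_(P <- t) G P * degP P = \sum_(P <- t | fpl P) G P * degP P + G oo.
move=> ut ot; rewrite (bigD1_seq oo) //= deg_oo mulr1 addrC; congr (_ + _). by apply: eq_bigl => P; rewrite fplE.
have [s1 hs1] := support C k0; have [s2 hs2] := support C hn0.
pose S := undup (oo :: P0 :: s ++ s1 ++ s2); have uS: uniq S := undup_uniq _.
have sS P: P \in S = [|| P == oo, P == P0, P \in s, P \in s1 | P \in s2]. by rewrite mem_undup !inE !mem_cat.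
have ooS: oo \in S by rewrite sS eqxx. have sumS (G: place C -> int) : (forall P, G P != 0 -> P \in s) ->
\sum_(P <- s) G P * degP P = 0 -> \sum_(P <- S | fpl P) G P * degP P = - G oo.
move=> Gs G0; apply/eqP; rewrite -subr_eq0 opprK -deg_fin // -[X in _ == X]G0; apply/eqP.
rewrite (bigID (mem s)) /= [X in _ + X = _]big1 ?addr0 => [|P nP]; last first.
by apply/eqP; rewrite mulf_eq0; apply/orP; left; apply: contraNT nP; apply: Gs.
rewrite -big_filter; apply: perm_big; apply: uniq_perm; rewrite ?filter_uniq //.
by move=> P; rewrite mem_filter sS; case: (P \in s); rewrite ?orbT ?andbF.
have inS (f: F) t : f != 0 -> (forall P, fpl P -> P f != 0 -> P \in t) ->
{subset t <= S} -> \sum_(P <- S | fpl P) P f * degP P = - oo f. move=> f0' ht tS; apply: principal_degree => // P Pf.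
by have [e1|n1] := eqVneq P oo; [rewrite e1|apply/tS/ht; rewrite ?fplE].
have Sk: \sum_(P <- S | fpl P) P k * degP P = - oo k. by apply: inS k0 hs1 _ => P Ps; rewrite sS Ps !orbT.
have Sh: \sum_(P <- S | fpl P) P h * degP P = - oo h. by apply: inS hn0 hs2 _ => P Ps; rewrite sS Ps !orbT.
(* E + div k is -e P0 off oo and has degree 0, while P0 and oo have degree one. *)
have Eoo: E oo + oo k = e%:Z. have : \sum_(P <- S | fpl P) (E P + P k) * degP P = - E oo - oo k.
rewrite -(sumS E) // -Sk. by rewrite -big_split /=; apply: eq_bigr => P _; rewrite mulrDl.
have P0S: P0 \in S by rewrite sS eqxx orbT.
rewrite big_mkcond (bigD1_seq P0) //= fP0 Ek // P0x (deg_branch P0x) mulr1 big1 => [|P nP].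
by move: (E oo) (oo k) => u w; clia. by case: ifP => // fP; rewrite Ek // P0u // (negPf nP) mul0r.
pose q := (p ^ n)%N; have q0: (0 < q)%N by rewrite expn_gt0 prime_gt0.
(* The theta condition concerns D + E, but E + div k = e oo - e P0; adding div (h / k) to D thus
   turns it into a condition on D alone, with the bound g - 1 + e at oo. *)
pose hk := h / k; have hk0: hk != 0 by rewrite mulf_neq0.
pose D' P := D P + P hk; have D'E P: D' P = D P + P h - P k by rewrite /D' dv_div // addrA.
have D'fin P: fpl P -> (if P == P0 then e%:Z else 0) <= D' P.
move=> fP; have := hDE P; have := Ek P fP; rewrite D'E P0u //. have /negPf ->: P != oo by rewrite -fplE.
rewrite mulr0n addr0. by case: eqP => _; move: (D P) (E P) (P h) (P k) => u w y z; clia.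
have D'oo: - (((d - 1)./2 + e)%N%:Z - 1) <= D' oo. have := hDE oo; rewrite D'E eqxx mulr1n; move: Eoo.
by move: (D oo) (E oo) (oo h) (oo k) => u w y z; clia. have D'oo0: D' oo <= 0.
have : 0 <= \sum_(P <- S | fpl P) D' P * degP P.
by apply: sumr_ge0 => P fP; apply: mulr_ge0 => //; apply: le_trans (D'fin P fP); case: ifP.
have ->: \sum_(P <- S | fpl P) D' P * degP P = - D' oo; last by rewrite oppr_ge0.
transitivity (\sum_(P <- S | fpl P) D P * degP P + \sum_(P <- S | fpl P) P h * degP P
- \sum_(P <- S | fpl P) P k * degP P). by rewrite -big_split -sumrB; apply: eq_bigr => P _; rewrite D'E mulrBl mulrDl.
rewrite (sumS D) // Sh Sk D'E; ring. pose f := f0 * hk ^+ q; have fn0: f != 0 by rewrite mulf_neq0.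
have fD P: P f = q%:Z * D' P. by rewrite dvM // dvX // f0D /D' mulrDr.
pose N := `|D' oo|%N; have NE: D' oo = - N%:Z by move: D'oo0; rewrite /N; move: (D' oo) => u; clia.
have x0 := x_unit C.
have [|P fP|||||J|c [g [g0 gE]]] := @torsion_principal _ _ _ _ C v p n f N e p_pr p2d p1d vp vd perf _ fn0.
- apply/inAP => P fP; rewrite vgeE // fD mulr_ge0 //; apply: le_trans (D'fin P fP); by case: ifP.
- by rewrite fD dvdz_mulr.
- by rewrite fD NE mulrN PoszM.
- by move: D'oo; rewrite NE; clia.
- exact: ed. apply/inAP => P fP; rewrite vgeE // dv_div // !dvX // fD.
have := D'fin P fP; rewrite -P0u //; case: ltP => Px.
have [-> _] := branch_xy Px; rewrite PoszM -/q => u; rewrite mulrCA [_ * d%:Z]mulrC (mulrCA d%:Z) -mulrBr -mulrBr.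
by rewrite !mulr_ge0 // subr_ge0. have ->: P x = 0 by apply/eqP; rewrite eq_le Px; apply: fP.
rewrite mulr0 subr0 => u0; rewrite mulr_ge0 // mulr_ge0 //.
- have [z [z0 [l [u [z1 zd zv z0v [u0 uD]]]]]] := eigD J. have dn0 (r: F) : r != 0 -> del C r != 0 by [].
have dP P (r: F) : P (del C r) = pconj 1 P r by rewrite pconjE.
(* w makes delta f / (f^z w^q) a function with zero divisor, hence a constant. *)
pose w := u * del C hk / hk ^+ z; have w0: w != 0 by rewrite !mulf_neq0.
have df0 := dn0 _ fn0; pose r := del C f / (f ^+ z * w ^+ q). have r0: r != 0 by rewrite mulf_neq0.
have rP P: P r = 0. rewrite dv_div // dvM // !dvX // dP !fD /w dv_div // dvM // dP dvX // /D' uD.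
move: (pconj 1 P hk) (P hk) (D P) (P u) => b1 b2 b3 b4; clear; ring. have [||c cE] := @inA_const _ _ _ _ C r.
+ by apply/inAP => P _; rewrite vgeE // rP.
+ by rewrite vgeE // rP. by exists z, z0, l, w, c; split=> //; rewrite -cE -mulrA -/q /r divfK.
exists (g * hk^-1) => [|P]; first by rewrite mulf_neq0.
have c0: cst C c != 0 by apply: contraNneq fn0 => c0; rewrite gE c0 mul0r.
have := fD P; rewrite gE dvM // pv_cst add0r dvX // => /(mulfI _) => e1.
rewrite dv_div // e1 /D' //; by move: q0; clia.
Qed.

End TorsionClass.

(** * The given function field as a curve *)

Section FunctionField.
Local Open Scope classical_set_scope.
Variables (K: fieldType) (F: fieldExtType (ratfun K)) (d a: nat) (y: F) (zeta: K) (delta: 'AEnd(F)).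
Hypotheses (d_pr: prime d) (d_odd: odd d) (a_bounds: (1 < a < d)%N) (y_gen: <<1%VS; y>>%VS = fullv)
 (curve_eq: y ^+ d = coord_x F ^+ a * (coord_x F - 1) ^+ (d + 1 - a)%N)
 (zeta_prim: d.-primitive_root zeta) (delta_y: delta y = constF F zeta * y).

Let inj (c: {poly K}) : F := (tofrac c)%:A.
Let injD: {morph inj: b c / b + c}. Proof. by move=> b c; rewrite /inj rmorphD scalerDl. Qed.
Let injM: {morph inj: b c / b * c}. Proof. by move=> b c; rewrite /inj rmorphM -scalerAl mul1r scalerA. Qed.
Let inj1: inj 1 = 1. Proof. by rewrite /inj scale1r. Qed.
Fact const1: constF F 1 = 1. Proof. by []. Qed.
Fact constD: {morph constF F: b c / b + c}. Proof. by move=> b c; rewrite /constF polyCD; apply: injD. Qed.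
Fact constM: {morph constF F: b c / b * c}. Proof. by move=> b c; rewrite /constF polyCM; apply: injM. Qed.
Let cs := make_rmorph const1 constD constM.
Let dl := make_rmorph (rmorph1 delta) (rmorphD delta) (rmorphM delta).
Let ev := evx cs (coord_x F).

Let evE c: ev c = inj c.
 elim/poly_ind: c => [|c r IH]; first by rewrite /ev evx0 /inj scale0r.
by rewrite injD injM -IH /ev evxD evxM evxX evxC.
Qed.

Let ev0 c: ev c = 0 -> c = 0.
 by rewrite evE => /eqP; rewrite scaler_eq0 oner_eq0 orbF tofrac_eq0 => /eqP. Qed.

Let gen f := exists s : nat -> {poly K}, exists2 c, c != 0 & f * ev c = \sum_(i < d) ev (s i) * y ^+ i.

Let genD f g: gen f -> gen g -> gen (f + g).
 move=> [s [c c0 fE]] [t [e e0 gE]]; exists (fun i => s i * e + t i * c), (c * e); first by [].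
have ->: (f + g) * ev (c * e) = (f * ev c) * ev e + (g * ev e) * ev c by rewrite /ev evxM; ring.
rewrite fE gE !mulr_suml -big_split. by apply: eq_bigr => i _; rewrite /ev evxD !evxM /=; ring.
Qed.

Let gen_monomial (r: ratfun K) i : gen (r%:A * y ^+ i).
 have [u [w [w0 ->]]] := fracE r; have d0 := prime_gt0 d_pr. pose W : {poly K} := 'X ^+ a * ('X - 1) ^+ (d + 1 - a)%N.
have yd: y ^+ d = ev W. by rewrite curve_eq /ev evxM !evxXn evxB evx1 evxX.
exists (fun j => if j == (i %% d)%N then u * W ^+ (i %/ d) else 0), w => //.
rewrite (bigD1 (Ordinal (ltn_pmod i d0))) //= eqxx big1 ?addr0 => [|j nj]; last first.
by rewrite ifN ?evE /inj ?rmorph0 ?scale0r ?mul0r // -[_ == _]/(val j == val (Ordinal (ltn_pmod i d0))).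
have e: (tofrac u / tofrac w)%:A * ev w = ev u. by rewrite !evE /inj -scalerAl mul1r scalerA divfK // tofrac_eq0.
have ->: ev (u * W ^+ (i %/ d)) = ev u * ev W ^+ (i %/ d) by rewrite /ev evxM evxXn.
by rewrite {1}(divn_eq i d) exprD mulnC exprM yd -e; ring.
Qed.
Lemma exists_curve: exists C : scurve d a K F, [/\ cst C =1 constF F, cx C = coord_x F, cy C = y,
 zet C = zeta & del C =1 delta].
 have sg f: gen f. have : f \in <<1%VS; y>>%VS by rewrite y_gen memvf.
case/Fadjoin1_polyP => q ->; rewrite horner_coef; elim/big_ind: _ => [|g h|i _]; first 2 last.
- by rewrite coef_map; apply: gen_monomial.
- by have := gen_monomial 0 0; rewrite scale0r mul0r.
- exact: genD. have h1 c: dl (cs c) = cs c by apply: aut_const.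
have h2: dl (coord_x F) = coord_x F by rewrite /dl /= /as_rmorph linearZ rmorph1.
by exists (SCurve d_pr d_odd a_bounds zeta_prim curve_eq h1 h2 delta_y ev0 sg).
Qed.

End FunctionField.

(** * Closed points as places, and divisors of sheaves of degree 0 *)

Section Points.
Local Open Scope classical_set_scope.
Variables (K: fieldType) (F: fieldExtType (ratfun K)) (d a: nat) (C: scurve d a K F).
Hypothesis cstE: cst C =1 constF F.
Implicit Types (P: place C) (Q: closed_point F).

Definition place_of Q: place C :=
 @Place _ _ _ _ C (Dval (ordp0 Q) (@ordpM _ _ Q) (@ordpD _ _ Q) (ordp_surj Q))
 (fun u => etrans (congr1 (ordp Q) (cstE u)) (ordp_const Q u)).

Definition point_of P: closed_point F :=
 @Point _ F (pv P) (dv0 P) (@dvM _ P) (@dvD _ P)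
 (fun c => etrans (congr1 (pv P) (esym (cstE c))) (pv_cst P c)) (dv_surj P).

Lemma place_ofK: cancel place_of point_of.
 by move=> Q; apply: point_eqP. Qed.
Lemma point_ofK: cancel point_of place_of.
 by move=> P; apply: place_ext. Qed.
Lemma degree_point P: point_degree (point_of P) = deg P.
 have ge (Q: closed_point F) f : vge (place_of Q) 0 f = (0 <= ordp Q f).
by rewrite /vge; case: eqVneq => // ->; rewrite ordp0.
have van (Q: closed_point F) f : vge (place_of Q) 1 f <-> vanishes_at Q f.
rewrite /vge /vanishes_at; split=> [/orP[/eqP->|h]|[->|h]]; rewrite ?eqxx //; first by left.
by right; apply: lt_le_trans h. by apply/orP; right; move: h => /=; clia.
rewrite /point_degree /deg -{2}[P]point_ofK; congr xget; apply/seteqP.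
have e n (b: 'I_n -> F) (c: {ffun 'I_n -> K}) f : f - \sum_i constF F (c i) * b i = f - \sum_i cst C (c i) * b i.
by congr (_ - _); apply: eq_bigr => i _; rewrite cstE. split=> n [b [b0 hb]]; exists b; split=> [i|f].
- by rewrite ge.
- rewrite ge => /hb[c [hc uc]]; exists c; split=> [|c' hc']; first by apply/van; rewrite -e.
by apply: uc; rewrite e; apply/van.
- by rewrite -ge. rewrite -ge => /hb[c [hc uc]]; exists c; split=> [|c' hc']; first by rewrite e; apply/van.
by apply: uc; apply/van; rewrite -e.
Qed.
Lemma finite_zeros f: f != 0 -> finite_set [set Q : closed_point F | ordp Q f != 0].
 move=> f0; have [s hs] := support C f0.
apply: (@sub_finite_set _ _ [set` [seq point_of P | P <- oo C :: s]]) => [Q Qf|]; last exact: finite_seq.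
apply/mapP; exists (place_of Q); last by rewrite place_ofK.
rewrite inE; case: eqVneq => //= n; apply: hs; rewrite ?fplE //.
Qed.
(** By the equation y is regular wherever x is, so Q is a pole of x, and there is only one. *)
Lemma infty_place Q: ~ (0 <= ordp Q (cx C) /\ 0 <= ordp Q (cy C)) -> point_of (oo C) = Q.
 move=> nQ; rewrite -(@oo_unique _ _ _ _ C (place_of Q)) ?place_ofK // ltNge; apply/negP => Qx.
apply: nQ; split=> //; have : vge (place_of Q) 0 (cy C ^+ d).
rewrite sc_eq; have hx: vge (place_of Q) 0 (cx C) by rewrite /vge Qx orbT.
by apply: vgeM0; apply: vge0X => //; apply: vgeB => //; apply: vge1.
have d0 := d_gt0 C; rewrite vgeE ?expf_neq0 ?y_unit // dvX //=. by rewrite pmulr_rge0.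
Qed.
Lemma divisor_class M: in_Jac M -> exists D : closed_point F -> int, exists s : seq (place C),
 [/\ class M D, finite_set [set Q | D Q != 0], forall P, D (point_of P) != 0 -> P \in s &
 forall t, uniq t -> {subset s <= t} -> \sum_(P <- t) D (point_of P) * (deg P)%:Z = 0].
 move=> [_ [U [Uo [r [r0 [D [rD Df dE]]]]]]]. have /finite_seqP[s0 s0E] := Df; exists D, [seq place_of Q | Q <- s0].
have hs P: D (point_of P) != 0 -> P \in [seq place_of Q | Q <- s0].
move=> DP; apply/mapP; exists (point_of P); last by rewrite point_ofK.
by have : [set Q | D Q != 0] (point_of P) by []; rewrite s0E.
split=> //; first exact: class_ord (point_of (oo C)) Uo rD.
move=> t ut st; rewrite [RHS]dE (@fsbigE _ _ _ _ _ [seq point_of P | P <- t]).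
- rewrite big_map; apply: eq_big => [P|P _]; first by rewrite in_setT. by rewrite degree_point.
- by rewrite map_inj_uniq //; apply: can_inj point_ofK.
- by []. move=> Q _ nQ; have ->: D Q = 0; last by [].
apply/eqP; apply: contraNT nQ => DQ; apply/mapP; exists (place_of Q); last by rewrite place_ofK.
by apply: st; apply: hs; rewrite place_ofK.
Qed.

End Points.

Theorem theorem5p1
  (p : nat) (p_pr : prime p) (K : fieldExtType (padic p_pr))
  (d : nat) (d_pr : prime d) (d_odd : odd d) (p1d : (p = 1 %[mod d])%N)
  (a : nat) (a_bounds : (1 < a < d)%N)
  (F : fieldExtType (ratfun K)) (y : F)
  (y_gen : <<1%VS; y>>%VS = fullv)
  (curve_eq : y ^+ d = coord_x F ^+ a * (coord_x F - 1) ^+ (d + 1 - a)%N)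
  (infty : closed_point F)
  (infty_not_affine : ~ (0 <= ordp infty (coord_x F) /\ 0 <= ordp infty y))
  (zeta : K) (zeta_prim : d.-primitive_root zeta)
  (delta : 'AEnd(F)) (delta_y : delta y = constF F zeta * y)
  (L : sheaf F) (L_Jac : in_Jac L) (L_fixed : sheaf_iso (pullback delta L) L)
  (n : nat) (n_gt0 : (0 < n)%N) (P : sheaf F) :
  in_Jac_eigen delta zeta n P ->
  in_Theta_sub ((d - 1)./2)%N infty L P ->
  sheaf_iso P (OX F).

 move=> [[PJ Pmul] [z zE zmul]] [_ [N tN [_ [N' tN' [sec sec0]]]]].
have [C [cE xE yE zetE dE]] := exists_curve d_pr d_odd a_bounds y_gen curve_eq zeta_prim delta_y.
have [v [vZ vp vL]] := exists_padic_dval K. have fin := finite_zeros cE.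
have infE : point_of cE (Inf.oo C) = infty by apply: infty_place; rewrite xE yE.
have [D [s1 [cD Df Ds D0]]] := divisor_class cE PJ. have [E [s2 [cL Ef Es E0]]] := divisor_class cE L_Jac.
have aE Q : aut_point delta (point_of cE Q) = point_of cE (pconj 1 Q).
by apply: point_eqP => f; rewrite -[RHS]/(pconj 1 Q f) pconjE -[RHS]/(Q (del C f)) dE.
have autf (G : closed_point F -> int) : finite_set [set Q | G Q != 0]%classic ->
finite_set [set Q | (G \o aut_point delta) Q != 0]%classic.
move=> Gf; apply: (@finite_preimage _ _ [set Q | G Q != 0]%classic (aut_point delta)) => //.
by move=> Q R _ _; apply: aut_point_inj. have scal (m : nat) : finite_set [set Q | m%:Z * D Q != 0]%classic.
by apply: sub_finite_set Df => Q /=; apply: contraNN => /eqP ->; rewrite mulr0.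
(* The hypotheses become functions: f0 with divisor p^n D, h0 comparing E with its pullback, u
   comparing the pullback of D with z D, and h, the section given by the theta condition. *)
have [|f0 f00 f0E] := class_unique fin (scal (p ^ n)%N) _ (class_multiple infty fin Df cD Pmul) (class_div _).
by apply: (@sub_finite_set _ _ set0%classic) => // Q /=; rewrite eqxx.
have [h0 h00 h0E] := class_unique fin (autf _ Ef) Ef (class_pullback delta cL) (class_iso L_fixed cL).
have [u u0 uE] := class_unique fin (autf _ Df) (scal (z n)) (class_pullback delta cD) (class_multiple infty fin Df cD zmul).
set g := ((d - 1)./2)%N in tN'.
have [h hn0 hE] : exists2 h, h != 0 & forall Q, 0 <= D Q + E Q + ordp Q h + (g%:Z - 1) *+ (Q == infty).
have gf : finite_set [set Q | (g%:Z - 1) *+ (Q == infty) != 0]%classic.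
apply: (@sub_finite_set _ _ [set infty]%classic); last exact: finite_set1.
by move=> Q /=; have [->//|_] := eqVneq Q infty; rewrite mulrb eqxx.
have [V [V1 V2 _ _]] := class_tensor infty fin gf (class_tensor infty fin Ef cD cL tN) (class_div _) tN'.
have [VD Vi] := V1 _ (zopenT _). have V0 : V setT 0 = 0 by apply: (addrI (V setT 0)); rewrite -VD !addr0.
exists (V _ sec). by apply: contra_neq sec0 => e; apply: Vi; rewrite e V0.
move=> Q; have /(V2 _ _ (zopenT _))/div_predP[e|/(_ Q I)] : exists s, V setT s = V setT sec by exists sec.
by case/eqP: sec0; apply: Vi; rewrite e V0. by move: (D Q) (E Q) (ordp Q _) (_ *+ _) => b1 b2 b3 b4; clia.
have chp := pchar_resf vZ vp. have d1 : (1 < d)%N := prime_gt1 d_pr; have p1 := prime_gt1 p_pr.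
have [l pl] : exists l, (p = l * d + 1)%N. by exists (p %/ d)%N; rewrite {1}(divn_eq p d) p1d modn_small.
(* p = d + 1 would be even, hence p = 2 and d = 1; so p is at least 2 d + 1. *)
have p2d : (2 * d < p)%N. have l0 : (0 < l)%N by move: p1; rewrite pl; case: (l).
have [l1|] := eqVneq l 1%N; last by move: l0; rewrite pl; move: (l) d1; cnia.
have op : (2 %| p)%N by rewrite pl l1 mul1n addn1 dvdn2 /= d_odd.
have := op; rewrite dvdn_prime2 // => /eqP e; move: pl d1; rewrite -e l1 mul1n; clia. have vd : v d%:R = 0.
have dZ : vge v 0 (d%:R : K) by rewrite -(of_nat K).
have [] // := @rd_neq0 _ v _ dZ; rewrite (rd_nat vZ) -(dvdn_pcharf chp) gtnNdvd //; move: p2d d1; clia.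
have natX m k : ((z ^+ k) m = z m ^ k %% p ^ m)%N. by elim: k => [|k IH] //; rewrite exprS /= IH modnMmr expnS.
have zd : z ^+ d = 1. apply/eqP; rewrite -subr_eq0 -(of_eq0 K) of_padicD of_padicN of_padicX zE.
by rewrite prim_expr_order // (of_nat K 1) subrr.
have [||||||||J|k k0 kE] := @torsion_class _ _ _ _ C v p n (D \o point_of cE) (E \o point_of cE)
(undup (s1 ++ s2)) f0 h h0 p_pr p2d p1d _ vd (residue_perfect vZ vp vL) (undup_uniq _) _ _ _ _ f00 _ h00 _ hn0 _ _.
- by rewrite vgeE ?p_neq0 //; move: vp; clia.
- by move=> Q /Ds; rewrite mem_undup mem_cat => ->.
- by move=> Q /Es; rewrite mem_undup mem_cat orbC => ->.
- by apply: D0; rewrite ?undup_uniq // => Q Qs; rewrite mem_undup mem_cat Qs.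
- by apply: E0; rewrite ?undup_uniq // => Q Qs; rewrite mem_undup mem_cat Qs orbT.
- by move=> Q; have := f0E (point_of cE Q); rewrite subr0.
- by move=> Q; have := h0E (point_of cE Q); rewrite /= aE => ->; rewrite subrKC.
- move=> Q; have := hE (point_of cE Q); rewrite -infE (inj_eq (can_inj (point_ofK cE))). exact.
(* Z is an integer with Z^d = 1 modulo p^m, and in particular modulo p^J. It agrees with the
   eigenvalue [z n] modulo p^n only; the difference t p^n is absorbed by f0^t, as f0 has divisor p^n
   D. The choice z0 = l satisfies d l + 1 = p. *)
- pose m := (J + n).+1; pose Z := z m; pose t := (Z %/ p ^ n)%N.
have mod1 j : (0 < p ^ j)%N by rewrite expn_gt0 prime_gt0. have Zd : (Z ^ d = 1 %[mod p ^ m])%N. by rewrite -natX zd.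
exists Z, l, (Z ^ d %/ p ^ m * p ^ (m - J))%N, (u / f0 ^+ t). have Z0 : (0 < Z)%N.
rewrite lt0n; apply/eqP => Z0; move: Zd; rewrite Z0 exp0n ?prime_gt0 // mod0n modn_small //.
by rewrite -(exp1n m) ltn_exp2r. have pm1 : (1 %% p ^ m = 1)%N by rewrite modn_small // -(exp1n m) ltn_exp2r.
have Zn : (Z = t * p ^ n + z n)%N. by rewrite {1}(divn_eq Z (p ^ n)) -/t /Z presP // /m; clia.
have Z1 : (Z = Z %/ p * p + z 1)%N. by rewrite {1}(divn_eq Z p) /Z -[p in (_ %% p)%N]expn1 presP. split=> //.
+ rewrite mulnCA -expnD subnKC; last by rewrite /m; clia. by rewrite {1}(divn_eq (Z ^ d) (p ^ m)) Zd pm1 addnC.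
+ rewrite zetE -zE; apply/rd_eqP; [by rewrite -(of_nat K)|exact: vZ|].
by rewrite (rd_nat vZ) (rd_padic vZ vp) Z1 natrD natrM (pcharf0 chp) mulr0 add0r.
+ have -> : (d * l).+1 = p by rewrite pl mulnC addn1. by rewrite vgeE ?p_neq0 //; move: vp; clia.
have f0t : f0 ^+ t != 0 by rewrite expf_neq0. split=> [|Q]; first by rewrite mulf_neq0 ?invr_eq0.
have e0 : Q f0 = (p ^ n)%N%:Z * D (point_of cE Q) by have := f0E (point_of cE Q); rewrite subr0.
have e1 : Q u = D (point_of cE (pconj 1 Q)) - (z n)%:Z * D (point_of cE Q).
by rewrite -aE; apply: (uE (point_of cE Q)). rewrite dv_div // dvX // e0 e1 Zn PoszD PoszM /=; ring.
apply: class_principal k0 _ cD => Q; rewrite -[Q](place_ofK cE). exact: kE.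
Qed.
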